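(* Let $X$ be a toric Fano manifold of dimension $n\le 7$, with pseudo-index $\iota_X$ and Picard number $\rho_X$. Then $\rho_X(\iota_X-1)\le n$. If $\rho_X(\iota_X-1)=n$, then $X\simeq(\mathbb{P}^{\iota_X-1})^{\rho_X}$.
   Context: A Fano manifold is a smooth connected projective variety $X$ over $\mathbb{C}$ whose anticanonical bundle $-K_X$ is ample; a toric Fano manifold is a Fano manifold that is a toric variety. The pseudo-index $\iota_X$ is the smallest integer of the form $-K_X\cdot C$, where $C$ is a rational curve in $X$. The Picard number is denoted $\rho_X$. *)

(* Defs.v *)
(* Algebraic varieties over an algebraically closed field K in the classical
   sense of Serre: a set of closed points together with its Zariski-open subsets
   and the K-valued regular functions on them. *)
From mathcomp Require Import all_boot all_order all_algebra.
From mathcomp Require Import boolp classical_sets reals.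
From mathcomp.real_closed Require Import complex.

Set Implicit Arguments.
Unset Strict Implicit.
Unset Printing Implicit Defensive.

Import Order.TTheory GRing.Theory Num.Theory.
Local Open Scope classical_set_scope.
Local Open Scope ring_scope.

(* [reg X U f] only constrains the values of [f] on [U]. No axiom is imposed
   here: for the spaces considered below, the structure is determined either by
   [glue] or by [closed_immersion]. *)
Record ringed_set (K : closedFieldType) := RingedSet {
  pt :> Type;
  opn : set (set pt);
  reg : set pt -> set (pt -> K) }.

(* Subalgebra of K-valued functions generated by G. *)
Inductive alg (K : closedFieldType) (T : Type) (G : set (T -> K)) :
    (T -> K) -> Prop :=
| alg_gen f : G f -> alg G f
| alg_cst c : alg G (fun=> c)
| alg_add f g : alg G f -> alg G g -> alg G (fun x => f x + g x)
| alg_mul f g : alg G f -> alg G g -> alg G (fun x => f x * g x).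

(* The space covered by the charts [U i] whose coordinate rings are generated
   by [G i]: the sets U i /\ {b <> 0} form a basis of opens, and regular
   functions are locally quotients a / b. *)
Definition glue (K : closedFieldType) (T I : Type) (U : I -> set T)
    (G : I -> set (T -> K)) : ringed_set K :=
  @RingedSet K T
    (fun W => forall x, W x -> exists i b,
       [/\ alg (G i) b, U i x, b x != 0
         & forall y, U i y -> b y != 0 -> W y])
    (fun W f => forall x, W x -> exists i a b,
       [/\ alg (G i) a, alg (G i) b, U i x, b x != 0
         & forall y, U i y -> b y != 0 -> W y /\ f y = a y / b y]).

Section Spaces.
Variable K : closedFieldType.
Implicit Types (X Y B : ringed_set K) (n r N : nat).

Definition point_space : ringed_set K :=
  @glue K unit unit (fun=> setT) (fun=> set0).

(* P^N as the set of lines of K^(N+1). *)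
Definition proj_pt N := {l : {vspace 'rV[K]_N.+1} | \dim l == 1%N}.

Definition hcoord N (l : proj_pt N) (i : 'I_N.+1) : K := vpick (sval l) 0 i.

Definition proj_space N : ringed_set K :=
  @glue K (proj_pt N) 'I_N.+1
    (fun i => [set l | hcoord l i != 0])
    (fun i => [set f | exists j, f = fun l => hcoord l j / hcoord l i]).

Definition invertible_row n (t : 'rV[K]_n) := [forall i, t 0 i != 0].

Definition torus_pt n := {t : 'rV[K]_n | invertible_row t}.

Definition torus n : ringed_set K :=
  @glue K (torus_pt n) unit (fun=> setT)
    (fun=> [set f | exists i : 'I_n,
       f = (fun t : torus_pt n => sval t 0 i)
       \/ f = (fun t : torus_pt n => (sval t 0 i)^-1)]).

Lemma torus_one_subproof n : invertible_row (const_mx 1 : 'rV[K]_n).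
Proof. by apply/forallP => i; rewrite mxE oner_neq0. Qed.

Definition torus_one n : torus n :=
  exist (@invertible_row n) _ (torus_one_subproof n).

Lemma torus_mul_subproof n (s t : torus_pt n) :
  invertible_row (\row_j (sval s 0 j * sval t 0 j)).
Proof.
apply/forallP => i; rewrite mxE mulf_neq0 //.
  exact: (forallP (svalP s) i).
exact: (forallP (svalP t) i).
Qed.

Definition torus_mul n (s t : torus_pt n) : torus n :=
  exist (@invertible_row n) _ (torus_mul_subproof s t).

Definition prod_space X Y : ringed_set K :=
  @glue K (X * Y)%type (set X * set Y)%type
    (fun W => [set z | [/\ opn W.1, opn W.2, W.1 z.1 & W.2 z.2]])
    (fun W => [set h | (exists2 f, reg W.1 f & h = fun z => f z.1)
                    \/ (exists2 g, reg W.2 g & h = fun z => g z.2)]).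

Fixpoint power X r : ringed_set K :=
  if r is r'.+1 then prod_space X (power X r') else point_space.

Definition morphism X Y (f : X -> Y) : Prop :=
  (forall V, opn V -> opn (f @^-1` V)) /\
  (forall V h, reg V h -> reg (f @^-1` V) (fun x => h (f x))).

Definition isomorphic X Y : Prop :=
  exists (f : X -> Y) (g : Y -> X),
    [/\ morphism f, morphism g, cancel f g & cancel g f].

(* f identifies X with a closed subset of Y carrying the induced topology and
   the induced sheaf of functions. *)
Definition closed_immersion X Y (f : X -> Y) : Prop :=
  [/\ injective f,
      opn (~` range f),
      forall W, opn W <-> exists2 V, opn V & W = f @^-1` V
    & forall (W : set X) g, reg W g <->
        opn W /\ forall x, W x -> exists V h,
          [/\ reg V h, V (f x) & forall y, W y -> V (f y) -> g y = h (f y)]].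

Definition open_immersion X Y (f : X -> Y) : Prop :=
  [/\ injective f, morphism f,
      forall W, opn W -> opn (f @` W)
    & forall W g, reg W g ->
        exists2 h, reg (f @` W) h & forall x, W x -> h (f x) = g x].

Definition irreducible X (Z : set X) : Prop :=
  Z !=set0 /\ forall U V, opn U -> opn V ->
    Z `&` U !=set0 -> Z `&` V !=set0 -> Z `&` (U `&` V) !=set0.

Definition closed_chain X n (Z : nat -> set X) : Prop :=
  (forall i, (i <= n)%N -> opn (~` Z i) /\ irreducible (Z i)) /\
  (forall i, (i < n)%N -> Z i `<` Z i.+1).

(* Krull dimension. *)
Definition dimension X n : Prop :=
  (exists Z : nat -> set X, closed_chain n Z) /\
  (forall m (Z : nat -> set X), closed_chain m Z -> (m <= n)%N).

Definition regular_at X (x : X) (f : X -> K) : Prop :=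
  exists U, [/\ opn U, U x & reg U f].

(* The germ of f at x lies in the square of the maximal ideal. *)
Definition in_max_sq X (x : X) (f : X -> K) : Prop :=
  exists k (a b : 'I_k -> X -> K) U,
    [/\ forall i, regular_at x (a i) /\ a i x = 0,
        forall i, regular_at x (b i) /\ b i x = 0,
        opn U, U x
      & forall y, U y -> f y = \sum_i a i y * b i y].

(* The classes of the t i - t i x form a basis of the cotangent space
   m_x / m_x^2. *)
Definition local_coords X n (x : X) (t : 'I_n -> X -> K) : Prop :=
  (forall i, regular_at x (t i)) /\
  forall f, regular_at x f -> exists! c : 'rV[K]_n,
    in_max_sq x (fun y => f y - f x - \sum_i c 0 i * (t i y - t i x)).

Definition coord_system X n (U : set X) (t : 'I_n -> X -> K) : Prop :=
  [/\ opn U, forall i, reg U (t i) & forall x, U x -> local_coords x t].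

(* The matrix of the partial derivatives of the s i with respect to the t j. *)
Definition jacobian X n (s t : 'I_n -> X -> K) (x : X) : 'M[K]_n :=
  xget 0 [set J : 'M[K]_n | forall i, in_max_sq x
    (fun y => s i y - s i x - \sum_j J i j * (t j y - t j x))].

(* Smooth irreducible (hence connected) projective variety of dimension n. *)
Definition projective_manifold X n : Prop :=
  [/\ exists N (f : X -> proj_space N), closed_immersion f,
      irreducible [set: X],
      dimension X n
    & forall x : X, exists t : 'I_n -> X -> K, local_coords x t].

(* Line bundles are given by transition functions. Convention: sections are
   families (s i), s i regular on [dom i], with s i = tr i j * s j on overlaps. *)
Record cocycle X := Cocycle {
  idx : Type;
  dom : idx -> set X;
  tr : idx -> idx -> X -> K }.

Definition line_bundle X (L : cocycle X) : Prop :=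
  [/\ forall i : idx L, opn (dom i),
      forall x, exists i : idx L, dom i x,
      forall i j : idx L, reg (dom i `&` dom j) (tr i j),
      forall (i j : idx L) x, dom i x -> dom j x -> tr i j x != 0
    & forall (i j k : idx L) x, dom i x -> dom j x -> dom k x ->
        tr i j x * tr j k x = tr i k x].

(* det T_X: the frame of [t] is d/dt_1 /\ ... /\ d/dt_n, and it equals
   det (ds/dt) times the frame of [s]. *)
Definition anticanonical X n : cocycle X :=
  @Cocycle X {p : set X * ('I_n -> X -> K) | coord_system p.1 p.2}
    (fun p => (sval p).1)
    (fun p q x => \det (jacobian (sval p).2 (sval q).2 x)).

Definition pullback X Y (f : X -> Y) (L : cocycle Y) : cocycle X :=
  @Cocycle X (idx L) (fun i => f @^-1` dom i) (fun i j x => tr i j (f x)).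

(* The tensor product of the L k raised to the powers a k. *)
Definition tensor X r (L : 'I_r -> cocycle X) (a : 'I_r -> int) : cocycle X :=
  @Cocycle X (forall k, idx (L k))
    (fun i => [set x | forall k, dom (i k) x])
    (fun i j x => \prod_k (tr (i k) (j k) x) ^ (a k)).

(* Some power of L has sections defining a closed immersion into P^N. *)
Definition ample X (L : cocycle X) : Prop :=
  exists (k N : nat) (s : 'I_N.+1 -> idx L -> X -> K)
         (phi : X -> proj_space N),
    [/\ (0 < k)%N,
        forall l i, reg (dom i) (s l i),
        forall l (i j : idx L) x, dom i x -> dom j x ->
          s l i x = tr i j x ^+ k * s l j x,
        closed_immersion phi
      & forall (i : idx L) x, dom i x ->
          sval (phi x) = <[\row_l s l i x]>%VS].

(* Degree of a line bundle on a smooth projective curve, computed from a rational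
   section s without zeros or poles outside the points z j, where it has the
   orders m j. *)
Definition degree B (L : cocycle B) (d : int) : Prop :=
  exists (k : nat) (z : 'I_k -> B) (m : 'I_k -> int) (s : idx L -> B -> K),
    let V := [set y | forall j, z j <> y] in
    [/\ injective z,
        forall i, reg (dom i `&` V) (s i)
                  /\ forall y, dom i y -> V y -> s i y != 0,
        forall (i i' : idx L) y, dom i y -> dom i' y -> V y ->
          s i y = tr i i' y * s i' y,
        forall j (i : idx L), dom i (z j) -> exists W u t,
          [/\ W (z j),
              local_coords (z j) (fun _ : 'I_1 => t),
              t (z j) = 0,
              reg W u /\ (forall y, W y -> u y != 0)
            & forall y, W y -> dom i y -> V y -> s i y = u y * t y ^ m j]
      & d = \sum_j m j].

(* Morphisms from P^1 that are birational onto their image (generic injectivity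
   amounts to this in characteristic 0), i.e. normalizations of rational
   curves. *)
Definition rational_curve X (f : proj_space 1 -> X) : Prop :=
  morphism f /\ exists V : set (proj_space 1),
    [/\ opn V, V !=set0 & forall x y, V x -> V y -> f x = f y -> x = y].

Definition pseudo_index X n (i : int) : Prop :=
  (exists2 f : proj_space 1 -> X, rational_curve f
     & degree (pullback f (anticanonical X n)) i) /\
  (forall f d, rational_curve f ->
     degree (pullback f (anticanonical X n)) d -> i <= d).

(* Testing on smooth curves B mapping to X is the same as testing on the curves
   contained in X, through their normalizations. *)
Definition num_trivial X (L : cocycle X) : Prop :=
  forall B (f : B -> X), projective_manifold B 1 -> morphism f ->
    degree (pullback f L) 0.

Definition num_independent X r (L : 'I_r -> cocycle X) : Prop :=
  (forall i, line_bundle (L i)) /\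
  (forall a, num_trivial (tensor L a) -> forall i, a i = 0).

(* The rank of the group of line bundles modulo numerical equivalence. *)
Definition picard_number X r : Prop :=
  (exists L : 'I_r -> cocycle X, num_independent L) /\
  (forall q (L : 'I_q -> cocycle X), num_independent L -> (q <= r)%N).

Definition fano_manifold X n : Prop :=
  projective_manifold X n /\ ample (anticanonical X n).

(* X contains a torus as a dense open subset, and the action of the torus on
   itself extends to an algebraic action on X. *)
Definition toric X n : Prop :=
  exists (e : torus n -> X) (act : prod_space (torus n) X -> X),
    [/\ open_immersion e
        /\ (forall U : set X, opn U -> U !=set0 -> U `&` range e !=set0),
        morphism act,
        forall x, act (torus_one n, x) = x,
        forall s t x, act (torus_mul s t, x) = act (s, act (t, x))
      & forall s t, act (s, e t) = e (torus_mul s t)].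

End Spaces.

(* Main.v *)
Require Import Defs.
From mathcomp Require Import all_boot all_order all_algebra.
From mathcomp Require Import boolp classical_sets reals.
From mathcomp.real_closed Require Import complex.
From mathcomp Require Import zify ring.

Import Order.TTheory GRing.Theory Num.Theory.
Local Open Scope classical_set_scope.
Local Open Scope ring_scope.
Set Implicit Arguments.
Unset Strict Implicit.
Unset Printing Implicit Defensive.


(** On the open torus, the sections of a power of -K_X are Laurent polynomials; let
    [A] be the set of their exponents. Using the torus action, each character [m] in [A]
    is seen to extend to a section, and X is covered by the nonvanishing loci [U v] of
    the sections attached to the vertices [v] of the hull of [A]. By smoothness the
    primitive edge vectors u_1, ..., u_n at [v] form a basis of Z^n, and U v is an affine
    space whose coordinates are the characters u_i; comparing frames yields
    v = k (1 + q_v) with q_v = - (u_1 + ... + u_n). The rays of the fan are the elements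
    of the dual bases.

    Picard number: a line bundle is trivial on every U v, so up to isomorphism it is
    determined by one integer for each ray outside of a fixed cone; hence
    rho <= r := #rays - n.

    Pseudo-index: the edge from v in the direction u_i ends at a vertex v' with
    q_v' = q_v + l u_i and carries a rational curve of anticanonical degree l, whence
    l >= iota. It follows that <q_v, f> >= iota - 1 for each ray f outside of the cone of
    v, whereas <q_v, f> = -1 for the n rays of that cone.

    Let w be the sum of all rays and v a vertex minimizing <q_v, w>. Then
    0 >= <q_v, w> >= - n + r (iota - 1), which is the bound. If equality holds then w = 0
    and all the inequalities above are equalities; the rays are then partitioned into r
    blocks of iota rays of sum zero, the cones being obtained by omitting one ray in each
    block: this is the fan of a power of the projective space of dimension iota - 1. *)

(** * Sheaf axioms for the basic spaces *)

(** Each geometric input is reduced to algebra on the torus. The torus being dense, identities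
    between regular functions are checked there, where linear independence of characters turns them
    into statements on exponents. Properness enters through the closedness of the projective
    embedding: a one-parameter subgroup moving a point gives a polynomial curve, whose limit stays
    in X; for a generic weight the limit is a fixed point, which produces the vertices and the
    covering by the [U v]. Smoothness enters by counting: the minimal generators of the monoid at a
    vertex form a basis of the cotangent space of the fixed point, so there are n of them. A line
    bundle on affine space is trivial because polynomial rings are factorial: a frame given off a
    hypersurface is extended across its prime components one at a time. The inequality rho <= r is
    proved in general; the equality rho = r is obtained from the bound on r once equality holds in
    the theorem, after separating the case iota <= 1, where multiplication by iota - 1 does not
    preserve inequalities. *)

Section Nice.
Variable K : closedFieldType.

(* The sheaf axioms, together with the invertibility of nonvanishing functions. *)
Record nice (X : ringed_set K) : Prop := Nice {
  nice_opnT : opn [set: X];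
  nice_opn : forall W : set X,
    (forall x, W x -> exists V, [/\ opn V, V x & V `<=` W]) -> opn W;
  nice_opnI : forall V W : set X, opn V -> opn W -> opn (V `&` W);
  nice_reg_opn : forall (W : set X) f, reg W f -> opn W;
  nice_reg : forall (W : set X) f,
    (forall x, W x -> exists V g,
       [/\ reg V g, V x & forall y, V y -> W y /\ f y = g y]) -> reg W f;
  nice_res : forall (W V : set X) f, reg W f -> opn V -> V `<=` W -> reg V f;
  nice_cst : forall (W : set X) c, opn W -> reg W (fun=> c);
  nice_add : forall (W : set X) f g,
    reg W f -> reg W g -> reg W (fun x => f x + g x);
  nice_mul : forall (W : set X) f g,
    reg W f -> reg W g -> reg W (fun x => f x * g x);
  nice_inv : forall (W : set X) f,
    reg W f -> reg (W `&` [set x | f x != 0]) (fun x => (f x)^-1) }.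

(** The clause [W y] makes a fraction carry a neighbourhood contained in [W] together with its
    formula. Openness of [W] is then the case of the zero function, see [glue_opn], and needs no
    separate treatment. *)
Definition frac_rep (T : Type) (U : set T) (G : set (T -> K)) x (W : set T)
    (f : T -> K) :=
  exists a b, [/\ alg G a, alg G b, b x != 0
    & forall y, U y -> b y != 0 -> W y /\ f y = a y / b y].

Lemma frac_repDM T (U : set T) G x W V f g :
  frac_rep U G x W f -> frac_rep U G x V g ->
  frac_rep U G x (W `&` V) (fun y => f y + g y) /\
  frac_rep U G x (W `&` V) (fun y => f y * g y).
Proof.
move=> [a [b [Ga Gb bx Hf]]] [c [d [Gc Gd dx Hg]]].
have Gbd : alg G (fun y => b y * d y) by apply: alg_mul.
have bdx : b x * d x != 0 by rewrite mulf_neq0.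
split.
  exists (fun y => a y * d y + c y * b y), (fun y => b y * d y); split => //.
    by apply: alg_add; apply: alg_mul.
  move=> y Uy; rewrite mulf_eq0 negb_or => /andP[by0 dy0].
  have [Wy ->] := Hf _ Uy by0; have [Vy ->] := Hg _ Uy dy0.
  by split => //; field; rewrite by0 dy0.
exists (fun y => a y * c y), (fun y => b y * d y); split => //.
  exact: alg_mul.
move=> y Uy; rewrite mulf_eq0 negb_or => /andP[by0 dy0].
have [Wy ->] := Hf _ Uy by0; have [Vy ->] := Hg _ Uy dy0.
by split => //; field; rewrite by0 dy0.
Qed.

Lemma frac_repD T (U : set T) G x W V f g :
  frac_rep U G x W f -> frac_rep U G x V g ->
  frac_rep U G x (W `&` V) (fun y => f y + g y).
Proof. by move=> A B; have [] := frac_repDM A B. Qed.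

Lemma frac_repM T (U : set T) G x W V f g :
  frac_rep U G x W f -> frac_rep U G x V g ->
  frac_rep U G x (W `&` V) (fun y => f y * g y).
Proof. by move=> A B; have [] := frac_repDM A B. Qed.

Lemma frac_rep_sub T (U : set T) G x (W V : set T) f g :
  frac_rep U G x W f -> (forall y, U y -> W y -> V y /\ g y = f y) ->
  frac_rep U G x V g.
Proof.
move=> [a [b [Ga Gb bx H]]] WV; exists a, b; split => // y Uy by0.
by have [Wy E] := H _ Uy by0; have [Vy ->] := WV _ Uy Wy.
Qed.

Lemma frac_rep_cst T (U : set T) G x c : frac_rep U G x setT (fun=> c).
Proof.
exists (fun=> c), (fun=> 1); split => //; try exact: alg_cst.
  by rewrite oner_neq0.
by move=> y _ _; rewrite divr1.
Qed.

Lemma frac_rep_alg T (U : set T) G x f : alg G f -> frac_rep U G x setT f.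
Proof.
move=> Gf; exists f, (fun=> 1); split => //; first exact: alg_cst.
  by rewrite oner_neq0.
by move=> y _ _; rewrite divr1.
Qed.

Lemma frac_repV T (U : set T) G x W f : U x ->
  frac_rep U G x W f -> f x != 0 ->
  frac_rep U G x (W `&` [set y | f y != 0]) (fun y => (f y)^-1).
Proof.
move=> Ux [a [b [Ga Gb bx H]]] fx.
have ax : a x != 0.
  by apply: contraNneq fx => ax; rewrite (H _ Ux bx).2 ax mul0r.
exists (fun y => b y * b y), (fun y => a y * b y); split; try exact: alg_mul.
  by rewrite mulf_neq0.
move=> y Uy; rewrite mulf_eq0 negb_or => /andP[ay by0].
have [Wy E] := H _ Uy by0; split; first split => //=.
  by rewrite E mulf_neq0 // invr_neq0.
by rewrite E; field; rewrite ay by0.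
Qed.

(** Change of chart near [x]. As the fractions are confined to [U l], this also says that [U l]
    contains a neighbourhood of [x] in [U k]. *)
Definition refines (T I : Type) (U : I -> set T) (G : I -> set (T -> K)) l k x :=
  forall f, alg (G l) f -> frac_rep (U k) (G k) x (U l) f.

Lemma refines_gen (T I : Type) (U : I -> set T) (G : I -> set (T -> K)) l k x :
  U k x -> frac_rep (U k) (G k) x (U l) (fun=> 0) ->
  (forall f, G l f -> frac_rep (U k) (G k) x (U l) f) -> refines U G l k x.
Proof.
move=> Uk H0 HG f; elim => {f} [f /HG //|c|f g _ Hf _ Hg|f g _ Hf _ Hg].
- apply: frac_rep_sub (frac_repD H0 (frac_rep_cst _ _ _ c)) _ => y _ [] Uy _.
  by rewrite add0r.
- apply: frac_rep_sub (frac_repD Hf Hg) _ => y _ [] //.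
- by apply: frac_rep_sub (frac_repM Hf Hg) _ => y _ [] //.
Qed.

Lemma frac_rep_refines (T I : Type) (U : I -> set T) (G : I -> set (T -> K))
    l k x W f : U l x -> U k x ->
  refines U G l k x -> frac_rep (U l) (G l) x W f ->
  frac_rep (U k) (G k) x W f.
Proof.
move=> Ul Uk R [a [b [Ga Gb bx H]]].
apply: frac_rep_sub (frac_repM (R _ Ga) (frac_repV Uk (R _ Gb) bx)) _.
by move=> y Uy [] Uly [] _ /= by0; have [] := H _ Uly by0.
Qed.

(** Functions written in two different charts can only be added in a common third one. For
    projective space one of the two charts serves; for products it is the intersection of two
    rectangles. *)
Definition compat (T I : Type) (U : I -> set T) (G : I -> set (T -> K)) :=
  (forall x, exists i, U i x) /\
  forall i j x, U i x -> U j x ->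
    exists k, [/\ U k x, refines U G i k x & refines U G j k x].

Lemma glue_opn (T I : Type) (U : I -> set T) (G : I -> set (T -> K)) W :
  opn (W : set (glue U G)) <-> reg (W : set (glue U G)) (fun=> 0).
Proof.
split=> H x Wx.
  have [i [b [Gb Ui bx Hb]]] := H x Wx; exists i, (fun=> 0), b; split => //.
    exact: alg_cst.
  by move=> y Uy by0; rewrite mul0r; split => //; apply: Hb.
have [i [a [b [Ga Gb Ui bx Hb]]]] := H x Wx; exists i, b; split => //.
by move=> y Uy by0; have [] := Hb _ Uy by0.
Qed.

Lemma glue_reg (T I : Type) (U : I -> set T) (G : I -> set (T -> K)) W f :
  reg (W : set (glue U G)) f <->
  forall x, W x -> exists2 i, U i x & frac_rep (U i) (G i) x W f.
Proof.
split=> H x Wx.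
  by have [i [a [b [Ga Gb Ui bx Hb]]]] := H x Wx; exists i => //; exists a, b.
by have [i Ui [a [b [Ga Gb bx Hb]]]] := H x Wx; exists i, a, b.
Qed.

Lemma glue_nice (T I : Type) (U : I -> set T) (G : I -> set (T -> K)) :
  compat U G -> nice (glue U G).
Proof.
move=> [cov cmp].
(* Both functions are moved to a common chart, which reduces the algebraic axioms to computations
   with fractions in a single chart. *)
have regI (V W : set (glue U G)) f g (h : T -> K) : reg V f -> reg W g ->
  (forall i x, U i x -> frac_rep (U i) (G i) x V f ->
    frac_rep (U i) (G i) x W g ->
    frac_rep (U i) (G i) x (V `&` W) h) -> reg (V `&` W) h.
  move=> /glue_reg HV /glue_reg HW H; apply/glue_reg => x [Vx Wx].
  have [i Ui Ri] := HV x Vx; have [j Uj Rj] := HW x Wx.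
  have [k [Uk R1 R2]] := cmp _ _ _ Ui Uj.
  exists k => //; apply: H => //.
    exact: frac_rep_refines Ri.
  exact: frac_rep_refines Rj.
split.
- apply/glue_opn/glue_reg => x _; have [i Ui] := cov x; exists i => //.
  exact: frac_rep_cst.
- move=> W H; apply/glue_opn/glue_reg => x Wx.
  have [V [/glue_opn/glue_reg oV Vx VW]] := H _ Wx.
  have [i Ui R] := oV _ Vx; exists i => //.
  by apply: frac_rep_sub R _ => y _ /VW.
- move=> V W /glue_opn oV /glue_opn oW; apply/glue_opn.
  apply: regI oV oW _ => i x _ R1 R2; apply: frac_rep_sub (frac_repD R1 R2) _.
  by move=> y _ ?; rewrite addr0.
- move=> W f /glue_reg H; apply/glue_opn/glue_reg => x Wx.
  have [i Ui R] := H _ Wx; exists i => //.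
  apply: frac_rep_sub (frac_repM R (frac_rep_cst _ _ _ 0)) _.
  by move=> y _ [? _]; rewrite mulr0.
- move=> W f H; apply/glue_reg => x Wx.
  have [V [g [/glue_reg rV Vx E]]] := H _ Wx.
  have [i Ui R] := rV _ Vx; exists i => //.
  by apply: frac_rep_sub R _ => y _ /E.
- move=> W V f rW /glue_opn rV VW; rewrite (_ : V = W `&` V); last first.
    by apply/seteqP; split => x //= => [Vx|[]//]; split => //; apply: VW.
  apply: regI rW rV _ => i x _ R1 R2; apply: frac_rep_sub (frac_repD R1 R2) _.
  by move=> y _ ?; rewrite addr0.
- move=> W c /glue_opn/glue_reg H; apply/glue_reg => x Wx.
  have [i Ui R] := H _ Wx; exists i => //.
  apply: frac_rep_sub (frac_repD R (frac_rep_cst _ _ _ c)) _.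
  by move=> y _ [? _]; rewrite add0r.
- move=> W f g rf rg; rewrite -[W]setIid; apply: regI rf rg _ => i x _.
  exact: frac_repD.
- move=> W f g rf rg; rewrite -[W]setIid; apply: regI rf rg _ => i x _.
  exact: frac_repM.
- move=> W f /glue_reg H; apply/glue_reg => x [Wx fx].
  have [i Ui R] := H _ Wx; exists i => //.
  exact: frac_repV.
Qed.

Lemma single_chart_nice (T : Type) (G : set (T -> K)) :
  nice (glue (fun _ : unit => setT) (fun=> G)).
Proof.
apply: glue_nice; split=> [x|[] [] x _ _]; first by exists tt.
by exists tt; split => // f; apply: frac_rep_alg.
Qed.

Lemma torus_nice n : nice (torus K n).
Proof. exact: single_chart_nice. Qed.

Lemma point_nice : nice (point_space K).
Proof. exact: single_chart_nice. Qed.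

(** The denominator is [x_j / x_i], because [x_k / x_j] is the quotient of [x_k / x_i] by it. *)
Lemma proj_refines N i j x : hcoord x i != 0 -> hcoord x j != 0 ->
  refines (fun i => [set l : proj_pt K N | hcoord l i != 0])
  (fun i => [set f | exists j, f = fun l => hcoord l j / hcoord l i]) j i x.
Proof.
move=> /= xi xj.
have Gj k : alg [set f | exists j, f = fun l : proj_pt K N =>
    hcoord l j / hcoord l i] (fun l => hcoord l k / hcoord l i).
  by apply: alg_gen; exists k.
apply: refines_gen => //.
  exists (fun=> 0), (fun l => hcoord l j / hcoord l i); split=> //.
  - exact: alg_cst.
  - by rewrite mulf_neq0 // invr_neq0.
  - by move=> y yi; rewrite mul0r mulf_eq0 negb_or => /andP[].
move=> _ [k ->]; exists (fun l => hcoord l k / hcoord l i),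
  (fun l => hcoord l j / hcoord l i); split=> //.
  by rewrite mulf_neq0 // invr_neq0.
move=> y yi; rewrite mulf_eq0 negb_or => /andP[yj _]; split => //.
by field; rewrite yi yj.
Qed.

Lemma hcoord_neq0 N (l : proj_pt K N) : exists i, hcoord l i != 0.
Proof.
have l0 : vpick (sval l) != 0.
  by rewrite vpick0; apply: contra_eq_neq (svalP l) => ->; rewrite dimv0.
apply: contrapT => H; case/eqP: l0; apply/rowP => i; rewrite mxE.
by apply: contrapT => /eqP ?; apply: H; exists i.
Qed.

Lemma proj_compat N : compat (fun i => [set l : proj_pt K N | hcoord l i != 0])
  (fun i => [set f | exists j, f = fun l => hcoord l j / hcoord l i]).
Proof.
split=> [l|i j x xi xj]; first exact: hcoord_neq0.
by exists i; split => //; apply: proj_refines.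
Qed.

Lemma proj_nice N : nice (proj_space K N).
Proof. exact: glue_nice (proj_compat N). Qed.

Lemma prod_nice (X Y : ringed_set K) : nice X -> nice Y -> nice (prod_space X Y).
Proof.
move=> nX nY; apply: glue_nice; split=> [x|i j x [i1 i2 xi1 xi2] [j1 j2 xj1 xj2]].
  by exists (setT, setT); split => //; apply: nice_opnT.
exists (i.1 `&` j.1, i.2 `&` j.2).
have o1 : opn (i.1 `&` j.1) by apply: nice_opnI.
have o2 : opn (i.2 `&` j.2) by apply: nice_opnI.
split; first by split.
  apply: refines_gen => /=; first by split.
    apply: frac_rep_sub (frac_rep_cst _ _ _ 0) _ => y /= [_ _ [] ? _ [] ? _] _.
    by split.
  move=> _ [[f rf ->]|[f rf ->]].
    apply: frac_rep_sub (frac_rep_alg _ _ _) _.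
      by apply: alg_gen; left; exists f => //; apply: nice_res rf _ _ => // ? [].
    by move=> y /= [_ _ [] ? _ [] ? _] _; split.
  apply: frac_rep_sub (frac_rep_alg _ _ _) _.
    by apply: alg_gen; right; exists f => //; apply: nice_res rf _ _ => // ? [].
  by move=> y /= [_ _ [] ? _ [] ? _] _; split.
apply: refines_gen => /=; first by split.
  apply: frac_rep_sub (frac_rep_cst _ _ _ 0) _ => y /= [_ _ [] _ ? [] _ ?] _.
  by split.
move=> _ [[f rf ->]|[f rf ->]].
  apply: frac_rep_sub (frac_rep_alg _ _ _) _.
    by apply: alg_gen; left; exists f => //; apply: nice_res rf _ _ => // ? [].
  by move=> y /= [_ _ [] _ ? [] _ ?] _; split.
apply: frac_rep_sub (frac_rep_alg _ _ _) _.
  by apply: alg_gen; right; exists f => //; apply: nice_res rf _ _ => // ? [].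
by move=> y /= [_ _ [] _ ? [] _ ?] _; split.
Qed.

Lemma power_nice (X : ringed_set K) r : nice X -> nice (power X r).
Proof.
by move=> nX; elim: r => [|r IH] /=; [exact: point_nice | exact: prod_nice].
Qed.

(** Regular functions are local restrictions of ambient ones, so each axiom is transported by
    choosing ambient representatives. For openness the representative is the union of all ambient
    open sets whose preimage is contained in the given set. *)
Lemma closed_immersion_nice (X Y : ringed_set K) (f : X -> Y) :
  nice Y -> closed_immersion f -> nice X.
Proof.
move=> nY [finj _ fo fr].
have ro (W : set X) g : reg W g -> opn W by move/fr => [].
have rI (W : set X) g : opn W -> (forall x, W x -> exists V h, [/\ reg V h, V (f x)
  & forall y, W y -> V (f y) -> g y = h (f y)]) -> reg W g.
  by move=> ? ?; apply/fr.
have oI (V W : set X) : opn V -> opn W -> opn (V `&` W).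
  move=> /fo[V' oV ->] /fo[W' oW ->]; apply/fo.
  by exists (V' `&` W') => //; apply: nice_opnI.
split => //.
- by apply/fo; exists setT => //; apply: nice_opnT.
- move=> W H; apply/fo; exists (\bigcup_(V in [set V | opn V /\ f @^-1` V `<=` W]) V).
    apply: nice_opn => // y [V [oV VW] Vy]; exists V; split => // z Vz.
    by exists V.
  apply/seteqP; split=> [x Wx|x [V [oV VW] Vy]]; last exact: VW.
  have [V [/fo[V' oV' VE] Vx VW]] := H _ Wx; exists V'; last by rewrite VE in Vx.
  by split => //; rewrite -VE.
- move=> W g H; have oW : opn W.
    apply/fo; exists (\bigcup_(V in [set V | opn V /\ f @^-1` V `<=` W]) V).
      apply: nice_opn => // y [V [oV VW] Vy]; exists V; split => // z Vz.
      by exists V.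
    apply/seteqP; split=> [x Wx|x [V [oV VW] Vy]]; last exact: VW.
    have [V [h [/ro/fo[V' oV' VE] Vx VW]]] := H _ Wx; exists V'.
      by split => // z V'z; have [] := VW z; rewrite ?VE.
    by rewrite VE in Vx.
  apply: rI => // x Wx; have [V [h [rV Vx E]]] := H _ Wx.
  have [oV HV] := (fr _ _).1 rV; have [V1 [h1 [r1 V1x E1]]] := HV _ Vx.
  have /fo[V2 oV2 V2E] := oV.
  exists (V1 `&` V2), h1; split.
  - apply: (nice_res nY r1) => //; apply: nice_opnI => //.
    exact: nice_reg_opn nY _ _ r1.
  - by split => //; rewrite V2E in Vx.
  - move=> y Wy [V1y V2y]; have Vy : V y by rewrite V2E.
    by rewrite (E _ Vy).2 E1.
- move=> W V g /fr[oW H] oV VW; apply: rI => // x Vx.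
  have [V1 [h [r1 V1x E]]] := H _ (VW _ Vx); exists V1, h; split => // y /VW.
  exact: E.
- move=> W c oW; apply: rI => // x Wx; exists setT, (fun=> c); split => //.
  by apply: nice_cst => //; apply: nice_opnT.
- move=> W g h /fr[oW Hg] /fr[_ Hh]; apply: rI => // x Wx.
  have [V1 [g1 [r1 V1x E1]]] := Hg _ Wx; have [V2 [g2 [r2 V2x E2]]] := Hh _ Wx.
  have o12 : opn (V1 `&` V2) by apply: nice_opnI; [|apply: nice_reg_opn r1|apply: nice_reg_opn r2].
  exists (V1 `&` V2), (fun y => g1 y + g2 y); split => //.
    by apply: nice_add => //; [apply: nice_res r1 _ _|apply: nice_res r2 _ _] => // ? [].
  by move=> y Wy [? ?]; rewrite E1 // E2.
- move=> W g h /fr[oW Hg] /fr[_ Hh]; apply: rI => // x Wx.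
  have [V1 [g1 [r1 V1x E1]]] := Hg _ Wx; have [V2 [g2 [r2 V2x E2]]] := Hh _ Wx.
  have o12 : opn (V1 `&` V2) by apply: nice_opnI; [|apply: nice_reg_opn r1|apply: nice_reg_opn r2].
  exists (V1 `&` V2), (fun y => g1 y * g2 y); split => //.
    by apply: nice_mul => //; [apply: nice_res r1 _ _|apply: nice_res r2 _ _] => // ? [].
  by move=> y Wy [? ?]; rewrite E1 // E2.
- move=> W g /fr[oW Hg].
  have oWg : opn (W `&` [set x | g x != 0]).
    apply/fo; exists (\bigcup_(V in [set V | opn V /\ f @^-1` V `<=` W `&` [set x | g x != 0]]) V).
      apply: nice_opn => // y [V [oV VW] Vy]; exists V; split => // z Vz.
      by exists V.
    apply/seteqP; split=> [x [Wx gx]|x [V [oV VW] Vy]]; last exact: VW.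
    have /fo[W' oW' WE] := oW; have [V1 [g1 [r1 V1x E1]]] := Hg _ Wx.
    have := nice_inv nY r1 => /(nice_reg_opn nY) o1.
    exists (W' `&` (V1 `&` [set y | g1 y != 0])); last first.
      split; first by move: Wx; rewrite WE.
      by split => //=; rewrite -E1.
    split; first exact: nice_opnI.
    move=> z [W'z [V1z /= gz]]; have Wz : W z by rewrite WE.
    by split => //=; rewrite E1.
  apply: rI => // x [Wx gx]; have [V1 [g1 [r1 V1x E1]]] := Hg _ Wx.
  exists (V1 `&` [set y | g1 y != 0]), (fun y => (g1 y)^-1); split.
  - exact: nice_inv.
  - by split => //=; rewrite -E1.
  - by move=> y [Wy _] [? _]; rewrite E1.
Qed.

End Nice.

(** * Regular functions, charts, morphisms and products *)

Section Charts.
Variable K : closedFieldType.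
Implicit Types X Y Z : ringed_set K.

Lemma reg_ext X (W : set X) f g : nice X ->
  reg W f -> (forall y, W y -> g y = f y) -> reg W g.
Proof. by move=> nX rf E; apply: nice_reg => // x Wx; exists W, f; split => // y Wy; rewrite E. Qed.

Lemma reg_sum X (W : set X) (I : Type) (r : seq I) (P : pred I) (f : I -> X -> K) :
  nice X -> opn W -> (forall i, P i -> reg W (f i)) ->
  reg W (fun y => \sum_(i <- r | P i) f i y).
Proof.
move=> nX oW H; elim: r => [|i r IH].
  by apply: reg_ext (nice_cst nX 0 oW) _ => // y _; rewrite big_nil.
case: (boolP (P i)) => Pi.
  by apply: reg_ext (nice_add nX (H _ Pi) IH) _ => // y _; rewrite big_cons Pi.
by apply: reg_ext IH _ => // y _; rewrite big_cons (negbTE Pi).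
Qed.

Lemma reg_prod X (W : set X) (I : Type) (r : seq I) (P : pred I) (f : I -> X -> K) :
  nice X -> opn W -> (forall i, P i -> reg W (f i)) ->
  reg W (fun y => \prod_(i <- r | P i) f i y).
Proof.
move=> nX oW H; elim: r => [|i r IH].
  by apply: reg_ext (nice_cst nX 1 oW) _ => // y _; rewrite big_nil.
case: (boolP (P i)) => Pi.
  by apply: reg_ext (nice_mul nX (H _ Pi) IH) _ => // y _; rewrite big_cons Pi.
by apply: reg_ext IH _ => // y _; rewrite big_cons (negbTE Pi).
Qed.

Lemma reg_exp X (W : set X) f k : nice X -> reg W f -> reg W (fun y => f y ^+ k).
Proof.
move=> nX rf; elim: k => [|k IH].
  by apply: reg_ext (nice_cst nX 1 (nice_reg_opn nX rf)) _.
by apply: reg_ext (nice_mul nX rf IH) _ => // y _; rewrite exprS.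
Qed.

Lemma reg_opp X (W : set X) f : nice X -> reg W f -> reg W (fun y => - f y).
Proof.
move=> nX rf; apply: reg_ext (nice_mul nX (nice_cst nX (-1) (nice_reg_opn nX rf)) rf) _ => //.
by move=> y _; rewrite mulN1r.
Qed.

Lemma reg_sub X (W : set X) f g : nice X -> reg W f -> reg W g ->
  reg W (fun y => f y - g y).
Proof. by move=> nX rf rg; apply: nice_add => //; apply: reg_opp. Qed.

Lemma reg_inv X (W : set X) f : nice X -> reg W f ->
  (forall y, W y -> f y != 0) -> reg W (fun y => (f y)^-1).
Proof.
move=> nX rf f0; have := nice_inv nX rf.
by rewrite (_ : W `&` _ = W) //; apply/seteqP; split => [x []//|x Wx]; split => //=; apply: f0.
Qed.

Lemma reg_exprz X (W : set X) f (k : int) : nice X -> reg W f ->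
  (forall y, W y -> f y != 0) -> reg W (fun y => f y ^ k).
Proof.
move=> nX rf f0; case: k => k; first exact: reg_exp.
apply: reg_inv => //; first exact: reg_exp.
by move=> y Wy; rewrite expf_neq0 // f0.
Qed.

Lemma opn_neq0 X (W : set X) f : nice X -> reg W f -> opn (W `&` [set y | f y != 0]).
Proof. by move=> nX rf; apply: (nice_reg_opn nX (nice_inv nX rf)). Qed.

Lemma reg_resI X (W V : set X) f : nice X -> reg W f -> opn V -> reg (W `&` V) f.
Proof.
move=> nX rf oV; apply: (nice_res nX rf); last by move=> ? [].
by apply: nice_opnI => //; apply: (nice_reg_opn nX rf).
Qed.

Lemma reg_resIr X (W V : set X) f : nice X -> reg W f -> opn V -> reg (V `&` W) f.
Proof. by move=> nX rf oV; rewrite setIC; apply: reg_resI. Qed.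

(* As for an affine open set, near each point the sections are quotients of
   elements of the algebra generated by [G]. *)
Definition chart X (U : set X) (G : set (X -> K)) :=
  [/\ opn U, forall f, G f -> reg U f
    & forall (W : set X) g x, reg W g -> W x -> U x -> frac_rep U G x W g].

Lemma frac_rep_gen T (U : set T) (G G' : set (T -> K)) x W f :
  U x ->
  (forall g, G g -> frac_rep U G' x setT g) ->
  frac_rep U G x W f -> frac_rep U G' x W f.
Proof.
move=> Ux HG [a [b [Ga Gb bx H]]].
have HA g : alg G g -> frac_rep U G' x setT g.
  elim=> {g} [g /HG //|c|f1 g1 _ Hf _ Hg|f1 g1 _ Hf _ Hg].
  - exact: frac_rep_cst.
  - exact: frac_rep_sub (frac_repD Hf Hg) _.
  - exact: frac_rep_sub (frac_repM Hf Hg) _.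
apply: frac_rep_sub (frac_repM (HA _ Ga) (frac_repV Ux (HA _ Gb) bx)) _.
by move=> y Uy [_ [_ /= b0]]; apply: H.
Qed.

Definition dense X (O : set X) :=
  forall U : set X, opn U -> U !=set0 -> U `&` O !=set0.

(** The locus where [f - g] does not vanish is open, so if nonempty it would meet [O]. Most
    identities below are proved in this way, with [O] the open torus. *)
Lemma dense_eq X (O W : set X) f g : nice X -> dense O ->
  reg W f -> reg W g -> (forall y, W y -> O y -> f y = g y) ->
  forall y, W y -> f y = g y.
Proof.
move=> nX dO rf rg E y Wy; apply/eqP; rewrite -subr_eq0; apply: contrapT => /negP fg.
have oV := opn_neq0 nX (reg_sub nX rf rg).
have [|z [[Wz /= fgz] Oz]] := dO _ oV; first by exists y.
by move/eqP: fgz; rewrite E // subrr.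
Qed.

(** Local extensions of [g] agree on overlaps by density, hence glue. Only the values of [g] on [O]
    matter, and the second conclusion is the form in which uniqueness gets used. *)
Lemma dense_ext X (O W : set X) g : nice X -> dense O -> opn W ->
  (forall x, W x -> exists V h,
    [/\ reg V h, V x & forall y, V y -> O y -> h y = g y]) ->
  exists2 g', reg W g' & forall (V : set X) h, reg V h ->
    (forall y, V y -> O y -> h y = g y) -> forall y, V y -> W y -> g' y = h y.
Proof.
move=> nX dO oW H.
pose P y := [set c | exists V h, [/\ reg V h, V y, forall y, V y -> O y -> h y = g y
  & c = h y]].
have key (V : set X) h : reg V h -> (forall y, V y -> O y -> h y = g y) ->
    forall y, V y -> W y -> xget 0 (P y) = h y.
  move=> rV E y Vy Wy; have : P y (h y) by exists V, h.
  move=> /(xgetI 0)[V' [h' [rV' V'y E' ->]]].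
  have oI : opn (V `&` V') by apply: nice_opnI => //; [exact: (nice_reg_opn nX rV)|exact: (nice_reg_opn nX rV')].
  apply: (dense_eq nX dO (W := V `&` V')) => //.
  - by rewrite setIC; apply: reg_resI => //; exact: (nice_reg_opn nX rV).
  - by apply: reg_resI => //; exact: (nice_reg_opn nX rV').
  - by move=> z [Vz V'z] Oz; rewrite E // E'.
exists (fun y => xget 0 (P y)); last by move=> V h rV E y Vy Wy; apply: key E _ _ _.
apply: nice_reg => // x Wx; have [V [h [rV Vx E]]] := H x Wx.
exists (V `&` W), h; split => //; first exact: reg_resI.
by move=> y [Vy Wy]; split => //; apply: key E _ _ _.
Qed.

Lemma morphism_comp X Y Z (f : X -> Y) (g : Y -> Z) :
  morphism f -> morphism g -> morphism (fun x => g (f x)).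
Proof.
move=> [f1 f2] [g1 g2]; split => [V oV|V h rV]; first exact: (f1 _ (g1 _ oV)).
exact: (f2 _ _ (g2 _ _ rV)).
Qed.

Lemma frac_rep_pullback T Y (U : set T) (G : set (T -> K)) (f : Y -> T)
  (W : set Y) V h y : nice Y -> opn W ->
  (forall z, W z -> U (f z)) -> (forall g, G g -> reg W (fun z => g (f z))) ->
  W y -> frac_rep U G (f y) V h ->
  exists2 W', W' y & reg W' (fun z => h (f z)) /\ W' `<=` f @^-1` V.
Proof.
move=> nY oW WU HG Wy [a [b [Ga Gb by0 H]]].
have HA g : alg G g -> reg W (fun z => g (f z)).
  elim=> {g} [g /HG //|c|f1 g1 _ Hf _ Hg|f1 g1 _ Hf _ Hg].
  - exact: nice_cst.
  - exact: nice_add.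
  - exact: nice_mul.
have rb := HA _ Gb.
exists (W `&` [set z | b (f z) != 0]) => //; split.
  have r1 := reg_resI nY (HA _ Ga) (opn_neq0 nY rb).
  have r2 : reg (W `&` (W `&` [set z | b (f z) != 0])) (fun z => (b (f z))^-1).
    by rewrite setIA setIid; exact: nice_inv.
  have r3 := nice_mul nY r1 r2; rewrite setIA setIid in r3.
  by apply: reg_ext r3 _ => // z [Wz /= bz]; rewrite (H _ (WU _ Wz) bz).2.
by move=> z [Wz /= bz]; have [] := H _ (WU _ Wz) bz.
Qed.

(** Fractions pull back to fractions, so it is enough that the generators of suitable charts pull
    back to regular functions. *)
Lemma morphism_chart X Y (f : Y -> X) : nice X -> nice Y ->
  (forall y, exists W U G, [/\ chart U G, opn W, W y, forall z, W z -> U (f z)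
     & forall g, G g -> reg W (fun z => g (f z))]) -> morphism f.
Proof.
move=> nX nY H.
have key V h : reg V h -> reg (f @^-1` V) (fun z => h (f z)).
  move=> rV; apply: nice_reg => // y Vy.
  have [W [U [G [[_ _ cU] oW Wy WU HG]]]] := H y.
  have [W' W'y [rW' W'V]] := frac_rep_pullback nY oW WU HG Wy (cU _ _ _ rV Vy (WU _ Wy)).
  by exists W', (fun z => h (f z)); split => // z W'z; split => //; apply: W'V.
split => // V oV; apply: (nice_reg_opn nY (key V (fun=> 0) _)).
exact: nice_cst.
Qed.

Lemma morphism_glue Y (T I : Type) (U : I -> set T) (G : I -> set (T -> K))
    (f : Y -> glue U G) : nice Y ->
  (forall i y, U i (f y) -> exists W, [/\ opn W, W y, forall z, W z -> U i (f z)
     & forall g, G i g -> reg W (fun z => g (f z))]) -> morphism f.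
Proof.
move=> nY H.
have key V h : reg V h -> reg (f @^-1` V) (fun z => h (f z)).
  move=> /glue_reg rV; apply: nice_reg => // y Vy; have [i Ui R] := rV _ Vy.
  have [W [oW Wy WU HG]] := H _ _ Ui.
  have [W' W'y [rW' W'V]] := frac_rep_pullback nY oW WU HG Wy R.
  by exists W', (fun z => h (f z)); split => // z W'z; split => //; apply: W'V.
split => // V /glue_opn oV; exact: (nice_reg_opn nY (key V (fun=> 0) oV)).
Qed.

Lemma fst_morphism X Y : nice X -> nice Y ->
  morphism (fst : prod_space X Y -> X).
Proof.
move=> nX nY; have key (V : set X) h : reg V h -> reg ((fst : prod_space X Y -> X) @^-1` V) (fun z : prod_space X Y => h z.1).
  move=> rV; apply/glue_reg => z Vz; exists (V, setT).
    by split=> //=; [exact: (nice_reg_opn nX rV)|exact: nice_opnT].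
  apply: frac_rep_sub (frac_rep_alg _ _ _) _; last by move=> y [_ _ Vy _] _; split; [exact: Vy|].
  by apply: alg_gen; left; exists h.
split => // V oV; apply: (nice_reg_opn (prod_nice nX nY) (key V (fun=> 0) _)).
exact: nice_cst.
Qed.

Lemma snd_morphism X Y : nice X -> nice Y ->
  morphism (snd : prod_space X Y -> Y).
Proof.
move=> nX nY; have key (V : set Y) h : reg V h -> reg ((snd : prod_space X Y -> Y) @^-1` V) (fun z : prod_space X Y => h z.2).
  move=> rV; apply/glue_reg => z Vz; exists (setT, V).
    by split=> //=; [exact: nice_opnT|exact: (nice_reg_opn nY rV)].
  apply: frac_rep_sub (frac_rep_alg _ _ _) _; last by move=> y [_ _ _ Vy] _; split; [exact: Vy|].
  by apply: alg_gen; right; exists h.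
split => // V oV; apply: (nice_reg_opn (prod_nice nX nY) (key V (fun=> 0) _)).
exact: nice_cst.
Qed.

Lemma pair_morphism X Y Z (f : Z -> X) (g : Z -> Y) : nice Z ->
  morphism f -> morphism g -> morphism (fun z => (f z, g z) : prod_space X Y).
Proof.
move=> nZ [of_ rf] [og rg]; apply: morphism_glue => // i z [/= o1 o2 i1 i2].
have oW : opn (f @^-1` i.1 `&` g @^-1` i.2).
  by apply: nice_opnI => //; [exact: of_|exact: og].
exists (f @^-1` i.1 `&` g @^-1` i.2); split => //; first by move=> ? [].
move=> _ [[h rh ->]|[h rh ->]] /=.
  by apply: (nice_res nZ (rf _ _ rh)) => // ? [].
by apply: (nice_res nZ (rg _ _ rh)) => // ? [].
Qed.

Lemma cst_morphism X Y (y : Y) : nice X -> nice Y -> morphism (fun _ : X => y).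
Proof.
move=> nX nY; have key (V : set Y) h : reg V h -> reg ((fun _ : X => y) @^-1` V) (fun=> h y).
  move=> rV; apply: nice_reg => // x Vy; exists setT, (fun=> h y); split => //.
  by apply: nice_cst => //; apply: nice_opnT.
split => // V oV; apply: (nice_reg_opn nX (key V (fun=> 0) _)).
exact: nice_cst.
Qed.

Lemma id_morphism X : morphism (fun x : X => x).
Proof. by split. Qed.

(** Powers are nested pairs ending in a point; [power_pr] and [power_mk] give them the universal
    property of a product indexed by ['I_r]. *)
Fixpoint power_pr X r : power X r -> 'I_r -> X :=
  match r return power X r -> 'I_r -> X with
  | 0 => fun _ i => False_rect _ (notF (ltn_ord i))
  | r'.+1 => fun p i => if unlift ord0 i is Some j then power_pr p.2 j else p.1
  end.

Fixpoint power_mk X r : ('I_r -> X) -> power X r :=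
  match r return ('I_r -> X) -> power X r with
  | 0 => fun _ => tt
  | r'.+1 => fun f => (f ord0, power_mk (fun i => f (lift ord0 i)))
  end.

Lemma power_mkK X r (f : 'I_r -> X) i : power_pr (power_mk f) i = f i.
Proof.
elim: r f i => [|r IH] f i /=; first by case: i.
by case: unliftP => [j|] -> //; rewrite IH.
Qed.

Lemma power_ext X r (p q : power X r) :
  (forall i, power_pr p i = power_pr q i) -> p = q.
Proof.
elim: r p q => [|r IH] [] //=; first by move=> [].
move=> p1 p2 [q1 q2] H; congr pair; first by have := H ord0; rewrite unlift_none.
by apply: IH => i; have := H (lift ord0 i); rewrite liftK.
Qed.

Lemma power_pr_morphism X r (i : 'I_r) : nice X ->
  morphism (fun p : power X r => power_pr p i).
Proof.
move=> nX; elim: r i => [|r IH] i; first by case: i.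
rewrite /=; case: unliftP => [j|] _.
  exact: morphism_comp (snd_morphism nX (power_nice r nX)) (IH j).
exact: (fst_morphism nX (power_nice r nX)).
Qed.

Lemma power_mk_morphism X Y r (f : Y -> 'I_r -> X) : nice Y ->
  (forall i, morphism (fun y => f y i)) -> morphism (fun y => power_mk (f y)).
Proof.
move=> nY; elim: r f => [|r IH] f H /=.
  exact: (cst_morphism _ nY (point_nice K)).
exact: pair_morphism (H ord0) (IH _ (fun i => H _)).
Qed.

Lemma proj_chart N i :
  chart (X := proj_space K N) [set l | hcoord l i != 0]
    [set f | exists j, f = fun l => hcoord l j / hcoord l i].
Proof.
have oU : opn ([set l | hcoord l i != 0] : set (proj_space K N)).
  apply/glue_opn/glue_reg => x Ux; exists i => //.
  exact: frac_rep_sub (frac_rep_cst _ _ _ 0) _.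
split => //.
  move=> f Gf; apply/glue_reg => x Ux; exists i => //.
  by apply: frac_rep_sub (frac_rep_alg _ _ _) _; [exact: alg_gen Gf|].
move=> W g x /glue_reg rW Wx Ux; have [j Uj R] := rW _ Wx.
exact: (@frac_rep_refines _ _ _ (fun i => [set l : proj_pt K N | hcoord l i != 0])
  (fun i => [set f | exists j, f = fun l => hcoord l j / hcoord l i])
  j i x W g Uj Ux (proj_refines Ux Uj) R).
Qed.

Lemma single_chart (T : Type) (G : set (T -> K)) :
  chart (X := glue (fun _ : unit => setT) (fun=> G)) setT G.
Proof.
split.
- exact: (nice_opnT (single_chart_nice G)).
- move=> f Gf; apply/glue_reg => x _; exists tt => //.
  by apply: frac_rep_alg; apply: alg_gen.
- by move=> W g x /glue_reg rW Wx _; have [j Uj R] := rW _ Wx.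
Qed.

End Charts.

(** * Differential calculus *)

Section Diff.
Variables (K : closedFieldType) (X : ringed_set K).
Hypothesis nX : nice X.
Implicit Types (x : X) (f g : X -> K).

Lemma reg_regular_at (U : set X) x f : reg U f -> U x -> regular_at x f.
Proof. by move=> rf Ux; exists U; split => //; exact: (nice_reg_opn nX rf). Qed.

Lemma regular_at_cst x (c : K) : regular_at x (fun=> c).
Proof. by exists setT; split => //; [|apply: nice_cst]; try exact: nice_opnT. Qed.

Lemma regular_at2 x f g : regular_at x f -> regular_at x g ->
  exists U : set X, [/\ opn U, U x, reg U f & reg U g].
Proof.
move=> [U [oU Ux rf]] [V [oV Vx rg]]; exists (U `&` V); split => //.
- exact: nice_opnI.
- exact: reg_resI.
- exact: reg_resIr.
Qed.

Lemma regular_atD x f g : regular_at x f -> regular_at x g ->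
  regular_at x (fun y => f y + g y).
Proof.
by move=> rf rg; have [U [oU Ux r1 r2]] := regular_at2 rf rg; exists U; split => //; apply: nice_add.
Qed.

Lemma regular_atM x f g : regular_at x f -> regular_at x g ->
  regular_at x (fun y => f y * g y).
Proof.
by move=> rf rg; have [U [oU Ux r1 r2]] := regular_at2 rf rg; exists U; split => //; apply: nice_mul.
Qed.

Lemma regular_atB x f g : regular_at x f -> regular_at x g ->
  regular_at x (fun y => f y - g y).
Proof.
by move=> rf rg; have [U [oU Ux r1 r2]] := regular_at2 rf rg; exists U; split => //; apply: reg_sub.
Qed.

Lemma regular_atV x f : regular_at x f -> f x != 0 ->
  regular_at x (fun y => (f y)^-1).
Proof.
move=> [U [oU Ux r]] fx; exists (U `&` [set y | f y != 0]); split => //.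
  exact: opn_neq0.
exact: nice_inv.
Qed.

Lemma regular_at_sum x (I : Type) (r : seq I) (P : pred I) (f : I -> X -> K) :
  (forall i, P i -> regular_at x (f i)) ->
  regular_at x (fun y => \sum_(i <- r | P i) f i y).
Proof.
move=> H; elim: r => [|i r IH].
  by under boolp.eq_fun => y do rewrite big_nil; apply: regular_at_cst.
case: (boolP (P i)) => Pi.
  under boolp.eq_fun => y do rewrite big_cons Pi.
  by apply: regular_atD => //; apply: H.
by under boolp.eq_fun => y do rewrite big_cons (negbTE Pi).
Qed.

Lemma regular_at_ext (V : set X) x f g : opn V -> V x ->
  (forall y, V y -> g y = f y) -> regular_at x f -> regular_at x g.
Proof.
move=> oV Vx E [U [oU Ux rf]]; exists (U `&` V); split => //.
  exact: nice_opnI.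
by apply: reg_ext (reg_resI nX rf oV) _ => // y [_ /E].
Qed.

Lemma ims_ext (V : set X) x f g : opn V -> V x ->
  (forall y, V y -> g y = f y) -> in_max_sq x f -> in_max_sq x g.
Proof.
move=> oV Vx E [k [a [b [U [Ha Hb oU Ux H]]]]]; exists k, a, b, (U `&` V); split => //.
  exact: nice_opnI.
by move=> y [Uy Vy]; rewrite E // H.
Qed.

Lemma ims_eq x f g : (forall y, g y = f y) -> in_max_sq x f -> in_max_sq x g.
Proof. by move=> E; apply: (ims_ext (V := setT)) => //; apply: nice_opnT. Qed.

Lemma ims_mul x f g : regular_at x f -> regular_at x g -> f x = 0 -> g x = 0 ->
  in_max_sq x (fun y => f y * g y).
Proof.
move=> rf rg f0 g0; exists 1%N, (fun=> f), (fun=> g), setT; split => //.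
  exact: nice_opnT.
by move=> y _; rewrite big_ord1.
Qed.

Lemma ims0 x : in_max_sq x (fun=> 0).
Proof.
apply: (@ims_eq x (fun y => 0 * 0)); first by move=> y; rewrite mul0r.
by apply: ims_mul => //; apply: regular_at_cst.
Qed.

Lemma imsD x f g : in_max_sq x f -> in_max_sq x g ->
  in_max_sq x (fun y => f y + g y).
Proof.
move=> [k [a [b [U [Ha Hb oU Ux H]]]]] [k' [a' [b' [U' [Ha' Hb' oU' Ux' H']]]]].
pose A (i : 'I_(k + k')) := match split i with inl j => a j | inr j => a' j end.
pose B (i : 'I_(k + k')) := match split i with inl j => b j | inr j => b' j end.
exists (k + k')%N, A, B, (U `&` U'); split => //.
- by move=> i; rewrite /A; case: split.
- by move=> i; rewrite /B; case: split.
- exact: nice_opnI.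
move=> y [Uy U'y]; rewrite big_split_ord /= H // H' //; congr +%R.
  apply: eq_bigr => i _; rewrite /A /B.
  by case: splitP => j /= E; [congr (a _ y * b _ y); apply: val_inj|
    have := ltn_ord i; rewrite E ltnNge leq_addr].
apply: eq_bigr => i _; rewrite /A /B.
case: splitP => j /= E; first by have := ltn_ord j; rewrite -E ltnNge leq_addr.
by congr (a' _ y * b' _ y); apply: val_inj; apply/eqP; rewrite -(eqn_add2l k) E.
Qed.

Lemma imsM x f g : regular_at x g -> in_max_sq x f ->
  in_max_sq x (fun y => g y * f y).
Proof.
move=> rg [k [a [b [U [Ha Hb oU Ux H]]]]].
exists k, (fun i y => g y * a i y), b, U; split => //.
  move=> i; have [ra a0] := Ha i; split; first exact: regular_atM.
  by rewrite a0 mulr0.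
by move=> y Uy; rewrite H // mulr_sumr; apply: eq_bigr => i _; rewrite mulrA.
Qed.

Lemma imsZ x f (c : K) : in_max_sq x f -> in_max_sq x (fun y => c * f y).
Proof. by apply: imsM; apply: regular_at_cst. Qed.

Lemma ims_sum x (I : Type) (r : seq I) (P : pred I) (f : I -> X -> K) :
  (forall i, P i -> in_max_sq x (f i)) ->
  in_max_sq x (fun y => \sum_(i <- r | P i) f i y).
Proof.
move=> H; elim: r => [|i r IH].
  by apply: ims_eq (ims0 x) => y; rewrite big_nil.
case: (boolP (P i)) => Pi.
  by apply: ims_eq (imsD (H _ Pi) IH) => y; rewrite big_cons Pi.
by apply: ims_eq IH => y; rewrite big_cons (negbTE Pi).
Qed.

Lemma ims_regular x f : in_max_sq x f -> regular_at x f /\ f x = 0.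
Proof.
move=> [k [a [b [U [Ha Hb oU Ux H]]]]]; split; last first.
  by rewrite H // big1 // => i _; rewrite (Ha i).2 mul0r.
apply: (@regular_at_ext U x (fun y => \sum_i a i y * b i y)) => //.
by apply: regular_at_sum => i _; apply: regular_atM; [case: (Ha i)|case: (Hb i)].
Qed.

(** [c] is a gradient of [f] at [x] with respect to [t], read in the cotangent space. Nothing is
    assumed about [t], so uniqueness of [c] is a separate matter, see [deriv_uniq]. *)
Definition deriv n x (t : 'I_n -> X -> K) f (c : 'I_n -> K) :=
  in_max_sq x (fun y => f y - f x - \sum_i c i * (t i y - t i x)).

Section Rules.
Variables (n : nat) (x : X) (t : 'I_n -> X -> K).
Hypothesis rt : forall i, regular_at x (t i).

Lemma deriv_regular f c : deriv x t f c -> regular_at x f.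
Proof.
move=> /ims_regular[r _].
have r2 : regular_at x (fun y => \sum_i c i * (t i y - t i x)).
  apply: regular_at_sum => i _; apply: regular_atM; first exact: regular_at_cst.
  by apply: regular_atB => //; apply: regular_at_cst.
have := regular_atD (regular_atD r r2) (regular_at_cst x (f x)).
apply: (@regular_at_ext setT) => //; first exact: nice_opnT.
by move=> y _; rewrite subrK subrK.
Qed.

Lemma deriv_ext (V : set X) f g c : opn V -> V x -> (forall y, V y -> g y = f y) ->
  deriv x t f c -> deriv x t g c.
Proof.
move=> oV Vx E; apply: (ims_ext (V := V)) => // y Vy.
by rewrite E // E.
Qed.

Lemma deriv_ceq f c c' : (forall i, c' i = c i) -> deriv x t f c -> deriv x t f c'.
Proof.
move=> E; apply: ims_eq => y; congr (_ - _); apply: eq_bigr => i _.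
by rewrite E.
Qed.

Lemma deriv_cst (a : K) : deriv x t (fun=> a) (fun=> 0).
Proof.
apply: ims_eq (ims0 x) => y; rewrite subrr big1 ?subr0 // => i _.
by rewrite mul0r.
Qed.

Lemma derivD f g c d : deriv x t f c -> deriv x t g d ->
  deriv x t (fun y => f y + g y) (fun i => c i + d i).
Proof.
move=> Df Dg; apply: ims_eq (imsD Df Dg) => y.
under eq_bigr => i do rewrite mulrDl.
by rewrite big_split /=; ring.
Qed.

Lemma derivM f g c d : deriv x t f c -> deriv x t g d ->
  deriv x t (fun y => f y * g y) (fun i => g x * c i + f x * d i).
Proof.
move=> Df Dg; have rf := deriv_regular Df; have rg := deriv_regular Dg.
have I0 : in_max_sq x (fun y => (f y - f x) * (g y - g x)).
  by apply: ims_mul; rewrite ?subrr //; apply: regular_atB => //; apply: regular_at_cst.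
apply: ims_eq (imsD I0 (imsD (imsZ (g x) Df) (imsZ (f x) Dg))) => y.
under eq_bigr => i do rewrite mulrDl -!mulrA.
by rewrite big_split /= -!mulr_sumr; ring.
Qed.

(** The function [1/f - 1/f x + (f - f x) / (f x)^2] equals [(f - f x)^2 / (f (f x)^2)], which lies
    in the square of the maximal ideal. *)
Lemma derivV f c : f x != 0 -> deriv x t f c ->
  deriv x t (fun y => (f y)^-1) (fun i => - c i / (f x) ^+ 2).
Proof.
move=> fx Df; have rf := deriv_regular Df.
have I0 : in_max_sq x (fun y => (f y - f x) * (f y - f x)).
  by apply: ims_mul; rewrite ?subrr //; apply: regular_atB => //; apply: regular_at_cst.
have r1 : regular_at x (fun y => (f y)^-1 * (f x) ^- 2).
  by apply: regular_atM; [apply: regular_atV|apply: regular_at_cst].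
have [U [oU Ux rU]] := rf.
apply: (ims_ext (V := U `&` [set y | f y != 0])) (imsD (imsM r1 I0) (imsZ (- (f x) ^- 2) Df)) => //.
  exact: opn_neq0.
move=> y [_ /= fy].
have -> : \sum_i - c i / f x ^+ 2 * (t i y - t i x)
   = - (f x) ^- 2 * \sum_i c i * (t i y - t i x).
  by rewrite mulr_sumr; apply: eq_bigr => i _; ring.
by field; rewrite fx fy.
Qed.

Lemma deriv_chain m (s : 'I_m -> X -> K) f c (J : 'I_m -> 'I_n -> K) :
  deriv x s f c -> (forall i, deriv x t (s i) (J i)) ->
  deriv x t f (fun j => \sum_i c i * J i j).
Proof.
move=> Df Ds.
have I1 : in_max_sq x (fun y => \sum_i c i * (s i y - s i x - \sum_j J i j * (t j y - t j x))).
  by apply: ims_sum => i _; apply: imsZ; apply: Ds.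
have E y : \sum_j (\sum_i c i * J i j) * (t j y - t j x)
    = \sum_i c i * \sum_j J i j * (t j y - t j x).
  under eq_bigr => j do rewrite mulr_suml.
  rewrite exchange_big; apply: eq_bigr => i _; rewrite mulr_sumr.
  by apply: eq_bigr => j _; rewrite mulrA.
apply: ims_eq (imsD Df I1) => y; rewrite E.
have -> : \sum_i c i * (s i y - s i x - \sum_j J i j * (t j y - t j x))
  = \sum_i c i * (s i y - s i x) - \sum_i c i * \sum_j J i j * (t j y - t j x).
  by rewrite -sumrB; apply: eq_bigr => i _; rewrite mulrBr.
by ring.
Qed.

Lemma deriv_coord i : deriv x t (t i) (fun j => (i == j)%:R).
Proof.
apply: ims_eq (ims0 x) => y; rewrite (bigD1 i) //= eqxx mul1r big1 ?addr0 ?subrr //.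
by move=> j ij; rewrite eq_sym (negbTE ij) mul0r.
Qed.

Lemma deriv_exp f c k : deriv x t f c ->
  deriv x t (fun y => f y ^+ k) (fun i => k%:R * f x ^+ k.-1 * c i).
Proof.
move=> Df; elim: k => [|k IH].
  rewrite (_ : (fun y => f y ^+ 0) = fun=> 1); last by apply/funext => y; rewrite expr0.
  by apply: deriv_ceq (deriv_cst 1) => i; rewrite mulr0n !mul0r.
rewrite (_ : (fun y => f y ^+ k.+1) = fun y => f y * f y ^+ k); last first.
  by apply/funext => y; rewrite exprS.
apply: deriv_ceq (derivM Df IH) => i /=; case: k {IH} => [|k].
  by rewrite mulr0n mulr1n !mul0r mulr0 addr0 expr0 !mul1r.
by rewrite -[in LHS]natr1 /= !exprS; ring.
Qed.

Lemma deriv_alg (G : set (X -> K)) f : (forall g, G g -> exists c, deriv x t g c) ->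
  alg G f -> exists c, deriv x t f c.
Proof.
move=> H; elim=> {f} [f /H //|c|f g _ [c Hf] _ [d Hg]|f g _ [c Hf] _ [d Hg]].
- by eexists; apply: deriv_cst.
- by eexists; apply: derivD Hf Hg.
- by eexists; apply: derivM Hf Hg.
Qed.

Lemma deriv_frac (U : set X) (G : set (X -> K)) W f : opn U -> U x ->
  (forall g, G g -> exists c, deriv x t g c) ->
  frac_rep U G x W f -> exists c, deriv x t f c.
Proof.
move=> oU Ux HG [a [b [Ga Gb bx H]]].
have [c Da] := deriv_alg HG Ga; have [d Db] := deriv_alg HG Gb.
have [V [oV Vx rb]] := deriv_regular Db.
have D := derivM Da (derivV bx Db); eexists.
apply: (deriv_ext (V := (V `&` [set y | b y != 0]) `&` U)) D => //.
  by apply: nice_opnI => //; apply: opn_neq0.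
by move=> y [[_ /= by0] Uy]; have [] := H y Uy by0.
Qed.

End Rules.

Lemma deriv_uniq n x (t : 'I_n -> X -> K) f c d : local_coords x t ->
  deriv x t f c -> deriv x t f d -> forall i, c i = d i.
Proof.
move=> [rt lt] Dc Dd i; have [e [_ He]] := lt _ (deriv_regular rt Dc).
have E1 : e = \row_i c i by apply: He; apply: ims_eq Dc => y; congr (_ - _); apply: eq_bigr => j _; rewrite mxE.
have E2 : e = \row_i d i by apply: He; apply: ims_eq Dd => y; congr (_ - _); apply: eq_bigr => j _; rewrite mxE.
by have := E2; rewrite E1 => /rowP /(_ i); rewrite !mxE.
Qed.

Lemma deriv_ex n x (t : 'I_n -> X -> K) f : local_coords x t ->
  regular_at x f -> exists c, deriv x t f c.
Proof. by move=> [_ lt] /lt[c [Dc _]]; exists (fun i => c 0 i). Qed.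

Lemma deriv_fun n x (t : 'I_n -> X -> K) m (s : 'I_m -> X -> K) : local_coords x t ->
  (forall i, regular_at x (s i)) ->
  exists J : 'M[K]_(m, n), forall i, deriv x t (s i) (J i).
Proof.
move=> lt rs; have [c Dc] := boolp.choice (fun i => deriv_ex lt (rs i)).
by exists (\matrix_(i, j) c i j) => i; apply: deriv_ceq (Dc i) => j; rewrite mxE.
Qed.

(** Expressing [t] and [z] in terms of each other gives rectangular matrices that are inverse to
    each other on both sides, hence of equal sizes. This is how the number of generators at a vertex
    gets compared with n. *)
Lemma coords_card n x (t : 'I_n -> X -> K) r (z : 'I_r -> X -> K) :
  local_coords x t -> (forall i, regular_at x (z i)) ->
  (forall f, regular_at x f -> exists c, deriv x z f c) ->
  (forall c, in_max_sq x (fun y => \sum_i c i * (z i y - z i x)) -> forall i, c i = 0) ->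
  r = n.
Proof.
move=> lt rz span ind; have rt := lt.1.
have [P DP] := deriv_fun lt rz.
have [c Dc] := boolp.choice (fun i => span _ (rt i)).
pose Q := \matrix_(i, j) c i j.
have DQ i : deriv x z (t i) (Q i) by apply: deriv_ceq (Dc i) => j; rewrite mxE.
have QP : Q *m P = 1%:M.
  apply/matrixP => i j; rewrite !mxE.
  exact: (deriv_uniq lt (deriv_chain (DQ i) DP) (deriv_coord x t i) j).
have PQ : P *m Q = 1%:M.
  apply/matrixP => i j; rewrite !mxE; apply/eqP; rewrite -subr_eq0; apply/eqP.
  have D1 := deriv_chain (DP i) DQ; have D2 := deriv_coord x z i.
  have := ind (fun j => (\sum_k P i k * Q k j) - (i == j)%:R); apply.
  apply: ims_eq (imsD D2 (imsZ (-1) D1)) => y.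
  under eq_bigr => k do rewrite mulrBl.
  by rewrite sumrB; ring.
apply/eqP; rewrite eqn_leq.
have := mulmx1_min PQ => ->.
by have := mulmx1_min QP => ->.
Qed.

(** One product of the two change-of-coordinates matrices is the identity. Being square, they are
    inverse to each other, which gives uniqueness of the coefficients. *)
Lemma coords_span n x (t z : 'I_n -> X -> K) :
  local_coords x t -> (forall i, regular_at x (z i)) ->
  (forall f, regular_at x f -> exists c, deriv x z f c) -> local_coords x z.
Proof.
move=> lt rz span; have rt := lt.1; split => // f rf.
have [P DP] := deriv_fun lt rz.
have [c Dc] := boolp.choice (fun i => span _ (rt i)).
pose Q := \matrix_(i, j) c i j.
have DQ i : deriv x z (t i) (Q i) by apply: deriv_ceq (Dc i) => j; rewrite mxE.
have QP : Q *m P = 1%:M.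
  apply/matrixP => i j; rewrite !mxE.
  exact: (deriv_uniq lt (deriv_chain (DQ i) DP) (deriv_coord x t i) j).
have PQ := mulmx1C QP.
have [d Dd] := span _ rf; exists (\row_i d i); split.
  by apply: ims_eq Dd => y; congr (_ - _); apply: eq_bigr => j _; rewrite mxE.
move=> e De; apply: (can_inj (mulmxK (mulmx1_unit PQ).1)).
apply/rowP => j; rewrite !mxE.
have := deriv_uniq lt (deriv_chain Dd DP) (deriv_chain De DP) j => /= <-.
by apply: eq_bigr => i _; rewrite mxE.
Qed.

Lemma jacobianP n x (t s : 'I_n -> X -> K) : local_coords x t ->
  (forall i, regular_at x (s i)) ->
  forall i, deriv x t (s i) (jacobian s t x i).
Proof.
move=> lt rs; have [J DJ] := deriv_fun lt rs.
exact: (@xgetI _ 0 [set J : 'M[K]_n | forall i, in_max_sq x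
    (fun y => s i y - s i x - \sum_j J i j * (t j y - t j x))] J DJ).
Qed.

Lemma jacobian_uniq n x (t s : 'I_n -> X -> K) J : local_coords x t ->
  (forall i, deriv x t (s i) (J i)) ->
  jacobian s t x = \matrix_(i, j) J i j.
Proof.
move=> lt DJ; apply/matrixP => i j; rewrite mxE.
apply: (deriv_uniq lt _ (DJ i)).
by apply: jacobianP => // k; apply: (deriv_regular lt.1 (DJ k)).
Qed.

Lemma jacobian_chain n x (t s r : 'I_n -> X -> K) :
  local_coords x t -> local_coords x s -> (forall i, regular_at x (r i)) ->
  jacobian r s x *m jacobian s t x = jacobian r t x.
Proof.
move=> lt ls rr; rewrite (@jacobian_uniq n x t r (jacobian r s x *m jacobian s t x)) //.
  by apply/matrixP => i j; rewrite [RHS]mxE.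
move=> i; apply: deriv_ceq (deriv_chain (jacobianP ls rr i) (jacobianP lt ls.1)).
by move=> k; rewrite mxE.
Qed.

Lemma jacobian_id n x (t : 'I_n -> X -> K) : local_coords x t ->
  jacobian t t x = 1%:M.
Proof.
move=> lt; rewrite (@jacobian_uniq n x t t (fun i j => (i == j)%:R)) //.
  by apply/matrixP => i j; rewrite !mxE.
by move=> i; apply: deriv_coord.
Qed.

Lemma det_jacobian_neq0 n x (t s : 'I_n -> X -> K) : local_coords x t ->
  local_coords x s -> \det (jacobian s t x) != 0.
Proof.
move=> lt ls; have := jacobian_chain ls lt ls.1; rewrite (jacobian_id ls).
move/(congr1 determinant); rewrite det_mulmx det1 => /eqP.
by apply: contraTneq => ->; rewrite mul0r eq_sym oner_neq0.
Qed.

(** Differentiability with regular partial derivatives. The class is closed under the operations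
    that build local fractions, whence the regularity of jacobians in [jacobian_reg]. *)
Definition dreg n (W : set X) (t : 'I_n -> X -> K) f :=
  exists d : 'I_n -> X -> K, (forall i, reg W (d i)) /\
    forall y, W y -> deriv y t f (fun i => d i y).

Section Dreg.
Variables (n : nat) (W : set X) (t : 'I_n -> X -> K).
Hypotheses (oW : opn W) (rt : forall i, reg W (t i)).

Let rty y (Wy : W y) i : regular_at y (t i) := reg_regular_at (rt i) Wy.

Lemma dreg_cst c : dreg W t (fun=> c).
Proof.
exists (fun _ _ => 0); split => [i|y _]; first exact: nice_cst.
exact: deriv_cst.
Qed.

Lemma dreg_coord i : dreg W t (t i).
Proof.
exists (fun j _ => (i == j)%:R); split => [j|y _]; first exact: nice_cst.
exact: deriv_coord.
Qed.

Lemma dregD f g : dreg W t f -> dreg W t g -> dreg W t (fun y => f y + g y).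
Proof.
move=> [c [rc Dc]] [d [rd Dd]]; exists (fun i y => c i y + d i y); split=> [i|y Wy].
  exact: nice_add.
by apply: derivD; [apply: Dc|apply: Dd].
Qed.

Lemma dregM f g : reg W f -> reg W g -> dreg W t f -> dreg W t g ->
  dreg W t (fun y => f y * g y).
Proof.
move=> rf rg [c [rc Dc]] [d [rd Dd]].
exists (fun i y => g y * c i y + f y * d i y); split=> [i|y Wy].
  by apply: nice_add => //; apply: nice_mul.
by apply: derivM; [exact: rty|apply: Dc|apply: Dd].
Qed.

Lemma dregV f : reg W f -> (forall y, W y -> f y != 0) -> dreg W t f ->
  dreg W t (fun y => (f y)^-1).
Proof.
move=> rf f0 [c [rc Dc]]; exists (fun i y => - c i y / (f y) ^+ 2); split=> [i|y Wy].
  apply: nice_mul => //; first exact: reg_opp.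
  by apply: reg_inv => //; [apply: reg_exp|move=> y Wy; rewrite expf_neq0 // f0].
by apply: derivV; [exact: rty|apply: f0|apply: Dc].
Qed.

Lemma dreg_alg (G : set (X -> K)) f : (forall g, G g -> reg W g /\ dreg W t g) ->
  alg G f -> reg W f /\ dreg W t f.
Proof.
move=> H; elim=> {f} [f /H //|c|f g _ [r1 d1] _ [r2 d2]|f g _ [r1 d1] _ [r2 d2]].
- by split; [apply: nice_cst|apply: dreg_cst].
- by split; [apply: nice_add|apply: dregD].
- by split; [apply: nice_mul|apply: dregM].
Qed.

End Dreg.

Lemma dreg_sub n (W V : set X) (t : 'I_n -> X -> K) f : opn V -> V `<=` W ->
  dreg W t f -> dreg V t f.
Proof.
move=> oV VW [d [rd Dd]]; exists d; split => [i|y /VW]; last exact: Dd.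
exact: nice_res (rd i) _ _.
Qed.

Lemma jacobian_reg n (U : set X) (G : set (X -> K)) (t : 'I_n -> X -> K) :
  chart U G -> (forall i, reg U (t i)) -> (forall x, U x -> local_coords x t) ->
  (forall g, G g -> dreg U t g) ->
  forall (W : set X) (s : 'I_n -> X -> K), (forall i, reg W (s i)) -> W `<=` U ->
  opn W -> forall i j, reg W (fun y => jacobian s t y i j).
Proof.
move=> [oU rG cU] rt lt HG W s rs WU oW i j; apply: nice_reg => // x Wx.
have [a [b [Ga Gb bx H]]] := cU _ _ _ (rs i) Wx (WU _ Wx).
have HG' g : G g -> reg U g /\ dreg U t g by move=> Gg; split; [apply: rG|apply: HG].
have [ra da] := dreg_alg oU rt HG' Ga; have [rb db] := dreg_alg oU rt HG' Gb.
pose V := U `&` [set y | b y != 0].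
have oV : opn V by apply: opn_neq0.
have VU : V `<=` U by move=> ? [].
have VW : V `<=` W by move=> y [Uy by0]; have [] := H _ Uy by0.
have rtV k : reg V (t k) by apply: (nice_res nX (rt k)).
have raV : reg V a by apply: (nice_res nX ra).
have rbV : reg V b by apply: (nice_res nX rb).
have b0 y : V y -> b y != 0 by case.
have [d [rd Dd]] := dregM rtV raV (reg_inv nX rbV b0) (dreg_sub oV VU da)
  (dregV rtV rbV b0 (dreg_sub oV VU db)).
exists V, (d j); split => //; first by split => //; apply: WU.
move=> y Vy; split; first exact: VW.
have ly := lt _ (VU _ Vy).
have D : deriv y t (s i) (fun i => d i y).
  apply: (deriv_ext (V := V)) (Dd _ Vy) => // z [Uz bz].
  by have [] := H _ Uz bz.
apply: (deriv_uniq ly _ D); apply: jacobianP => // k.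
by apply: reg_regular_at (rs k) (VW _ Vy).
Qed.

Lemma reg_det n (W : set X) (M : X -> 'M[K]_n) : opn W ->
  (forall i j, reg W (fun y => M y i j)) -> reg W (fun y => \det (M y)).
Proof.
move=> oW rM; apply: reg_sum => // s _; apply: nice_mul => //.
  exact: nice_cst.
by apply: reg_prod.
Qed.

End Diff.

Section Pullback.
Variables (K : closedFieldType) (X Y : ringed_set K).

Lemma regular_at_pullback (g : X -> Y) x f : morphism g ->
  regular_at (g x) f -> regular_at x (fun y => f (g y)).
Proof. by move=> [og rg] [U [oU Ux rf]]; exists (g @^-1` U); split => //; [apply: og|apply: rg]. Qed.

Lemma ims_pullback (g : X -> Y) x f : morphism g ->
  in_max_sq (g x) f -> in_max_sq x (fun y => f (g y)).
Proof.
move=> mg [k [a [b [U [Ha Hb oU Ux H]]]]].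
exists k, (fun i y => a i (g y)), (fun i y => b i (g y)), (g @^-1` U); split => //.
- by move=> i; have [ra a0] := Ha i; split => //; apply: regular_at_pullback.
- by move=> i; have [ra a0] := Hb i; split => //; apply: regular_at_pullback.
- exact: mg.1.
- by move=> y; apply: H.
Qed.

End Pullback.

(** Serves for the translations by elements of the torus, with [h] the inverse translation. *)
Lemma local_coords_pullback (K : closedFieldType) (X Y : ringed_set K) n
  (nX : nice X) (nY : nice Y) (g : X -> Y) (h : Y -> X) x (t : 'I_n -> Y -> K) :
  morphism g -> morphism h -> (forall y, h (g y) = y) -> (forall y, g (h y) = y) ->
  local_coords (g x) t -> local_coords x (fun i y => t i (g y)).
Proof.
move=> mg mh gK hK lt; split=> [i|f rf].
  exact: (regular_at_pullback mg (lt.1 i)).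
have rfh : regular_at (g x) (fun y => f (h y)).
  by apply: (regular_at_pullback mh); rewrite gK.
have [c [Dc uc]] := lt.2 _ rfh; exists c; split.
  have := ims_pullback mg Dc; apply: (ims_eq nX) => y.
  by rewrite !gK.
move=> d Dd; apply: uc.
have : in_max_sq (h (g x)) (fun y => f y - f x - \sum_i d 0 i * (t i (g y) - t i (g x))).
  by rewrite gK.
move/(ims_pullback mh); apply: (ims_eq nY) => y.
by rewrite !hK gK.
Qed.


(** * Factorial rings *)

Section Factorization.
Variable R : idomainType.
Implicit Types a b c p u : R.

Definition dvdr a b := exists c, b = c * a.
Definition prime_elt p :=
  [/\ p != 0, ~ dvdr p 1 & forall a b, dvdr p (a * b) -> dvdr p a \/ dvdr p b].
Definition prime_fact a := exists u (l : seq R),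
  [/\ dvdr u 1, forall p, p \in l -> prime_elt p & a = u * \prod_(p <- l) p].
Definition coprime_elt a b := forall p, prime_elt p -> dvdr p a -> ~ dvdr p b.

Lemma dvdr_refl a : dvdr a a. Proof. by exists 1; rewrite mul1r. Qed.
Lemma dvdr_mull a b c : dvdr a b -> dvdr a (c * b).
Proof. by move=> [d ->]; exists (c * d); rewrite mulrA. Qed.
Lemma dvdr_mulr a b c : dvdr a b -> dvdr a (b * c).
Proof. by rewrite mulrC; apply: dvdr_mull. Qed.
Lemma dvdr_trans a b c : dvdr a b -> dvdr b c -> dvdr a c.
Proof. by move=> ab [d ->]; apply: dvdr_mull. Qed.
Lemma dvdr_add a b c : dvdr a b -> dvdr a c -> dvdr a (b + c).
Proof. by move=> [d ->] [e ->]; exists (d + e); rewrite mulrDl. Qed.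
Lemma dvdr_sub a b c : dvdr a b -> dvdr a c -> dvdr a (b - c).
Proof. by move=> [d ->] [e ->]; exists (d - e); rewrite mulrBl. Qed.
Lemma dvdr0 a : dvdr a 0. Proof. by exists 0; rewrite mul0r. Qed.
Lemma dvdr_sum a (I : Type) (r : seq I) (P : pred I) (F : I -> R) :
  (forall i, P i -> dvdr a (F i)) -> dvdr a (\sum_(i <- r | P i) F i).
Proof.
move=> H; elim: r => [|i r IH]; rewrite ?big_nil ?big_cons; first exact: dvdr0.
by case: ifP => // Pi; apply: dvdr_add => //; apply: H.
Qed.

Lemma unit_neq0 u : dvdr u 1 -> u != 0.
Proof. by move=> [v E]; apply: contra_eq_neq E => ->; rewrite mulr0 oner_neq0. Qed.

Lemma prime_neq0 p : prime_elt p -> p != 0. Proof. by case. Qed.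

Lemma prime_dvd_unit p u : prime_elt p -> dvdr u 1 -> ~ dvdr p u.
Proof. by move=> [_ p1 _] u1 pu; apply: p1; apply: dvdr_trans u1. Qed.

Lemma prime_mul p a b : prime_elt p -> ~ dvdr p a -> ~ dvdr p b -> ~ dvdr p (a * b).
Proof. by move=> [_ _ H] na nb /H[]. Qed.

Lemma prime_prod p (l : seq R) : prime_elt p -> dvdr p (\prod_(q <- l) q) ->
  exists2 q, q \in l & dvdr p q.
Proof.
move=> pp; elim: l => [|q l IH].
  by rewrite big_nil => /(prime_dvd_unit pp (dvdr_refl 1)).
rewrite big_cons => /(let: And3 _ _ H := pp in H _ _)[pq|/IH[r rl pr]].
  by exists q => //; rewrite mem_head.
by exists r => //; rewrite in_cons rl orbT.
Qed.

Lemma prime_dvd_prime p q : prime_elt p -> prime_elt q -> dvdr p q ->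
  exists2 w, dvdr w 1 & q = w * p.
Proof.
move=> [p0 p1 _] [q0 q1 Hq] [w E]; exists w => //.
have [|[z Ez]|[z Ez]] := Hq w p; first by rewrite -E; apply: dvdr_refl.
  case: p1; exists z; apply: (mulfI q0); rewrite mulr1 [LHS]E Ez.
  by ring.
by exists z; apply: (mulfI p0); rewrite mulr1 [LHS]Ez E; ring.
Qed.

Lemma prime_dvd_sym p q : prime_elt p -> prime_elt q -> dvdr p q -> dvdr q p.
Proof.
move=> pp pq /(prime_dvd_prime pp pq)[w [v E] ->].
by exists v; rewrite mulrA -E mul1r.
Qed.

Lemma prime_fact_mul a b : prime_fact a -> prime_fact b -> prime_fact (a * b).
Proof.
move=> [u [l [u1 Hl ->]]] [v [m [v1 Hm ->]]]; exists (u * v), (l ++ m); split.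
- have [[x ux] [y vy]] := (u1, v1); exists (x * y).
  by rewrite mulrACA -ux -vy mulr1.
- by move=> p; rewrite mem_cat => /orP[/Hl|/Hm].
- by rewrite big_cat /=; ring.
Qed.

Lemma prime_fact_unit u : dvdr u 1 -> prime_fact u.
Proof. by move=> u1; exists u, [::]; split => //; rewrite big_nil mulr1. Qed.

Lemma prime_fact_prime p : prime_elt p -> prime_fact p.
Proof.
move=> pp; exists 1, [:: p]; split; first exact: dvdr_refl.
  by move=> q; rewrite inE => /eqP ->.
by rewrite big_seq1 mul1r.
Qed.

Lemma multiplicity p a : prime_elt p -> prime_fact a ->
  exists k b, a = p ^+ k * b /\ ~ dvdr p b.
Proof.
move=> pp [u [l [u1 Hl ->]]]; elim: l Hl => [|q l IH] Hl.
  exists 0%N, u; rewrite big_nil mulr1 expr0 mul1r; split => //.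
  exact: prime_dvd_unit.
have [|k [b [E nb]]] := IH; first by move=> r rl; apply: Hl; rewrite in_cons rl orbT.
have pq : prime_elt q by apply: Hl; rewrite mem_head.
have [d|nd] := pselect (dvdr p q).
  have [w w1 ->] := prime_dvd_prime pp pq d.
  exists k.+1, (w * b); split; last by apply: prime_mul => //; apply: prime_dvd_unit.
  by rewrite big_cons mulrCA E exprS; ring.
exists k, (q * b); split; last exact: prime_mul.
by rewrite big_cons mulrCA E; ring.
Qed.

(** The primes of [a] that divide [b] are cancelled one at a time, so factoring [a] is enough. *)
Lemma coprime_reduce a b : prime_fact a ->
  exists d a' b', [/\ a = d * a', b = d * b' & coprime_elt a' b'].
Proof.
move=> [u [l [u1 Hl ->]]]; elim: l Hl b => [|q l IH] Hl b.
  exists 1, (u * 1), b; rewrite big_nil !mul1r mulr1; split => // p pp pu.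
  by case: (prime_dvd_unit pp u1 pu).
have Hl' t : t \in l -> prime_elt t by move=> tl; apply: Hl; rewrite in_cons tl orbT.
have pq : prime_elt q by apply: Hl; rewrite mem_head.
rewrite big_cons; have [[b1 Eb]|nb] := pselect (dvdr q b).
  have [d [a' [b' [E1 E2 C]]]] := IH Hl' b1; exists (d * q), a', b'; split => //.
    by rewrite mulrCA E1; ring.
  by rewrite Eb E2; ring.
have [d [a' [b' [E1 E2 C]]]] := IH Hl' b; exists d, (q * a'), b'; split => //.
  by rewrite mulrCA E1; ring.
move=> p pp; case: (pp) => _ _ H /H[pdq pb|/C]; last exact.
apply: nb; rewrite E2; apply: dvdr_mull; apply: dvdr_trans pb.
exact: prime_dvd_sym.
Qed.

(** Euclid's lemma, by induction on the factors of [b]: each prime of [b] divides [a * c] but not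
    [a], so it can be cancelled from [c]. *)
Lemma coprime_dvd a b c d : prime_fact b -> coprime_elt a b ->
  a * c = d * b -> dvdr b c.
Proof.
move=> [u [l [u1 Hl ->]]]; elim: l Hl c => [|q l IH] Hl c C.
  rewrite big_nil mulr1 => _; have [v E] := u1.
  by exists (c * v); rewrite -mulrA -E mulr1.
have Hl' t : t \in l -> prime_elt t by move=> tl; apply: Hl; rewrite in_cons tl orbT.
have pq : prime_elt q by apply: Hl; rewrite mem_head.
rewrite big_cons in C *; move=> E.
have qb : dvdr q (u * (q * \prod_(p <- l) p)) by do 1!apply: dvdr_mull; apply: dvdr_mulr; apply: dvdr_refl.
have [|qa|[c' Ec]] := (let: And3 _ _ H := pq in H a c).
- by rewrite E; apply: dvdr_mull.
- by case: (C q pq qa).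
have [||e Ee] := IH Hl' c'.
- by move=> p pp pa pb; apply: (C p pp pa); rewrite mulrCA; apply: dvdr_mull.
- by apply: (mulfI (prime_neq0 pq)); rewrite Ec in E; transitivity (a * (c' * q)); [ring|rewrite E; ring].
by exists e; rewrite Ec Ee; ring.
Qed.

End Factorization.

Definition ufd (R : idomainType) := forall a : R, a != 0 -> prime_fact a.

(** * Gauss's lemma: factoriality passes to polynomial rings *)

Section Gauss.
Variable R : idomainType.
Hypothesis uR : ufd R.
Implicit Types (c r : R) (f g h p : {poly R}).

Lemma dvd_polyC c f : dvdr c%:P f <-> forall i, dvdr c f`_i.
Proof.
split=> [[g ->] i|H]; first by exists g`_i; rewrite coefMC.
have [e He] := boolp.choice H.
exists (\poly_(i < size f) e i); apply/polyP => i; rewrite coefMC coef_poly.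
by case: ltnP => [_|s]; [exact: He|rewrite nth_default // mul0r].
Qed.

Lemma dvd_polyCC c r : dvdr c%:P r%:P <-> dvdr c r.
Proof.
split=> [/dvd_polyC/(_ 0%N)|[d ->]]; first by rewrite coefC.
by exists d%:P; rewrite polyCM.
Qed.

Lemma ex_first (P : nat -> Prop) : (exists i, P i) ->
  exists i, P i /\ forall j, (j < i)%N -> ~ P j.
Proof.
case=> i; elim/ltn_ind: i => i IH Pi.
have [[j ji Pj]|H] := pselect (exists2 j, (j < i)%N & P j); first exact: IH ji Pj.
by exists i; split => // j ji Pj; apply: H; exists j.
Qed.

(** Let [i] and [j] be the first degrees where [c] does not divide the coefficients of [f] and [g].
    In degree [i + j] all terms of the product but one are divisible by [c]. *)
Lemma prime_polyC c : prime_elt c -> prime_elt (c%:P : {poly R}).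
Proof.
move=> pc; have [c0 c1 Hc] := pc; split; first by rewrite polyC_eq0.
  by move/dvd_polyCC.
move=> f g fg; apply: contrapT => /not_orP[nf ng].
have wit h : ~ dvdr c%:P h -> exists i, ~ dvdr c h`_i /\ forall j, (j < i)%N -> dvdr c h`_j.
  move=> nh; have [|i [Hi Hj]] := @ex_first (fun i => ~ dvdr c h`_i).
    by apply: contrapT => H; apply: nh; apply/dvd_polyC => i; apply: contrapT => H'; apply: H; exists i.
  by exists i; split => // j /Hj /contrapT.
have [i [ni Hi]] := wit _ nf; have [j [nj Hj]] := wit _ ng.
apply: (prime_mul pc ni nj).
move/dvd_polyC/(_ (i + j)%N): fg; rewrite coefM.
have ilt : (i < (i + j).+1)%N by rewrite ltnS leq_addr.
rewrite (bigD1 (Ordinal ilt)) //= addKn => D.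
rewrite -[_ * _](addrK (\sum_(k < (i + j).+1 | k != Ordinal ilt) f`_k * g`_(i + j - k))).
apply: dvdr_sub => //; apply: dvdr_sum => k ki.
have [ki'|ik] := ltnP k i; first by apply: dvdr_mulr; apply: Hi.
have ik' : (i < k)%N by rewrite ltn_neqAle ik andbT eq_sym; apply: contraNneq ki => E; apply/eqP/val_inj.
by apply: dvdr_mull; apply: Hj; have := ltn_ord k; lia.
Qed.

Definition primitive f := forall c, prime_elt c -> ~ dvdr c%:P f.
(** Only degrees are looked at; constant factors are the business of [primitive]. *)
Definition irreducible_deg f :=
  forall g h, f = g * h -> (size g <= 1)%N \/ (size h <= 1)%N.

(** Gauss's lemma in a form that stays away from the fraction field: each prime of [r] divides
    [f * k] but not the primitive [f], hence it divides [k] and cancels. *)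
Lemma primitive_cancel f k h r : primitive f -> r != 0 -> f * k = r%:P * h ->
  dvdr f h.
Proof.
move=> pf /uR[u [l [u1 Hl ->]]]; elim: l Hl k => [|q l IH] Hl k E.
  have [v Ev] := u1; exists (k * v%:P).
  rewrite big_nil mulr1 in E; rewrite mulrAC [k * f]mulrC E mulrAC -polyCM.
  by rewrite [u * v]mulrC -Ev mul1r.
have Hl' t : t \in l -> prime_elt t by move=> tl; apply: Hl; rewrite in_cons tl orbT.
have pq : prime_elt q by apply: Hl; rewrite mem_head.
have pqP := prime_polyC pq; rewrite big_cons in E.
have [|/(pf _ pq)//|[k' Ek]] := (let: And3 _ _ H := pqP in H f k).
  by rewrite E !polyCM; apply: dvdr_mulr; apply: dvdr_mull; apply: dvdr_mulr; apply: dvdr_refl.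
apply: (IH Hl' k'); apply: (mulfI (prime_neq0 pqP)).
by transitivity (f * k); [rewrite Ek; ring|rewrite E !polyCM; ring].
Qed.

(** A prime constant dividing [f] divides its leading coefficient, whose number of prime factors
    bounds the induction. *)
Lemma primitive_strip f : f != 0 -> exists c f0,
  [/\ c != 0, f = c%:P * f0 & primitive f0].
Proof.
move=> f0; have := uR (a := lead_coef f); rewrite lead_coef_eq0 => /(_ f0).
move=> [u [l [u1 Hl E]]]; elim: {l}(size l) {-2}l (leqnn (size l)) u u1 Hl f f0 E
  => [|s IH] l sl u u1 Hl f f0 E.
  exists 1, f; split; rewrite ?oner_neq0 ?mul1r // => c pc /dvd_polyC/(_ (size f).-1).
  rewrite -lead_coefE E; case: l sl {E Hl} => // _; rewrite big_nil mulr1.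
  exact: prime_dvd_unit.
have [[c [pc [f' Ef]]]|H] := pselect (exists c, prime_elt c /\ dvdr c%:P f); last first.
  by exists 1, f; split; rewrite ?oner_neq0 ?mul1r // => c pc d; apply: H; exists c.
have f'0 : f' != 0 by apply: contraNneq f0 => f'0; rewrite Ef f'0 mul0r.
have cl : dvdr c (u * \prod_(p <- l) p).
  by rewrite -E Ef lead_coefM lead_coefC; apply: dvdr_mull; apply: dvdr_refl.
have [/(prime_dvd_unit pc u1)//|/(prime_prod pc)[q ql cq]] := (let: And3 _ _ H := pc in H _ _ cl).
have [w w1 Eq] := prime_dvd_prime pc (Hl _ ql) cq.
have [||||c' [g [c'0 Eg pg]]] := IH (rem q l) _ (u * w) _ _ f' f'0.
- by rewrite size_rem //; case: (l) ql sl.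
- by have [[x ux] [y vy]] := (u1, w1); exists (x * y); rewrite mulrACA -ux -vy mulr1.
- by move=> p /mem_rem /Hl.
- apply: (mulIf (prime_neq0 pc)).
  have := E; rewrite Ef lead_coefM lead_coefC => ->.
  rewrite (perm_big _ (perm_to_rem ql)) /= big_cons {1}Eq; ring.
exists (c' * c), g; split => //; first by rewrite mulf_neq0 // prime_neq0.
by rewrite Ef Eg polyCM; ring.
Qed.

Lemma primitive_const f : primitive f -> f != 0 -> (size f <= 1)%N -> dvdr f 1.
Proof.
move=> pf f0 /size1_polyC E; have c0 : f`_0 != 0 by rewrite -polyC_eq0 -E.
have [u [[|p l] [u1 Hl Eu]]] := uR c0.
  by rewrite E Eu big_nil mulr1 -polyC1; apply/dvd_polyCC.
case: (pf p); first by apply: Hl; rewrite mem_head.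
by rewrite E; apply/dvd_polyCC; rewrite Eu big_cons; apply: dvdr_mull; apply: dvdr_mulr; apply: dvdr_refl.
Qed.

(** Euclidean descent by pseudo-division, on the degree of a nonzero combination [d]. If both
    remainders vanish while [d] has positive degree, its primitive part divides [p] and [g]; by
    irreducibility it is associated to [p], against [~ dvdr p g]. *)
Lemma poly_bezout p g : primitive p -> irreducible_deg p -> (1 < size p)%N ->
  ~ dvdr p g ->
  exists (r : R) (a b : {poly R}), r != 0 /\ r%:P = a * p + b * g.
Proof.
move=> pp ip sp ng.
have p0 : p != 0 by rewrite -size_poly_gt0; apply: leq_trans sp.
suff: forall (m : nat) (a b : {poly R}), a * p + b * g != 0 -> (size (a * p + b * g)%R <= m)%N ->
    exists (r : R) (a b : {poly R}), r != 0 /\ r%:P = a * p + b * g.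
  by move/(_ _ 1 0); rewrite mul1r mul0r addr0 => /(_ _ p0 (leqnn _)).
elim=> [|m IH] a b d0 sd; first by rewrite size_poly_leq0 (negbTE d0) in sd.
have [s1|s1] := leqP (size (a * p + b * g)) 1.
  exists (a * p + b * g)`_0, a, b; rewrite -size1_polyC //; split => //.
  by rewrite -polyC_eq0 -size1_polyC.
set d := a * p + b * g in d0 sd s1.
have l0 k : lead_coef d ^+ k != 0 by rewrite expf_neq0 // lead_coef_eq0.
have Ep := Pdiv.Idomain.divp_eq p d; have Eg := Pdiv.Idomain.divp_eq g d.
have sr f : (size (f %% d)%R <= m)%N.
  by have := Pdiv.Idomain.ltn_modp f d; rewrite d0 => H; rewrite -ltnS; apply: leq_trans H _.
have [rp0|rp0] := eqVneq (p %% d) 0; last first.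
  apply: (IH ((lead_coef d ^+ scalp p d)%:P - p %/ d * a) (- (p %/ d * b))); last first.
    rewrite (_ : _ + _ = p %% d); first exact: sr.
    by rewrite -[p %% d](addKr (p %/ d * d)) -Ep -mul_polyC /d; ring.
  rewrite (_ : _ + _ = p %% d) //.
  by rewrite -[p %% d](addKr (p %/ d * d)) -Ep -mul_polyC /d; ring.
have [rg0|rg0] := eqVneq (g %% d) 0; last first.
  apply: (IH (- (g %/ d * a)) ((lead_coef d ^+ scalp g d)%:P - g %/ d * b)); last first.
    rewrite (_ : _ + _ = g %% d); first exact: sr.
    by rewrite -[g %% d](addKr (g %/ d * d)) -Eg -mul_polyC /d; ring.
  rewrite (_ : _ + _ = g %% d) //.
  by rewrite -[g %% d](addKr (g %/ d * d)) -Eg -mul_polyC /d; ring.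
have [c [d' [c0 Ed pd]]] := primitive_strip d0.
rewrite rp0 addr0 -mul_polyC in Ep; rewrite rg0 addr0 -mul_polyC in Eg.
have [w Ew] : dvdr d' p.
  by apply: (primitive_cancel (k := c%:P * (p %/ d)) pd (l0 (scalp p d))); rewrite Ep {3}Ed; ring.
have dg : dvdr d' g.
  by apply: (primitive_cancel (k := c%:P * (g %/ d)) pd (l0 (scalp g d))); rewrite Eg {3}Ed; ring.
case: ng; apply: dvdr_trans dg.
have sd' : (1 < size d')%N by move: s1; rewrite Ed mul_polyC size_scale.
have [sw|] := ip _ _ Ew; last by rewrite leqNgt sd'.
have w0 : w != 0 by apply: contraNneq p0 => w0; rewrite Ew w0 mul0r.
have [|v Ev] := primitive_const _ w0 sw.
  by move=> e pe ew; apply: (pp e pe); rewrite Ew; apply: dvdr_mulr.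
by exists v; rewrite Ew mulrA -Ev mul1r.
Qed.

(** If [p] divides [a * b] but not [a], a Bezout relation for [p] and [a] shows that [p] divides a
    nonzero constant times [b], and the constant is cancelled. *)
Lemma prime_irreducible_deg p : primitive p -> irreducible_deg p -> (1 < size p)%N ->
  prime_elt p.
Proof.
move=> pp ip sp; have p0 : p != 0 by rewrite -size_poly_gt0; apply: leq_trans sp.
split => //.
  move=> [q E]; have q0 : q != 0 by apply: contra_eq_neq E => ->; rewrite mul0r oner_neq0.
  move/(congr1 (fun f : {poly R} => size f)): E; rewrite size_poly1 size_mul // => E.
  by move: sp q0; rewrite -size_poly_gt0; lia.
move=> a b [k E]; have [?|na] := pselect (dvdr p a); [by left|right].
have [r [x [y [r0 Er]]]] := poly_bezout pp ip sp na.
apply: (primitive_cancel (k := x * b + y * k) pp r0).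
rewrite Er mulrDl -mulrA mulrDr; congr (_ + _); first by ring.
by rewrite -mulrA E; ring.
Qed.

Lemma ufd_poly : ufd {poly R}.
Proof.
move=> f; elim: {f}(size f) {-2}f (leqnn (size f)) => [|m IH] f sf f0.
  by rewrite size_poly_leq0 (negbTE f0) in sf.
have [c [g [c0 Ef pg]]] := primitive_strip f0.
have g0 : g != 0 by apply: contraNneq f0 => g0; rewrite Ef g0 mulr0.
rewrite Ef; apply: prime_fact_mul.
  have [u [l [u1 Hl ->]]] := uR c0; exists u%:P, (map polyC l); split.
  - by rewrite -polyC1; apply/dvd_polyCC.
  - by move=> p /mapP[q ql ->]; apply: prime_polyC; apply: Hl.
  - by rewrite polyCM rmorph_prod big_map.
have [s1|s1] := leqP (size g) 1; first exact/prime_fact_unit/primitive_const.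
have [ig|] := pselect (irreducible_deg g).
  by apply: prime_fact_prime; apply: prime_irreducible_deg.
move=> /existsNP[a /existsNP[b /not_implyP[E /not_orP[/negP sa /negP sb]]]].
rewrite -!ltnNge in sa sb.
have a0 : a != 0 by rewrite -size_poly_gt0; apply: leq_trans sa.
have b0 : b != 0 by rewrite -size_poly_gt0; apply: leq_trans sb.
have sg : (size g <= m.+1)%N by move: sf; rewrite Ef mul_polyC size_scale.
rewrite E size_mul // in sg.
by rewrite E; apply: prime_fact_mul; apply: IH => //; lia.
Qed.

End Gauss.

(** * Polynomials in several variables and their zeros *)

Section IterPoly.
Variable K : closedFieldType.

(* The polynomial ring in [n] variables, iterated so that Gauss's lemma and the
   evaluation can be handled one variable at a time. *)
Fixpoint mp n : idomainType :=
  if n is n'.+1 then ({poly mp n'} : idomainType) else (K : idomainType).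

Lemma mp_ufd n : ufd (mp n).
Proof.
elim: n => [|n IH]; last exact: ufd_poly.
by move=> a a0; apply: prime_fact_unit; exists a^-1; rewrite mulVf.
Qed.

(** Points are infinite sequences, so that one point evaluates polynomials in any number of
    variables and the recursion needs no reindexing. *)
Fixpoint evr n (x : nat -> K) : {rmorphism mp n -> K} :=
  match n return {rmorphism mp n -> K} with
  | 0 => idfun
  | n'.+1 => horner_morph (fun c => mulrC (x n') (evr n' x c))
  end.

Definition ev n (p : mp n) (x : nat -> K) : K := evr n x p.

Lemma evS n (p : mp n.+1) x : ev p x = (map_poly (evr n x) (p : {poly mp n})).[x n].
Proof. by []. Qed.

Lemma evD n (p q : mp n) x : ev (p + q) x = ev p x + ev q x.
Proof. exact: rmorphD. Qed.
Lemma evB n (p q : mp n) x : ev (p - q) x = ev p x - ev q x.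
Proof. exact: rmorphB. Qed.
Lemma evM n (p q : mp n) x : ev (p * q) x = ev p x * ev q x.
Proof. exact: rmorphM. Qed.
Lemma ev1 n x : ev (1 : mp n) x = 1.
Proof. exact: rmorph1. Qed.
Lemma ev0 n x : ev (0 : mp n) x = 0.
Proof. exact: rmorph0. Qed.
Lemma evX n (p : mp n) k x : ev (p ^+ k) x = ev p x ^+ k.
Proof. exact: rmorphXn. Qed.

Lemma ev_eq n (p : mp n) x y : (forall j, (j < n)%N -> x j = y j) -> ev p x = ev p y.
Proof.
elim: n p => [|n IH] p H //; rewrite !evS H ?ltnS //.
congr (_.[_]); apply: eq_map_poly => c.
by apply: IH => j jn; apply: H; apply: ltnW.
Qed.

Fixpoint cstp n (c : K) : mp n :=
  match n return mp n with 0 => c | n'.+1 => (cstp n' c)%:P end.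

Lemma ev_cst n c x : ev (cstp n c) x = c.
Proof. by elim: n => [|n IH] //; rewrite evS /= map_polyC hornerC. Qed.

Fixpoint varp n (j : nat) : mp n :=
  match n return mp n with
  | 0 => 0 | n'.+1 => if j == n' then 'X else (varp n' j)%:P end.

Lemma ev_var n j x : (j < n)%N -> ev (varp n j) x = x j.
Proof.
elim: n => [|n IH] // jn; rewrite evS /=; case: eqVneq => [->|jn'].
  by rewrite map_polyX hornerX.
by rewrite map_polyC hornerC; apply: IH; rewrite ltn_neqAle jn' -ltnS.
Qed.

Definition upd (x : nat -> K) n s : nat -> K := fun j => if j == n then s else x j.

Lemma ev_updS n (p : mp n.+1) x s : ev p (upd x n s) = (map_poly (evr n x) (p : {poly mp n})).[s].
Proof.
rewrite evS /upd eqxx; congr (_.[_]); apply: eq_map_poly => c.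
by apply: ev_eq => j jn; rewrite /upd ltn_eqF.
Qed.

Lemma nonroot (p : {poly K}) : p != 0 -> exists s, p.[s] != 0.
Proof. by move/closed_nonrootP => [s]; exists s. Qed.

Lemma ev_neq0 n (p : mp n) : p != 0 -> exists x, ev p x != 0.
Proof.
elim: n p => [|n IH] p p0; first by exists (fun=> 0).
have : lead_coef (p : {poly mp n}) != 0 by rewrite lead_coef_eq0.
move/IH => [x lx].
have [|s sp] := @nonroot (map_poly (evr n x) (p : {poly mp n})).
  apply: contraNneq lx => /(congr1 (fun q : {poly K} => q`_(size (p : {poly mp n})).-1)).
  by rewrite coef_map coef0 => <-.
by exists (upd x n s); rewrite ev_updS.
Qed.

Lemma ev_inj n (p q : mp n) : (forall x, ev p x = ev q x) -> p = q.
Proof.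
move=> E; apply/eqP; rewrite -subr_eq0; apply: contraT => /ev_neq0[x].
by rewrite evB E subrr eqxx.
Qed.

Lemma const_prime (R : idomainType) (c : R) :
  prime_elt (c%:P : {poly R}) -> prime_elt c.
Proof.
move=> [c0 c1 Hc]; split; first by rewrite -polyC_eq0.
  by move/dvd_polyCC.
by move=> a b /dvd_polyCC; rewrite polyCM => /Hc[] /dvd_polyCC; [left|right].
Qed.

Lemma prime_primitive (R : idomainType) (p : {poly R}) :
  prime_elt p -> (1 < size p)%N -> primitive p /\ irreducible_deg p.
Proof.
move=> pp sp; have [p0 p1 Hp] := pp.
split=> [c [c0 c1 _] [k E]|g h E].
  have [|/=[z Ez]|[z Ez]] := Hp k c%:P; first by rewrite -E; apply: dvdr_refl.
    apply: c1; exists z`_0; apply/polyC_inj; rewrite polyC1.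
    have zc : 1 = z * c%:P by apply: (mulfI p0); rewrite mulr1 [LHS]E Ez; ring.
    have := congr1 (fun q : {poly R} => q`_0) zc; rewrite coefMC coef1 /= => <-.
    by rewrite polyC1.
  have z0 : z != 0 by apply: contraNneq c0 => z0; rewrite -polyC_eq0 Ez z0 mul0r.
  move/(congr1 (fun q : {poly R} => size q)): Ez; rewrite /= size_mul // size_polyC c0.
  by move: sp; rewrite -size_poly_gt0 in z0; lia.
have ar (sg sh sz : nat) : sg = (sz + size p).-1 -> size p = (sg + sh).-1 ->
  (0 < sz)%N -> (sh <= 1)%N by lia.
have g0 : g != 0 by apply: contraNneq p0 => z; rewrite E z mul0r.
have h0 : h != 0 by apply: contraNneq p0 => z; rewrite E z mulr0.
have sE := congr1 (fun q : {poly R} => size q) E; rewrite /= size_mul // in sE.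
have [|/=[z Ez]|[z Ez]] := Hp g h; first by rewrite -E; apply: dvdr_refl.
  right; have z0 : z != 0 by apply: contraNneq g0 => z0; rewrite Ez z0 mul0r.
  move/(congr1 (fun q : {poly R} => size q)): Ez; rewrite /= size_mul //.
  by rewrite -size_poly_gt0 in z0 => Ez; apply: (ar _ _ _ Ez sE z0).
left; have z0 : z != 0 by apply: contraNneq h0 => z0; rewrite Ez z0 mul0r.
move/(congr1 (fun q : {poly R} => size q)): Ez; rewrite /= size_mul //.
rewrite -size_poly_gt0 in z0 => Ez; apply: (ar _ _ _ Ez _ z0).
by rewrite addnC.
Qed.

(** A Nullstellensatz for hypersurfaces, by elimination of the last variable. A relation
    [r = a p + b u] with [r] free of that variable is evaluated where [r] and the leading
    coefficient of [p] do not vanish; a root of [p] in the last variable is then not a root of [u].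
    If [p] is constant in that variable, the induction hypothesis is applied to [p] and a
    coefficient of [u]. *)
Lemma prime_zero n (p u : mp n) : prime_elt p -> ~ dvdr p u ->
  exists x, ev p x = 0 /\ ev u x != 0.
Proof.
elim: n p u => [|n IH] p u pp nu.
  have [p0 p1 _] := pp; case: p1; exists p^-1.
  by rewrite mulVf.
have p0 : p != 0 by case: pp.
have [s1|s1] := leqP (size (p : {poly mp n})) 1.
  have Ep := size1_polyC s1; set c := (p : {poly mp n})`_0 in Ep.
  have pc : prime_elt c by apply: const_prime; rewrite -Ep.
  have [i ni] : exists i, ~ dvdr c (u : {poly mp n})`_i.
    by apply/existsNP => H; apply: nu; rewrite Ep; apply/dvd_polyC.
  have [x [cx ux]] := IH _ _ pc ni.
  have [|s us] := @nonroot (map_poly (evr n x) (u : {poly mp n})).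
    apply: contraNneq ux => /(congr1 (fun q : {poly K} => q`_i)).
    by rewrite coef_map coef0 => <-.
  exists (upd x n s); rewrite !ev_updS; split => //.
  by rewrite Ep map_polyC hornerC.
have [pr ir] := prime_primitive pp s1.
have [r [a [b [r0 Er]]]] := poly_bezout (@mp_ufd n) pr ir s1 nu.
have : r * lead_coef (p : {poly mp n}) != 0 by rewrite mulf_neq0 // lead_coef_eq0.
move/ev_neq0 => [x]; rewrite evM mulf_eq0 negb_or => /andP[rx lx].
have sz : size (map_poly (evr n x) (p : {poly mp n})) = size (p : {poly mp n}).
  by apply: size_map_poly_id0.
have [|s /rootP ps] := @closed_rootP K (map_poly (evr n x) (p : {poly mp n})) _.
  by rewrite sz neq_ltn s1 orbT.
exists (upd x n s); rewrite ev_updS; split => //.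
apply: contraNneq rx => us; have := congr1 (fun q => ev (q : mp n.+1) (upd x n s)) Er.
rewrite /= evD !evM us mulr0 [ev p _]ev_updS ps mulr0 addr0 ev_updS map_polyC hornerC => <-.
by rewrite eqxx.
Qed.

End IterPoly.

(** * Characters and Laurent polynomials *)

Section Characters.
Variable K : closedFieldType.
Variable n : nat.
Implicit Types (m : 'rV[int]_n) (t z : 'rV[K]_n) (w : 'cV[int]_n).

Definition chi m t : K := \prod_i t 0 i ^ m 0 i.
Definition dotp m w : int := (m *m w) 0 0.
(* The one-parameter subgroup of weight [w]. *)
Definition oneps w (s : K) : 'rV[K]_n := \row_j s ^ (w j 0).

Lemma chi0 t : chi 0 t = 1.
Proof. by rewrite /chi big1 // => i _; rewrite mxE expr0z. Qed.

Lemma inv_neq0 t i : invertible_row t -> t 0 i != 0.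
Proof. by move/forallP. Qed.

Lemma chi_neq0 m t : invertible_row t -> chi m t != 0.
Proof. by move=> ti; apply/prodf_neq0 => i _; rewrite expfz_neq0 // inv_neq0. Qed.

Lemma chiD m m' t : invertible_row t -> chi (m + m') t = chi m t * chi m' t.
Proof.
by move=> ti; rewrite /chi -big_split; apply: eq_bigr => i _; rewrite mxE expfzDr // inv_neq0.
Qed.

Lemma chiN m t : chi (- m) t = (chi m t)^-1.
Proof.
rewrite /chi -prodfV; apply: eq_bigr => i _.
by rewrite mxE -invr_expz.
Qed.

Lemma chiB m m' t : invertible_row t -> chi (m - m') t = chi m t / chi m' t.
Proof. by move=> ti; rewrite chiD // chiN. Qed.

Lemma chiMn m k t : invertible_row t -> chi (m *+ k) t = chi m t ^+ k.
Proof. by move=> ti; elim: k => [|k IH]; rewrite ?chi0 // mulrS chiD // IH exprS. Qed.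

Lemma chiMz m (k : int) t : invertible_row t -> chi (m *~ k) t = chi m t ^ k.
Proof.
move=> ti; case: k => k; first by rewrite -pmulrn chiMn.
by rewrite NegzE mulrNz chiN -pmulrn chiMn // -exprnN.
Qed.

Lemma chi_sum (I : Type) (r : seq I) (P : pred I) (F : I -> 'rV[int]_n) t :
  invertible_row t ->
  chi (\sum_(i <- r | P i) F i) t = \prod_(i <- r | P i) chi (F i) t.
Proof.
move=> ti; apply: (big_morph (fun m => chi m t)) => [m m'|]; last exact: chi0.
exact: chiD.
Qed.

Lemma chi_delta i t : chi (delta_mx 0 i) t = t 0 i.
Proof.
rewrite /chi (bigD1 i) //= mxE !eqxx expr1z big1 ?mulr1 // => j ji.
by rewrite mxE eqxx (negbTE ji) expr0z.
Qed.

Lemma chi_mul m t z : chi m (\row_j (t 0 j * z 0 j)) = chi m t * chi m z.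
Proof. by rewrite /chi -big_split; apply: eq_bigr => i _; rewrite mxE expfzMl. Qed.

Lemma chi_one m : chi m (const_mx 1) = 1.
Proof. by rewrite /chi big1 // => i _; rewrite mxE exp1rz. Qed.

Lemma oneps_inv w s : s != 0 -> invertible_row (oneps w s).
Proof. by move=> s0; apply/forallP => i; rewrite mxE expfz_neq0. Qed.

Lemma chi_oneps m w s : s != 0 -> chi m (oneps w s) = s ^ (dotp m w).
Proof.
move=> s0; rewrite /dotp mxE.
rewrite (big_morph (fun k : int => s ^ k) (id1 := 1) (op1 := *%R)) //.
  by apply: eq_bigr => i _; rewrite mxE exprz_exp mulrC.
by move=> k k'; rewrite expfzDr.
Qed.

Lemma dotpD m m' w : dotp (m + m') w = dotp m w + dotp m' w.
Proof. by rewrite /dotp mulmxDl mxE. Qed.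
Lemma dotpB m m' w : dotp (m - m') w = dotp m w - dotp m' w.
Proof. by rewrite /dotp mulmxBl !mxE. Qed.

Lemma int_nonroot (p : {poly int}) : p != 0 -> exists b : int, p.[b] != 0.
Proof.
move=> p0; apply: contrapT => H.
have := @max_poly_roots _ p [seq Posz k | k <- iota 0 (size p)] p0.
rewrite size_map size_iota ltnn => F; apply: notF; apply: F.
  by apply/allP => _ /mapP[k _ ->]; apply/rootP/eqP; apply: contrapT => /negP pk; apply: H; exists (Posz k).
by rewrite map_inj_uniq ?iota_uniq // => i j [].
Qed.

(** [w] is taken on the moment curve [(1, b, b^2, ...)]: each [d] becomes a nonzero polynomial in
    [b], and the integer [b] avoids the roots of their product. *)
Lemma separating (D : seq 'rV[int]_n) : (forall d, d \in D -> d != 0) ->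
  exists w, forall d, d \in D -> dotp d w != 0.
Proof.
move=> D0; have P0 : \prod_(d <- D) rVpoly d != 0.
  rewrite prodf_seq_neq0; apply/allP => d dD /=.
  apply: contraNneq (D0 _ dD) => E.
  by rewrite -[d]rVpolyK E linear0.
have [b Hb] := int_nonroot P0; exists (\col_i b ^+ i) => d dD.
have -> : dotp d (\col_i b ^+ i) = (rVpoly d).[b].
  rewrite /dotp mxE horner_poly; apply: eq_bigr => i _.
  by rewrite mxE; case: insubP => [j _ /val_inj ->|]; rewrite ?ltn_ord.
rewrite horner_prod in Hb; apply: contraNneq Hb => E.
by rewrite prodf_seq_eq0; apply/hasP; exists d => //=; rewrite E.
Qed.

Lemma separating_inj (l : seq 'rV[int]_n) :
  exists w, {in l &, injective (fun m => dotp m w)}.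
Proof.
have [d|w Hw] := @separating [seq x <- [seq x.1 - x.2 | x <- allpairs pair l l] | x != 0].
  by rewrite mem_filter => /andP[].
exists w => m m' ml ml' E; apply/eqP; rewrite -subr_eq0; apply: contraT => mm.
have := Hw (m - m'); rewrite mem_filter mm dotpB E subrr eqxx; apply.
by apply/mapP; exists (m, m') => //; apply/allpairsP; exists (m, m').
Qed.

(** Restriction to a one-parameter subgroup separating the exponents turns the relation into a
    polynomial in one variable with pairwise distinct exponents, after a shift by [N] that makes
    them nonnegative. *)
Lemma chi_indep (l : seq 'rV[int]_n) (c : 'rV[int]_n -> K) : uniq l ->
  (forall t, invertible_row t -> \sum_(m <- l) c m * chi m t = 0) ->
  forall m, m \in l -> c m = 0.
Proof.
move=> ul H; have [w Hw] := separating_inj l.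
pose N := (\sum_(m <- l) `|dotp m w|)%N.
have HN m : m \in l -> (- N%:Z <= dotp m w)%R.
  move=> ml; have : (absz (dotp m w) <= N)%N by rewrite /N (big_rem m) //= leq_addr.
  lia.
pose e m := absz (dotp m w + N%:Z).
have eE m : m \in l -> (e m)%:Z = dotp m w + N%:Z by move/HN; rewrite /e; lia.
have ei : {in l &, injective e}.
  move=> m m' ml ml' E; apply: Hw => //.
  by have := eE _ ml; rewrite E eE // => /addIr.
pose q := \sum_(m <- l) c m *: 'X^(e m).
(* The extra factor ['X] forces a point of nonvanishing to be nonzero, so that the one-parameter
   subgroup is defined there. *)
have q0 : q * 'X = 0.
  apply/eqP; apply: contraT => /nonroot[s]; rewrite hornerM hornerX.
  have [->|s0] := eqVneq s 0; first by rewrite mulr0 eqxx.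
  rewrite /q horner_sum.
  have -> : \sum_(m <- l) (c m *: 'X^(e m)).[s] = (\sum_(m <- l) c m * chi m (oneps w s)) * s ^ N%:Z.
    rewrite mulr_suml; apply: eq_big_seq => m ml.
    by rewrite hornerZ hornerXn chi_oneps // -mulrA -expfzDr // -eE.
  by rewrite H ?mul0r ?eqxx // oneps_inv.
move=> m ml; move/eqP: q0; rewrite mulf_eq0 polyX_eq0 orbF => /eqP/(congr1 (fun p : {poly K} => p`_(e m))).
rewrite coef0 coef_sum (bigD1_seq m) //= coefZ coefXn eqxx mulr1 big_seq_cond big1 ?addr0 //.
move=> m' /andP[m'l mm']; rewrite coefZ coefXn; case: eqVneq => [E|]; last by rewrite mulr0.
by case/eqP: mm'; apply: ei.
Qed.

(** Laurent polynomials supported in [P]. The expression need not be reduced, which makes support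
    conditions stable under sums and products; [lspan_uniq] gives the reduced form. *)
Definition lspan (P : set 'rV[int]_n) (f : 'rV[K]_n -> K) :=
  exists l : seq (K * 'rV[int]_n), (forall cm, cm \in l -> P cm.2) /\
    forall t, invertible_row t -> f t = \sum_(cm <- l) cm.1 * chi cm.2 t.

Lemma lspan_ext P f g : lspan P f -> (forall t, invertible_row t -> g t = f t) ->
  lspan P g.
Proof. by move=> [l [Pl E]] H; exists l; split => // t ti; rewrite H // E. Qed.

Lemma lspan_sub (P Q : set 'rV[int]_n) f : (forall m, P m -> Q m) -> lspan P f -> lspan Q f.
Proof. by move=> PQ [l [Pl E]]; exists l; split => // cm /Pl/PQ. Qed.

Lemma lspan_chi (P : set 'rV[int]_n) m : P m -> lspan P (chi m).
Proof.
move=> Pm; exists [:: (1, m)]; split => [cm|t ti]; first by rewrite inE => /eqP ->.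
by rewrite big_seq1 mul1r.
Qed.

Lemma lspan0 P : lspan P (fun=> 0).
Proof. by exists [::]; split => // t _; rewrite big_nil. Qed.

Lemma lspanD P f g : lspan P f -> lspan P g -> lspan P (fun t => f t + g t).
Proof.
move=> [l [Pl El]] [k [Pk Ek]]; exists (l ++ k); split.
  by move=> cm; rewrite mem_cat => /orP[/Pl|/Pk].
by move=> t ti; rewrite big_cat El // Ek.
Qed.

Lemma lspanZ P c f : lspan P f -> lspan P (fun t => c * f t).
Proof.
move=> [l [Pl El]]; exists [seq (c * cm.1, cm.2) | cm <- l]; split.
  by move=> cm /mapP[x xl ->]; apply: (Pl x).
move=> t ti; rewrite big_map El // mulr_sumr; apply: eq_bigr => cm _.
by rewrite mulrA.
Qed.

Lemma lspan_sum P (I : Type) (r : seq I) (Q : pred I) (F : I -> 'rV[K]_n -> K) :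
  (forall i, Q i -> lspan P (F i)) -> lspan P (fun t => \sum_(i <- r | Q i) F i t).
Proof.
move=> H; elim: r => [|i r IH]; first by apply: lspan_ext (lspan0 P) _ => t _; rewrite big_nil.
case: (boolP (Q i)) => Qi.
  by apply: lspan_ext (lspanD (H _ Qi) IH) _ => t _; rewrite big_cons Qi.
by apply: lspan_ext IH _ => t _; rewrite big_cons (negbTE Qi).
Qed.

Lemma lspanM (P Q S : set 'rV[int]_n) f g : (forall p q, P p -> Q q -> S (p + q)) ->
  lspan P f -> lspan Q g -> lspan S (fun t => f t * g t).
Proof.
move=> PQ [l [Pl El]] [k [Pk Ek]].
exists [seq (x.1 * y.1, x.2 + y.2) | x <- l, y <- k]; split.
  by move=> cm /allpairsP[[x y] [/= xl yk ->]]; apply: PQ; [apply: Pl|apply: Pk].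
move=> t ti; rewrite big_allpairs_dep El // Ek // mulr_suml; apply: eq_bigr => x _.
rewrite mulr_sumr; apply: eq_bigr => y _ /=; rewrite chiD //; ring.
Qed.

Lemma lspan_uniq P f : lspan P f -> exists (l : seq 'rV[int]_n) c,
  [/\ uniq l, forall m, m \in l -> P m, forall m, m \in l -> c m != 0
    & forall t, invertible_row t -> f t = \sum_(m <- l) c m * chi m t].
Proof.
move=> [l [Pl E]]; pose c m := \sum_(cm <- l | cm.2 == m) cm.1.
exists [seq m <- undup (map snd l) | c m != 0], c; split.
- by rewrite filter_uniq // undup_uniq.
- by move=> m; rewrite mem_filter mem_undup => /andP[_ /mapP[cm /Pl ? ->]].
- by move=> m; rewrite mem_filter => /andP[].
move=> t ti; rewrite E // big_filter.
rewrite [RHS]big_rmcond; last by move=> m /negPn/eqP ->; rewrite mul0r.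
rewrite /c; under [RHS]eq_bigr => m _ do rewrite mulr_suml.
rewrite (exchange_big_dep predT) //= big_seq [RHS]big_seq; apply: eq_bigr => cm cml.
rewrite big_mkcond (bigD1_seq cm.2) ?undup_uniq //=; last by rewrite mem_undup map_f.
by rewrite eqxx big1 ?addr0 // => m; rewrite eq_sym => /negbTE ->.
Qed.

(** Combined with evaluation at the unit of the torus, this is how single coefficients are isolated
    and how an exponent is shown to belong to a given set. *)
Lemma lspan_disjoint (P Q : set 'rV[int]_n) f : (forall m, P m -> ~ Q m) ->
  lspan P f -> lspan Q f -> forall t, invertible_row t -> f t = 0.
Proof.
move=> PQ /lspan_uniq[l [c [ul Pl c0 El]]] /lspan_uniq[k [d [uk Pk d0 Ek]]] t ti.
have lk m : m \in l -> m \in k -> false by move=> /Pl Pm /Pk /(PQ _ Pm).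
pose e m := if m \in l then c m else - d m.
have ue : uniq (l ++ k).
  rewrite cat_uniq ul uk andbT /=; apply/hasPn => m mk; apply/negP => ml.
  by have := lk _ ml mk.
have H : forall m, m \in l ++ k -> e m = 0.
  apply: chi_indep => // z zi; rewrite big_cat /=.
  have -> : \sum_(m <- l) e m * chi m z = f z.
    by rewrite El //; apply: eq_big_seq => m ml; rewrite /e ml.
  have -> : \sum_(m <- k) e m * chi m z = - f z.
    rewrite Ek // -sumrN; apply: eq_big_seq => m mk; rewrite /e; case: ifP => [/lk/(_ mk)//|].
    by rewrite mulNr.
  by rewrite subrr.
rewrite El // big1_seq // => m /andP[_ ml].
have := H m; rewrite mem_cat ml /e ml => /(_ isT) ->.
by rewrite mul0r.
Qed.

End Characters.

(** * Regular and invertible functions on the torus *)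

Section Laurent.
Variable K : closedFieldType.
Variable n : nat.
Implicit Types (z t : 'rV[K]_n).

Definition crd z : nat -> K := fun j => oapp (fun i : 'I_n => z 0 i) 0 (insub j).
Definition evz (p : mp K n) z : K := ev p (crd z).

Lemma crd_ord z (i : 'I_n) : crd z i = z 0 i.
Proof. by rewrite /crd valK. Qed.

Lemma evz_row (p : mp K n) (x : nat -> K) : evz p (\row_i x i) = ev p x.
Proof. by apply: ev_eq => j jn; rewrite -[j]/(nat_of_ord (Ordinal jn)) crd_ord mxE. Qed.

Lemma evz_var (i : 'I_n) z : evz (varp K n i) z = z 0 i.
Proof. by rewrite /evz ev_var // crd_ord. Qed.

Lemma evz_neq0 (p : mp K n) : p != 0 -> exists z, evz p z != 0.
Proof. by move/ev_neq0 => [x px]; exists (\row_i x i); rewrite evz_row. Qed.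

Lemma evz_inj (p q : mp K n) : (forall z, evz p z = evz q z) -> p = q.
Proof. by move=> E; apply: ev_inj => x; rewrite -!evz_row. Qed.

Lemma evzD (p q : mp K n) z : evz (p + q) z = evz p z + evz q z.
Proof. exact: evD. Qed.
Lemma evzM (p q : mp K n) z : evz (p * q) z = evz p z * evz q z.
Proof. exact: evM. Qed.
Lemma evzX (p : mp K n) k z : evz (p ^+ k) z = evz p z ^+ k.
Proof. exact: evX. Qed.
Lemma evz_cst c z : evz (cstp n c) z = c.
Proof. exact: ev_cst. Qed.
Lemma evz0 z : evz 0 z = 0.
Proof. exact: ev0. Qed.
Lemma evz_prod (I : Type) (r : seq I) (P : pred I) (F : I -> mp K n) z :
  evz (\prod_(i <- r | P i) F i) z = \prod_(i <- r | P i) evz (F i) z.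
Proof.
apply: (big_morph (fun p => evz p z)) => [p q|]; first exact: evzM.
exact: ev1.
Qed.

Lemma prime_zeroz (p u : mp K n) : prime_elt p -> ~ dvdr p u ->
  exists z, evz p z = 0 /\ evz u z != 0.
Proof. by move=> pp nu; have [x] := prime_zero pp nu; exists (\row_i x i); rewrite !evz_row. Qed.

Lemma dvdr_evz (p q : mp K n) z : dvdr p q -> evz q z != 0 -> evz p z != 0.
Proof. by move=> [c ->]; rewrite evzM mulf_eq0 negb_or => /andP[]. Qed.

Lemma not_dvdr_evz (p q : mp K n) z : evz p z = 0 -> evz q z != 0 -> ~ dvdr p q.
Proof. by move=> pz qz /dvdr_evz /(_ qz); rewrite pz eqxx. Qed.

Lemma unit_mp m (u : mp K m) : dvdr u 1 -> exists2 c, c != 0 & u = cstp m c.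
Proof.
elim: m u => [|m IH] u; first by move=> /unit_neq0 u0; exists u.
move=> u1; have u0 := unit_neq0 u1; have [v Ev] := u1.
have v0 : v != 0 by apply: contra_eq_neq Ev => ->; rewrite mul0r oner_neq0.
have sz : (size (u : {poly mp K m}) <= 1)%N.
  move: (congr1 (fun q : {poly mp K m} => size q) Ev); rewrite size_poly1 size_mul //.
  have ar (a b : nat) : 1%N = (b + a).-1 -> (0 < b)%N -> (a <= 1)%N by lia.
  by move=> E; rewrite -size_poly_gt0 in v0; apply: ar E v0.
have Eu := size1_polyC sz.
have [|c c0 Ec] := IH (u : {poly mp K m})`_0.
  by apply/dvd_polyCC; rewrite -Eu polyC1.
by exists c => //; rewrite Eu Ec.
Qed.

Lemma prime_varp m j : (j < m)%N -> prime_elt (varp K m j).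
Proof.
elim: m => [|m IH] // jm /=; case: eqVneq => [_|jm']; last first.
  by apply: prime_polyC; apply: IH; rewrite ltn_neqAle jm' -ltnS.
have dX (f : {poly mp K m}) : dvdr 'X f <-> f.[0] = 0.
  split=> [[g ->]|f0]; first by rewrite hornerM hornerX mulr0.
  by have /factor_theorem[g ->] : root f 0 by [apply/eqP]; exists g; rewrite subr0.
split; first by rewrite polyX_eq0.
  by move/dX/eqP; rewrite hornerC oner_eq0.
move=> f g /dX; rewrite hornerM => /eqP; rewrite mulf_eq0 => /orP[]/eqP ?; [left|right]; exact/dX.
Qed.

Lemma inv_row_evz z : invertible_row z <-> evz (\prod_(i < n) varp K n i) z != 0.
Proof.
rewrite evz_prod; split=> [iz|/prodf_neq0 H].
  by apply/prodf_neq0 => i _; rewrite evz_var inv_neq0.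
by apply/forallP => i; have := H i isT; rewrite evz_var.
Qed.

(** By [prime_zeroz], a prime factor of [a] divides the product of the variables, as it has no zero
    on the torus; hence it is a variable up to a constant. *)
Lemma nonvanishing_chi (a : mp K n) :
  (forall z, invertible_row z -> evz a z != 0) ->
  exists c m, c != 0 /\ forall z, invertible_row z -> evz a z = c * chi m z.
Proof.
move=> Ha; have a0 : a != 0.
  have one : invertible_row (const_mx 1 : 'rV[K]_n) by apply: torus_one_subproof.
  by apply: contraNneq (Ha _ one) => ->; rewrite evz0.
have [u [l [u1 Hl Ea]]] := mp_ufd a0.
have [c c0 Ec] := unit_mp u1.
have Hp p : p \in l -> exists c m, c != 0 /\ forall z, invertible_row z -> evz p z = c * chi m z.
  move=> pl; have pp := Hl _ pl.
  have pX : dvdr p (\prod_(i < n) varp K n i).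
    apply: contrapT => /(prime_zeroz pp)[z [pz /inv_row_evz iz]].
    have /negP := Ha _ iz; apply; rewrite Ea evzM evz_prod mulf_eq0; apply/orP; right.
    by rewrite prodf_seq_eq0; apply/hasP; exists p => //=; rewrite pz.
  have [q ql pq] : exists2 q, q \in [seq varp K n (nat_of_ord i) | i <- enum 'I_n] & dvdr p q.
    by apply: prime_prod => //; rewrite big_map big_enum.
  have [i _ Eq] := mapP ql.
  have pv := prime_varp (ltn_ord i); rewrite Eq in pq.
  have [w w1 E] := prime_dvd_prime pp pv pq.
  have [d d0 Ed] := unit_mp w1; exists d^-1, (delta_mx 0 i); split; first by rewrite invr_neq0.
  move=> z iz; rewrite chi_delta -evz_var E evzM Ed evz_cst mulrA mulVf //.
  by rewrite mul1r.
have [d [m [d0 Hd]]] : exists d m, d != 0 /\ forall z, invertible_row z ->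
    \prod_(p <- l) evz p z = d * chi m z.
  elim: (l) Hp => [|p k IH] Hp.
    by exists 1, 0; split => [|z _]; rewrite ?oner_neq0 // big_nil chi0 mulr1.
  have [|d [m [d0 Hd]]] := IH; first by move=> q qk; apply: Hp; rewrite in_cons qk orbT.
  have [|e [m' [e0 He]]] := Hp p; first by rewrite mem_head.
  exists (e * d), (m' + m); split; first by rewrite mulf_neq0.
  by move=> z iz; rewrite big_cons Hd // He // chiD //; ring.
exists (c * d), m; split; first by rewrite mulf_neq0.
by move=> z iz; rewrite Ea evzM evz_prod Hd // Ec evz_cst mulrA.
Qed.

Lemma lspan_evz (p : mp K n) : lspan setT (evz p).
Proof.
suff H m (q : mp K m) : (m <= n)%N -> lspan setT (fun z => ev q (crd z)) by apply: H.
elim: m q => [|m IH] q mn.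
  have H0 := lspanZ (q : K) (lspan_chi K (P := setT) (m := 0 : 'rV[int]_n) I).
  by apply: lspan_ext H0 _ => t _; rewrite chi0 mulr1.
pose i := Ordinal mn.
apply: (@lspan_ext _ _ setT (fun z => \sum_(j < size (q : {poly mp K m}))
   ev (q : {poly mp K m})`_j (crd z) * chi (delta_mx 0 i *+ j) z)); last first.
  move=> t ti; rewrite evS (@horner_coef_wide _ (size (q : {poly mp K m}))); last exact: size_poly.
  apply: eq_bigr => j _; rewrite coef_map chiMn // chi_delta.
  by rewrite -[m]/(nat_of_ord i) crd_ord.
apply: lspan_sum => j _; apply: (lspanM (P := setT) (Q := setT)) => //.
  by apply: IH; apply: ltnW.
exact: lspan_chi.
Qed.

Lemma alg_torus (a : torus_pt K n -> K) :
  alg [set f | exists i : 'I_n, f = (fun t : torus_pt K n => sval t 0 i)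
       \/ f = (fun t : torus_pt K n => (sval t 0 i)^-1)] a ->
  exists p k, forall t : torus_pt K n, a t = evz p (sval t) / evz (\prod_(i < n) varp K n i) (sval t) ^+ k.
Proof.
set X := \prod_(i < n) _.
have X0 (t : torus_pt K n) : evz X (sval t) != 0 by apply/inv_row_evz; exact: (svalP t).
elim=> {a} [_ [i [->|->]]|c|a b _ [p [k Ea]] _ [q [l Eb]]|a b _ [p [k Ea]] _ [q [l Eb]]].
- by exists (varp K n i), 0%N => t; rewrite evz_var expr0 divr1.
- exists (\prod_(j < n | j != i) varp K n j), 1%N => t.
  have ti : sval t 0 i != 0 by apply: inv_neq0; exact: (svalP t).
  apply: (mulIf (X0 t)); rewrite expr1 divfK // /X (bigD1 i) //= evzM evz_var.
  by rewrite mulKf.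
- by exists (cstp n c), 0%N => t; rewrite evz_cst expr0 divr1.
- exists (p * X ^+ l + q * X ^+ k), (k + l)%N => t; rewrite Ea Eb evzD !evzM !evzX exprD.
  by field; rewrite !expf_neq0.
- exists (p * q), (k + l)%N => t; rewrite Ea Eb evzM exprD.
  by field; rewrite !expf_neq0.
Qed.

(** A fraction valid near the unit is reduced to lowest terms. Compared with a local fraction at any
    other point, its denominator divides the other one by factoriality, so it does not vanish there:
    one reduced fraction serves everywhere. *)
Lemma torus_frac (f : torus K n -> K) : reg setT f ->
  exists a b : mp K n, (forall z, invertible_row z -> evz b z != 0) /\
    forall t : torus_pt K n, f t = evz a (sval t) / evz b (sval t).
Proof.
move=> rf.
set X := \prod_(i < n) varp K n i.
have X0 (t : torus_pt K n) : evz X (sval t) != 0 by apply/inv_row_evz; exact: (svalP t).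
have Xz z : invertible_row z -> evz X z != 0 by move/inv_row_evz.
have XN : X != 0.
  by apply: contraNneq (X0 (torus_one K n)) => ->; rewrite evz0.
have loc (t0 : torus_pt K n) : exists p q : mp K n, evz q (sval t0) != 0 /\
    forall t : torus_pt K n, evz q (sval t) != 0 -> f t = evz p (sval t) / evz q (sval t).
  have [_ [a [b [Ga Gb _ b0 H]]]] := rf t0 I.
  have [p [k Ea]] := alg_torus Ga; have [q [l Eb]] := alg_torus Gb.
  have qb (t : torus_pt K n) : (b t != 0) = (evz q (sval t) != 0).
    by rewrite Eb mulf_eq0 invr_eq0 expf_eq0 (negbTE (X0 t)) andbF orbF.
  exists (p * X ^+ l), (q * X ^+ k); split.
    by rewrite evzM mulf_neq0 -?qb // evzX expf_neq0.
  move=> t; rewrite evzM mulf_eq0 negb_or => /andP[qt _].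
  rewrite (H t I _).2 ?qb // Ea Eb !evzM !evzX.
  by field; rewrite qt !expf_neq0.
have [p [q [q1 Hpq]]] := loc (torus_one K n).
have q0 : q != 0 by apply: contraNneq q1 => ->; rewrite evz0.
have [d [b [a [Eb Ea C]]]] := coprime_reduce p (mp_ufd q0).
have b0 : b != 0 by apply: contraNneq q0 => z; rewrite Eb z mulr0.
have d0 : d != 0 by apply: contraNneq q0 => z; rewrite Eb z mul0r.
have main (t : torus_pt K n) : evz b (sval t) != 0 /\ f t = evz a (sval t) / evz b (sval t).
  have [p' [q' [q't H]]] := loc t.
  have q'0 : q' != 0 by apply: contraNneq q't => ->; rewrite evz0.
  have E : a * q' = p' * b.
    apply: (mulfI d0); rewrite mulrA -Ea mulrCA -Eb.
    (* Multiplication by [q * q' * X] makes both sides vanish at the points where the two fractions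
       cannot be compared, so that the identity can be tested at all points. *)
    apply: (mulfI (mulf_neq0 (mulf_neq0 q0 q'0) XN)).
    apply: evz_inj => z; rewrite !evzM.
    have [->|qz] := eqVneq (evz q z) 0; first by rewrite !mul0r.
    have [->|q'z] := eqVneq (evz q' z) 0; first by rewrite !(mulr0, mul0r).
    have [->|/inv_row_evz iz] := eqVneq (evz X z) 0; first by rewrite !(mulr0, mul0r).
    have E1 := Hpq (exist _ z iz) qz; have := H (exist _ z iz) q'z; rewrite E1 /=.
    by move/eqP; rewrite eqr_div // => /eqP E2; rewrite E2.
  have bq : dvdr b q'.
    apply: (coprime_dvd (mp_ufd b0) _ E).
    by move=> r pr ra rb; apply: (C r pr rb ra).
  have bt := dvdr_evz bq q't; split => //.
  have := congr1 (fun r => evz r (sval t)) E; rewrite /= !evzM => E'.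
  rewrite H //; apply: (mulIf bt); rewrite divfK //.
  by rewrite mulrAC -E' mulfK.
exists a, b; split=> [z iz|t]; last by case: (main t).
exact: (main (exist _ z iz)).1.
Qed.

(** A denominator without zeros on the torus is a monomial up to a constant, hence invertible among
    Laurent polynomials. *)
Lemma torus_laurent (f : torus K n -> K) : reg setT f ->
  exists g, lspan setT g /\ forall t : torus_pt K n, f t = g (sval t).
Proof.
move=> /torus_frac[a [b [b0 Hf]]].
have [c [m [c0 Eb]]] := nonvanishing_chi b0.
exists (fun z => c^-1 * (evz a z * chi (- m) z)); split.
  apply: lspanZ; apply: (lspanM (P := setT) (Q := setT)) => //.
    exact: lspan_evz.
  exact: lspan_chi.
move=> t; have it := svalP t; rewrite Hf Eb // chiN.
by field; rewrite c0 chi_neq0.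
Qed.

Lemma torus_unit (f : torus K n -> K) : reg setT f ->
  (forall t : torus_pt K n, f t != 0) ->
  exists c m, c != 0 /\ forall t : torus_pt K n, f t = c * chi m (sval t).
Proof.
move=> /torus_frac[a [b [b0 Hf]]] f0.
have [c [m [c0 Eb]]] := nonvanishing_chi b0.
have a0 z : invertible_row z -> evz a z != 0.
  move=> iz; apply: contraNneq (f0 (exist _ z iz)) => E.
  by rewrite Hf /= E mul0r.
have [d [m' [d0 Ea]]] := nonvanishing_chi a0.
exists (d / c), (m' - m); split; first by rewrite mulf_neq0 // invr_neq0.
move=> t; have it := svalP t; rewrite Hf Ea // Eb // chiB //.
by field; rewrite c0 chi_neq0.
Qed.

End Laurent.

(** * Line bundles on affine space *)

Section AffineChart.
Variables (K : closedFieldType) (X : ringed_set K) (n : nat).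
Variables (U : set X) (xc : X -> 'rV[K]_n).
Hypothesis nX : nice X.
Hypothesis dU : dense U.
Hypothesis cU : chart U [set f | exists i, f = fun y => xc y 0 i].
Hypothesis xsurj : forall z, exists2 y, U y & xc y = z.

Definition pf (p : mp K n) (y : X) : K := evz p (xc y).

Let oU : opn U. Proof. by case: cU. Qed.

Lemma pfM p q y : pf (p * q) y = pf p y * pf q y. Proof. exact: evzM. Qed.
Lemma pfX p k y : pf (p ^+ k) y = pf p y ^+ k. Proof. exact: evzX. Qed.

Lemma alg_pf f : alg [set f | exists i, f = fun y => xc y 0 i] f ->
  exists p, forall y, f y = pf p y.
Proof.
elim=> {f} [_ [i ->]|c|f g _ [p Ep] _ [q Eq]|f g _ [p Ep] _ [q Eq]].
- by exists (varp K n i) => y; rewrite /pf evz_var.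
- by exists (cstp n c) => y; rewrite /pf evz_cst.
- by exists (p + q) => y; rewrite /pf evzD Ep Eq.
- by exists (p * q) => y; rewrite pfM Ep Eq.
Qed.

Lemma reg_evz (Y : ringed_set K) (W : set Y) (yc : Y -> 'rV[K]_n) (p : mp K n) :
  nice Y -> opn W -> (forall i, reg W (fun y => yc y 0 i)) ->
  reg W (fun y => evz p (yc y)).
Proof.
move=> nY oW H.
suff main m (q : mp K m) : (m <= n)%N -> reg W (fun y => ev q (crd (yc y))) by apply: main.
elim: m q => [|m IH] q mn; first exact: nice_cst.
pose i := Ordinal mn.
apply: (@reg_ext _ _ _ (fun y => \sum_(j < size (q : {poly mp K m}))
   ev (q : {poly mp K m})`_j (crd (yc y)) * yc y 0 i ^+ j)) => //.
  apply: reg_sum => // j _; apply: nice_mul => //; last exact: reg_exp.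
  by apply: IH; apply: ltnW.
move=> y _; rewrite evS (@horner_coef_wide _ (size (q : {poly mp K m}))); last exact: size_poly.
apply: eq_bigr => j _; rewrite coef_map.
by rewrite -[m]/(nat_of_ord i) crd_ord.
Qed.

Lemma pf_reg p : reg U (pf p).
Proof. by apply: reg_evz => // i; case: cU => _ H _; apply: H; exists i. Qed.

Lemma pf_rep (W : set X) g x : reg W g -> W x -> U x ->
  exists p q, pf q x != 0 /\
    forall y, U y -> pf q y != 0 -> W y /\ g y = pf p y / pf q y.
Proof.
move=> rg Wx Ux; have [_ _ C] := cU; have [a [b [Ga Gb bx H]]] := C _ _ _ rg Wx Ux.
have [p Ep] := alg_pf Ga; have [q Eq] := alg_pf Gb.
by exists p, q; rewrite -Eq; split => // y Uy; rewrite -Eq -Ep; apply: H.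
Qed.

Lemma pf_nbhd (W : set X) x : opn W -> W x -> U x ->
  exists c, pf c x != 0 /\ forall y, U y -> pf c y != 0 -> W y.
Proof.
move=> oW Wx Ux; have [p [q [qx H]]] := pf_rep (nice_cst nX 0 oW) Wx Ux.
by exists q; split => // y Uy qy; have [] := H y Uy qy.
Qed.

Lemma pf_pt p : p != 0 -> exists2 y, U y & pf p y != 0.
Proof. by move/evz_neq0 => [z pz]; have [y Uy Ey] := xsurj z; exists y => //; rewrite /pf Ey. Qed.

Lemma pf_neq0 p y : pf p y != 0 -> p != 0.
Proof. by apply: contraNneq => ->; rewrite /pf evz0. Qed.

Lemma pf_inj h p q : h != 0 -> (forall y, U y -> pf h y != 0 -> pf p y = pf q y) -> p = q.
Proof.
move=> h0 H; apply: (mulfI h0); apply: evz_inj => z.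
have [y Uy <-] := xsurj z; rewrite !evzM.
have [->|hy] := eqVneq (evz h (xc y)) 0; first by rewrite !mul0r.
by congr (_ * _); apply: H.
Qed.

Lemma pf_prime p u : prime_elt p -> ~ dvdr p u ->
  exists y, [/\ U y, pf p y = 0 & pf u y != 0].
Proof.
move=> pp /(prime_zeroz pp)[z [pz uz]]; have [y Uy Ey] := xsurj z.
by exists y; rewrite /pf Ey.
Qed.

Lemma pf_opn p : opn (U `&` [set y | pf p y != 0]).
Proof. exact: opn_neq0 nX (pf_reg p). Qed.

Lemma pf_dense h : h != 0 -> dense (U `&` [set y | pf h y != 0]).
Proof.
move=> h0 W oW W0; have [x [Wx Ux]] := dU oW W0.
have [c [cx Hc]] := pf_nbhd oW Wx Ux.
have [|y Uy] := @pf_pt (c * h); first by rewrite mulf_neq0 // (pf_neq0 cx).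
by rewrite pfM mulf_eq0 negb_or => /andP[cy hy]; exists y; split => //; apply: Hc.
Qed.

Lemma pf_factor_zero a y : a != 0 -> pf a y = 0 ->
  exists p, [/\ prime_elt p, dvdr p a & pf p y = 0].
Proof.
move=> a0; have [u [l [u1 Hl ->]]] := mp_ufd a0.
have [c c0 ->] := unit_mp u1; move/eqP; rewrite pfM mulf_eq0 /pf evz_cst (negbTE c0) /=.
rewrite evz_prod prodf_seq_eq0 => /hasP[p pl /= /eqP py].
exists p; split => //; first exact: Hl.
by apply: dvdr_mull; rewrite (big_rem p) //=; apply: dvdr_mulr; apply: dvdr_refl.
Qed.

Variable L : cocycle X.
Hypothesis hL : line_bundle L.

(** A nowhere vanishing section, that is a frame of [L] over [V]; the values of [s i] are
    constrained on [dom i] and inside [V] only. *)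
Definition generates (V : set X) (s : idx L -> X -> K) :=
  (forall i : idx L, reg (dom i `&` V) (s i)) /\
  forall (i : idx L) y, dom i y -> V y -> s i y != 0 /\
    forall j : idx L, dom j y -> s i y = tr i j y * s j y.

Let UH (h : mp K n) := U `&` [set y | pf h y != 0].

Let od (i : idx L) : opn (dom i : set X). Proof. by case: hL. Qed.
(** The trivialization of index [i0] around a point is itself a frame, written [tr i i0] in the
    others. Shrinking to a principal open set leaves only the primes of [h] to be crossed. *)
Lemma generates_generic : exists h s, h != 0 /\ generates (UH h) s.
Proof.
have [y0 Uy0 _] := xsurj 0; have [od' cov rt tn tc] := hL.
have [i0 Di0] := cov y0; have [c [cy Hc]] := pf_nbhd (od i0) Di0 Uy0.
exists c, (fun i => tr i i0); split; first exact: pf_neq0 cy.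
split=> [i|i y Di [Uy /= cy']].
  apply: (nice_res nX (rt i i0)); first by apply: nice_opnI => //; apply: pf_opn.
  by move=> y [Di [Uy cy']]; split => //; apply: Hc.
have Dy : dom i0 y by apply: Hc.
by split=> [|j Dj]; [apply: tn|rewrite tc].
Qed.

Section Step.
Variables (p h : mp K n) (s : idx L -> X -> K).
Hypothesis pp : prime_elt p.
Hypothesis h0 : h != 0.
Hypothesis gs : generates (UH (p * h)) s.

Let p0 : p != 0. Proof. by case: pp. Qed.

(** The reduced fraction [A / B] of [s i] has neither zeros nor poles where [c], [p] and [h] do not
    vanish. The prime factors of [A] and [B] other than [p] therefore do not vanish at [y], and what
    remains is a power of [p] times a unit near [y]. *)
Lemma generator_local (i : idx L) y : dom i y -> U y -> pf p y = 0 -> pf h y != 0 ->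
  exists (k l : nat) a b c, [/\ pf a y != 0, pf b y != 0, pf c y != 0
   & forall z, U z -> pf c z != 0 -> dom i z /\ (pf p z != 0 -> pf h z != 0 ->
       pf b z != 0 /\ s i z = pf p z ^+ k * pf a z / (pf p z ^+ l * pf b z))].
Proof.
move=> Di Uy py hy; have [c [cy Hc]] := pf_nbhd (od i) Di Uy.
have [rs ns] := gs.
have cph : c * (p * h) != 0 by rewrite !mulf_neq0 // (pf_neq0 cy).
have inW z : U z -> pf (c * (p * h)) z != 0 -> (dom i `&` UH (p * h)) z.
  by move=> Uz; rewrite pfM mulf_eq0 negb_or => /andP[cz phz]; split => //; apply: Hc.
have [z0 Uz0 z0n] := pf_pt cph.
have [P [Q [Qz0 HPQ]]] := pf_rep (rs i) (inW _ Uz0 z0n) Uz0.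
have Q0 := pf_neq0 Qz0.
have [d [B [A [EQ EP C]]]] := coprime_reduce P (mp_ufd Q0).
have d0 : d != 0 by apply: contraNneq Q0 => z; rewrite EQ z mul0r.
have B0 : B != 0 by apply: contraNneq Q0 => z; rewrite EQ z mulr0.
have main z : U z -> pf (c * (p * h)) z != 0 ->
    [/\ pf A z != 0, pf B z != 0 & s i z = pf A z / pf B z].
  move=> Uz zn; have Wz := inW _ Uz zn.
  have [P' [Q' [Q'z H]]] := pf_rep (rs i) Wz Uz.
  have E : A * Q' = P' * B.
    apply: (mulfI d0); rewrite mulrA -EP mulrCA -EQ.
    apply: (@pf_inj (Q * Q')); first by rewrite mulf_neq0 // (pf_neq0 Q'z).
    move=> x Ux; rewrite !pfM mulf_eq0 negb_or => /andP[Qx Q'x].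
    have [_ E1] := HPQ x Ux Qx; have [_ E2] := H x Ux Q'x.
    by move/eqP: E2; rewrite E1 eqr_div // => /eqP.
  have BQ : dvdr B Q'.
    by apply: (coprime_dvd (mp_ufd B0) _ E) => r pr ra rb; apply: (C r pr rb ra).
  have Bz := dvdr_evz BQ Q'z.
  have sE : s i z = pf A z / pf B z.
    have [_ ->] := H z Uz Q'z; apply/eqP; rewrite eqr_div // -!pfM.
    by rewrite -E.
  split => //; have [Diz Uz'] := Wz; have [snz _] := ns _ _ Diz Uz'.
  by apply: contraNneq snz => Az; rewrite sE Az mul0r.
have [y1 Uy1 y1n] := pf_pt cph.
have A0 : A != 0 by have [Ay _ _] := main _ Uy1 y1n; exact: pf_neq0 Ay.
have [k [a [Ea na]]] := multiplicity pp (mp_ufd A0).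
have [l [b [Eb nb]]] := multiplicity pp (mp_ufd B0).
have nz r : (forall z, U z -> pf (c * (p * h)) z != 0 -> pf r z != 0) -> r != 0 ->
    ~ dvdr p r -> pf r y != 0.
  move=> Hr r0 npr; apply/eqP => ry.
  have [q [pq qr qy]] := pf_factor_zero r0 ry.
  have : dvdr q (c * (p * h)).
    apply: contrapT => /(pf_prime pq)[z [Uz qz /(Hr _ Uz) rz]].
    by apply: (not_dvdr_evz qz rz).
  have [_ _ Hq] := pq; case/Hq => [|/Hq[]].
  - exact: not_dvdr_evz qy cy.
  - by move=> /(prime_dvd_sym pq pp) pq'; apply: npr; apply: dvdr_trans qr.
  - exact: not_dvdr_evz qy hy.
exists k, l, a, b, c; split => //.
- apply: nz => //; last by apply: contraNneq A0 => z; rewrite Ea z mulr0.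
  by move=> z Uz /(main _ Uz)[Az _ _]; apply: (dvdr_evz _ Az); rewrite Ea; apply: dvdr_mull; apply: dvdr_refl.
- apply: nz => //; last by apply: contraNneq B0 => z; rewrite Eb z mulr0.
  by move=> z Uz /(main _ Uz)[_ Bz _]; apply: (dvdr_evz _ Bz); rewrite Eb; apply: dvdr_mull; apply: dvdr_refl.
- move=> z Uz cz; split; first exact: Hc.
  move=> pz hz; have [|_ Bz sE] := main z Uz; first by rewrite !pfM !mulf_neq0.
  rewrite sE Ea Eb !pfM !pfX in Bz *; split => //.
  by move: Bz; rewrite mulf_eq0 negb_or => /andP[].
Qed.

Lemma prime_exp_inj k l a b : ~ dvdr p a -> ~ dvdr p b ->
  p ^+ k * a = p ^+ l * b -> k = l.
Proof.
have key k' l' a' b' : ~ dvdr p a' -> p ^+ k' * a' = p ^+ l' * b' -> (l' <= k')%N.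
  move=> na E; rewrite leqNgt; apply/negP => kl; apply: na.
  exists (p ^+ (l' - k').-1 * b'); apply: (mulfI (expf_neq0 k' p0)).
  rewrite E -{1}(subnKC (ltnW kl)) exprD -mulrA; congr (_ * _).
  by rewrite -{1}(prednK (n := l' - k')%N) ?subn_gt0 // exprS; ring.
move=> na nb E; apply/eqP; rewrite eqn_leq (key _ _ _ _ na E) andbT.
by apply: (key _ _ _ _ nb (esym E)).
Qed.

(** The order [k - l] of the frame along [p] depends neither on the trivialization nor on the point.
    Multiplication by the opposite power of [p] gives a frame that extends across the zeros of
    [p]. *)
Lemma generates_step : exists s', generates (UH h) s'.
Proof.
have [rs ns] := gs; have [_ _ rt tn _] := hL.
have phE y : (pf (p * h) y != 0) = (pf p y != 0) && (pf h y != 0).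
  by rewrite pfM mulf_eq0 negb_or.
have [HA|] := pselect (forall y, U y -> pf h y != 0 -> pf p y != 0).
  exists s; rewrite (_ : UH h = UH (p * h)) //.
  apply/seteqP; split=> y [Uy /=].
    by move=> hy; split => //=; rewrite phE hy andbT; apply: HA.
  by rewrite phE => /andP[].
move=> /existsNP[y0 /not_implyP[Uy0 /not_implyP[hy0 /negP/negPn/eqP py0]]].
have [_ cov _ _ _] := hL; have [i0 Di0] := cov y0.
have [k0 [l0 [a0 [b0 [c0 [ay0 by0 cy0 H0]]]]]] := generator_local Di0 Uy0 py0 hy0.
(* Two local expressions are compared at a common zero [z] of [p], which exists because [p] does not
   divide [c * c0]. The transition function is a unit there and contributes no power of [p]. *)
have expo (i : idx L) y (Di : dom i y) k l a b c : U y -> pf p y = 0 ->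
    [/\ pf a y != 0, pf b y != 0, pf c y != 0
   & forall z, U z -> pf c z != 0 -> dom i z /\ (pf p z != 0 -> pf h z != 0 ->
       pf b z != 0 /\ s i z = pf p z ^+ k * pf a z / (pf p z ^+ l * pf b z))] ->
   (k + l0 = k0 + l)%N.
  move=> Uy py [ay by_ cy H].
  have nc : ~ dvdr p (c * c0).
    by apply: (prime_mul pp); [exact: not_dvdr_evz py cy|exact: not_dvdr_evz py0 cy0].
  have [z [Uz pz]] := pf_prime pp nc; rewrite pfM mulf_eq0 negb_or => /andP[cz c0z].
  have Diz := (H z Uz cz).1; have Di0z := (H0 z Uz c0z).1.
  have [P [Q [Qz HPQ]]] := pf_rep (rt i i0) (conj Diz Di0z) Uz.
  have Pz : pf P z != 0.
    apply: contraNneq (tn _ _ _ Diz Di0z) => E.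
    by have [_ ->] := HPQ z Uz Qz; rewrite E mul0r.
  apply: (@prime_exp_inj _ _ (a * b0 * Q) (P * a0 * b)).
  - apply: (prime_mul pp); last exact: not_dvdr_evz pz Qz.
    by apply: (prime_mul pp); [exact: not_dvdr_evz py ay|exact: not_dvdr_evz py0 by0].
  - apply: (prime_mul pp); last exact: not_dvdr_evz py by_.
    by apply: (prime_mul pp); [exact: not_dvdr_evz pz Pz|exact: not_dvdr_evz py0 ay0].
  apply: (@pf_inj (Q * c * c0 * (p * h))).
    by rewrite !mulf_neq0 // ?(pf_neq0 Qz) ?(pf_neq0 cz) ?(pf_neq0 c0z).
  move=> x Ux; rewrite !pfM !mulf_eq0 !negb_or => /andP[/andP[/andP[Qx cx] c0x] /andP[px hx]].
  have [Dix /(_ px hx)[bx Esi]] := H x Ux cx.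
  have [Di0x /(_ px hx)[b0x Esi0]] := H0 x Ux c0x.
  have phx : UH (p * h) x by split => //=; rewrite phE px hx.
  have [_ /(_ _ Di0x)] := ns _ _ Dix phx.
  rewrite (HPQ x Ux Qx).2 Esi Esi0 !pfX !exprD => E.
  have pk m : pf p x ^+ m != 0 by rewrite expf_neq0.
  apply: (mulfI (mulf_neq0 (mulf_neq0 (invr_neq0 Qx) (invr_neq0 b0x))
    (mulf_neq0 (invr_neq0 bx) (mulf_neq0 (invr_neq0 (pk l)) (invr_neq0 (pk l0)))))).
  transitivity (pf p x ^+ k * pf a x / (pf p x ^+ l * pf b x)).
    by field; rewrite Qx b0x bx !pk.
  by rewrite E; field; rewrite Qx b0x bx !pk.
pose g (i : idx L) y := s i y * pf p y ^+ l0 / pf p y ^+ k0.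
have dO : dense (UH (p * h)) by apply: pf_dense; rewrite mulf_neq0.
have oH : opn (UH h) by apply: pf_opn.
have oPH : opn (UH (p * h)) by apply: pf_opn.
have rgi (i : idx L) : reg (dom i `&` UH (p * h)) (g i).
  have oV : opn (dom i `&` UH (p * h)) by apply: nice_opnI.
  have rp : reg (dom i `&` UH (p * h)) (pf p).
    by apply: (nice_res nX (pf_reg p)) => // y [_ []].
  apply: nice_mul => //; first by apply: nice_mul => //; apply: reg_exp.
  apply: reg_inv => //; first exact: reg_exp.
  by move=> y [_ [_ /=]]; rewrite phE => /andP[py _]; rewrite expf_neq0.
have locE (i : idx L) y : dom i y -> U y -> pf p y = 0 -> pf h y != 0 ->
    exists (V : set X) f, [/\ reg V f, V y, f y != 0 & forall z, V z -> UH (p * h) z -> f z = g i z].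
  move=> Di Uy py hy.
  have [k [l [a [b [c Hloc]]]]] := generator_local Di Uy py hy.
  have Ekl := expo _ _ Di _ _ _ _ _ Uy py Hloc; have [ay by_ cy H] := Hloc.
  exists (UH c `&` UH b), (fun z => pf a z / pf b z); split => //.
  - have oV : opn (UH c `&` UH b) by apply: nice_opnI => //; apply: pf_opn.
    apply: nice_mul => //; first by apply: (nice_res nX (pf_reg a)) => // z [[]].
    apply: reg_inv => //; first by apply: (nice_res nX (pf_reg b)) => // z [[]].
    by move=> z [_ []].
  - by rewrite mulf_neq0 // invr_neq0.
  - move=> z [[Uz /= cz] [_ /= bz]] [_ /=]; rewrite phE => /andP[pz hz].
    have [_ /(_ pz hz)[_ sE]] := H z Uz cz; rewrite /g sE.
    have pk m : pf p z ^+ m != 0 by rewrite expf_neq0.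
    transitivity (pf p z ^+ (k + l0) * pf a z / (pf p z ^+ (k0 + l) * pf b z)).
      by rewrite Ekl; field; rewrite bz pk.
    by rewrite !exprD; field; rewrite bz !pk.
have ext (i : idx L) : exists g', reg (dom i `&` UH h) g' /\ forall (V : set X) f, reg V f ->
    (forall y, V y -> UH (p * h) y -> f y = g i y) ->
    forall y, V y -> (dom i `&` UH h) y -> g' y = f y.
  have [|y [Di [Uy hy]]|g' rg' Hg'] := @dense_ext _ _ _ (dom i `&` UH h) (g i) nX dO.
  - by apply: nice_opnI.
  - have [py|py] := eqVneq (pf p y) 0.
      have [V [f [rf Vy _ E]]] := locE _ _ Di Uy py hy; exists V, f; split => //.
    exists (dom i `&` UH (p * h)), (g i); split => //.
    by split => //; split => //=; rewrite phE py.
  - by exists g'.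
have [s' Hs'] := boolp.choice ext.
have s'g (i : idx L) y : dom i y -> UH (p * h) y -> s' i y = g i y.
  move=> Di Uy; have [_ E] := Hs' i; apply: (E _ _ (rgi i)) => //.
  by case: Uy => Uy /=; rewrite phE => /andP[_ hy].
exists s'; split=> [i|i y Di [Uy /= hy]]; first by have [] := Hs' i.
split.
  have [py|py] := eqVneq (pf p y) 0.
    have [V [f [rf Vy fy E]]] := locE _ _ Di Uy py hy.
    by have [_ E'] := Hs' i; rewrite (E' _ _ rf E) //.
  have Uy' : UH (p * h) y by split => //=; rewrite phE py.
  rewrite s'g // /g; have [sn _] := ns _ _ Di Uy'.
  by rewrite !mulf_neq0 ?invr_neq0 ?expf_neq0.
move=> j Dj.
have oW : opn (dom i `&` dom j `&` UH h) by apply: nice_opnI => //; apply: nice_opnI.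
apply: (@dense_eq _ _ _ (dom i `&` dom j `&` UH h) (s' i) (fun y => tr i j y * s' j y) nX dO) => //.
- by have [r _] := Hs' i; apply: (nice_res nX r) => // z [[]].
- apply: nice_mul => //; first by apply: (nice_res nX (rt i j)) => // z [].
  by have [r _] := Hs' j; apply: (nice_res nX r) => // z [[]].
move=> z [[Diz Djz] _] Oz; rewrite !s'g // /g.
by have [_ /(_ _ Djz) ->] := ns _ _ Diz Oz; rewrite !mulrA.
Qed.

End Step.

Lemma affine_line_bundle_trivial : exists s, generates U s.
Proof.
have [h [s [h0 gs]]] := generates_generic.
have [u [l [u1 Hl Eh]]] := mp_ufd h0.
suff [s' Hs'] : exists s', generates (UH u) s'.
  exists s'; rewrite (_ : U = UH u) //; apply/seteqP; split => [y Uy|y []//].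
  by split => //=; have [c c0 ->] := unit_mp u1; rewrite /pf evz_cst.
rewrite {}Eh in h0 gs; elim: l s Hl h0 gs => [|p l IH] s Hl h0 gs.
  by exists s; rewrite big_nil mulr1 in gs.
have pp : prime_elt p by apply: Hl; rewrite mem_head.
rewrite big_cons mulrCA in h0 gs.
have h1 : u * \prod_(q <- l) q != 0 by apply: contraNneq h0 => ->; rewrite mulr0.
have [s1 gs1] := generates_step pp h1 gs.
by apply: IH gs1 => // q ql; apply: Hl; rewrite in_cons ql orbT.
Qed.

End AffineChart.

(** * Local coordinates at a point are coordinates nearby *)

Section CoordsOpen.
Variables (K : closedFieldType) (X : ringed_set K) (n : nat).
Hypothesis nX : nice X.
Hypothesis smooth : forall x : X, exists t : 'I_n -> X -> K, local_coords x t.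
Variables (U : set X) (M : nat) (y : 'I_M -> X -> K).
Hypothesis cU : chart U [set f | exists a, f = y a].

Let oU : opn U. Proof. by case: cU. Qed.
Let ry a : reg U (y a). Proof. by case: cU => _ H _; apply: H; exists a. Qed.

Lemma open_forall (I : finType) (x : X) (P : I -> set X) :
  (forall i, exists V, [/\ opn V, V x & V `<=` P i]) ->
  exists V, [/\ opn V, V x & forall i, V `<=` P i].
Proof.
move=> H; have [V HV] := boolp.choice H.
suff [W [oW Wx HW]] : exists W, [/\ opn W, W x & forall i, i \in enum I -> W `<=` V i].
  exists W; split => // i z Wz; have [_ _ HP] := HV i; apply: HP.
  by apply: HW Wz; rewrite mem_enum.
elim: (enum I) => [|i l [W [oW Wx HW]]].
  by exists setT; split => //; apply: nice_opnT.
have [oV Vx _] := HV i; exists (W `&` V i); split => //; first exact: nice_opnI.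
move=> j; rewrite in_cons => /orP[/eqP -> z []//|jl z [Wz _]].
exact: HW jl _ Wz.
Qed.

Lemma dreg_near x f : U x -> regular_at x f ->
  exists V, [/\ opn V, V x, V `<=` U, reg V f & dreg V y f].
Proof.
move=> Ux [W [oW Wx rf]]; have [_ rG C] := cU.
have [a [b [Ga Gb bx H]]] := C _ _ _ rf Wx Ux.
have HG g : [set f | exists a, f = y a] g -> reg U g /\ dreg U y g.
  by move=> [c ->]; split => //; apply: dreg_coord.
have [ra da] := dreg_alg nX oU ry HG Ga; have [rb db] := dreg_alg nX oU ry HG Gb.
pose V := U `&` [set z | b z != 0].
have oV : opn V by apply: opn_neq0.
have VU : V `<=` U by move=> ? [].
have VW : V `<=` W by move=> z [Uz bz]; have [] := H _ Uz bz.
have ryV k : reg V (y k) by apply: (nice_res nX (ry k)).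
have raV : reg V a by apply: (nice_res nX ra).
have rbV : reg V b by apply: (nice_res nX rb).
have b0 z : V z -> b z != 0 by case.
exists V; split => //; first exact: (nice_res nX rf).
have [d [rd Dd]] := dregM nX ryV raV (reg_inv nX rbV b0) (dreg_sub nX oV VU da)
  (dregV nX ryV rbV b0 (dreg_sub nX oV VU db)).
exists d; split => // z Vz; apply: (deriv_ext nX oV Vz) (Dd _ Vz) => w [Uw bw].
by have [] := H _ Uw bw.
Qed.

(** By the Leibniz rule, a product of two functions vanishing at [x] has a gradient that vanishes at
    [x], with regular coefficients nearby. These coefficients make up the matrix [eps] of
    [coords_open]. *)
Lemma ims_near x f : U x -> in_max_sq x f ->
  exists V (d : 'I_M -> X -> K), [/\ opn V, V x, V `<=` U,
    forall a, reg V (d a) /\ d a x = 0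
    & forall z, V z -> deriv z y f (fun a => d a z)].
Proof.
move=> Ux [k [a [b [W [Ha Hb oW Wx H]]]]].
pose P f := exists V (d : 'I_M -> X -> K), [/\ opn V, V x, V `<=` U,
    forall a, reg V (d a) /\ d a x = 0
    & forall z, V z -> deriv z y f (fun a => d a z)].
have ryz V z c : V `<=` U -> V z -> regular_at z (y c).
  by move=> VU Vz; apply: (reg_regular_at nX (ry c)); apply: VU.
have P1 i : P (fun z => a i z * b i z).
  have [ra a0] := Ha i; have [rb b0] := Hb i.
  have [V1 [oV1 V1x V1U rV1 [d1 [rd1 D1]]]] := dreg_near Ux ra.
  have [V2 [oV2 V2x V2U rV2 [d2 [rd2 D2]]]] := dreg_near Ux rb.
  have oV : opn (V1 `&` V2) by apply: nice_opnI.
  exists (V1 `&` V2), (fun c z => b i z * d1 c z + a i z * d2 c z); split => //.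
  - by move=> z [/V1U].
  - move=> c; rewrite a0 b0 !mul0r addr0; split => //.
    have r1 g : reg V1 g -> reg (V1 `&` V2) g by move=> r; apply: (reg_resI nX).
    have r2 g : reg V2 g -> reg (V1 `&` V2) g by move=> r; apply: (reg_resIr nX).
    by apply: nice_add => //; apply: nice_mul => //; [exact: r2|exact: r1|exact: r1|exact: r2].
  - move=> z [V1z V2z]; apply: derivM => //; last exact: D2.
      by move=> c; apply: ryz V1U V1z.
    exact: D1.
have PD f1 f2 : P f1 -> P f2 -> P (fun z => f1 z + f2 z).
  move=> [V1 [d1 [oV1 V1x V1U rd1 D1]]] [V2 [d2 [oV2 V2x V2U rd2 D2]]].
  exists (V1 `&` V2), (fun c z => d1 c z + d2 c z); split => //.
  - exact: nice_opnI.
  - by move=> z [/V1U].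
  - move=> c; have [r1 e1] := rd1 c; have [r2 e2] := rd2 c; rewrite e1 e2 addr0; split => //.
    by apply: nice_add => //; [apply: (reg_resI nX)|apply: (reg_resIr nX)].
  - by move=> z [V1z V2z]; apply: derivD => //; [apply: D1|apply: D2].
have P0 : P (fun=> 0).
  exists U, (fun _ _ => 0); split => //; last by move=> z _; apply: deriv_cst.
  by move=> c; split => //; apply: nice_cst.
have PS (l : seq 'I_k) : P (fun z => \sum_(i <- l) a i z * b i z).
  elim: l => [|i l IH].
    by rewrite (_ : (fun z => _) = fun=> 0) //; apply/funext => z; rewrite big_nil.
  rewrite (_ : (fun z => _) = fun z => a i z * b i z + \sum_(i <- l) a i z * b i z).
    exact: PD.
  by apply/funext => z; rewrite big_cons.
have [V [d [oV Vx VU rd D]]] := PS (index_enum 'I_k).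
exists (V `&` W), d; split => //.
- exact: nice_opnI.
- by move=> z [/VU].
- by move=> c; have [r e] := rd c; split => //; apply: (reg_resI nX).
- by move=> z [Vz Wz]; apply: (deriv_ext nX oW Wz) (D _ Vz) => w Ww; apply: H.
Qed.

(* Nakayama: near [x] the generators [y a] expand in the coordinates [t] up to a linear
   combination of themselves whose matrix [eps] vanishes at [x], so that [1 - eps] is
   invertible in a neighbourhood. *)
Lemma coords_open x (t : 'I_n -> X -> K) : U x -> local_coords x t ->
  exists V, V x /\ coord_system V t.
Proof.
move=> Ux lt; have [P DP] := deriv_fun nX lt (fun a => reg_regular_at nX (ry a) Ux).
have [Vt HVt] := boolp.choice lt.1.
have [Wt [oWt Wtx WtV]] := @open_forall _ x Vt (fun i => let: And3 oV Vx _ := HVt i in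
  ex_intro _ (Vt i) (And3 oV Vx (fun z (Vz : Vt i z) => Vz))).
have rt i : reg Wt (t i) by have [_ _ r] := HVt i; apply: (nice_res nX r).
have step a : exists Ve : set X * ('I_M -> X -> K), [/\ opn Ve.1, Ve.1 x, Ve.1 `<=` U `&` Wt,
    forall b, reg Ve.1 (Ve.2 b) /\ Ve.2 b x = 0
    & forall z, Ve.1 z -> in_max_sq z (fun w => y a w - y a z -
       \sum_j P a j * (t j w - t j z) - \sum_b Ve.2 b z * (y b w - y b z))].
  have [V [d [oV Vx VU rd D]]] := ims_near Ux (DP a).
  exists (V `&` Wt, d); split => //=.
  - exact: nice_opnI.
  - by move=> z [/VU].
  - by move=> c; have [r e] := rd c; split => //; apply: (reg_resI nX).
  - move=> z [/D Dz _]; apply: (ims_eq nX) Dz => w.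
    have E u v : \sum_j P a j * (t j u - t j x) - \sum_j P a j * (t j v - t j x)
       = \sum_j P a j * (t j u - t j v).
      by rewrite -sumrB; apply: eq_bigr => j _; ring.
    by rewrite -(E w z) /=; ring.
have [Ve HVe] := boolp.choice step.
have [V0 [oV0 V0x V0V]] := @open_forall _ x (fun a => (Ve a).1) (fun a =>
  let: And5 oV Vx _ _ _ := HVe a in
  ex_intro _ (Ve a).1 (And3 oV Vx (fun z (Vz : (Ve a).1 z) => Vz))).
pose eps z := \matrix_(a < M, b < M) (Ve a).2 b z.
pose N z : 'M[K]_M := 1%:M - eps z.
have reps a b : reg V0 (fun z => N z a b).
  have [oV _ _ rd _] := HVe a; have [r _] := rd b.
  apply: reg_ext (reg_sub nX (nice_cst nX (1%:M a b : K) oV0) (nice_res nX r oV0 (V0V a))) _ => //.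
  by move=> z _; rewrite !mxE.
have rdet := reg_det nX oV0 reps.
have Nx : N x = 1%:M.
  by apply/matrixP => a b; rewrite !mxE; have [_ _ _ rd _] := HVe a; have [_ ->] := rd b; rewrite subr0.
pose V := (V0 `&` (U `&` Wt)) `&` [set z | \det (N z) != 0].
have oV1 : opn (V0 `&` (U `&` Wt)) by apply: nice_opnI => //; apply: nice_opnI.
have oV : opn V by apply: opn_neq0 => //; apply: (nice_res nX rdet) => // z [].
exists V; split; first by split => //=; rewrite Nx det1 oner_neq0.
split => //=.
  by move=> i; apply: (nice_res nX (rt i)) => // z [[_ []]].
move=> z [[V0z [Uz Wz]] /= dz].
have Nu : N z \in unitmx by rewrite unitmxE unitfE.
have ryz c : regular_at z (y c) by apply: (reg_regular_at nX (ry c)).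
have rtz i : regular_at z (t i) by apply: (reg_regular_at nX (rt i)).
pose Q := invmx (N z) *m P.
have DQ c : deriv z t (y c) (Q c).
  pose F a w := y a w - y a z - \sum_j P a j * (t j w - t j z)
     - \sum_b (Ve a).2 b z * (y b w - y b z).
  have IF a : in_max_sq z (F a) by have [_ _ _ _ D] := HVe a; apply: D; apply: V0V.
  have IS : in_max_sq z (fun w => \sum_a invmx (N z) c a * F a w).
    by apply: ims_sum => // a _; apply: (imsZ nX).
  apply: (ims_eq nX) IS => w.
  pose Y := \col_b (y b w - y b z); pose Tt := \col_j (t j w - t j z).
  have FE : \col_a F a w = N z *m Y - P *m Tt.
    apply/colP => a; rewrite mulmxBl mul1mx !mxE /F.
    rewrite [in RHS]addrAC; congr (_ - _ - _).
      by apply: eq_bigr => j _; rewrite !mxE.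
    by apply: eq_bigr => b _; rewrite !mxE.
  have := congr1 (fun A => (invmx (N z) *m A) c 0) FE.
  rewrite mulmxBr mulKmx // mulmxA !mxE => E.
  have -> : \sum_a invmx (N z) c a * F a w = \sum_a invmx (N z) c a * (\col_a F a w) a 0.
    by apply: eq_bigr => a _; rewrite mxE.
  rewrite E; congr (_ - _); apply: eq_bigr => j _.
  by rewrite [Tt j 0]mxE.
have [t0 lt0] := smooth z; apply: (coords_span nX lt0) => // f [W [oW Wz' rf]].
have [_ _ C] := cU; have R := C _ _ _ rf Wz' Uz.
apply: (deriv_frac nX rtz oU Uz _ R) => g [c ->].
by exists (Q c).
Qed.

End CoordsOpen.

(** * The open torus *)

Section ClosedImmersionChart.
Variables (K : closedFieldType) (X : ringed_set K) (N : nat) (f : X -> proj_space K N).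
Hypothesis fi : closed_immersion f.

Lemma closed_immersion_morphism : morphism f.
Proof.
have nX := closed_immersion_nice (proj_nice K N) fi.
have [_ _ fo fr] := fi; split=> [V oV|V h rh]; first by apply/fo; exists V.
apply/fr; split; first by apply/fo; exists V => //; apply: (nice_reg_opn (proj_nice K N) rh).
by move=> x Vx; exists V, h.
Qed.

Lemma closed_immersion_chart i :
  chart (f @^-1` [set l | hcoord l i != 0])
    [set g | exists j, g = fun y => hcoord (f y) j / hcoord (f y) i].
Proof.
have nX := closed_immersion_nice (proj_nice K N) fi.
have [m1 m2] := closed_immersion_morphism.
have [oU rG C] := proj_chart K i.
split; first exact: m1.
  by move=> _ [j ->]; exact: (m2 _ _ (rG _ (ex_intro _ j erefl))).
move=> W g x rg Wx Ux; have [_ _ fo fr] := fi.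
have [oW H] := (fr _ _).1 rg; have [V [h [rh Vx E]]] := H _ Wx.
have [V' oV' WE] := (fo _).1 oW.
have V'x : V' (f x) by rewrite WE in Wx.
have R1 := C _ _ _ rh Vx Ux.
(* The first representation only confines the fraction to [V]; adding a representation of zero on
   [V'] confines it to [W] as well. *)
have R2 := C _ _ _ (nice_cst (proj_nice K N) 0 oV') V'x Ux.
have [a [b [Ga Gb bx Hab]]] := frac_repD R1 R2.
have pull k : alg [set f0 | exists j, f0 = fun l : proj_pt K N => hcoord l j / hcoord l i] k ->
   alg [set g0 | exists j, g0 = fun y : X => hcoord (f y) j / hcoord (f y) i] (fun y => k (f y)).
  elim=> {k} [k [j ->]|c|k l _ Hk _ Hl|k l _ Hk _ Hl].
  - by apply: alg_gen; exists j.
  - exact: alg_cst.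
  - exact: alg_add.
  - exact: alg_mul.
exists (fun y => a (f y)), (fun y => b (f y)); split => //; try exact: pull.
move=> y Uy by0; have [[Vy V'y] Eh] := Hab _ Uy by0.
have Wy : W y by rewrite WE.
by split => //; rewrite -Eh addr0; apply: E.
Qed.

Lemma closed_immersion_coords_open n (x : X) (t : 'I_n -> X -> K) :
  (forall x : X, exists t : 'I_n -> X -> K, local_coords x t) ->
  local_coords x t -> exists V, V x /\ coord_system V t.
Proof.
move=> smooth lt; have nX := closed_immersion_nice (proj_nice K N) fi.
have [i xi] := hcoord_neq0 (f x).
have C := closed_immersion_chart i.
exact: (coords_open nX smooth (y := fun j y => hcoord (f y) j / hcoord (f y) i) C xi lt).
Qed.

End ClosedImmersionChart.

Section LogDeriv.
Variables (K : closedFieldType) (X : ringed_set K) (n : nat).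
Hypothesis nX : nice X.
Variables (x : X) (t : 'I_n -> X -> K).
Hypothesis rt : forall i, regular_at x (t i).

(* Logarithmic derivatives turn characters into linear forms. *)
Definition ld (f : X -> K) (d : 'I_n -> K) :=
  f x != 0 /\ deriv x t f (fun j => f x * d j).

Lemma ld_cst c : c != 0 -> ld (fun=> c) (fun=> 0).
Proof.
by move=> c0; split => //; apply: (deriv_ceq nX) (deriv_cst nX x t c) => i; rewrite mulr0.
Qed.

Lemma ldM f g d d' : ld f d -> ld g d' -> ld (fun y => f y * g y) (fun j => d j + d' j).
Proof.
move=> [f0 Df] [g0 Dg]; split; first by rewrite mulf_neq0.
by apply: (deriv_ceq nX) (derivM nX rt Df Dg) => i; ring.
Qed.

Lemma ldV f d : ld f d -> ld (fun y => (f y)^-1) (fun j => - d j).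
Proof.
move=> [f0 Df]; split; first by rewrite invr_neq0.
by apply: (deriv_ceq nX) (derivV nX rt f0 Df) => i; field.
Qed.

Lemma ldX f d k : ld f d -> ld (fun y => f y ^+ k) (fun j => k%:R * d j).
Proof.
move=> Lf; elim: k => [|k [_ D]]; last first.
  have [a b] := ldM Lf (conj (expf_neq0 k Lf.1) D); split; first exact: expf_neq0 Lf.1.
  rewrite (_ : (fun y => f y ^+ k.+1) = fun y => f y * f y ^+ k).
    by apply: (deriv_ceq nX) b => i; rewrite /= exprS [k.+1%:R]mulrS mulrDl mul1r.
  by apply/funext => y; rewrite exprS.
have [a b] := ld_cst (oner_neq0 K); split; first by rewrite expr0.
rewrite (_ : (fun y => f y ^+ 0) = fun=> 1); last by apply/funext => y; rewrite expr0.
by apply: (deriv_ceq nX) b => i; rewrite mulr0n expr0 mul0r.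
Qed.

Lemma ldXz f d (k : int) : ld f d -> ld (fun y => f y ^ k) (fun j => k%:~R * d j).
Proof.
case: k => k Lf; first exact: ldX.
have [a b] := ldV (ldX k.+1 Lf); split; first by [].
apply: (deriv_ceq nX) b => i.
by rewrite (_ : (Negz k)%:~R = - k.+1%:R :> K) ?mulNr.
Qed.

Lemma ld_prod (I : Type) (r : seq I) (f : I -> X -> K) d :
  (forall i, ld (f i) (d i)) ->
  ld (fun y => \prod_(i <- r) f i y) (fun j => \sum_(i <- r) d i j).
Proof.
move=> H; elim: r => [|i r IH].
  have [a b] := ld_cst (oner_neq0 K); split; first by rewrite big_nil oner_neq0.
  rewrite (_ : (fun y => _) = fun=> 1); last by apply/funext => y; rewrite big_nil.
  by apply: (deriv_ceq nX) b => j; rewrite !big_nil.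
have [a b] := ldM (H i) IH; split; first by rewrite big_cons.
rewrite (_ : (fun y => _) = fun y => f i y * \prod_(i <- r) f i y).
  by apply: (deriv_ceq nX) b => j; rewrite !big_cons.
by apply/funext => y; rewrite big_cons.
Qed.

Lemma ld_coord i : t i x != 0 -> ld (t i) (fun j => (i == j)%:R / t j x).
Proof.
move=> t0; split => //; apply: (deriv_ceq nX) (deriv_coord nX x t i) => j.
by case: eqVneq => [<-|_]; [field|rewrite mul0r mulr0].
Qed.

Lemma ld_chi (T : X -> 'rV[K]_n) m : (forall i, t i = fun y => T y 0 i) ->
  (forall i, t i x != 0) ->
  ld (fun y => chi m (T y)) (fun j => (m 0 j)%:~R / t j x).
Proof.
move=> tT t0; have [a b] := ld_prod (index_enum 'I_n) (fun i => ldXz (m 0 i) (ld_coord (t0 i))).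
have E : (fun y => \prod_i t i y ^ m 0 i) = (fun y => chi m (T y)).
  by apply/funext => y; apply: eq_bigr => i _; rewrite tT.
rewrite (_ : (fun y => chi m (T y)) = fun y => \prod_i t i y ^ m 0 i) //.
split => //; apply: (deriv_ceq nX) b => j; congr (_ * _).
rewrite (bigD1 j) //= eqxx mul1r big1 ?addr0 // => i ij.
by rewrite (negbTE ij) mul0r mulr0.
Qed.

End LogDeriv.

(** * Coordinates and jacobians on the open torus *)

Section OpenTorus.
Variables (K : closedFieldType) (X : ringed_set K) (n : nat).
Hypothesis nX : nice X.
Hypothesis smooth : forall x : X, exists t : 'I_n -> X -> K, local_coords x t.
Variable e : torus K n -> X.
Hypothesis oe : open_immersion e.

(* Junk value 1 outside the open torus. *)
Definition einv (x : X) : torus_pt K n :=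
  if pselect (exists t, e t = x) is left h then projT1 (cid h) else torus_one K n.

Definition tpt (x : X) : 'rV[K]_n := sval (einv x).

Definition taus (i : 'I_n) : X -> K := fun x => tpt x 0 i.

Definition torus_gens : set (X -> K) :=
  [set f | exists i, f = taus i \/ f = fun x => (taus i x)^-1].

Lemma eK t : einv (e t) = t.
Proof.
rewrite /einv; case: pselect => [h|[]]; last by exists t.
by case: (cid h) => s /= E; have [einj _ _ _] := oe; apply: einj.
Qed.

Lemma tptE t : tpt (e t) = sval t. Proof. by rewrite /tpt eK. Qed.

Lemma tpt_inv x : invertible_row (tpt x). Proof. exact: (svalP (einv x)). Qed.

Lemma taus_neq0 i x : taus i x != 0. Proof. exact: inv_neq0 (tpt_inv x). Qed.

Lemma range_opn : opn (range e).
Proof. by have [_ _ H _] := oe; apply: H; exact: (nice_opnT (torus_nice K n)). Qed.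

Lemma taus_reg i : reg (range e) (taus i).
Proof.
have [_ _ _ H] := oe; have [_ rG _] := single_chart [set f | exists i : 'I_n,
       f = (fun t : torus_pt K n => sval t 0 i)
       \/ f = (fun t : torus_pt K n => (sval t 0 i)^-1)].
have [|h rh Hh] := H setT (fun t : torus_pt K n => sval t 0 i).
  by apply: rG; exists i; left.
apply: (reg_ext nX rh) => _ [t _ <-].
by rewrite Hh // /taus tptE.
Qed.

Lemma torus_chart : chart (range e) torus_gens.
Proof.
split; first exact: range_opn.
  move=> f [i [->|->]]; first exact: taus_reg.
  by apply: (reg_inv nX (taus_reg i)) => y _; apply: taus_neq0.
move=> W g x rg Wx [t0 _ Ex]; rewrite -{x}Ex in Wx *; have [_ [m1 m2] _ _] := oe.
have [_ [a [b [Ga Gb _ bx H]]]] := m2 _ _ rg t0 Wx.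
have push k : alg [set f | exists i : 'I_n,
       f = (fun t : torus_pt K n => sval t 0 i)
       \/ f = (fun t : torus_pt K n => (sval t 0 i)^-1)] k ->
   alg torus_gens (fun y => k (einv y)).
  elim=> {k} [k [i [->|->]]|c|k l _ Hk _ Hl|k l _ Hk _ Hl].
  - by apply: alg_gen; exists i; left.
  - by apply: alg_gen; exists i; right.
  - exact: alg_cst.
  - exact: alg_add.
  - exact: alg_mul.
exists (fun y => a (einv y)), (fun y => b (einv y)); split; try exact: push.
  by rewrite eK.
move=> _ [t _ <-]; rewrite eK => bt.
by have [Wt E] := H t I bt.
Qed.

Lemma torus_coords x : range e x -> local_coords x taus.
Proof.
move=> Ox; have [t lt] := smooth x; have rt i := reg_regular_at nX (taus_reg i) Ox.
apply: (coords_span nX lt rt) => f [W [oW Wx rf]].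
have [_ _ C] := torus_chart; apply: (deriv_frac nX rt range_opn Ox _ (C _ _ _ rf Wx Ox)).
move=> g [i [->|->]].
  by exists (fun j => (i == j)%:R); apply: deriv_coord.
by eexists; apply: (derivV nX rt (taus_neq0 i x)); apply: deriv_coord.
Qed.

Lemma torus_coord_system : coord_system (range e) taus.
Proof. by split; [exact: range_opn|exact: taus_reg|exact: torus_coords]. Qed.

Lemma torus_pullback_reg (W : set X) f : reg W f -> range e `<=` W ->
  reg (setT : set (torus K n)) (fun t => f (e t)).
Proof.
move=> rf OW; have [_ [_ m2] _ _] := oe.
rewrite (_ : setT = e @^-1` W); first exact: m2.
by apply/seteqP; split => // t _; apply: OW; exists t.
Qed.

(* The matrix of a system of characters in logarithmic coordinates is constant. *)
Lemma jacobian_chi (B : 'M[int]_n) (s : 'I_n -> X -> K) x : range e x ->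
  (exists V : set X, [/\ opn V, V x & forall i y, V y -> s i y = chi (row i B) (tpt y)]) ->
  \det (jacobian s taus x) = (\det B)%:~R * chi (\sum_i row i B - const_mx 1) (tpt x).
Proof.
move=> Ox [V [oV Vx E]].
have lt := torus_coords Ox.
have D i : deriv x taus (s i) (fun j => s i x * (B i j)%:~R / taus j x).
  have [_ D] := ld_chi nX lt.1 (row i B) (T := tpt) (fun=> erefl) (fun i => taus_neq0 i x).
  apply: (deriv_ext nX oV Vx (E i)); apply: (deriv_ceq nX) D => j.
  by rewrite E // mxE mulrA.
rewrite (jacobian_uniq nX lt D).
have -> : \matrix_(i, j) (s i x * (B i j)%:~R / taus j x) =
   diag_mx (\row_i s i x) *m map_mx intr B *m diag_mx (\row_j (taus j x)^-1).
  by apply/matrixP => i j; rewrite mul_mx_diag mul_diag_mx !mxE.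
rewrite !det_mulmx !det_diag det_map_mx mulrAC mulrC; congr (_ * _).
have iv := tpt_inv x.
rewrite chiB // chi_sum //; congr (_ * _).
  by apply: eq_bigr => i _; rewrite mxE E.
rewrite /chi -prodfV; apply: eq_bigr => i _; rewrite !mxE.
by rewrite expr1z.
Qed.

End OpenTorus.

(** * Limits of algebraic curves in X *)

Section CurveLimit.
Variables (K : closedFieldType) (X : ringed_set K) (N : nat) (phi : X -> proj_space K N).
Hypothesis fi : closed_immersion phi.

(** [hcoord] reads an arbitrarily chosen vector of the line, so coordinates are known up to a common
    scalar. This is the origin of the scalars [c] in what follows. *)
Lemma line_hcoord (l : proj_pt K N) v : sval l = <[v]>%VS ->
  exists2 c, c != 0 & forall j, hcoord l j = c * v 0 j.
Proof.
move=> E; have [j lj] := hcoord_neq0 l.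
have : vpick (sval l) \in <[v]>%VS by rewrite -E memv_pick.
move=> /vlineP[c Ec]; exists c; last by move=> i; rewrite /hcoord Ec mxE.
by apply: contraNneq lj => c0; rewrite /hcoord Ec c0 scale0r mxE.
Qed.

Definition mk_line (v : 'rV[K]_N.+1) (v0 : v != 0) : proj_pt K N :=
  exist _ <[v]>%VS (introT eqP (etrans (dim_vline v) (congr1 nat_of_bool v0))).

Lemma proj_pt_ext (l l' : proj_pt K N) c : c != 0 ->
  (forall j, hcoord l j = c * hcoord l' j) -> l = l'.
Proof.
move=> c0 H.
have pick_line (m : proj_pt K N) : sval m = <[vpick (sval m)]>%VS.
  apply/eqP; rewrite eq_sym eqEdim dim_vline.
  have m0 : vpick (sval m) != 0.
    by rewrite vpick0; apply: contra_eq_neq (svalP m) => ->; rewrite dimv0.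
  by rewrite m0 (eqP (svalP m)) -memvE memv_pick.
have E : vpick (sval l) = c *: vpick (sval l') by apply/rowP => j; rewrite mxE; apply: H.
apply: val_inj; rewrite [LHS]pick_line [RHS]pick_line E.
apply/eqP; rewrite eqEdim !dim_vline scaler_eq0 (negbTE c0) /= leqnn andbT -memvE.
by apply/vlineP; exists c.
Qed.

(** Along a polynomial curve a chart function has powers of [G i] as denominators. The formula holds
    at every point whose coordinates are proportional to the values of [G] at [s], so it covers the
    limit point too. *)
Lemma alg_on_curve (T : Type) (h : T -> 'I_N.+1 -> K) (G : 'I_N.+1 -> {poly K}) i a :
  alg [set g | exists j, g = fun y => h y j / h y i] a ->
  exists (p : {poly K}) k, forall y s c, c != 0 -> (forall j, h y j = c * (G j).[s]) ->
    (G i).[s] != 0 -> a y = p.[s] / (G i).[s] ^+ k.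
Proof.
elim=> {a} [_ [j ->]|d|a b _ [p [k Ea]] _ [q [l Eb]]|a b _ [p [k Ea]] _ [q [l Eb]]].
- exists (G j), 1%N => y s c c0 H Gs; rewrite !H expr1.
  by field; rewrite Gs c0.
- by exists d%:P, 0%N => y s c c0 H Gs; rewrite hornerC expr0 divr1.
- exists (p * G i ^+ l + q * G i ^+ k), (k + l)%N => y s c c0 H Gs.
  rewrite (Ea y s c) // (Eb y s c) // hornerD !hornerM !horner_exp exprD.
  by field; rewrite !expf_neq0.
- exists (p * q), (k + l)%N => y s c c0 H Gs.
  rewrite (Ea y s c) // (Eb y s c) // hornerM exprD.
  by field; rewrite !expf_neq0.
Qed.

(** Dividing by the common power of ['X] gives the curve a value at 0 in projective space. *)
Lemma divide_at0 (F : 'I_N.+1 -> {poly K}) : (exists j, F j != 0) ->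
  exists d (G : 'I_N.+1 -> {poly K}), (forall j, F j = 'X^d * G j) /\
    exists j, (G j).[0] != 0.
Proof.
move=> [j Fj]; suff : forall m (H : 'I_N.+1 -> {poly K}), H j != 0 -> (size (H j) <= m)%N ->
    exists d (G : 'I_N.+1 -> {poly K}), (forall j, H j = 'X^d * G j) /\
    exists j, (G j).[0] != 0 by move=> /(_ _ F Fj (leqnn _)).
elim=> [|m IH] H Hj sz; first by rewrite size_poly_leq0 (negbTE Hj) in sz.
have [[i Hi]|H0] := pselect (exists i, (H i).[0] != 0).
  by exists 0%N, H; split => [k|]; [rewrite expr0 mul1r|exists i].
have div k : exists q, H k = q * 'X.
  have /factor_theorem[q E] : root (H k) 0.
    by apply/rootP/eqP; apply: contrapT => /negP ?; apply: H0; exists k.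
  by exists q; rewrite E subr0.
have [q Hq] := boolp.choice div.
have qj : q j != 0 by apply: contraNneq Hj => q0; rewrite Hq q0 mul0r.
have [|d [G [HG G0]]] := IH q qj; first by move: sz; rewrite Hq size_mulX.
exists d.+1, G; split => // k; rewrite Hq HG exprS; ring.
Qed.

(** The value of the curve at 0 lies in the closed image of [phi]: otherwise a neighbourhood of it
    in the complement would contain [phi (gam s)] for some nonzero [s]. Regular functions near the
    limit become rational functions of [s] without pole at 0, and their limits are values at 0. *)
Lemma curve_limit (gam : K -> X) (F : 'I_N.+1 -> {poly K}) : (exists j, F j != 0) ->
  (forall s, s != 0 -> exists2 c, c != 0 &
     forall j, hcoord (phi (gam s)) j = c * (F j).[s]) ->
  exists y, forall (W : set X) g, reg W g -> W y ->
    exists p q : {poly K}, [/\ q.[0] != 0, g y = p.[0] / q.[0]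
     & forall s, s != 0 -> q.[s] != 0 -> W (gam s) /\ g (gam s) = p.[s] / q.[s]].
Proof.
move=> F0 HF; have [d [G [FG [i Gi]]]] := divide_at0 F0.
have HG s : s != 0 -> exists2 c, c != 0 & forall j, hcoord (phi (gam s)) j = c * (G j).[s].
  move=> s0; have [c c0 H] := HF _ s0; exists (c * s ^+ d); first by rewrite mulf_neq0 ?expf_neq0.
  by move=> j; rewrite H FG hornerM hornerXn mulrA.
have v0 : \row_j (G j).[0] != 0.
  by apply: contraNneq Gi => /rowP/(_ i); rewrite !mxE => ->.
pose L0 := mk_line v0.
have [c0 c0n HL0] := @line_hcoord L0 (\row_j (G j).[0]) erefl.
have HL j : hcoord L0 j = c0 * (G j).[0] by rewrite HL0 mxE.
have L0i : hcoord L0 i != 0 by rewrite HL mulf_neq0.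
have [y _ Ey] : range phi L0.
  apply: contrapT => nr; have [_ orng _ _] := fi.
  have [_ _ C] := proj_chart K i.
  have [a [b [Ga Gb b0 H]]] := C _ _ _ (nice_cst (proj_nice K N) 0 orng) nr L0i.
  have [p [k Hp]] := alg_on_curve G Gb.
  have p0 : p.[0] != 0.
    by move: b0; rewrite (Hp L0 0 c0 c0n HL Gi) mulf_eq0 negb_or => /andP[].
  have [s] : exists s, (p * G i * 'X).[s] != 0.
    apply: nonroot; rewrite !mulf_neq0 ?polyX_eq0 //.
      by apply: contraNneq p0 => ->; rewrite horner0.
    by apply: contraNneq Gi => ->; rewrite horner0.
  rewrite !hornerM hornerX !mulf_eq0 !negb_or => /andP[/andP[ps Gs] s0].
  have [c cn Hc] := HG _ s0.
  have := H (phi (gam s)); case; first by rewrite /= Hc mulf_neq0.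
    by rewrite (Hp _ s c cn Hc Gs) ?mulf_neq0 ?invr_neq0 ?expf_neq0.
  by move=> nrs _; apply: nrs; exists (gam s).
exists y => W g rg Wy.
have [_ _ C] := closed_immersion_chart fi i.
have Uy : (phi @^-1` [set l | hcoord l i != 0]) y by rewrite /= Ey.
have [a [b [Ga Gb b0 H]]] := C _ _ _ rg Wy Uy.
have [p [k Hp]] := alg_on_curve (h := fun y j => hcoord (phi y) j) G Ga.
have [q [l Hq]] := alg_on_curve (h := fun y j => hcoord (phi y) j) G Gb.
have HLy j : hcoord (phi y) j = c0 * (G j).[0] by rewrite Ey.
have q0 : q.[0] != 0.
  by move: b0; rewrite (Hq y 0 c0 c0n HLy Gi) mulf_eq0 negb_or => /andP[].
exists (p * G i ^+ l * G i), (q * G i ^+ k * G i); split.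
- by rewrite !hornerM horner_exp !mulf_neq0 ?expf_neq0.
- rewrite (H y Uy b0).2 (Hp y 0 c0) // (Hq y 0 c0) // !hornerM !horner_exp.
  by field; rewrite q0 Gi !expf_neq0.
- move=> s s0; rewrite !hornerM !mulf_eq0 !negb_or => /andP[/andP[qs _] Gs].
  have [c cn Hc] := HG _ s0.
  have Us : (phi @^-1` [set l | hcoord l i != 0]) (gam s) by rewrite /= Hc mulf_neq0.
  have bs : b (gam s) != 0 by rewrite (Hq _ s c cn Hc Gs) ?mulf_neq0 ?invr_neq0 ?expf_neq0.
  have [Ws ->] := H _ Us bs; split => //.
  rewrite (Hp _ s c cn Hc Gs) (Hq _ s c cn Hc Gs) !horner_exp.
  by field; rewrite qs Gs !expf_neq0.
Qed.

End CurveLimit.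

(** * Sections of the anticanonical bundle and characters *)

Section Sections.
Variables (K : closedFieldType) (X : ringed_set K) (n k N : nat).
Hypothesis nX : nice X.
Hypothesis smooth : forall x : X, exists t : 'I_n -> X -> K, local_coords x t.
Variable e : torus K n -> X.
Hypothesis oe : open_immersion e.
Hypothesis dO : dense (range e).
Variable act : torus_pt K n -> X -> X.
Hypothesis ma : forall t, morphism (act t).
Hypothesis act1 : forall x, act (torus_one K n) x = x.
Hypothesis actM : forall t u x, act (torus_mul t u) x = act t (act u x).
Hypothesis acte : forall t u, act t (e u) = e (torus_mul t u).
Variable s : 'I_N.+1 -> idx (anticanonical X n) -> X -> K.
Variable phi : X -> proj_space K N.
Hypothesis rs : forall l (i : idx (anticanonical X n)), reg (dom i) (s l i).
Hypothesis trs : forall l (i j : idx (anticanonical X n)) x, dom i x -> dom j x ->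
  s l i x = tr i j x ^+ k * s l j x.
Hypothesis fi : closed_immersion phi.
Hypothesis hphi : forall (i : idx (anticanonical X n)) x, dom i x ->
  sval (phi x) = <[\row_l s l i x]>%VS.

Notation AC := (anticanonical X n).
Notation O := (range e).
Notation T := (tpt e).
Notation Te := (@tptE _ _ _ _ oe).

Lemma chart_cover x : exists p : idx AC, dom p x.
Proof.
have [t lt] := smooth x; have [V [Vx cV]] := closed_immersion_coords_open fi smooth lt.
by exists (exist (fun p : set X * ('I_n -> X -> K) => coord_system p.1 p.2) (V, t) cV).
Qed.

Definition pX x : idx AC := projT1 (cid (chart_cover x)).
Lemma pXP x : dom (pX x) x. Proof. exact: projT2 (cid (chart_cover x)). Qed.

(* The sections [s l] in an arbitrary local frame; only the ratios of the [sv l x] matter. *)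
Definition sv l x := s l (pX x) x.

Lemma dom_opn (p : idx AC) : opn (dom p : set X).
Proof. by case: p => [[V t] cV] /=; case: cV. Qed.

Lemma dom_coords (p : idx AC) x : dom p x -> local_coords x (sval p).2.
Proof. by case: p => [[V t] cV] /= Vx; case: cV => _ _; apply. Qed.

Lemma tr_neq0 (p q : idx AC) x : dom p x -> dom q x -> tr p q x != 0.
Proof. by move=> px qx; apply: (det_jacobian_neq0 nX); apply: dom_coords. Qed.

Lemma s_sv l (p : idx AC) x : dom p x -> s l p x = tr p (pX x) x ^+ k * sv l x.
Proof. by move=> px; apply: trs => //; apply: pXP. Qed.

Lemma trk_neq0 (p q : idx AC) x : dom p x -> dom q x -> tr p q x ^+ k != 0.
Proof. by move=> px qx; rewrite expf_neq0 // tr_neq0. Qed.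

Lemma s_neq0 l (p : idx AC) x : dom p x -> (s l p x != 0) = (sv l x != 0).
Proof.
by move=> px; rewrite s_sv // mulf_eq0 (negbTE (trk_neq0 px (pXP x))).
Qed.

Lemma s_ratio l l' (p : idx AC) x : dom p x -> s l p x / s l' p x = sv l x / sv l' x.
Proof.
move=> px; rewrite !(s_sv _ px) -mulf_div divff ?mul1r //.
exact: trk_neq0 (pXP x).
Qed.

Definition D l : set X := [set x | sv l x != 0].

Lemma D_local l (p : idx AC) : dom p `&` [set x | s l p x != 0] `<=` D l.
Proof. by move=> x [px /=]; rewrite s_neq0. Qed.

Lemma D_opn l : opn (D l).
Proof.
apply: nice_opn => // x Dx; exists (dom (pX x) `&` [set x0 | s l (pX x) x0 != 0]); split.
- exact: opn_neq0.
- by split => //; apply: pXP.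
- exact: D_local.
Qed.

Lemma reg_D l f : (forall x, D l x -> exists (p : idx AC) g, [/\ dom p x,
    reg (dom p `&` [set x | s l p x != 0]) g
  & forall y, dom p y -> s l p y != 0 -> f y = g y]) -> reg (D l) f.
Proof.
move=> H; apply: nice_reg => // x Dx; have [p [g [px rg E]]] := H x Dx.
exists (dom p `&` [set x | s l p x != 0]), g; split => //.
  by split => //=; rewrite s_neq0.
by move=> y [py sy]; split; [apply: (@D_local l p); split|apply: E].
Qed.

Lemma ratio_reg l l' : reg (D l) (fun x => sv l' x / sv l x).
Proof.
apply: reg_D => x Dx; exists (pX x), (fun y => s l' (pX x) y / s l (pX x) y); split.
- exact: pXP.
- apply: nice_mul => //; last exact: nice_inv.
  apply: (nice_res nX (rs l' _)); first exact: opn_neq0.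
  by move=> ? [].
- by move=> y py _; rewrite s_ratio.
Qed.

Lemma hcoord_sv x : exists2 c, c != 0 & forall j, hcoord (phi x) j = c * sv j x.
Proof.
have [c c0 H] := line_hcoord (hphi (pXP x)); exists c => // j.
by rewrite H mxE.
Qed.

(** In this frame the sections [s l] become regular functions [fl l] on the torus, hence Laurent
    polynomials. *)
Definition iT : idx AC :=
  exist (fun p : set X * ('I_n -> X -> K) => coord_system p.1 p.2) (O, taus e)
    (torus_coord_system nX smooth oe).

Definition fl l (t : torus_pt K n) := s l iT (e t).

Lemma fl_sv t : exists2 c, c != 0 & forall l, fl l t = c * sv l (e t).
Proof.
have Ot : dom iT (e t) by exists t.
exists (tr iT (pX (e t)) (e t) ^+ k); first exact: trk_neq0 (pXP _).
by move=> l'; rewrite /fl s_sv.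
Qed.

Lemma fl_neq0 l t : (fl l t != 0) = (sv l (e t) != 0).
Proof. by have [c c0 E] := fl_sv t; rewrite E mulf_eq0 (negbTE c0). Qed.

Lemma fl_ratio l l' t : fl l t / fl l' t = sv l (e t) / sv l' (e t).
Proof. by have [c c0 E] := fl_sv t; rewrite !E -mulf_div divff ?mul1r. Qed.

Lemma fl_laurent : exists (A : seq 'rV[int]_n) (c : 'I_N.+1 -> 'rV[int]_n -> K),
  [/\ uniq A, forall m, m \in A -> exists l, c l m != 0
    & forall l t, fl l t = \sum_(m <- A) c l m * chi m (sval t)].
Proof.
have H l : exists Ac : seq 'rV[int]_n * ('rV[int]_n -> K), [/\ uniq Ac.1,
    forall m, m \in Ac.1 -> Ac.2 m != 0
    & forall t, fl l t = \sum_(m <- Ac.1) Ac.2 m * chi m (sval t)].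
  have rf := torus_pullback_reg oe (rs l iT) (fun x Ox => Ox).
  have [g [/lspan_uniq[A [c [uA _ c0 E]]] Hg]] := torus_laurent rf.
  exists (A, c); split => // t; rewrite -E; first exact: Hg.
  exact: (svalP t).
have [Ac HAc] := boolp.choice H.
exists (undup (flatten [seq (Ac l).1 | l <- enum 'I_N.+1])),
  (fun l m => if m \in (Ac l).1 then (Ac l).2 m else 0); split.
- exact: undup_uniq.
- move=> m; rewrite mem_undup => /flattenP[_ /mapP[l _ ->] ml]; exists l.
  by rewrite ml; have [_ c0 _] := HAc l; apply: c0.
- move=> l t; have [uA c0 ->] := HAc l.
  rewrite [RHS](bigID (fun m => m \in (Ac l).1)) /= [X in _ + X]big1 ?addr0; last first.
    by move=> m /negbTE ->; rewrite mul0r.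
  set B := undup _.
  have P : perm_eq (Ac l).1 [seq m <- B | m \in (Ac l).1].
    apply: uniq_perm => //; first by rewrite filter_uniq // undup_uniq.
    move=> m; rewrite mem_filter mem_undup; case: (boolP (m \in (Ac l).1)) => //= ml.
    by apply/esym/flattenP; exists (Ac l).1 => //; apply: map_f; rewrite mem_enum.
  rewrite -[RHS]big_filter (perm_big _ P) /=.
  by apply: eq_big_seq => m; rewrite mem_filter => /andP[-> _].
Qed.

Definition tinv (t : torus_pt K n) : torus_pt K n.
Proof.
exists (\row_j (sval t 0 j)^-1).
by apply/forallP => i; rewrite mxE invr_neq0 // inv_neq0 //; exact: (svalP t).
Defined.

Lemma tmulC (t u : torus_pt K n) : torus_mul t u = torus_mul u t.
Proof. by apply: val_inj; apply/rowP => j; rewrite !mxE mulrC. Qed.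
Lemma tmulA (t u v : torus_pt K n) :
  torus_mul t (torus_mul u v) = torus_mul (torus_mul t u) v.
Proof. by apply: val_inj; apply/rowP => j; rewrite !mxE mulrA. Qed.
Lemma tmulV (t : torus_pt K n) : torus_mul t (tinv t) = torus_one K n.
Proof.
apply: val_inj; apply/rowP => j; rewrite !mxE mulfV // inv_neq0 //; exact: (svalP t).
Qed.
Lemma tmul1 (t : torus_pt K n) : torus_mul (torus_one K n) t = t.
Proof. by apply: val_inj; apply/rowP => j; rewrite !mxE mul1r. Qed.

Lemma actK t x : act (tinv t) (act t x) = x.
Proof. by rewrite -actM tmulC tmulV act1. Qed.
Lemma actVK t x : act t (act (tinv t) x) = x.
Proof. by rewrite -actM tmulV act1. Qed.

Lemma chi_tmul (m : 'rV[int]_n) (t u : torus_pt K n) : chi m (sval (torus_mul t u)) = chi m (sval t) * chi m (sval u).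
Proof. by rewrite /= chi_mul. Qed.

Lemma taus_e i t : taus e i (e t) = sval t 0 i.
Proof. by rewrite /taus Te. Qed.

Definition t0prod (t0 : torus_pt K n) : K := \prod_j sval t0 0 j.

Lemma t0prod_neq0 t0 : t0prod t0 != 0.
Proof. by apply/prodf_neq0 => j _; apply: inv_neq0; exact: (svalP t0). Qed.

Lemma translate_coords t0 V (t : 'I_n -> X -> K) : coord_system V t ->
  coord_system (act (tinv t0) @^-1` V) (fun i y => t i (act (tinv t0) y)).
Proof.
move=> [oV rt lt]; split.
- exact: (ma _).1.
- by move=> i; apply: (ma (tinv t0)).2 (rt i).
- move=> x Vx; apply: (local_coords_pullback (X := X) (Y := X) nX nX (ma (tinv t0)) (ma t0)).
  + by move=> y; apply: actVK.
  + by move=> y; apply: actK.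
  + exact: lt.
Qed.

(** Translation by [t0] scales each torus coordinate by the one of [t0], whence the constant factor
    [t0prod t0] between the frames. *)
Lemma translate_jacobian t0 V (t : 'I_n -> X -> K) u : coord_system V t ->
  V (e u) -> \det (jacobian (fun i y => t i (act (tinv t0) y)) (taus e) (e (torus_mul t0 u)))
    = \det (jacobian t (taus e) (e u)) / t0prod t0.
Proof.
move=> [oV rt lt] Vu; set J := jacobian t _ _; set z := e (torus_mul t0 u).
have Oz : O z by exists (torus_mul t0 u).
have Ou : O (e u) by exists u.
have gz : act (tinv t0) z = e u by rewrite /z -acte actK.
have t0n j : sval t0 0 j != 0 by apply: inv_neq0; exact: (svalP t0).
have DJ i : deriv z (taus e) (fun y => t i (act (tinv t0) y)) (fun j => J i j / sval t0 0 j).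
  have DJ := jacobianP nX (torus_coords nX smooth oe Ou) (fun i => reg_regular_at nX (rt i) Vu) i.
  rewrite -/J -gz in DJ; have := ims_pullback (ma (tinv t0)) DJ.
  apply: (ims_ext nX (range_opn oe) Oz) => _ [v _ <-] /=.
  congr (_ - _); apply: eq_bigr => j _; rewrite gz acte !taus_e /=.
  by rewrite !mxE; field.
rewrite (jacobian_uniq nX (torus_coords nX smooth oe Oz) DJ).
have -> : \matrix_(i, j) (J i j / sval t0 0 j) = J *m diag_mx (\row_j (sval t0 0 j)^-1).
  by apply/matrixP => i j; rewrite mul_mx_diag !mxE.
rewrite det_mulmx det_diag; congr (_ * _).
by rewrite /t0prod -prodfV; apply: eq_bigr => j _; rewrite mxE.
Qed.

(** The translate of a section of the anticanonical bundle is again a section: it is regular in the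
    coordinates transported along [act t0]. The factor [t0prod t0 ^+ k] compensates the scaling of
    the torus frame. *)
Lemma translate_local t0 l l' x : D l x -> exists (V : set X) h,
  [/\ reg V h, V x & forall y, V y -> O y ->
    h y = fl l' (torus_mul t0 (einv e y)) / fl l (einv e y)].
Proof.
move=> Dx; have [[[V t] cV] /= Vx] := chart_cover x.
have [oV rt lt] := cV; pose cV' := translate_coords t0 cV.
pose p : idx AC := exist (fun p : set X * ('I_n -> X -> K) => coord_system p.1 p.2) (V, t) cV.
pose q : idx AC := exist (fun p : set X * ('I_n -> X -> K) => coord_system p.1 p.2)
  (act (tinv t0) @^-1` V, fun i y => t i (act (tinv t0) y)) cV'.
pose W := dom p `&` [set y | s l p y != 0].
have rW : reg W (fun y => (s l p y)^-1) by apply: nice_inv.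
have rq : reg W (fun y => s l' q (act t0 y)).
  have := (ma t0).2 _ _ (rs l' q) => /(nice_res nX); apply.
    exact: (nice_reg_opn nX rW).
  by move=> y [Vy _] /=; rewrite actK.
exists W, (fun y => s l' q (act t0 y) * (s l p y)^-1 * t0prod t0 ^+ k); split.
- apply: nice_mul => //; first exact: nice_mul.
  by apply: nice_cst => //; exact: (nice_reg_opn nX rW).
- by split => //=; rewrite s_neq0.
move=> y [/= Vy sy] [u _ Eu]; rewrite -{y}Eu in Vy sy *; rewrite (eK oe) acte.
have Vz : dom q (e (torus_mul t0 u)) by rewrite /= -acte actK.
have Oz : dom iT (e (torus_mul t0 u)) by exists (torus_mul t0 u).
have Ou : dom iT (e u) by exists u.
rewrite (trs l' Vz Oz) (trs l (i := p) Vy Ou).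
have -> : tr q iT (e (torus_mul t0 u)) = tr p iT (e u) / t0prod t0.
  exact: (translate_jacobian t0 cV Vy).
have d0 : tr p iT (e u) != 0 by apply: tr_neq0.
have f0 : fl l u != 0 by rewrite fl_neq0 -(s_neq0 l (p := p) Vy).
rewrite /fl in f0 *; rewrite expr_div_n.
by field; rewrite f0 !expf_neq0 ?t0prod_neq0.
Qed.

Lemma translate t0 l l' : exists2 h, reg (D l) h &
  forall t, D l (e t) -> h (e t) = fl l' (torus_mul t0 t) / fl l t.
Proof.
have [h rh Hh] := @dense_ext _ _ _ (D l)
  (fun x => fl l' (torus_mul t0 (einv e x)) / fl l (einv e x)) nX dO (D_opn l)
  (fun x Dx => @translate_local t0 l l' x Dx).
exists h => // t Dt; have [V [g [rg Vt E]]] := @translate_local t0 l l' _ Dt.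
by rewrite (Hh V g rg E _ Vt Dt) E // (eK oe).
Qed.

Section Supports.
Variables (A : seq 'rV[int]_n) (c : 'I_N.+1 -> 'rV[int]_n -> K).
Hypothesis uA : uniq A.
Hypothesis cA : forall m, m \in A -> exists l, c l m != 0.
Hypothesis flE : forall l t, fl l t = \sum_(m <- A) c l m * chi m (sval t).

(** Asking for all translates [t0] at once makes the property stable under the operators that
    isolate a character in [extends_chi]. *)
Definition extends l (g : torus_pt K n -> K) := forall t0, exists2 h, reg (D l) h &
  forall t, D l (e t) -> h (e t) = g (torus_mul t0 t) / fl l t.

Lemma chi_separates (m m' : 'rV[int]_n) : m != m' ->
  exists t : torus_pt K n, chi m (sval t) != chi m' (sval t).
Proof.
move=> mm; apply: contrapT => H.
have E t : invertible_row t -> chi m t = chi m' t :> K.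
  move=> it; apply/eqP; apply: contrapT => /negP ne; apply: H.
  by exists (exist _ t it).
have := @lspan_disjoint K n [set m] [set m'] (chi m).
move=> /(_ _ _ _ (const_mx 1) (torus_one_subproof K n)) F.
have : chi m (const_mx 1) = 0 :> K.
  apply: F; first by move=> x -> xm; case/eqP: mm.
    exact: lspan_chi.
  by apply: lspan_ext (lspan_chi _ _) _; last by move=> t it; rewrite E.
by rewrite chi_one => /eqP; rewrite oner_eq0.
Qed.

(* The components of exponent different from [m] are killed one after the other
   by the operators g |-> g(t' .) - chi(t') g. *)
Lemma extends_chi l m : m \in A -> extends l (fun t => chi m (sval t)).
Proof.
move=> mA; have [l' cl] := cA mA.
suff H (r : seq 'rV[int]_n) : m \notin r -> exists g d, [/\ extends l g, d m != 0,
    forall m', m' \in r -> d m' = 0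
    & forall t, g t = \sum_(m' <- A) d m' * chi m' (sval t)].
  have [|g [d [eg dm dr gE]]] := H [seq m' <- A | m' != m].
    by rewrite mem_filter eqxx.
  move=> t0; have [h rh Hh] := eg t0; exists (fun y => (d m)^-1 * h y).
    by apply: nice_mul => //; apply: nice_cst => //; apply: D_opn.
  move=> t Dt; rewrite Hh // gE (bigD1_seq m) //= big1_seq ?addr0.
    by rewrite mulrA mulKf.
  by move=> m' /andP[mm' m'A]; rewrite dr ?mul0r // mem_filter mm'.
elim: r => [_|m' r IH].
  exists (fl l'), (c l'); split => // t0.
  exact: translate.
rewrite in_cons negb_or => /andP[mm' mr]; have [g [d [eg dm dr gE]]] := IH mr.
have [t' Ht'] := chi_separates mm'.
exists (fun t => g (torus_mul t' t) - chi m' (sval t') * g t),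
  (fun x => d x * (chi x (sval t') - chi m' (sval t'))); split.
- move=> t0; have [h1 r1 H1] := eg (torus_mul t' t0); have [h2 r2 H2] := eg t0.
  exists (fun y => h1 y - chi m' (sval t') * h2 y).
    apply: reg_sub => //; apply: nice_mul => //; apply: nice_cst => //; exact: D_opn.
  by move=> t Dt; rewrite H1 // H2 // tmulA mulrBl mulrA.
- by rewrite mulf_neq0 // subr_eq0.
- move=> x; rewrite in_cons => /orP[/eqP ->|/dr ->]; last by rewrite mul0r.
  by rewrite subrr mulr0.
- move=> t; rewrite !gE mulr_sumr -sumrB; apply: eq_bigr => x _.
  by rewrite chi_tmul; ring.
Qed.

Lemma R_ex : exists R : 'I_N.+1 -> 'rV[int]_n -> X -> K, forall l m, m \in A ->
  reg (D l) (R l m) /\ forall t, D l (e t) -> R l m (e t) = chi m (sval t) / fl l t.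
Proof.
have H (lm : 'I_N.+1 * 'rV[int]_n) : exists f, lm.2 \in A -> reg (D lm.1) f /\
    forall t, D lm.1 (e t) -> f (e t) = chi lm.2 (sval t) / fl lm.1 t.
  have [mA|] := boolP (lm.2 \in A); last by exists (fun=> 0).
  have [h rh Hh] := extends_chi lm.1 mA (torus_one K n); exists h => _; split => // t Dt.
  by rewrite Hh // tmul1.
have [R HR] := boolp.choice H; exists (fun l m => R (l, m)) => l m.
exact: (HR (l, m)).
Qed.

End Supports.

End Sections.

(** * The sections attached to characters and their ratios *)

Section Ratios.
Variables (K : closedFieldType) (X : ringed_set K) (n N : nat).
Hypothesis nX : nice X.
Variable e : torus K n -> X.
Hypothesis dO : dense (range e).
Variable act : torus_pt K n -> X -> X.
Hypothesis ma : forall t, morphism (act t).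
Hypothesis acte : forall t u, act t (e u) = e (torus_mul t u).
Variable phi : X -> proj_space K N.
Hypothesis fi : closed_immersion phi.
Variables (A : seq 'rV[int]_n) (c : 'I_N.+1 -> 'rV[int]_n -> K).
Variable sv : 'I_N.+1 -> X -> K.
Hypothesis hcoord_sv : forall x, exists2 c, c != 0 &
  forall j, hcoord (phi x) j = c * sv j x.
Let D l : set X := [set x | sv l x != 0].
Hypothesis D_opn : forall l, opn (D l).
Hypothesis ratio_reg : forall l l', reg (D l) (fun x => sv l' x / sv l x).
Variable fl : 'I_N.+1 -> torus_pt K n -> K.
Hypothesis flE : forall l t, fl l t = \sum_(m <- A) c l m * chi m (sval t).
Hypothesis fl_neq0 : forall l t, (fl l t != 0) = (sv l (e t) != 0).
Hypothesis fl_ratio : forall l l' t, fl l t / fl l' t = sv l (e t) / sv l' (e t).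
(* [R l m] is the quotient by [s l] of the section equal to the character [m] on the torus. *)
Variable R : 'I_N.+1 -> 'rV[int]_n -> X -> K.
Hypothesis R_reg : forall l m, m \in A -> reg (D l) (R l m).
Hypothesis R_e : forall l m t, m \in A -> D l (e t) -> R l m (e t) = chi m (sval t) / fl l t.

Lemma some_sv x : exists l, D l x.
Proof.
have [c' c0 H] := hcoord_sv x; have [j xj] := hcoord_neq0 (phi x); exists j.
by apply: contraNneq xj => sj; rewrite H sj mulr0.
Qed.

Lemma R_change l l' m x : D l x -> D l' x -> m \in A ->
  R l m x = sv l' x / sv l x * R l' m x.
Proof.
move=> Dx D'x mA; have oW : opn (D l `&` D l') by apply: nice_opnI.
apply: (@dense_eq _ _ (range e) (D l `&` D l') (R l m) (fun x => sv l' x / sv l x * R l' m x)) => //.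
- exact: (reg_resI nX (R_reg l mA)).
- apply: nice_mul => //; first exact: (reg_resI nX).
  exact: (reg_resIr nX (R_reg l' mA)).
move=> y [Dy D'y] [t _ E]; rewrite -{y}E in Dy D'y *.
rewrite !R_e // -fl_ratio.
by field; rewrite !fl_neq0; apply/andP.
Qed.

Lemma R_sum l l' x : D l x -> sv l' x / sv l x = \sum_(m <- A) c l' m * R l m x.
Proof.
move=> Dx; apply: (@dense_eq _ _ (range e) (D l) (fun x => sv l' x / sv l x)
  (fun x => \sum_(m <- A) c l' m * R l m x)) => //.
  rewrite (_ : (fun x => \sum_(m <- A) c l' m * R l m x) =
    fun x => \sum_(m <- A | m \in A) c l' m * R l m x); last first.
    by apply/funext => z; rewrite big_seq.
  apply: reg_sum => // m mA; apply: nice_mul => //; last exact: R_reg.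
  exact: nice_cst.
move=> y Dy [t _ E]; rewrite -{y}E in Dy *.
rewrite -fl_ratio flE mulr_suml; apply: eq_big_seq => m mA.
by rewrite R_e // mulrA.
Qed.

(** On [D l] the function 1 is a combination of the [R l m], so these have no common zero. *)
Lemma some_R l x : D l x -> exists2 m, m \in A & R l m x != 0.
Proof.
move=> Dx; have := R_sum l Dx; rewrite divff // => E.
apply: contrapT => H; have := oner_eq0 K; rewrite E big1_seq ?eqxx // => m /andP[_ mA].
have [->|Rm] := eqVneq (R l m x) 0; first by rewrite mulr0.
by case: H; exists m.
Qed.

Definition lX x := projT1 (cid (some_sv x)).
Lemma lXP x : D (lX x) x. Proof. exact: projT2 (cid (some_sv x)). Qed.

(** A denominator [lX x] is chosen at each point; [YE] and [UE] show that the choice does not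
    matter. *)
Definition Y m m' x := R (lX x) m x / R (lX x) m' x.
Definition U m : set X := [set x | R (lX x) m x != 0].

Lemma ratio_neq0 l l' x : D l x -> D l' x -> sv l' x / sv l x != 0.
Proof. by move=> Dx D'x; rewrite mulf_neq0 ?invr_neq0. Qed.

Lemma YE l m m' x : D l x -> m \in A -> m' \in A -> Y m m' x = R l m x / R l m' x.
Proof.
move=> Dx mA m'A; have lx := lXP x.
by rewrite /Y !(R_change lx Dx) // -mulf_div divff ?mul1r // ratio_neq0.
Qed.

Lemma UE l m x : D l x -> m \in A -> U m x = (R l m x != 0) :> Prop.
Proof.
move=> Dx mA; have lx := lXP x; rewrite /U /= (R_change lx Dx) // mulf_eq0.
by rewrite (negbTE (ratio_neq0 lx Dx)).
Qed.

Lemma U_opn m : m \in A -> opn (U m).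
Proof.
move=> mA; apply: nice_opn => // x Ux.
exists (D (lX x) `&` [set y | R (lX x) m y != 0]); split.
- by apply: opn_neq0 => //; apply: R_reg.
- by split; [exact: lXP|].
- by move=> y [Dy Ry]; rewrite (UE Dy mA).
Qed.

Lemma Y_reg m m' : m \in A -> m' \in A -> reg (U m') (Y m m').
Proof.
move=> mA m'A; apply: nice_reg => // x Ux.
exists (D (lX x) `&` [set y | R (lX x) m' y != 0]), (fun y => R (lX x) m y / R (lX x) m' y).
have oV : opn (D (lX x) `&` [set y | R (lX x) m' y != 0]).
  by apply: opn_neq0 => //; apply: R_reg.
split.
- apply: nice_mul => //; last by apply: nice_inv => //; apply: R_reg.
  by apply: (nice_res nX (R_reg (lX x) mA)) => // ? [].
- by split; [exact: lXP|].
- by move=> y [Dy Ry]; rewrite (UE Dy m'A) (YE Dy).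
Qed.

Lemma U_e m t : m \in A -> U m (e t).
Proof.
move=> mA; have lx := lXP (e t); rewrite /U /= R_e // mulf_neq0 //.
  by apply: chi_neq0; exact: (svalP t).
by rewrite invr_neq0 // fl_neq0.
Qed.

Lemma Y_e m m' t : m \in A -> m' \in A -> Y m m' (e t) = chi (m - m') (sval t).
Proof.
move=> mA m'A; have lx := lXP (e t); have it := svalP t.
rewrite /Y !R_e // chiB //; field.
by rewrite chi_neq0 // fl_neq0.
Qed.

Lemma U_cover x : exists2 m, m \in A & U m x.
Proof. exact: some_R (lXP x). Qed.

Lemma U_Y m m' x : U m' x -> U m x = (Y m m' x != 0) :> Prop.
Proof. by rewrite /U /Y /= => H; rewrite mulf_eq0 invr_eq0 (negbTE H) orbF. Qed.

Lemma Y_id m x : U m x -> Y m m x = 1.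
Proof. by move=> Ux; rewrite /Y divff. Qed.

Lemma Y_trans m m' m'' x : U m' x -> U m'' x -> Y m m'' x = Y m m' x * Y m' m'' x.
Proof. by rewrite /U /Y /= => H H'; field; rewrite H H'. Qed.

Lemma sv_Y m0 l j x : m0 \in A -> U m0 x -> D l x ->
  sv j x / sv l x = R l m0 x * \sum_(m <- A) c j m * Y m m0 x.
Proof.
move=> mA Ux Dx; rewrite R_sum // mulr_sumr; apply: eq_big_seq => m mmA.
rewrite (YE Dx) //; rewrite (UE Dx mA) in Ux.
by field.
Qed.

(** Up to a common factor, the homogeneous coordinates of [phi] are the linear combinations [L j] of
    the [Y m m0]. Fractions in the former thus become fractions in the latter. *)
Lemma U_chart m0 : m0 \in A -> chart (U m0) [set g | exists2 m, m \in A & g = Y m m0].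
Proof.
move=> mA; split; first exact: U_opn.
  by move=> _ [m mmA ->]; apply: Y_reg.
move=> W g x rg Wx Ux; have [i xi] := hcoord_neq0 (phi x).
have [_ _ C] := closed_immersion_chart fi i.
have R1 := C _ _ _ rg Wx xi.
(* The two charts are indexed by a boolean in order to apply the change of chart for families. *)
pose Ub (b : bool) := if b then phi @^-1` [set l | hcoord l i != 0] else U m0.
pose Gb (b : bool) := if b then [set g : X -> K | exists j, g = fun y => hcoord (phi y) j / hcoord (phi y) i]
   else [set g : X -> K | exists2 m, m \in A & g = Y m m0].
pose L j y := \sum_(m <- A) c j m * Y m m0 y.
have GL j : alg (Gb false) (L j).
  suff H (r : seq 'rV[int]_n) : {subset r <= A} -> alg (Gb false) (fun y => \sum_(m <- r) c j m * Y m m0 y) by apply: H.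
  elim: r => [_|m r IH sub].
    rewrite (_ : (fun y => _) = fun=> 0); first exact: alg_cst.
    by apply/funext => y; rewrite big_nil.
  rewrite (_ : (fun y => _) = fun y => c j m * Y m m0 y + \sum_(m <- r) c j m * Y m m0 y).
    apply: alg_add; last by apply: IH => z zr; apply: sub; rewrite in_cons zr orbT.
    apply: alg_mul; first exact: alg_cst.
    by apply: alg_gen; exists m => //; apply: sub; rewrite mem_head.
  by apply/funext => y; rewrite big_cons.
have hE y : U m0 y -> exists2 d, d != 0 & forall j, hcoord (phi y) j = d * L j y.
  move=> Uy; have [d d0 H] := hcoord_sv y; have ly := lXP y.
  exists (d * (sv (lX y) y * R (lX y) m0 y)); first by rewrite !mulf_neq0.
  move=> j; rewrite H; have /= E := sv_Y j mA Uy ly.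
  by rewrite -[sv j y](divfK ly) E /L; ring.
have Lx : L i x != 0 by have [d d0 H] := hE x Ux; move: xi; rewrite H mulf_eq0 negb_or => /andP[].
apply: (@frac_rep_refines _ _ _ Ub Gb true false x W g xi Ux _ R1).
apply: refines_gen => //.
  exists (fun=> 0), (L i); split => //; first exact: alg_cst.
  move=> y Uy Ly; rewrite mul0r; split => //=.
  by have [d d0 H] := hE y Uy; rewrite H mulf_neq0.
move=> _ [j ->]; exists (L j), (L i); split => // y Uy Ly.
have [d d0 H] := hE y Uy; split => /=; first by rewrite H mulf_neq0.
by rewrite !H; field; rewrite d0 Ly.
Qed.

Lemma Y_sep m0 x x' : m0 \in A -> U m0 x -> U m0 x' ->
  (forall m, m \in A -> Y m m0 x = Y m m0 x') -> x = x'.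
Proof.
move=> mA Ux Ux' E; have [pinj _ _ _] := fi; apply: pinj.
have hE y : U m0 y -> exists2 d, d != 0 & forall j, hcoord (phi y) j = d * \sum_(m <- A) c j m * Y m m0 y.
  move=> Uy; have [d d0 H] := hcoord_sv y; have ly := lXP y.
  exists (d * (sv (lX y) y * R (lX y) m0 y)); first by rewrite !mulf_neq0.
  move=> j; rewrite H; have /= E1 := sv_Y j mA Uy ly.
  by rewrite -[sv j y](divfK ly) E1; ring.
have [d d0 H] := hE _ Ux; have [d' d'0 H'] := hE _ Ux'.
apply: (proj_pt_ext (c := d / d')); first by rewrite mulf_neq0 ?invr_neq0.
move=> j; rewrite H H'.
have -> : \sum_(m <- A) c j m * Y m m0 x = \sum_(m <- A) c j m * Y m m0 x'.
  by apply: eq_big_seq => m mmA; rewrite E.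
by field.
Qed.

(** Translation by [t] multiplies the character [m] by its value at [t]; passing from [s l] to
    [s l'] introduces a factor [B] common to all [m], which disappears in the ratios [Y]. *)
Lemma R_act t x l l' : D l x -> D l' (act t x) -> exists2 B, B != 0 &
  forall m, m \in A -> R l' m (act t x) * B = chi m (sval t) * R l m x.
Proof.
move=> Dx D'x; pose W := D l `&` act t @^-1` (D l').
have oW : opn W by apply: nice_opnI => //; apply: (ma t).1.
pose B y := \sum_(m <- A) c l' m * (chi m (sval t) * R l m y).
have it := svalP t.
have E m : m \in A -> forall y, W y -> R l' m (act t y) * B y = chi m (sval t) * R l m y.
  move=> mA; apply: (@dense_eq _ _ (range e) W (fun y => R l' m (act t y) * B y)
    (fun y => chi m (sval t) * R l m y)) => //.
  - apply: nice_mul => //.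
      by apply: (nice_res nX ((ma t).2 _ _ (R_reg l' mA))) => // y [].
    rewrite (_ : B = fun y => \sum_(m <- A | m \in A) c l' m * (chi m (sval t) * R l m y)); last first.
      by apply/funext => z; rewrite /B big_seq.
    apply: reg_sum => // m' m'A; apply: nice_mul => //; first exact: nice_cst.
    apply: nice_mul => //; first exact: nice_cst.
    by apply: (nice_res nX (R_reg l m'A)) => // y [].
  - apply: nice_mul => //; first exact: nice_cst.
    by apply: (nice_res nX (R_reg l mA)) => // y [].
  move=> y [Dy D'y] [u _ Eu]; rewrite -{y}Eu in Dy D'y *.
  have D'y' : D l' (e (torus_mul t u)) by rewrite -acte.
  have f1 : fl l u != 0 by rewrite fl_neq0.
  have f2 : fl l' (torus_mul t u) != 0 by rewrite fl_neq0.
  have -> : B (e u) = fl l' (torus_mul t u) / fl l u.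
    rewrite flE mulr_suml; apply: eq_big_seq => m' m'A.
    by rewrite R_e //= chi_mul; ring.
  rewrite acte !R_e //= chi_mul.
  by field; rewrite f1 f2.
have Wx : W x by split.
exists (B x); last by move=> m mA; apply: E.
have [m mA Rm] := some_R Dx; have := E m mA x Wx.
move=> EB; apply: contraNneq (mulf_neq0 (chi_neq0 m it) Rm) => B0.
by rewrite -EB B0 mulr0.
Qed.

Lemma poly_eq_generic (p q h : {poly K}) : h != 0 ->
  (forall s, h.[s] != 0 -> p.[s] = q.[s]) -> p = q.
Proof.
move=> h0 H; apply/eqP; rewrite -subr_eq0; apply: contraT => pq.
have [s] := nonroot (mulf_neq0 h0 pq); rewrite hornerM hornerD hornerN mulf_eq0 negb_or.
by move=> /andP[/H ->]; rewrite subrr eqxx.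
Qed.

(* The limit of the one-parameter subgroup [w] acting on [x]; the image of [phi] being
   closed, it exists in [X]. *)
Lemma limit_point x w m0 : m0 \in A -> U m0 x ->
  (forall m, m \in A -> Y m m0 x != 0 -> dotp m0 w <= dotp m w) ->
  exists y, U m0 y /\ forall m, m \in A ->
    Y m m0 y = if dotp m w == dotp m0 w then Y m m0 x else 0.
Proof.
move=> m0A Ux hmin; have lx := lXP x; set l := lX x in lx.
have r0 : R l m0 x != 0 by [].
pose gam s := oapp (fun t => act t x) x (insub (oneps w s) : option (torus_pt K n)).
have gamE (s : K) : s != 0 -> exists t : torus_pt K n, sval t = oneps w s /\ gam s = act t x.
  move=> s0; rewrite /gam; case: insubP => [t _ Et|]; last by rewrite oneps_inv.
  by exists t.
(* Exponents are measured from that of [m0]. The difference is nonnegative whenever [R l m x] is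
   nonzero; otherwise the absolute value is immaterial, as the coefficient vanishes. *)
pose ex m := absz (dotp m w - dotp m0 w).
have exE m (s : K) : m \in A -> s != 0 -> R l m x != 0 ->
    s ^ dotp m w = s ^ dotp m0 w * s ^+ ex m.
  move=> mA s0 Rm; have le := hmin m mA.
  have : Y m m0 x != 0 by rewrite (YE lx) // mulf_neq0 ?invr_neq0.
  move=> /le le'; rewrite exprnP -expfzDr //; congr (s ^ _).
  by rewrite /ex; lia.
pose F j := \sum_(m <- A) (c j m * R l m x) *: 'X^(ex m).
have FE (s : K) j : s != 0 -> (F j).[s] * s ^ dotp m0 w = \sum_(m <- A) c j m * (s ^ dotp m w * R l m x).
  move=> s0; rewrite /F horner_sum mulr_suml; apply: eq_big_seq => m mA.
  rewrite hornerZ hornerXn; have [->|Rm] := eqVneq (R l m x) 0; first by rewrite !(mulr0, mul0r).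
  by rewrite (exE m) //; move: (s ^+ ex m) (s ^ dotp m0 w) => z z1; ring.
have HF (s : K) : s != 0 -> exists2 d, d != 0 & forall j, hcoord (phi (gam s)) j = d * (F j).[s].
  move=> s0; have [t [Et ->]] := gamE s s0.
  have [d d0 Hd] := hcoord_sv (act t x); have l'x := lXP (act t x).
  have [B B0 HB] := R_act lx l'x.
  exists (d * sv (lX (act t x)) (act t x) * B^-1 * s ^ dotp m0 w).
    by rewrite !mulf_neq0 ?invr_neq0 ?expfz_neq0.
  move=> j; rewrite Hd -[sv j _](divfK l'x) R_sum //.
  have -> : \sum_(m <- A) c j m * R (lX (act t x)) m (act t x)
     = B^-1 * \sum_(m <- A) c j m * (s ^ dotp m w * R l m x).
    rewrite mulr_sumr; apply: eq_big_seq => m mA.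
    rewrite -chi_oneps // -Et -HB //; field; exact: B0.
  by rewrite -FE //; move: (s ^ dotp m0 w) => z; ring.
have F0 : exists j, F j != 0.
  have [d d0 Hd] := HF 1 (oner_neq0 K); have [j hj] := hcoord_neq0 (phi (gam 1)).
  by exists j; apply: contraNneq hj => Fj; rewrite Hd Fj horner0 mulr0.
have [y Hy] := curve_limit fi F0 HF.
have ly := lXP y; set l0 := lX y in ly.
(* Stated with cross products because [R l0 m0 y] is seen to be nonzero only afterwards. It is the
   value at 0 of an identity of polynomials in [s], where [s ^+ ex m] survives only for
   [ex m = 0]. *)
have key m : m \in A -> R l0 m y * R l m0 x = R l0 m0 y * R l m x * (dotp m w == dotp m0 w)%:R.
  move=> mA.
  have [p [q [q0 Ep Hp]]] := Hy _ _ (R_reg l0 mA) ly.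
  have [p' [q' [q'0 Ep' Hp']]] := Hy _ _ (R_reg l0 m0A) ly.
  have qn : q != 0 by apply: contraNneq q0 => ->; rewrite horner0.
  have q'n : q' != 0 by apply: contraNneq q'0 => ->; rewrite horner0.
  have E : (R l m0 x)%:P * p * q' = (R l m x)%:P * p' * q * 'X^(ex m).
    apply: (poly_eq_generic (h := q * q' * 'X)); first by rewrite !mulf_neq0 ?polyX_eq0.
    move=> s; rewrite !hornerM hornerX !mulf_eq0 !negb_or => /andP[/andP[qs q's] s0].
    have [Dg Eg] := Hp s s0 qs; have [_ Eg'] := Hp' s s0 q's.
    have [t [Et Eg2]] := gamE s s0; rewrite Eg2 in Dg Eg Eg'.
    have [B B0 HB] := R_act lx Dg.
    have H1 := HB m mA; have H2 := HB m0 m0A; rewrite Et !chi_oneps // in H1 H2.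
    rewrite !hornerC hornerXn.
    have -> : p.[s] = R l0 m (act t x) * q.[s] by rewrite Eg divfK.
    have -> : p'.[s] = R l0 m0 (act t x) * q'.[s] by rewrite Eg' divfK.
    have [Rm|Rm] := eqVneq (R l m x) 0.
      rewrite Rm mulr0 in H1; move/eqP: H1; rewrite mulf_eq0 (negbTE B0) orbF => /eqP ->.
      by rewrite Rm !(mul0r, mulr0).
    rewrite (exE m) // in H1; move: (s ^+ ex m) (s ^ dotp m0 w) (expfz_neq0 (dotp m0 w) s0) H1 H2 => z z' z'0 H1 H2.
    apply: (mulfI B0); apply: (mulfI z'0).
    transitivity (R l m0 x * (z' * q.[s] * q'.[s]) * (R l0 m (act t x) * B)); first by ring.
    rewrite H1.
    transitivity (z' * R l m x * z * q.[s] * q'.[s] * (z' * R l m0 x)); first by ring.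
    by rewrite -H2; ring.
  have := congr1 (fun r => r.[0]) E; rewrite /= !hornerM !hornerC hornerXn expr0n => E0.
  have exd : (ex m == 0)%N = (dotp m w == dotp m0 w) by rewrite absz_eq0 subr_eq0.
  rewrite -exd Ep Ep'; apply: (mulfI (mulf_neq0 q0 q'0)).
  transitivity (R l m0 x * p.[0] * q'.[0]); first by field.
  by rewrite E0; field.
have R0y : R l0 m0 y != 0.
  have [m mA Rm] := some_R ly; apply: contraNneq Rm => z.
  by have := key m mA; rewrite z !mul0r => /eqP; rewrite mulf_eq0 (negbTE r0) orbF => /eqP ->.
exists y; split; first exact: R0y.
move=> m mA; rewrite (YE ly) // (YE lx) //; apply: (mulIf r0).
rewrite mulrAC key //; case: eqP => _; last by rewrite mulr0 !mul0r.
by rewrite mulr1; field; rewrite r0 R0y.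
Qed.

End Ratios.

(** * Vertices and their affine charts *)

(* [A] is the set of exponents of the sections of the k-th power of the anticanonical
   bundle on the torus, [U m] the nonvanishing locus of the section of exponent [m]
   and [Y m m'] the quotient of the sections of exponents [m] and [m']. *)
Record toric_data (K : closedFieldType) (X : ringed_set K) (n k : nat)
    (e : torus K n -> X) (A : seq 'rV[int]_n) (U : 'rV[int]_n -> set X)
    (Y : 'rV[int]_n -> 'rV[int]_n -> X -> K) : Prop := ToricData {
  td_nice : nice X;
  td_smooth : forall x : X, exists t : 'I_n -> X -> K, local_coords x t;
  td_open : open_immersion e;
  td_dense : dense (range e);
  td_opn : forall m, m \in A -> opn (U m);
  td_reg : forall m m', m \in A -> m' \in A -> reg (U m') (Y m m');
  td_Ue : forall m t, m \in A -> U m (e t);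
  td_Ye : forall m m' t, m \in A -> m' \in A -> Y m m' (e t) = chi (m - m') (sval t);
  td_cover : forall x, exists2 m, m \in A & U m x;
  td_UY : forall m m' x, U m' x -> U m x = (Y m m' x != 0) :> Prop;
  td_id : forall m x, U m x -> Y m m x = 1;
  td_trans : forall m m' m'' x, U m' x -> U m'' x -> Y m m'' x = Y m m' x * Y m' m'' x;
  td_chart : forall m0, m0 \in A ->
    chart (U m0) [set g | exists2 m, m \in A & g = Y m m0];
  td_sep : forall m0 x x', m0 \in A -> U m0 x -> U m0 x' ->
    (forall m, m \in A -> Y m m0 x = Y m m0 x') -> x = x';
  td_lim : forall x w m0, m0 \in A -> U m0 x ->
    (forall m, m \in A -> Y m m0 x != 0 -> dotp m0 w <= dotp m w) ->
    exists y, U m0 y /\ forall m, m \in A ->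
      Y m m0 y = if dotp m w == dotp m0 w then Y m m0 x else 0;
  td_k : (0 < k)%N;
  td_section : forall v (p : idx (anticanonical X n)) x, v \in A -> dom p x -> U v x ->
    exists V h, [/\ reg V h, V x, h x != 0 & forall t, V (e t) ->
      h (e t) = chi v (sval t) * \det (jacobian (sval p).2 (taus e) (e t)) ^+ k] }.

Lemma exists_min (T : eqType) (l : seq T) (f : T -> int) x0 : x0 \in l ->
  exists2 x, x \in l & forall y, y \in l -> f x <= f y.
Proof.
elim: l x0 => [|a l IH] x0 // _; case: l IH => [|b l] IH.
  by exists a; [rewrite mem_head|move=> y; rewrite inE => /eqP ->].
have [x xl Hx] := IH b (mem_head _ _).
have [le|le] := lerP (f a) (f x).
  exists a; first exact: mem_head.
  by move=> y; rewrite in_cons => /orP[/eqP ->//|/Hx]; apply: le_trans.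
exists x; first by rewrite in_cons xl orbT.
by move=> y; rewrite in_cons => /orP[/eqP ->|/Hx//]; apply: ltW.
Qed.

Section Vertices.
Variables (K : closedFieldType) (X : ringed_set K) (n k : nat).
Variables (e : torus K n -> X) (A : seq 'rV[int]_n) (U : 'rV[int]_n -> set X).
Variable Y : 'rV[int]_n -> 'rV[int]_n -> X -> K.
Hypothesis TD : toric_data k e A U Y.

Let nX := td_nice TD.
Let dO := td_dense TD.

(* The second condition says that [U v] contains a fixed point of the torus. *)
Definition vtx v := v \in A /\
  exists y, U v y /\ forall m, m \in A -> m != v -> Y m v y = 0.

(** For a weight separating [A], let [m0] be minimal among the exponents not vanishing at [x]. The
    limit of [x] keeps the exponent [m0] alone, so it witnesses that [m0] is a vertex. *)
Lemma vtx_cover x : exists v, vtx v /\ U v x.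
Proof.
have [w Hw] := separating_inj A.
have [m1 m1A Um1] := td_cover TD x.
have [|m0] := @exists_min _ [seq m <- A | Y m m1 x != 0] (fun m => dotp m w) m1.
  by rewrite mem_filter m1A andbT (td_id TD Um1) oner_neq0.
rewrite mem_filter => /andP[Ym0 m0A] hmin.
have Um0 : U m0 x by rewrite (td_UY TD m0 Um1).
exists m0; split => //; split => //.
have [|y [Uy Hy]] := td_lim TD (w := w) m0A Um0.
  move=> m mA Ym; apply: hmin; rewrite mem_filter mA andbT.
  by rewrite (td_trans TD m Um0 Um1) mulf_neq0.
exists y; split => // m mA mm0; rewrite Hy //.
by case: eqP => // E; case/eqP: mm0; apply: Hw.
Qed.

Section Basis.
Variables (v : 'rV[int]_n) (y : X).
Hypothesis vA : v \in A.
Hypothesis Uy : U v y.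
Hypothesis Yy : forall m, m \in A -> m != v -> Y m v y = 0.

(** [r] vectors of [A - v] generate [A - v] as a monoid. The least such [r] is used below and turns
    out to be [n]. *)
Let Pgen r := exists G : 'M[int]_(r, n), (forall i, v + row i G \in A) /\
  forall m, m \in A -> exists q : 'I_r -> nat, m - v = \sum_i row i G *+ q i.

Lemma gens_exist : Pgen (size A).
Proof.
exists (\matrix_(i < size A) (nth 0 A i - v)); split=> [i|m mA].
  by rewrite rowK addrC subrK mem_nth.
have mi : (index m A < size A)%N by rewrite index_mem.
exists (fun i => (i == Ordinal mi)%N : nat); rewrite (bigD1 (Ordinal mi)) //= eqxx rowK nth_index //.
by rewrite big1 ?addr0 // => i /negbTE ->.
Qed.

Section MinimalGens.
Variables (r : nat) (G : 'M[int]_(r, n)).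
Hypothesis GA : forall i, v + row i G \in A.
Hypothesis Ggen : forall m, m \in A -> exists q : 'I_r -> nat, m - v = \sum_i row i G *+ q i.
Hypothesis rmin : forall r', (r' < r)%N -> ~ Pgen r'.

Let mon (q : 'I_r -> nat) := \sum_i row i G *+ q i.

Lemma gens_reduce i0 (q : 'I_r -> nat) : q i0 = 0%N -> row i0 G = mon q -> False.
Proof.
rewrite /mon; move: i0 q GA Ggen rmin; case: (r) G => [|r'] G' i0 q GA' Ggen' rmin' q0 E.
  by have := ltn_ord i0.
apply: (rmin' r'); first exact: ltnSn.
exists (row' i0 G'); split=> [i|m mA]; first by rewrite row_rowsub; exact: GA'.
have [p Ep] := Ggen' m mA.
exists (fun j => q (lift i0 j) * p i0 + p (lift i0 j))%N.
rewrite Ep (bigD1_ord i0) //= E (bigD1_ord i0) //= q0 mulr0n add0r.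
rewrite -sumrMnl -big_split; apply: eq_bigr => j _.
by rewrite row_rowsub mulrnDr mulrnA.
Qed.

Lemma gens_neq0 i : row i G != 0.
Proof.
apply/eqP => E; apply: (@gens_reduce i (fun=> 0%N)) => //.
by rewrite E /mon big1 // => j _; rewrite mulr0n.
Qed.

Lemma gens_inj i j : row i G = row j G -> i = j.
Proof.
move=> E; apply: contrapT => /eqP ij; apply: (@gens_reduce i (fun k => (k == j)%N : nat)).
  by rewrite (negbTE ij).
rewrite E /mon (bigD1 j) //= eqxx big1 ?addr0 // => l /negbTE ->.
by rewrite mulr0n.
Qed.

Let z i := Y (v + row i G) v.

Lemma gens_reg i : reg (U v) (z i). Proof. exact: (td_reg TD (GA i) vA). Qed.

Lemma gens_zero i : z i y = 0.
Proof.
apply: Yy; first exact: GA.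
by rewrite -subr_eq0 addrC addKr gens_neq0.
Qed.

Lemma gens_e i t : z i (e t) = chi (row i G) (sval t).
Proof. by rewrite /z (td_Ye TD) // addrC addKr. Qed.

Lemma Y_mon m q : m \in A -> m - v = mon q ->
  forall x, U v x -> Y m v x = \prod_i z i x ^+ q i.
Proof.
move=> mA E; have oU := td_opn TD vA.
apply: (@dense_eq _ _ (range e) (U v) (Y m v) (fun x => \prod_i z i x ^+ q i)) => //.
- exact: (td_reg TD).
- by apply: reg_prod => // i _; apply: reg_exp => //; apply: gens_reg.
move=> x Ux [t _ Et]; rewrite -{x}Et in Ux *.
have it := svalP t; rewrite (td_Ye TD) // E chi_sum //.
by apply: eq_bigr => i _; rewrite gens_e chiMn.
Qed.

(** A nontrivial relation would write the function 1 as a monomial in the [z i], all of which vanish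
    at [y]. *)
Lemma gens_pointed q : mon q = 0 -> forall i, q i = 0%N.
Proof.
move=> E i; have := Y_mon (m := v) (q := q) vA _ Uy; rewrite subrr E (td_id TD Uy) => /(_ erefl) /eqP.
apply: contraTeq => qi; rewrite (bigD1 i) //= gens_zero expr0n (negbTE qi) mul0r.
exact: oner_neq0.
Qed.

Let S2 : set 'rV[int]_n := [set u | exists q, u = mon q /\ (2 <= \sum_i q i)%N].
Let S1 : set 'rV[int]_n := [set u | exists i, u = row i G].

Lemma monD q q' : mon q + mon q' = mon (fun i => q i + q' i)%N.
Proof. by rewrite /mon -big_split; apply: eq_bigr => i _; rewrite mulrnDr. Qed.

Lemma mon_delta i : row i G = mon (fun j => (j == i)%N : nat).
Proof.
rewrite /mon (bigD1 i) //= eqxx big1 ?addr0 // => l /negbTE ->.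
by rewrite mulr0n.
Qed.

Lemma sum_delta (i : 'I_r) : (\sum_(j < r) ((j == i)%N : nat))%N = 1%N.
Proof. by rewrite (bigD1 i) //= eqxx big1 // => j /negbTE ->. Qed.

(** If generator [i] does not occur in the product it is redundant, against minimality; if it
    occurs, cancelling it leaves a nontrivial relation, excluded by [gens_pointed]. *)
Lemma S2_irr i : ~ S2 (row i G).
Proof.
move=> [q [E s2]]; have [q0|qi] := eqVneq (q i) 0%N; first exact: gens_reduce q0 E.
pose q' j := (q j - (j == i))%N.
have qq j : q j = (q' j + (j == i))%N.
  by rewrite /q'; case: eqVneq => [->|_]; [rewrite subnK // lt0n|rewrite subn0 addn0].
have E0 : mon q' = 0.
  apply: (addIr (row i G)); rewrite add0r {1}mon_delta monD [RHS]E.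
  by rewrite /mon; apply: eq_bigr => j _; rewrite qq.
have := gens_pointed E0 => q'0; move: s2.
rewrite (eq_bigr (fun j => ((j == i)%N : nat))) ?sum_delta // => j _.
by rewrite qq q'0.
Qed.

Lemma S12 p q : S1 p -> S2 q -> S2 (p + q).
Proof.
move=> [i ->] [q' [-> s2]]; rewrite mon_delta monD; eexists; split; first by [].
by rewrite big_split /=; apply: leq_trans s2 _; apply: leq_addl.
Qed.
Lemma S22 p q : S2 p -> S2 q -> S2 (p + q).
Proof.
move=> [p' [-> s1]] [q' [-> s2]]; rewrite monD; eexists; split; first by [].
by rewrite big_split /=; apply: leq_trans s2 _; apply: leq_addl.
Qed.
Lemma S11 p q : S1 p -> S1 q -> S2 (p + q).
Proof.
move=> [i ->] [j ->]; rewrite !mon_delta monD; eexists; split; first by [].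
by rewrite big_split /= !sum_delta.
Qed.

Let lin (d : 'I_r -> K) (t : 'rV[K]_n) := \sum_i d i * chi (row i G) t.

Lemma lin_span d : lspan S1 (lin d).
Proof. by apply: lspan_sum => i _; apply: lspanZ; apply: lspan_chi; exists i. Qed.

(** First-order Taylor expansion in the [z i], read on the torus through exponents: constant term,
    linear part, and a remainder supported in degrees at least two. *)
Definition jet (f : X -> K) (a : K) (d : 'I_r -> K) := exists h, lspan S2 h /\
  forall t, f (e t) = a + lin d (sval t) + h (sval t).

Lemma jet_cst a : jet (fun=> a) a (fun=> 0).
Proof.
exists (fun=> 0); split; first exact: lspan0.
by move=> t; rewrite /lin big1 ?addr0 // => i _; rewrite mul0r.
Qed.

Lemma jetD f g a b c d : jet f a c -> jet g b d ->
  jet (fun x => f x + g x) (a + b) (fun i => c i + d i).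
Proof.
move=> [h [sh E]] [h' [sh' E']]; exists (fun t => h t + h' t); split.
  exact: lspanD.
move=> t; rewrite E E'.
have -> : lin (fun i => c i + d i) (sval t) = lin c (sval t) + lin d (sval t).
  by rewrite /lin -big_split; apply: eq_bigr => i _; rewrite mulrDl.
by ring.
Qed.

Lemma jetM f g a b c d : jet f a c -> jet g b d ->
  jet (fun x => f x * g x) (a * b) (fun i => b * c i + a * d i).
Proof.
move=> [h [sh E]] [h' [sh' E']].
exists (fun t => lin c t * lin d t + (a * h' t + b * h t) +
   (lin c t * h' t + lin d t * h t + h t * h' t)); split.
  apply: lspanD.
    apply: lspanD; first exact: lspanM S11 (lin_span c) (lin_span d).
    by apply: lspanD; apply: lspanZ.
  apply: lspanD; last exact: lspanM S22 sh sh'.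
  by apply: lspanD; [exact: lspanM S12 (lin_span c) sh'|exact: lspanM S12 (lin_span d) sh].
move=> t; rewrite E E'.
have -> : lin (fun i => b * c i + a * d i) (sval t) = b * lin c (sval t) + a * lin d (sval t).
  rewrite /lin !mulr_sumr -big_split; apply: eq_bigr => i _ /=; ring.
by ring.
Qed.

Lemma jet_ext f g a d : (forall t, g (e t) = f (e t)) -> jet f a d -> jet g a d.
Proof. by move=> E [h [sh Eh]]; exists h; split => // t; rewrite E Eh. Qed.

Lemma jet_eq f a a' d d' : a' = a -> (forall i, d' i = d i) -> jet f a d -> jet f a' d'.
Proof. by move=> -> /funext ->. Qed.

Lemma jet_gen i : jet (z i) 0 (fun j => (j == i)%:R).
Proof.
exists (fun=> 0); split; first exact: lspan0.
move=> t; rewrite gens_e /lin (bigD1 i) //= eqxx mul1r big1 ?addr0 ?add0r // => j /negbTE ->.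
by rewrite mul0r.
Qed.

Let Gv := [set g | exists2 m, m \in A & g = Y m v].

Lemma jet_alg f : alg Gv f -> exists d, jet f (f y) d.
Proof.
elim=> {f} [_ [m mA ->]|a|f g _ [c jf] _ [d jg]|f g _ [c jf] _ [d jg]].
- have [q Eq] := Ggen mA.
  have [->|mv] := eqVneq m v.
    exists (fun=> 0); rewrite (td_id TD Uy); apply: jet_ext (jet_cst 1) => t.
    by rewrite (td_Ye TD) // subrr chi0.
  rewrite Yy //; have [s2|s2] := leqP 2 (\sum_i q i).
    exists (fun=> 0), (chi (m - v)); split; first by apply: lspan_chi; exists q.
    move=> t; rewrite (td_Ye TD) // /lin big1 ?addr0 ?add0r // => i _.
    by rewrite mul0r.
  have [i qi] : exists i, (0 < q i)%N.
    apply: contrapT => H; case/eqP: mv; apply/eqP; rewrite -subr_eq0 Eq big1 // => i _.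
    case: (posnP (q i)) => [->|qi]; first by rewrite mulr0n.
    by case: H; exists i.
  exists (fun j => (j == i)%:R); apply: jet_ext (jet_gen i) => t.
  rewrite gens_e (td_Ye TD) // Eq; congr (chi _ _).
  have qE j : q j = ((j == i)%N : nat).
    have := s2; rewrite (bigD1 i) //=; case: eqVneq => [->|ji]; first by lia.
    by rewrite (bigD1 j) //=; lia.
  rewrite (bigD1 i) //= qE eqxx big1 ?addr0 // => j /negbTE ji.
  by rewrite qE ji mulr0n.
- by exists (fun=> 0); apply: jet_cst.
- by eexists; apply: jetD jf jg.
- by eexists; apply: jetM jf jg.
Qed.

(** The exponent of generator [i] is neither 0, nor that of another generator, nor in [S2];
    independence of characters therefore isolates its coefficient. *)
Lemma jet_zero f a d : jet f a d -> (forall t, f (e t) = 0) -> forall i, d i = 0.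
Proof.
move=> [h [sh E]] f0 i.
pose Q : set 'rV[int]_n := [set u | u <> row i G].
have F : lspan Q (fun t => (-1) * (a * chi 0 t + (\sum_(j | j != i) d j * chi (row j G) t + h t))).
  apply: lspanZ; apply: lspanD.
    by apply: lspanZ; apply: lspan_chi => /esym/eqP; rewrite (negbTE (gens_neq0 i)).
  apply: lspanD; last by apply: lspan_sub sh => u S2u Eu; apply: (@S2_irr i); rewrite -Eu.
  apply: lspan_sum => j ji; apply: lspanZ; apply: lspan_chi => /gens_inj jE.
  by rewrite jE eqxx in ji.
have H : lspan Q (fun t => d i * chi (row i G) t).
  apply: lspan_ext F _ => t it.
  have := E (exist _ t it); rewrite f0 /lin /= (bigD1 i) //= chi0 => E0.
  by apply/eqP; rewrite -subr_eq0; apply/eqP; rewrite [RHS]E0; ring.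
have H' : lspan [set row i G] (fun t => d i * chi (row i G) t).
  by apply: lspanZ; apply: lspan_chi.
have := lspan_disjoint (P := [set row i G]) (Q := Q) _ H' H (torus_one_subproof K n).
by rewrite chi_one mulr1; apply => m -> /=.
Qed.

(** An element of the square of the maximal ideal is a fraction whose numerator has zero jet. Once
    denominators are cleared, the jet of the combination of the [z i] is [c] times their nonzero
    values at [y], and it must vanish. *)
Lemma gens_independent (c : 'I_r -> K) :
  in_max_sq y (fun x => \sum_i c i * (z i x - z i y)) -> forall i, c i = 0.
Proof.
move=> [l [a [b [W [Ha Hb oW Wy H]]]]].
have [_ _ C] := td_chart TD vA.
pose Q F := exists al be, [/\ alg Gv be, jet al 0 (fun=> 0), be y != 0
  & forall t, be (e t) != 0 -> F (e t) = al (e t) / be (e t)].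
have Qm j : Q (fun x => a j x * b j x).
  have [[Wa [oWa Way ra]] a0] := Ha j; have [[Wb [oWb Wby rb]] b0] := Hb j.
  have [a1 [a2 [Ga1 Ga2 a2y Ea]]] := C _ _ _ ra Way Uy.
  have [b1 [b2 [Gb1 Gb2 b2y Eb]]] := C _ _ _ rb Wby Uy.
  have [d1 j1] := jet_alg Ga1; have [d2 j2] := jet_alg Gb1.
  have a1y : a1 y = 0.
    have [_ ] := Ea y Uy a2y; rewrite a0 => /esym/eqP.
    by rewrite mulf_eq0 invr_eq0 (negbTE a2y) orbF => /eqP.
  have b1y : b1 y = 0.
    have [_ ] := Eb y Uy b2y; rewrite b0 => /esym/eqP.
    by rewrite mulf_eq0 invr_eq0 (negbTE b2y) orbF => /eqP.
  exists (fun x => a1 x * b1 x), (fun x => a2 x * b2 x); split.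
  - exact: alg_mul.
  - by apply: jet_eq (jetM j1 j2) => [|i]; rewrite a1y b1y !mul0r ?addr0.
  - by rewrite mulf_neq0.
  - move=> t; rewrite mulf_eq0 negb_or => /andP[at0 bt0].
    have Ut := td_Ue TD t vA.
    rewrite (Ea _ Ut at0).2 (Eb _ Ut bt0).2; field.
    by rewrite at0 bt0.
have QD F F' : Q F -> Q F' -> Q (fun x => F x + F' x).
  move=> [al [be [Gb jal by0 E]]] [al' [be' [Gb' jal' by0' E']]].
  have [d jb] := jet_alg Gb; have [d' jb'] := jet_alg Gb'.
  exists (fun x => al x * be' x + al' x * be x), (fun x => be x * be' x); split.
  - exact: alg_mul.
  - apply: jet_eq (jetD (jetM jal jb') (jetM jal' jb)) => [|i];
      by rewrite ?(mul0r, mulr0, addr0).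
  - by rewrite mulf_neq0.
  - move=> t; rewrite mulf_eq0 negb_or => /andP[bt0 b't0].
    rewrite E // E' //; field; by rewrite bt0 b't0.
have Q0 : Q (fun=> 0).
  exists (fun=> 0), (fun=> 1); split; rewrite ?oner_neq0 //.
  - exact: alg_cst.
  - exact: jet_cst.
  - by move=> t _; rewrite mul0r.
have QS (s : seq 'I_l) : Q (fun x => \sum_(j <- s) a j x * b j x).
  elim: s => [|j s IH].
    by rewrite (_ : (fun x => _) = fun=> 0) //; apply/funext => x; rewrite big_nil.
  rewrite (_ : (fun x => _) = fun x => a j x * b j x + \sum_(j <- s) a j x * b j x).
    exact: QD.
  by apply/funext => x; rewrite big_cons.
have [al [be [Gb jal by0 E]]] := QS (index_enum 'I_l).
(* The expansion [H] holds on [W] only; on [U v] the factor [bW] vanishes outside of [W], which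
   extends the identity to the whole torus. *)
have [a0 [bW [_ GbW bWy HW]]] := C _ _ _ (nice_cst nX 0 oW) Wy Uy.
have [d jb] := jet_alg Gb; have [d' jbW] := jet_alg GbW.
have jz : jet (fun x => \sum_i c i * z i x) 0 c.
  exists (fun=> 0); split; first exact: lspan0.
  by move=> t; rewrite add0r addr0; apply: eq_bigr => i _; rewrite gens_e.
have JJ := jetM (jetM jb jbW) (jetD (jetM jz jb) (jetM (jet_cst (-1)) jal)).
have J2 := jet_eq (a' := 0) (d' := fun i => be y * bW y * (be y * c i)) _ _ JJ.
have {}J2 := J2 _ (fun i => _); move=> i.
have /eqP : be y * bW y * (be y * c i) = 0; last first.
  by rewrite !mulf_eq0 (negbTE by0) (negbTE bWy) /= => /eqP.
apply: (jet_zero (J2 _ _)) => [|j|]; [by ring|by ring|].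
  move=> t; have [->|bt] := eqVneq (be (e t)) 0; first by rewrite !mul0r.
  have [->|bWt] := eqVneq (bW (e t)) 0; first by rewrite mulr0 !mul0r.
  have Wt := (HW _ (td_Ue TD t vA) bWt).1.
  have := H _ Wt; rewrite E // => E1.
  have E2 : \sum_i c i * z i (e t) = al (e t) / be (e t).
    by rewrite -E1; apply: eq_bigr => j _; rewrite gens_zero subr0.
  by rewrite E2 divfK // mulN1r subrr mulr0.
Qed.

Lemma gens_regular_at i : regular_at y (z i).
Proof. exact: (reg_regular_at nX (gens_reg i) Uy). Qed.

Lemma gens_span f : regular_at y f -> exists c, deriv y z f c.
Proof.
move=> [W [oW Wy rf]]; have [_ _ C] := td_chart TD vA.
have oU := td_opn TD vA.
apply: (deriv_frac nX gens_regular_at oU Uy _ (C _ _ _ rf Wy Uy)) => _ [m mA ->].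
have [q Eq] := Ggen mA.
have H (s : seq 'I_r) : exists c, deriv y z (fun x => \prod_(i <- s) z i x ^+ q i) c.
  elim: s => [|i s [c Dc]].
    exists (fun=> 0); rewrite (_ : (fun x => _) = fun=> 1); first exact: deriv_cst.
    by apply/funext => x; rewrite big_nil.
  eexists; rewrite (_ : (fun x => _) = fun x => z i x ^+ q i * \prod_(i <- s) z i x ^+ q i).
    apply: (derivM nX gens_regular_at _ Dc).
    exact: (deriv_exp nX gens_regular_at (q i) (deriv_coord nX y z i)).
  by apply/funext => x; rewrite big_cons.
have [c Dc] := H (index_enum 'I_r); exists c.
by apply: (deriv_ext nX oU Uy _ Dc) => x Ux; apply: Y_mon.
Qed.

Lemma gens_card : r = n.
Proof.
have [t lt] := td_smooth TD y.
exact: (coords_card nX lt gens_regular_at gens_span gens_independent).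
Qed.

(** The torus coordinate [j] is regular at the unit of the torus, hence a quotient of elements of
    the algebra of [U v], whose exponents lie in the subgroup [L]. If its exponent were not in [L],
    the two sides of the cleared identity would have disjoint supports and vanish. *)
Lemma gens_group j : exists C : 'I_r -> int,
  delta_mx 0 j = \sum_i row i G *~ C i :> 'rV[int]_n.
Proof.
pose L : set 'rV[int]_n := [set u | exists C : 'I_r -> int, u = \sum_i row i G *~ C i].
have LD p q : L p -> L q -> L (p + q).
  move=> [C ->] [C' ->]; exists (fun i => C i + C' i).
  by rewrite -big_split; apply: eq_bigr => i _; rewrite mulrzDr.
have L0 : L 0 by exists (fun=> 0); rewrite big1.
have LN p : L p -> L (- p).
  move=> [C ->]; exists (fun i => - C i); rewrite -sumrN.
  by apply: eq_bigr => i _; rewrite mulrNz.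
have Lalg f : alg Gv f -> exists h, lspan L h /\ forall t, f (e t) = h (sval t).
  elim=> {f} [_ [m mA ->]|a|f g _ [h [sh E]] _ [h' [sh' E']]|f g _ [h [sh E]] _ [h' [sh' E']]].
  - exists (chi (m - v)); split; last by move=> t; rewrite (td_Ye TD).
    apply: lspan_chi; have [q ->] := Ggen mA; exists (fun i => (q i)%:Z).
    by apply: eq_bigr => i _; rewrite pmulrn.
  - exists (fun t => a * chi 0 t); split; first by apply: lspanZ; apply: lspan_chi.
    by move=> t; rewrite chi0 mulr1.
  - exists (fun t => h t + h' t); split; first exact: lspanD.
    by move=> t; rewrite E E'.
  - exists (fun t => h t * h' t); split; first exact: (lspanM LD sh sh').
    by move=> t; rewrite E E'.
have oe := td_open TD.
have O1 : range e (e (torus_one K n)) by exists (torus_one K n).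
have [_ _ C] := td_chart TD vA.
have [al [be [Ga Gb b1 E]]] := C _ _ _ (taus_reg nX oe j) O1 (td_Ue TD (torus_one K n) vA).
have [h [sh Eh]] := Lalg _ Ga; have [h' [sh' Eh']] := Lalg _ Gb.
apply: contrapT => nL.
have key t : invertible_row t -> t 0 j * (h' t * h' t) = h t * h' t.
  move=> it; have := E (e (exist _ t it)) (td_Ue TD _ vA); rewrite Eh Eh' /= => H.
  have [->|/H[_]] := eqVneq (h' t) 0; first by rewrite !mulr0.
  rewrite (taus_e oe) /= => ->; have [->|h'0] := eqVneq (h' t) 0; first by rewrite !mulr0.
  by field.
have s1 : lspan L (fun t => h t * h' t) by exact: (lspanM LD sh sh').
have s2 : lspan [set u | exists2 p, L p & u = delta_mx 0 j + p] (fun t => t 0 j * (h' t * h' t)).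
  have s3 : lspan L (fun t => h' t * h' t) by exact: (lspanM LD sh' sh').
  have s4 := lspan_chi K (P := [set delta_mx 0 j : 'rV[int]_n]) (m := delta_mx 0 j) erefl.
  apply: (lspan_ext (lspanM (S := [set u | exists2 p, L p & u = delta_mx 0 j + p]) _ s4 s3)).
    by move=> p q -> Lq; exists q.
  by move=> t _; rewrite chi_delta.
have s5 := lspan_ext s1 key.
have := lspan_disjoint _ s2 s5 (torus_one_subproof K n).
rewrite mxE mul1r => F; move: b1; rewrite Eh' => /negP; apply.
have /eqP : h' (const_mx 1) * h' (const_mx 1) = 0.
  apply: F => u [p Lp ->] Lu; apply: nL.
  have := LD _ _ Lu (LN _ Lp); rewrite addrK => -[D ED].
  by exists D.
by rewrite mulf_eq0 orbb.
Qed.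

End MinimalGens.

(** The minimal generators are n in number and generate [Z^n] as a group, so their matrix is
    unimodular. Nonnegativity of the coordinates expresses generation as a monoid. *)
Lemma vertex_basis : exists B : 'M[int]_n, [/\ B \in unitmx, forall i, v + row i B \in A
  & forall m, m \in A -> forall i, 0 <= ((m - v) *m invmx B) 0 i].
Proof.
have [r [[G [GA Ggen]] rmin]] := ex_first (ex_intro Pgen _ gens_exist).
have rn := gens_card GA Ggen rmin; have [C HC] := boolp.choice (gens_group Ggen).
subst r; exists G.
have CG : (\matrix_(j, i) C j i) *m G = 1%:M.
  apply/row_matrixP => j; rewrite row_mul row1 HC; apply/rowP => a.
  rewrite mxE summxE; apply: eq_bigr => i _.
  by rewrite -scaler_int intz !mxE.
have uG := (mulmx1_unit CG).2; split => // m mA i.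
have [q Eq] := Ggen m mA.
have -> : m - v = (\row_i (q i)%:Z) *m G.
  rewrite Eq; apply/rowP => a; rewrite mxE summxE; apply: eq_bigr => l _.
  by rewrite -scaler_nat natz !mxE.
by rewrite mulmxK // mxE.
Qed.

End Basis.

Lemma vtx_basis v : vtx v -> exists B : 'M[int]_n, [/\ B \in unitmx,
  forall i, v + row i B \in A
  & forall m, m \in A -> forall i, 0 <= ((m - v) *m invmx B) 0 i].
Proof. by move=> [vA [y [Uy Yy]]]; apply: vertex_basis Uy Yy. Qed.

End Vertices.

(** * Affine coordinates at a vertex and neighbouring vertices *)

Section VertexCharts.
Variables (K : closedFieldType) (X : ringed_set K) (n k : nat).
Variables (e : torus K n -> X) (A : seq 'rV[int]_n) (U : 'rV[int]_n -> set X).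
Variable Y : 'rV[int]_n -> 'rV[int]_n -> X -> K.
Hypothesis TD : toric_data k e A U Y.

Let nX := td_nice TD.
Let dO := td_dense TD.
Let oe := td_open TD.
Notation vtx := (vtx A U Y).

Definition basis_spec v (B : 'M[int]_n) := [/\ B \in unitmx,
  forall i, v + row i B \in A
  & forall m, m \in A -> forall i, 0 <= ((m - v) *m invmx B) 0 i].

(* The rows of [Bv v] are the primitive vectors of the edges at [v], hence the columns
   of its inverse are the rays of the cone of [v] in the fan. *)
Definition Bv v : 'M[int]_n := xget 1%:M [set B | basis_spec v B].

Lemma BvP v : vtx v -> basis_spec v (Bv v).
Proof. by move=> /(vtx_basis TD)[B HB]; exact: (xgetI 1%:M (P := [set B | basis_spec v B]) HB). Qed.

Lemma Bv_unit v : vtx v -> Bv v \in unitmx. Proof. by move/BvP => []. Qed.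

Definition xc v (x : X) : 'rV[K]_n := \row_i Y (v + row i (Bv v)) v x.
Definition ex v m : 'rV[int]_n := (m - v) *m invmx (Bv v).

Lemma ex_ge0 v m i : vtx v -> m \in A -> 0 <= ex v m 0 i.
Proof. by move=> /BvP[_ _ H] mA; apply: H. Qed.

Lemma exK v m : vtx v -> m = v + ex v m *m Bv v.
Proof. by move=> vv; rewrite /ex mulmxKV ?Bv_unit // addrC subrK. Qed.

Lemma ex_row v i : vtx v -> ex v (v + row i (Bv v)) = delta_mx 0 i.
Proof. by move=> vv; rewrite /ex addrAC subrr add0r -row_mul mulmxV ?Bv_unit // row1. Qed.

Lemma xc_e v t i : vtx v -> xc v (e t) 0 i = chi (row i (Bv v)) (sval t).
Proof.
move=> vv; have [_ BA _] := BvP vv; have [vA _] := vv.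
by rewrite mxE (td_Ye TD) // addrC addKr.
Qed.

Lemma chi_mulmx m (C : 'M[int]_n) (z : 'rV[K]_n) : invertible_row z ->
  chi m (\row_j chi (row j C) z) = chi (m *m C) z.
Proof.
move=> iz; rewrite mulmx_sum_row chi_sum //; apply: eq_bigr => j _.
by rewrite mxE -[m 0 j *: _]/(_) -[m 0 j]intz scaler_int chiMz // intz.
Qed.

Lemma xc_inv v t : vtx v -> invertible_row (xc v (e t)).
Proof.
move=> vv; apply/forallP => i; rewrite xc_e // chi_neq0 //; exact: (svalP t).
Qed.

Lemma chi_xc v (u : 'rV[int]_n) t : vtx v ->
  chi (u *m invmx (Bv v)) (xc v (e t)) = chi u (sval t).
Proof.
move=> vv; have it := svalP t.
have -> : xc v (e t) = \row_j chi (row j (Bv v)) (sval t).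
  by apply/rowP => j; rewrite xc_e // mxE.
by rewrite chi_mulmx // mulmxKV // Bv_unit.
Qed.

Lemma xc_reg v i : vtx v -> reg (U v) (fun x => xc v x 0 i).
Proof.
move=> vv; have [_ BA _] := BvP vv; have [vA _] := vv.
by apply: (reg_ext nX (td_reg TD (BA i) vA)) => y _; rewrite mxE.
Qed.

Lemma Y_xc v m x : vtx v -> m \in A -> U v x ->
  Y m v x = \prod_i xc v x 0 i ^+ absz (ex v m 0%R i).
Proof.
move=> vv mA; have [vA _] := vv; have oU := td_opn TD vA.
move: x; apply: (@dense_eq _ _ (range e) (U v) (Y m v)
   (fun x => \prod_i xc v x 0 i ^+ absz (ex v m 0%R i))) => //.
- exact: (td_reg TD).
- by apply: reg_prod => // i _; apply: reg_exp => //; apply: xc_reg.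
move=> x Ux [t _ Et]; rewrite -{x}Et in Ux *.
rewrite (td_Ye TD) // -(chi_xc _ t vv) /chi; apply: eq_bigr => i _.
by rewrite exprnP gez0_abs // ex_ge0.
Qed.

Lemma vchart v : vtx v -> chart (U v) [set f | exists i, f = fun y => xc v y 0 i].
Proof.
move=> vv; have [vA _] := vv; split; first exact: (td_opn TD).
  by move=> f [i ->]; apply: xc_reg.
move=> W g x rg Wx Ux; have [_ _ C] := td_chart TD vA.
apply: frac_rep_gen (C _ _ _ rg Wx Ux) => // _ [m mA ->].
have H (s : seq 'I_n) : alg [set f | exists i, f = fun y => xc v y 0 i]
    (fun x => \prod_(i <- s) xc v x 0 i ^+ absz (ex v m 0%R i)).
  elim: s => [|i s IH].
    by rewrite (_ : (fun x => _) = fun=> 1); [exact: alg_cst|apply/funext => y; rewrite big_nil].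
  rewrite (_ : (fun x => _) = fun x => xc v x 0 i ^+ absz (ex v m 0%R i) *
     \prod_(i <- s) xc v x 0 i ^+ absz (ex v m 0%R i)).
    apply: alg_mul => //; elim: (absz _) => [|a IHa].
      by rewrite (_ : (fun x => _) = fun=> 1); [exact: alg_cst|apply/funext => y; rewrite expr0].
    rewrite (_ : (fun x => _) = fun x => xc v x 0 i * xc v x 0 i ^+ a).
      by apply: alg_mul => //; apply: alg_gen; exists i.
    by apply/funext => y; rewrite exprS.
  by apply/funext => y; rewrite big_cons.
apply: frac_rep_sub (frac_rep_alg _ _ (H (index_enum 'I_n))) _ => y Uy _; split => //.
exact: Y_xc.
Qed.

Lemma xc_inj v x x' : vtx v -> U v x -> U v x' -> xc v x = xc v x' -> x = x'.
Proof.
move=> vv Ux Ux' E; have [vA _] := vv; apply: (td_sep TD vA) => // m mA.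
by rewrite !Y_xc // E.
Qed.

(** A point with nonzero coordinates comes from the torus. In general zeros are replaced by 1, and
    the resulting torus point is pushed to its limit along the subgroup [w], of weight 1 on the
    coordinates to be killed and 0 on the others. *)
Lemma xc_surj v z : vtx v -> exists2 x, U v x & xc v x = z.
Proof.
move=> vv; have [vA _] := vv; have [uB BA Bp] := BvP vv.
pose z' : 'rV[K]_n := \row_i (if z 0 i == 0 then 1 else z 0 i).
have iz' : invertible_row z'.
  by apply/forallP => i; rewrite mxE; case: ifP => [_|/negbT//]; rewrite oner_neq0.
pose t' : 'rV[K]_n := \row_j chi (row j (invmx (Bv v))) z'.
have it' : invertible_row t' by apply/forallP => j; rewrite mxE chi_neq0.
pose t : torus_pt K n := exist _ t' it'.
have xt i : chi (row i (Bv v)) t' = z' 0 i.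
  by rewrite chi_mulmx // -row_mul mulmxV // row1 chi_delta.
pose w : 'cV[int]_n := invmx (Bv v) *m \col_i (z 0 i == 0)%:R.
have dw m : dotp m w - dotp v w = \sum_i ex v m 0 i * (z 0 i == 0)%:R.
  rewrite -dotpB /dotp /w mulmxA mxE; apply: eq_bigr => i _.
  by rewrite [(\col_i _) i 0]mxE.
have [|y [Uy Hy]] := td_lim TD (w := w) vA (td_Ue TD t vA).
  move=> m mA _; rewrite -subr_ge0 dw; apply: sumr_ge0 => i _.
  by rewrite mulr_ge0 ?ler0n // ex_ge0.
exists y => //; apply/rowP => i; rewrite mxE Hy //.
have -> : (dotp (v + row i (Bv v)) w == dotp v w) = (z 0 i != 0).
  rewrite -subr_eq0 dw ex_row // (bigD1 i) //= mxE !eqxx mul1r big1 ?addr0; last first.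
    by move=> j /negbTE ji; rewrite mxE ji andbF mul0r.
  by case: (z 0 i == 0).
case: eqP => [->//|/eqP zi] /=.
by rewrite (td_Ye TD) // addrC addKr xt mxE (negbTE zi).
Qed.

Lemma xc_coords v x : vtx v -> U v x -> local_coords x (fun i y => xc v y 0 i).
Proof.
move=> vv Ux; have [t lt] := td_smooth TD x; have [vA _] := vv.
have rx i := reg_regular_at nX (xc_reg i vv) Ux.
apply: (coords_span nX lt rx) => f [W [oW Wx rf]]; have [_ _ C] := vchart vv.
apply: (deriv_frac nX rx (td_opn TD vA) Ux _ (C _ _ _ rf Wx Ux)) => _ [i ->].
by exists (fun j => (i == j)%:R); apply: (deriv_coord nX x (fun i y => xc v y 0 i) i).
Qed.

Lemma xc_coord_system v : vtx v -> coord_system (U v) (fun i y => xc v y 0 i).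
Proof.
move=> vv; have [vA _] := vv; split; first exact: (td_opn TD).
  by move=> i; apply: xc_reg.
by move=> x; apply: xc_coords.
Qed.

Lemma xc_jacobian_reg v : vtx v -> forall (W : set X) (s : 'I_n -> X -> K),
  (forall i, reg W (s i)) -> W `<=` U v -> opn W ->
  forall i j, reg W (fun y => jacobian s (fun i y => xc v y 0 i) y i j).
Proof.
move=> vv; have [vA _] := vv.
apply: (jacobian_reg nX (vchart vv) (fun i => xc_reg i vv) (fun x => xc_coords vv)) => _ [i ->].
exact: (dreg_coord nX (fun i y => xc v y 0 i) (td_opn TD vA)).
Qed.

Lemma range_U v : vtx v -> range e `<=` U v.
Proof. by move=> [vA _] _ [t _ <-]; apply: (td_Ue TD). Qed.

(* The order of a character along the coordinate hyperplane through a general point. *)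
Lemma monomial_order v x (V : set X) h u d i : vtx v -> U v x -> reg V h -> V x ->
  h x != 0 -> d != 0 -> (forall t, V (e t) -> h (e t) = d * chi u (sval t)) ->
  xc v x 0 i = 0 -> (forall j, j != i -> xc v x 0 j != 0) ->
  (u *m invmx (Bv v)) 0 i = 0.
Proof.
move=> vv Ux rh Vx hx d0 Hh xi xj; have [vA _] := vv.
set a := u *m invmx (Bv v).
have oV := nice_reg_opn nX rh; have oU := td_opn TD vA.
have rx j : reg (V `&` U v) (fun y => xc v y 0 j) by apply: (reg_resIr nX (xc_reg j vv) oV).
have oVU : opn (V `&` U v) by apply: nice_opnI.
have E : forall y, (V `&` U v) y ->
    h y * \prod_(j | (a 0 j < 0)%R) xc v y 0 j ^+ absz (a 0%R j)
    = d * \prod_(j | (0 < a 0 j)%R) xc v y 0 j ^+ absz (a 0%R j).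
  apply: (@dense_eq _ _ (range e) (V `&` U v)
    (fun y => h y * \prod_(j | (a 0 j < 0)%R) xc v y 0 j ^+ absz (a 0%R j))
    (fun y => d * \prod_(j | (0 < a 0 j)%R) xc v y 0 j ^+ absz (a 0%R j))) => //.
  - apply: nice_mul => //; first exact: (reg_resI nX).
    by apply: reg_prod => // j _; apply: reg_exp.
  - apply: nice_mul => //; first exact: nice_cst.
    by apply: reg_prod => // j _; apply: reg_exp.
  move=> y [Vy Uy] [t _ Et]; rewrite -{y}Et in Vy Uy *.
  rewrite Hh // -mulrA; congr (_ * _); rewrite -(chi_xc u t vv) -/a /chi.
  rewrite [RHS]big_mkcond /= [X in _ * X]big_mkcond -big_split; apply: eq_bigr => j _ /=.
  have xn : xc v (e t) 0 j != 0 by apply: inv_neq0; apply: xc_inv.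
  have [aj|aj|aj] := ltrgtP (a 0 j) 0.
  - have -> : xc v (e t) 0 j ^ a 0 j = (xc v (e t) 0 j ^+ absz (a 0%R j))^-1.
      by rewrite exprnN ltz0_abs // opprK.
    by rewrite mulVf // expf_neq0.
  - by rewrite mulr1 exprnP gtz0_abs.
  - by rewrite aj expr0z mulr1.
have := E x (conj Vx Ux); have [aj|aj|//] := ltrgtP (a 0 i) 0.
  rewrite (bigD1 i) //= xi expr0n absz_eq0 lt_eqF // mul0r mulr0 => /esym/eqP.
  rewrite mulf_eq0 (negbTE d0) /= => /eqP E0.
  have : \prod_(j | (0 < a 0 j)%R) xc v x 0 j ^+ absz (a 0%R j) != 0.
    apply/prodf_neq0 => j aj'; rewrite expf_neq0 // xj //.
    by apply: contraTneq aj' => ->; rewrite lt_gtF.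
  by rewrite E0 eqxx.
rewrite [X in _ = d * X -> _](bigD1 i) //= xi expr0n absz_eq0 gt_eqF // mul0r mulr0 => /eqP.
rewrite mulf_eq0 (negbTE hx) /= => /eqP E0.
have : \prod_(j | (a 0 j < 0)%R) xc v x 0 j ^+ absz (a 0%R j) != 0.
  apply/prodf_neq0 => j aj'; rewrite expf_neq0 // xj //.
  by apply: contraTneq aj' => ->; rewrite lt_gtF.
by rewrite E0 eqxx.
Qed.

Lemma xc_point v i : vtx v -> exists x, [/\ U v x, xc v x 0 i = 0 & forall j, j != i -> xc v x 0 j != 0].
Proof.
move=> vv; have [x Ux Ex] := xc_surj (\row_j (j != i)%:R) vv; exists x; split => //.
  by rewrite Ex mxE eqxx.
by move=> j ji; rewrite Ex mxE ji oner_neq0.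
Qed.

Lemma det_unit_intr (M : 'M[int]_n) : M \in unitmx -> (\det M)%:~R != 0 :> K.
Proof.
rewrite unitmxE => /unitrP[b [bM _]]; apply: contra_eq_neq (congr1 (fun z : int => z%:~R : K) bM).
by rewrite rmorphM /= => ->; rewrite mulr0 eq_sym oner_neq0.
Qed.

Definition qv v : 'rV[int]_n := - \sum_i row i (Bv v).

(* The section of exponent [v] generates the k-th power of the anticanonical bundle
   on [U v]. *)
Lemma vtx_formula v : vtx v -> v = (const_mx 1 + qv v) *+ k.
Proof.
move=> vv; have [vA _] := vv; have uB := Bv_unit vv.
(* [u] is the exponent of the section attached to [v], written in the frame of the coordinates
   [xc v]. This section has no zero on [U v], so [u] has order 0 along each coordinate
   hyperplane. *)
pose u := v + (\sum_i row i (Bv v) - const_mx 1) *+ k.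
suff u0 : u = 0.
  apply: (addIr ((\sum_i row i (Bv v) - const_mx 1) *+ k)); rewrite -mulrnDl -/u u0 /qv.
  by rewrite addrA subrK subrr mul0rn.
pose p : idx (anticanonical X n) := exist (fun p : set X * ('I_n -> X -> K) => coord_system p.1 p.2)
  (U v, fun i y => xc v y 0 i) (xc_coord_system vv).
have a0 i : (u *m invmx (Bv v)) 0 i = 0.
  have [x [Ux xi xj]] := xc_point i vv.
  have [V [h [rh Vx hx Hh]]] := td_section TD (p := p) vA Ux Ux.
  apply: (monomial_order (d := (\det (Bv v))%:~R ^+ k) vv Ux rh Vx hx) => //.
    by rewrite expf_neq0 // det_unit_intr.
  move=> t Vt; rewrite Hh //.
  have Ot : range e (e t) by exists t.
  have it := svalP t.
  rewrite (@jacobian_chi _ _ _ nX (td_smooth TD) e oe (Bv v)) //; last first.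
    exists (range e); split => //; first exact: (range_opn oe).
    by move=> i' _ [t' _ <-]; rewrite (tptE oe) /= xc_e.
  by rewrite (tptE oe) exprMn mulrCA; congr (_ * _); rewrite /u chiD // chiMn.
have : u *m invmx (Bv v) = 0 by apply/rowP => i; rewrite a0 mxE.
by move/(congr1 (fun M => M *m Bv v)); rewrite mulmxKV // mul0mx.
Qed.

Lemma ex_bound v : vtx v -> exists b : nat, forall m i, m \in A -> (absz (ex v m 0%R i) <= b)%N.
Proof.
move=> vv; exists (\sum_(m <- A) \sum_i absz (ex v m 0%R i))%N => m i mA.
by rewrite (big_rem m) //= (bigD1 i) //= -addnA leq_addr.
Qed.

Lemma ray_end v i : vtx v -> exists L : nat, [/\ (0 < L)%N, vtx (v + row i (Bv v) *+ L)
  & forall L', v + row i (Bv v) *+ L' \in A -> (L' <= L)%N].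
Proof.
move=> vv; have [vA _] := vv; have [uB BA Bp] := BvP vv; have [b Hb] := ex_bound vv.
have exr L : ex v (v + row i (Bv v) *+ L) = delta_mx 0 i *+ L.
  rewrite /ex addrAC subrr add0r -[row i _ *+ L]scaler_nat -scalemxAl -row_mul mulmxV // row1.
  by rewrite scaler_nat.
have exri L : ex v (v + row i (Bv v) *+ L) 0 i = L%:Z.
  by rewrite exr mulmxnE mxE !eqxx /= mulr1n natz.
pose P L := v + row i (Bv v) *+ L \in A.
have P1 : exists L, P L by exists 1%N; apply: BA.
have Pb L : P L -> (L <= b)%N.
  by move=> /(Hb _ i); rewrite exri.
have [L PL HL] := ex_maxnP P1 Pb.
exists L; split => //; first by apply: HL; apply: BA.
(* Weight -1 along the edge and [b + 1] in the other directions: as exponents are at most [b],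
   leaving the edge costs more than can be gained along it, so the minimum is attained only at the
   end of the edge. *)
pose w : 'cV[int]_n := invmx (Bv v) *m \col_j (if j == i then -1 else b.+1%:Z).
have dw m : dotp m w - dotp v w = - ex v m 0 i + b.+1%:Z * \sum_(j | j != i) ex v m 0 j.
  rewrite -dotpB /dotp /w mulmxA mxE (bigD1 i) //= mxE eqxx mulrN1; congr (_ + _).
  rewrite mulr_sumr; apply: eq_bigr => j /negbTE ji; rewrite [(\col_j _) j 0]mxE ji.
  by rewrite mulrC.
pose v' := v + row i (Bv v) *+ L.
have dv' : dotp v' w - dotp v w = - L%:Z.
  rewrite dw exri big1 ?mulr0 ?addr0 // => j /negbTE ji.
  by rewrite exr mulmxnE mxE ji andbF mul0rn.
have key m : m \in A -> dotp v' w <= dotp m w /\ (dotp m w = dotp v' w -> m = v').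
  move=> mA.
  have le : dotp m w - dotp v w >= - L%:Z /\ (dotp m w - dotp v w = - L%:Z -> m = v').
    rewrite dw; have ai := Hb m i mA; have ai0 := ex_ge0 i vv mA.
    have s0 : 0 <= \sum_(j | j != i) ex v m 0 j by apply: sumr_ge0 => j _; apply: ex_ge0.
    have [sp|s00] := ltrP 0 (\sum_(j | j != i) ex v m 0 j).
      by move: (\sum_(j | j != i) ex v m 0 j) sp s0 => S; nia.
    have sE : \sum_(j | j != i) ex v m 0 j = 0 by apply/eqP; rewrite eq_le s00 s0.
    have aj j : j != i -> ex v m 0 j = 0.
      move=> ji; apply/eqP.
      have := sE => /eqP; rewrite psumr_eq0; last by move=> l _; apply: ex_ge0.
      by move/allP/(_ j (mem_index_enum j)); rewrite ji.
    have mE : m = v + row i (Bv v) *+ absz (ex v m 0%R i).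
      rewrite {1}(exK m vv); congr (_ + _).
      rewrite mulmx_sum_row (bigD1 i) //= big1 ?addr0; last by move=> j /aj ->; rewrite scale0r.
      by rewrite -{1}(gez0_abs ai0) -scaler_nat natz.
    have aL : (absz (ex v m 0%R i) <= L)%N by apply: HL; rewrite /P -mE.
    rewrite sE mulr0 addr0; split; first by lia.
    move=> E; have : absz (ex v m 0%R i) = L by lia.
    by move=> E'; rewrite mE E'.
  have [le1 le2] := le; split; first by lia.
  by move=> E; apply: le2; lia.
have v'A : v' \in A by exact: PL.
split => //; have [|y [Uy Hy]] := td_lim TD (w := w) v'A (td_Ue TD (torus_one K n) v'A).
  by move=> m mA _; have [] := key m mA.
exists y; split => // m mA mv'; rewrite Hy //.
by case: eqP => // /(key m mA).2 E; case/eqP: mv'.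
Qed.

(** Both ends are vertices, so by [vtx_formula] their difference is divisible by [k]; the quotient
    is the length [l] in the anticanonical polytope. *)
Lemma neighbor v i : vtx v -> exists v' (l : nat), [/\ vtx v', (0 < l)%N,
  qv v' = qv v + row i (Bv v) *+ l, v' = v + row i (Bv v) *+ (k * l)
  & forall L', v + row i (Bv v) *+ L' \in A -> (L' <= k * l)%N].
Proof.
move=> vv; have [L [L0 vv' HL]] := ray_end i vv.
set v' := v + _ in vv'; have k0 := td_k TD; have uB := Bv_unit vv.
have F1 := vtx_formula vv'; have F2 := vtx_formula vv.
have E : (qv v' - qv v) *+ k = row i (Bv v) *+ L.
  have -> : qv v' - qv v = (const_mx 1 + qv v') - (const_mx 1 + qv v).
    by rewrite opprD addrACA subrr add0r.
  by rewrite mulrnBl -F1 -F2 /v' addrC addKr.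
pose c := ((qv v' - qv v) *m invmx (Bv v)) 0 i.
have scale (M : 'rV[int]_n) (a : nat) : ((M *+ a) *m invmx (Bv v)) 0 i = a%:R * (M *m invmx (Bv v)) 0 i.
  by rewrite -scaler_nat -scalemxAl [LHS]mxE.
have cE : k%:R * c = L%:R.
  have := congr1 (fun M => (M *m invmx (Bv v)) 0 i) E; rewrite /= !scale -/c => ->.
  by rewrite -row_mul mulmxV // !mxE !eqxx mulr1.
have kn : (k%:R : int) != 0 by rewrite pnatr_eq0 -lt0n.
have c0 : 0 < c by move: cE; rewrite !natz; nia.
have kl : (k * absz c)%N = L by move: cE; rewrite !natz; nia.
exists v', (absz c); split => //.
- by lia.
- apply: (addrI (- qv v)); rewrite addKr addrC; apply/rowP => j; apply: (mulfI kn).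
  have := congr1 (fun M : 'rV[int]_n => M 0 j) E; rewrite /= !mulmxnE => E'.
  by rewrite !mulr_natl -mulrnA mulnC kl.
- by rewrite kl.
- by rewrite kl.
Qed.

End VertexCharts.

(** * Combinatorics of the polytope *)

(* [Vs] are the vertices of the moment polytope, the rows of [B v] the edges at [v]
   and the columns of [invmx (B v)] the rays of the cone of [v]; [q v] is the
   corresponding vertex of the anticanonical polytope. *)
Section Combinatorics.
Variables (n : nat) (Vs : seq 'rV[int]_n) (B : 'rV[int]_n -> 'M[int]_n) (iota : int).
Let q v : 'rV[int]_n := - \sum_i row i (B v).
Hypothesis uB : forall v, v \in Vs -> B v \in unitmx.
Hypothesis facets : forall v v' i, v \in Vs -> v' \in Vs ->
  -1 <= dotp (q v') (col i (invmx (B v))).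
Hypothesis edges : forall v i, v \in Vs -> exists v' (l : nat), [/\ v' \in Vs, (0 < l)%N,
  q v' = q v + row i (B v) *+ l & iota <= l%:Z].
Hypothesis Vs0 : exists v, v \in Vs.

Let ec v i : 'cV[int]_n := col i (invmx (B v)).
Definition rays : seq 'cV[int]_n := undup [seq col p.2 (invmx (B p.1)) | p <- allpairs pair Vs (enum 'I_n)].
Let cols v : seq 'cV[int]_n := [seq ec v i | i <- enum 'I_n].
Let F v := [seq f <- rays | f \notin cols v].

Lemma dotp_Dr (m : 'rV[int]_n) (w w' : 'cV[int]_n) : dotp m (w + w') = dotp m w + dotp m w'.
Proof. by rewrite /dotp mulmxDr mxE. Qed.
Lemma dotp_0r (m : 'rV[int]_n) : dotp m 0 = 0.
Proof. by rewrite /dotp mulmx0 mxE. Qed.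
Lemma dotp_sumr (m : 'rV[int]_n) (I : Type) (r : seq I) (P : pred I) (G : I -> 'cV[int]_n) :
  dotp m (\sum_(i <- r | P i) G i) = \sum_(i <- r | P i) dotp m (G i).
Proof. by apply: (big_morph (dotp m)) => [x y|]; [exact: dotp_Dr|exact: dotp_0r]. Qed.
Lemma dotp_MnD (m m' : 'rV[int]_n) (l : nat) w : dotp (m + m' *+ l) w = dotp m w + l%:Z * dotp m' w.
Proof. by rewrite dotpD; congr (_ + _); rewrite /dotp -scaler_nat -scalemxAl mxE natz. Qed.
Lemma dotp_q v w : dotp (q v) w = - \sum_i dotp (row i (B v)) w.
Proof.
rewrite /dotp /q mulNmx mxE; congr (- _); rewrite mulmx_suml summxE.
by [].
Qed.

Lemma dotp_row v i j : v \in Vs -> dotp (row i (B v)) (ec v j) = (i == j)%:R.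
Proof.
move=> vV; have -> : (i == j)%:R = (B v *m invmx (B v)) i j by rewrite mulmxV ?uB // mxE.
by rewrite /dotp !mxE; apply: eq_bigr => l _; rewrite !mxE.
Qed.

Lemma dotp_qcol v i : v \in Vs -> dotp (q v) (ec v i) = -1.
Proof.
move=> vV; rewrite dotp_q (bigD1 i) //= dotp_row // eqxx big1 ?addr0 // => j /negbTE ji.
by rewrite dotp_row // ji.
Qed.

Lemma mem_rays v i : v \in Vs -> ec v i \in rays.
Proof.
move=> vV; rewrite mem_undup; apply/mapP; exists (v, i) => //.
by apply/allpairsP; exists (v, i); rewrite mem_enum.
Qed.

Lemma raysP f : f \in rays -> exists v i, v \in Vs /\ f = ec v i.
Proof.
rewrite mem_undup => /mapP[[v i] /allpairsP[[v' i'] /= [vV _ [-> ->]]] ->].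
by exists v', i'.
Qed.

Lemma rays_ge f v : f \in rays -> v \in Vs -> -1 <= dotp (q v) f.
Proof. by move=> /raysP[v' [i [v'V ->]]] vV; apply: facets. Qed.

Lemma ec_inj v : v \in Vs -> injective (ec v).
Proof.
move=> vV i j E; have := dotp_row i i vV; rewrite E dotp_row // eqxx.
by case: eqVneq.
Qed.

Lemma col_expand v (f : 'cV[int]_n) : v \in Vs -> f = \sum_i dotp (row i (B v)) f *: ec v i.
Proof.
move=> vV; rewrite -[LHS](mulKmx (uB vV)); apply/matrixP => a b.
rewrite ord1 [LHS]mxE [RHS]summxE; apply: eq_bigr => i _.
rewrite /dotp !mxE mulrC; congr (_ * _).
by apply: eq_bigr => j _; rewrite !mxE.
Qed.

(** If all coordinates of [f] at [v] were nonnegative, their sum would be at most 1 by the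
    inequality for [q v], so [f] would be 0 or a ray of the cone of [v]. *)
Lemma negative_coord v f : v \in Vs -> f \in rays -> f \notin cols v ->
  exists i, dotp (row i (B v)) f < 0.
Proof.
move=> vV fR fv; apply: contrapT => H.
have a0 i : 0 <= dotp (row i (B v)) f.
  by rewrite leNgt; apply/negP => ai; apply: H; exists i.
have := rays_ge fR vV; rewrite dotp_q lerN2 => s1.
have [z|[i ai]] : (forall i, dotp (row i (B v)) f = 0) \/ exists i, 0 < dotp (row i (B v)) f.
  have [[i ai]|N] := pselect (exists i, 0 < dotp (row i (B v)) f); first by right; exists i.
  left=> i; apply/eqP; rewrite eq_le a0 andbT leNgt; apply/negP => ai.
  by apply: N; exists i.
  have f0 : f = 0 by rewrite (col_expand f vV) big1 // => i _; rewrite z scale0r.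
  have [v' [i [v'V E]]] := raysP fR; have := dotp_row i i v'V.
  by rewrite -E f0 dotp_0r eqxx.
rewrite (bigD1 i) //= in s1.
have s0 : 0 <= \sum_(j | j != i) dotp (row j (B v)) f by apply: sumr_ge0.
have [aE sE] : dotp (row i (B v)) f = 1 /\ \sum_(j | j != i) dotp (row j (B v)) f = 0.
  set S := \sum_(j | j != i) _ in s0 s1 *; set D := dotp _ _ in ai s1 *.
  by move: S D s0 s1 ai => S D; lia.
move/negP: fv; apply; apply/mapP; exists i; first by rewrite mem_enum.
rewrite {1}(col_expand f vV) (bigD1 i) //= aE scale1r big1 ?addr0 // => j ji.
move/eqP: sE; rewrite psumr_eq0 // => /allP/(_ j (mem_index_enum j)).
by rewrite ji => /eqP ->; rewrite scale0r.
Qed.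

(** At the end of an edge on which [f] is negative, the pairing with [f] has dropped by at least [l]
    and is still at least -1. The two bounds come from [l >= iota] and [l >= 1]. *)
Lemma far_ray v f : v \in Vs -> f \in rays -> f \notin cols v ->
  iota - 1 <= dotp (q v) f /\ 0 <= dotp (q v) f.
Proof.
move=> vV fR fv; have [i ai] := negative_coord vV fR fv.
have [v' [l [v'V l0 E il]]] := edges i vV.
have := rays_ge fR v'V; rewrite E dotp_MnD => H.
have : l%:Z * dotp (row i (B v)) f <= - l%:Z by nia.
by lia.
Qed.

Lemma cols_sub v : v \in Vs -> {subset cols v <= rays}.
Proof. by move=> vV f /mapP[i _ ->]; apply: mem_rays. Qed.

Lemma cols_uniq v : v \in Vs -> uniq (cols v).
Proof. by move=> vV; rewrite map_inj_uniq ?enum_uniq //; apply: ec_inj. Qed.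

Lemma rays_perm v : v \in Vs -> perm_eq rays (cols v ++ F v).
Proof.
move=> vV; apply: uniq_perm; first exact: undup_uniq.
  rewrite cat_uniq cols_uniq // filter_uniq ?undup_uniq // andbT /=.
  by apply/hasPn => f; rewrite mem_filter => /andP[].
move=> f; rewrite mem_cat mem_filter; case: (boolP (f \in cols v)) => //= fv.
exact: (cols_sub vV fv).
Qed.

Lemma size_rays v : v \in Vs -> size rays = (n + size (F v))%N.
Proof.
by move=> vV; rewrite (perm_size (rays_perm vV)) size_cat size_map size_enum_ord.
Qed.

Lemma rays_sum v (G : 'cV[int]_n -> int) : v \in Vs ->
  \sum_(f <- rays) G f = \sum_i G (ec v i) + \sum_(f <- F v) G f.
Proof.
by move=> vV; rewrite (perm_big _ (rays_perm vV)) big_cat /= big_map big_enum.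
Qed.

Let w := \sum_(f <- rays) f.
Let r := (size rays - n)%N.

Lemma size_F v : v \in Vs -> size (F v) = r.
Proof. by move=> vV; rewrite /r (size_rays vV) addKn. Qed.

Lemma dotp_w v : v \in Vs -> dotp (q v) w = - n%:Z + \sum_(f <- F v) dotp (q v) f.
Proof.
move=> vV; rewrite /w dotp_sumr (rays_sum _ vV); congr (_ + _).
under eq_bigr => i _ do rewrite dotp_qcol //.
by rewrite sumr_const card_ord mulNrn natz.
Qed.

Lemma far_sum v : v \in Vs -> r%:Z * (iota - 1) <= \sum_(f <- F v) dotp (q v) f.
Proof.
move=> vV; rewrite -(size_F vV).
have : forall s : seq 'cV[int]_n, {subset s <= F v} ->
    (size s)%:Z * (iota - 1) <= \sum_(f <- s) dotp (q v) f.
  elim=> [|f s IH] sub; first by rewrite big_nil mul0r.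
  rewrite big_cons /=; have fF : f \in F v by apply: sub; rewrite mem_head.
  have {}IH := IH (fun g gs => sub g (mem_behead (s := f :: s) gs)).
  rewrite mem_filter in fF; case/andP: fF => fv fR.
  have [H _] := far_ray vV fR fv; rewrite -[(size s).+1]add1n PoszD mulrDl mul1r.
  exact: lerD.
by apply.
Qed.

Lemma minimal_vertex : exists v, v \in Vs /\ forall i, 0 <= dotp (row i (B v)) w.
Proof.
have [v0 v0V] := Vs0; have [v vV Hv] := exists_min (fun v => dotp (q v) w) v0V.
exists v; split => // i; have [v' [l [v'V l0 E _]]] := edges i vV.
by have := Hv v' v'V; rewrite E dotp_MnD; nia.
Qed.

Lemma comb_bound : r%:Z * (iota - 1) <= n%:Z.
Proof.
have [v [vV H]] := minimal_vertex; have := far_sum vV; have := dotp_w vV.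
rewrite dotp_q; have : 0 <= \sum_i dotp (row i (B v)) w by apply: sumr_ge0.
by lia.
Qed.

(** * The equality case of the combinatorial bound *)

Section Equality.
Hypothesis eqn : r%:Z * (iota - 1) = n%:Z.

(** At the minimal vertex the coordinates of [w] are nonnegative and their sum, [n] minus the far
    pairings, is at most 0. *)
Lemma w_zero : w = 0.
Proof.
have [v [vV H]] := minimal_vertex; have := far_sum vV; have := dotp_w vV.
rewrite dotp_q eqn => H1 H2.
have s0 : 0 <= \sum_i dotp (row i (B v)) w by apply: sumr_ge0.
have /eqP : \sum_i dotp (row i (B v)) w = 0 by lia.
rewrite psumr_eq0 // => /allP z; rewrite (col_expand w vV) big1 // => i _.
by have /eqP -> := z i (mem_index_enum i); rewrite scale0r.
Qed.

(** As [w = 0], the pairings with the [r] far rays sum to [n = r (iota - 1)] at every vertex, not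
    only at the minimal one, and none of them is below [iota - 1]. *)
Lemma far_value v f : v \in Vs -> f \in rays -> f \notin cols v -> dotp (q v) f = iota - 1.
Proof.
move=> vV fR fv; have fF : f \in F v by rewrite mem_filter fv.
have := dotp_w vV; rewrite w_zero dotp_0r => S.
have [le _] := far_ray vV fR fv; apply/eqP; rewrite eq_le le andbT.
have : (r.-1)%:Z * (iota - 1) <= \sum_(g <- rem f (F v)) dotp (q v) g.
  have -> : r.-1 = size (rem f (F v)) by rewrite size_rem // size_F.
  have : {subset rem f (F v) <= F v} by move=> g; apply: mem_rem.
  elim: (rem f (F v)) => [|g s IH] sub; first by rewrite big_nil mul0r.
  rewrite big_cons /=; have gF : g \in F v by apply: sub; rewrite mem_head.
  have {}IH := IH (fun h hs => sub h (mem_behead (s := g :: s) hs)).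
  rewrite mem_filter in gF; case/andP: gF => gv gR.
  have [H _] := far_ray vV gR gv; rewrite -[(size s).+1]add1n PoszD mulrDl mul1r.
  exact: lerD.
rewrite (perm_big _ (perm_to_rem fF)) /= big_cons in S.
have r0 : (0 < r)%N by rewrite -(size_F vV); case: (F v) fF.
have rE : r%:Z = (r.-1)%:Z + 1 by lia.
have ar (a b c d g : int) : b + g = a -> b <= d -> 0 = - a + (c + d) -> c <= g by lia.
by move=> le'; apply: (ar _ _ _ _ _ _ le' S); rewrite -eqn rE mulrDl mul1r.
Qed.

Lemma rays_value v f : v \in Vs -> f \in rays ->
  dotp (q v) f = if f \in cols v then -1 else iota - 1.
Proof.
move=> vV fR; case: ifPn => [/mapP[i _ ->]|]; first exact: dotp_qcol.
exact: far_value.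
Qed.

(** Along the edge the pairing with [f] moves from [iota - 1] by [l] times the coordinate and must
    land on [-1] or [iota - 1]. Since [l >= iota], only the coordinates 0 and -1 are possible. *)
Lemma far_coord v f i : v \in Vs -> f \in F v ->
  dotp (row i (B v)) f = 0 \/ dotp (row i (B v)) f = -1.
Proof.
move=> vV; rewrite mem_filter => /andP[fv fR].
have [_ D0] := far_ray vV fR fv; have DE := far_value vV fR fv; rewrite DE in D0.
have [v' [l [v'V l0 E il]]] := edges i vV.
have := rays_value v'V fR; rewrite E dotp_MnD DE => H.
have H' : iota - 1 + l%:Z * dotp (row i (B v)) f = -1 \/
    iota - 1 + l%:Z * dotp (row i (B v)) f = iota - 1 by rewrite H; case: ifP; [left|right].
have [p|p|p] := ltrgtP (dotp (row i (B v)) f) 0; last by left.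
  have [p2|p2] := lerP (dotp (row i (B v)) f) (-2).
    have : l%:Z * dotp (row i (B v)) f <= - 2 * l%:Z by nia.
    by case: H'; nia.
  by right; lia.
have : l%:Z <= l%:Z * dotp (row i (B v)) f by nia.
by case: H'; lia.
Qed.

Lemma coord_sum v i : v \in Vs -> \sum_(f <- F v) dotp (row i (B v)) f = -1.
Proof.
move=> vV; have := dotp_0r (row i (B v)); rewrite -w_zero /w dotp_sumr (rays_sum _ vV).
rewrite (bigD1 i) //= dotp_row // eqxx big1 ?addr0; last first.
  by move=> j ji; rewrite dotp_row // eq_sym (negbTE ji).
by move=> H; lia.
Qed.

(** The coordinates are 0 or -1 and sum to -1. Each ray of the cone of [v] is thereby assigned to
    one far ray, which defines the blocks. *)
Lemma coord_unique v i : v \in Vs -> exists f, [/\ f \in F v, dotp (row i (B v)) f = -1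
  & forall g, g \in F v -> dotp (row i (B v)) g = -1 -> g = f].
Proof.
move=> vV; have := coord_sum i vV.
have uF : uniq (F v) by rewrite filter_uniq // undup_uniq.
have [[f [fF E]]|N] := pselect (exists f, f \in F v /\ dotp (row i (B v)) f = -1); last first.
  rewrite big1_seq // => f /andP[_ fF]; have [//|E] := far_coord i vV fF.
  by case: N; exists f.
move=> S; exists f; split => // g gF Eg; apply: contrapT => /eqP gf.
move: S; rewrite (bigD1_seq f) //= E (big_rem g) //= gf Eg.
have ar (a : int) : a <= 0 -> -1 + (-1 + a) = -1 -> False by lia.
apply: ar; rewrite big_seq_cond; apply: sumr_le0 => j /andP[/mem_rem jF _].
by have [->|->] := far_coord i vV jF.
Qed.

(** For a reference vertex [v0], block [a] consists of the far ray [fa a] and of the rays of the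
    cone on which its coordinate is -1. There are [iota - 1] of these because [fa a] pairs to
    [iota - 1], and the block sums to 0 because [fa a] is minus their sum. *)
Lemma comb_equality : exists eps : 'I_r -> 'I_(absz (iota - 1)).+1 -> 'cV[int]_n,
  [/\ [/\ forall v i, v \in Vs -> exists a b, col i (invmx (B v)) = eps a b,
      forall a b a' b', eps a b = eps a' b' -> a = a' /\ b = b'
    & forall a, \sum_b eps a b = 0],
    forall v a b, v \in Vs -> dotp (q v) (eps a b) = -1 ->
      exists i, eps a b = col i (invmx (B v)),
    forall v, v \in Vs -> exists be, forall a b, dotp (q v) (eps a b) =
      if b == be a then (absz (iota - 1))%:Z else -1
   & forall be, exists v, v \in Vs /\ forall a b, dotp (q v) (eps a b) =
      if b == be a then (absz (iota - 1))%:Z else -1].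
Proof.
have [v0 v0V] := Vs0; set d := absz (iota - 1).
have szF := size_F v0V.
have uF : uniq (F v0) by rewrite filter_uniq // undup_uniq.
pose fa (a : 'I_r) : 'cV[int]_n := nth (0 : 'cV[int]_n) (F v0) a.
have faF a : fa a \in F v0 by rewrite mem_nth // szF.
have fa_inj : injective fa.
  by move=> a a' /eqP; rewrite nth_uniq ?szF // => /eqP /val_inj.
(* Without a far ray the sign of [iota - 1] is not controlled, so this identity takes an index [a]
   as a witness. *)
have dE (a : 'I_r) : d%:Z = iota - 1.
  have := faF a; rewrite mem_filter => /andP[fv fR].
  have [_] := far_ray v0V fR fv; rewrite (far_value v0V fR fv) /d; lia.
pose I a := [set i | dotp (row i (B v0)) (fa a) == -1]%SET.
have IE a i : dotp (row i (B v0)) (fa a) = - ((i \in I a)%N : nat)%:Z.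
  by rewrite inE; have [->|->] := far_coord i v0V (faF a).
have cardI a : #|I a| = d.
  have := faF a; rewrite mem_filter => /andP[fv fR].
  have := far_value v0V fR fv; rewrite -(dE a) dotp_q.
  under eq_bigr => i _ do rewrite IE.
  rewrite sumrN opprK -(big_morph _ PoszD (erefl 0%:Z)) => -[] <-.
  by rewrite -sum1_card big_mkcond; apply: eq_bigr => i _; case: (i \in I a).
pose block (a : 'I_r) : seq 'cV[int]_n := fa a :: [seq ec v0 i | i <- enum (I a)].
have sz_block a : size (block a) = d.+1 by rewrite /= size_map -cardE cardI.
have col_notF i : ec v0 i \notin F v0.
  by rewrite mem_filter negb_and negbK; apply/orP; left; apply: map_f; rewrite mem_enum.
have block_uniq a : uniq (block a).
  rewrite /= map_inj_uniq ?enum_uniq ?andbT; last exact: ec_inj.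
  by apply/mapP => -[i _ E]; have := faF a; rewrite E (negbTE (col_notF i)).
pose eps (a : 'I_r) (b : 'I_d.+1) : 'cV[int]_n := nth (0 : 'cV[int]_n) (block a) b.
have eps_mem a b : eps a b \in block a by rewrite mem_nth // sz_block.
have blockP a (f : 'cV[int]_n) : f \in block a -> exists b, f = eps a b.
  move=> fb; have ib : (index f (block a) < d.+1)%N by rewrite -(sz_block a) index_mem.
  by exists (Ordinal ib); rewrite /eps /= nth_index.
have block_rays a (f : 'cV[int]_n) : f \in block a -> f \in rays.
  rewrite in_cons => /orP[/eqP ->|/mapP[i _ ->]]; last exact: mem_rays.
  by have := faF a; rewrite mem_filter => /andP[].
have block_inj a a' (f : 'cV[int]_n) : f \in block a -> f \in block a' -> a = a'.
  rewrite !in_cons => /orP[/eqP ->|/mapP[i iI ->]].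
    move=> /orP[/eqP/fa_inj//|/mapP[j _ E]].
    by have := faF a; rewrite E (negbTE (col_notF j)).
  rewrite mem_enum in iI; move=> /orP[/eqP E|/mapP[j jI Eij]].
    by have := faF a'; rewrite -E (negbTE (col_notF i)).
  rewrite mem_enum -(ec_inj v0V Eij) in jI.
  have [f0 [_ _ uf]] := coord_unique i v0V; apply: fa_inj.
  have Ea : dotp (row i (B v0)) (fa a) = -1 by rewrite IE iI.
  have Ea' : dotp (row i (B v0)) (fa a') = -1 by rewrite IE jI.
  exact: etrans (uf _ (faF a) Ea) (esym (uf _ (faF a') Ea')).
have rays_block (f : 'cV[int]_n) : f \in rays -> exists a b, f = eps a b.
  move=> fR; suff [a fa'] : exists a, f \in block a by have [b ->] := blockP a f fa'; exists a, b.
  have [/mapP[i _ ->]|fv] := boolP (f \in cols v0).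
    have [g [gF Eg _]] := coord_unique i v0V.
    have gi : (index g (F v0) < r)%N by rewrite -szF index_mem.
    exists (Ordinal gi); rewrite in_cons; apply/orP; right; apply: map_f.
    by rewrite mem_enum inE /fa /= nth_index // Eg.
  have fF : f \in F v0 by rewrite mem_filter fv.
  have fi : (index f (F v0) < r)%N by rewrite -szF index_mem.
  by exists (Ordinal fi); rewrite in_cons /fa /= nth_index // eqxx.
have eps_inj a b a' b' : eps a b = eps a' b' -> a = a' /\ b = b'.
  move=> E; have aa : a = a' by apply: (@block_inj _ _ (eps a b)); rewrite ?eps_mem // E.
  split => //; move: E; rewrite -aa => /eqP.
  by rewrite /eps nth_uniq ?sz_block // => /eqP /val_inj.
have eps_sum a : \sum_b eps a b = 0.
  have -> : \sum_b eps a b = \sum_(f <- block a) f.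
    by rewrite [RHS](big_nth 0) sz_block big_mkord.
  rewrite big_cons big_map {1}(col_expand (fa a) v0V) big_enum /= [X in _ + X]big_mkcond.
  rewrite -big_split big1 //= => i _; rewrite IE.
  by case: (i \in I a); rewrite ?scaleN1r ?addNr // oppr0 scale0r addr0.
have eps_rays a b : eps a b \in rays by apply: (block_rays a); apply: eps_mem.
have value v a b : v \in Vs -> dotp (q v) (eps a b) = -1 \/ dotp (q v) (eps a b) = d%:Z.
  by move=> vV; rewrite (rays_value vV) // (dE a); case: ifP; [left|right].
(* The pairings with a block are [d + 1] numbers equal to -1 or [d] and of sum 0, so exactly one of
   them is [d]. *)
have vertex_choice v : v \in Vs -> exists be, forall a b, dotp (q v) (eps a b) =
    if b == be a then d%:Z else -1.
  move=> vV; suff H a : exists be, forall b, dotp (q v) (eps a b) = if b == be then d%:Z else -1.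
    by have [be Hbe] := boolp.choice H; exists be.
  have S := dotp_0r (q v); rewrite -(eps_sum a) dotp_sumr in S.
  have [[b Eb]|N] := pselect (exists b, dotp (q v) (eps a b) = d%:Z); last first.
    move: S; rewrite (eq_bigr (fun=> -1)); last first.
      by move=> b _; have [//|E] := value v a b vV; case: N; exists b.
    by rewrite sumr_const card_ord mulNrn natz.
  exists b => b'; case: eqVneq => [->//|bb'].
  have [//|Eb'] := value v a b' vV.
  move: S; rewrite (bigD1 b) //= (bigD1 b') //= Eb Eb'.
  have : - (d.-1)%:Z <= \sum_(i < d.+1 | (i != b) && (i != b')) dotp (q v) (eps a i).
    have cd : #|[pred i : 'I_d.+1 | (i != b) && (i != b')]| = d.-1.
      have := cardC [set b; b']%SET; rewrite cards2 (eq_sym b) bb' card_ord /= add2n => -[Ed].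
      have -> : d.-1 = #|[predC [set b; b']%SET]| by rewrite -[in LHS]Ed.
      by apply: eq_card => i; rewrite !inE negb_or.
    apply: le_trans (_ : \sum_(i < d.+1 | (i != b) && (i != b')) (-1) <= _).
      by rewrite sumr_const cd mulNrn natz.
    by apply: ler_sum => i _; have [->|->] := value v a i vV.
  have ar (m i j : nat) (x : int) : (i < m.+1)%N -> (j < m.+1)%N -> (i != j)%N ->
    - (m.-1)%:Z <= x -> m%:Z + (m%:Z + x) = 0 -> False by lia.
  by move=> h1 h2; case: (ar _ _ _ _ (ltn_ord b') (ltn_ord b) bb' h1 h2).
have col_of v a b : v \in Vs -> dotp (q v) (eps a b) = -1 -> exists i, eps a b = col i (invmx (B v)).
  move=> vV; rewrite (rays_value vV) //; case: ifPn => [/mapP[i _ E]|_]; first by exists i.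
  by rewrite -(dE a).
exists eps; split.
- by split => // v i vV; apply: rays_block; apply: mem_rays.
- exact: col_of.
- exact: vertex_choice.
(* Every choice of omitted rays is reached from that of [v0] by crossing edges: each crossing
   corrects one block and leaves the others unchanged, so the number of wrong blocks decreases. *)
move=> be; suff : forall m v ga, v \in Vs -> (forall a b, dotp (q v) (eps a b) =
    if b == ga a then d%:Z else -1) -> (#|[set a | ga a != be a]%SET| <= m)%N ->
    exists v, v \in Vs /\ forall a b, dotp (q v) (eps a b) = if b == be a then d%:Z else -1.
  by have [ga Hga] := vertex_choice v0 v0V; move=> /(_ _ v0 ga v0V Hga (leqnn _)).
elim=> [|m IH] v ga vV Hga.
  rewrite leqn0 cards_eq0 => /eqP z; exists v; split => // a b; rewrite Hga.
  suff -> : ga a = be a by [].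
  by apply/eqP; apply: contraT => ne; have := finset.in_set0 a; rewrite -z inE ne.
have [z|[a]] := set_0Vmem [set a | ga a != be a]%SET.
  by move=> _; apply: (IH v ga vV Hga); rewrite z cards0.
rewrite inE => ne card_le.
have [|i Ei] := col_of v a (be a) vV; first by rewrite Hga eq_sym (negbTE ne).
have [v' [l [v'V l0 E il]]] := edges i vV.
have [ga' Hga'] := vertex_choice v' v'V.
(* The cone of [v'] keeps all the rays of the cone of [v] except the one dual to the edge. *)
have other a' b' : dotp (q v) (eps a' b') = -1 -> (a', b') != (a, be a) ->
    dotp (q v') (eps a' b') = -1.
  move=> E1 ne'; have [j Ej] := col_of v a' b' vV E1.
  rewrite E dotp_MnD E1 Ej (dotp_row i j vV); case: eqVneq => [ij|_]; last by rewrite mulr0 addr0.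
  have [aa bb] : a' = a /\ b' = be a by apply: eps_inj; rewrite Ej Ei ij.
  by rewrite aa bb eqxx in ne'.
have ga'E a' : a' != a -> ga' a' = ga a'.
  move=> aa; apply/eqP; apply: contraT => gg.
  have := other a' (ga' a'); rewrite Hga (negbTE gg) Hga' eqxx => /(_ erefl).
  by rewrite xpair_eqE (negbTE aa) /= => /(_ isT).
have ga'a : ga' a = be a.
  apply/eqP; apply: contraT => gg.
  have := Hga' a (be a); rewrite eq_sym (negbTE gg) E dotp_MnD Hga eq_sym (negbTE ne) Ei.
  by rewrite (dotp_row i i vV) eqxx => h; move: l0; clear -h; lia.
apply: (IH v' ga' v'V Hga'); rewrite -ltnS; apply: leq_trans card_le; apply: proper_card.
apply/properP; split.
  apply/fintype.subsetP => x; rewrite !inE; have [->|xa] := eqVneq x a.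
    by rewrite ga'a eqxx.
  by rewrite ga'E.
by exists a; rewrite !inE ?ga'a ?eqxx.
Qed.

End Equality.
End Combinatorics.

(** * Bound on the Picard number *)

(** A rational vector of the left kernel exists by rank; multiplying by the product of all
    denominators makes it integral. *)
Lemma int_left_kernel (q r : nat) (M : 'M[int]_(q, r)) : (r < q)%N ->
  exists a : 'rV[int]_q, a != 0 /\ a *m M = 0.
Proof.
move=> rq; pose M' : 'M[rat]_(q, r) := map_mx intr M.
have k0 : kermx M' != 0.
  rewrite -mxrank_eq0 mxrank_ker -lt0n subn_gt0.
  exact: leq_ltn_trans (rank_leq_col _) rq.
have [v [v0 vM]] : exists v : 'rV[rat]_q, v != 0 /\ v *m M' = 0.
  exists (nz_row (kermx M')); split; first by rewrite nz_row_eq0.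
  by apply/sub_kermxP; apply: nz_row_sub.
pose a : 'rV[int]_q := \row_i (numq (v 0 i) * \prod_(j | j != i) denq (v 0 j)).
pose D : rat := \prod_j (denq (v 0 j))%:~R.
have D0 : D != 0 by apply/prodf_neq0 => j _; rewrite intr_eq0 denq_neq0.
have aE : map_mx intr a = D *: v.
  apply/rowP => i; rewrite !mxE intrM rmorph_prod /D [in RHS](bigD1 i) //= numqE.
  by rewrite [RHS]mulrC mulrA.
exists a; split.
  apply: contraNneq v0 => a0; have := aE; rewrite a0 map_mx0 => /esym/eqP.
  by rewrite scaler_eq0 (negbTE D0).
have E : map_mx intr (a *m M) = 0 :> 'M[rat]_(1, r).
  by rewrite map_mxM aE -scalemxAl vM scaler0.
by apply/matrixP => i j; apply: (@intr_inj rat); move/matrixP/(_ i j): E; rewrite !mxE.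
Qed.

Section Picard.
Variables (K : closedFieldType) (X : ringed_set K) (n k : nat).
Variables (e : torus K n -> X) (A : seq 'rV[int]_n) (U : 'rV[int]_n -> set X).
Variable Y : 'rV[int]_n -> 'rV[int]_n -> X -> K.
Hypothesis TD : toric_data k e A U Y.

Let nX := td_nice TD.
Let dO := td_dense TD.
Let oe := td_open TD.
Notation vtx := (vtx A U Y).
Notation Bv := (Bv A).
Notation ec v i := (col i (invmx (Bv v))).

Definition vtxs := [seq v <- A | `[< vtx v >]].
Lemma vtxsP v : v \in vtxs <-> vtx v.
Proof.
rewrite mem_filter; split=> [/andP[/asboolP]//|vv].
by apply/andP; split; [apply/asboolP|case: vv].
Qed.

Lemma U_dense v : vtx v -> dense (U v).
Proof.
move=> vv W oW W0; have [x [Wx Ox]] := dO oW W0; exists x; split => //.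
exact: (range_U TD vv).
Qed.

Lemma qv_e v i : vtx v -> dotp (qv A v) (ec v i) = -1.
Proof.
move=> vv; apply: (@dotp_qcol n vtxs Bv); last exact/vtxsP.
by move=> u /vtxsP uv; apply: (Bv_unit TD).
Qed.

Lemma ex_dotp v m i : ex A v m 0 i = dotp (m - v) (ec v i).
Proof.
rewrite /ex /dotp !mxE; apply: eq_bigr => j _; by rewrite !mxE.
Qed.

Lemma ex_vtx v v' i : vtx v -> vtx v' ->
  ex A v v' 0 i = k%:Z * (dotp (qv A v') (ec v i) + 1).
Proof.
move=> vv vv'; rewrite ex_dotp.
have -> : v' - v = (qv A v' - qv A v) *+ k.
  rewrite {1}(vtx_formula TD vv') {1}(vtx_formula TD vv) -mulrnBl.
  by rewrite opprD addrACA subrr add0r.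
rewrite -[_ *+ k]add0r dotp_MnD dotpB qv_e // opprK.
by rewrite /dotp mul0mx mxE add0r.
Qed.

Lemma vtx_facets v v' i : vtx v -> vtx v' -> -1 <= dotp (qv A v') (ec v i).
Proof.
move=> vv vv'; have [v'A _] := vv'; have := ex_ge0 TD i vv v'A.
rewrite ex_vtx //; have := td_k TD.
move: (dotp _ _) => x; nia.
Qed.

Section Bundle.
Variable L : cocycle X.
Hypothesis hL : line_bundle L.

Lemma dom_cover x : exists i : idx L, dom i x.
Proof. by case: hL. Qed.

Lemma bundle_generator v : vtx v -> exists s, generates (L := L) (U v) s.
Proof.
move=> vv; apply: (affine_line_bundle_trivial nX (U_dense vv) (vchart TD vv) _ hL).
by move=> z; apply: (xc_surj TD).
Qed.

Lemma ratio_local (V V' : set X) s s' : opn V -> opn V' -> generates (L := L) V s -> generates V' s' ->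
  forall (i j : idx L) x, dom i x -> dom j x -> V x -> V' x ->
  s i x / s' i x = s j x / s' j x.
Proof.
move=> oV oV' [rs gs] [rs' gs'] i j x Di Dj Vx V'x.
have [si0 /(_ j Dj) Ei] := gs i x Di Vx; have [s'i0 /(_ j Dj) E'i] := gs' i x Di V'x.
have [_ _ _ tn _] := hL; have t0 := tn _ _ _ Di Dj.
have [s'j0 _] := gs' j x Dj V'x.
by rewrite Ei E'i -mulf_div divff // mul1r.
Qed.

(** Over the torus two frames differ by an invertible regular function, that is a constant times a
    character. *)
Lemma generator_ratio v v' s s' : vtx v -> vtx v' ->
  generates (L := L) (U v) s -> generates (U v') s' ->
  exists c m, c != 0 /\ forall (i : idx L) t, dom i (e t) ->
    s i (e t) = c * chi m (sval t) * s' i (e t).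
Proof.
move=> vv vv' gs gs'; have [vA _] := vv; have [v'A _] := vv'.
have oV := td_opn TD vA; have oV' := td_opn TD v'A.
have [ix Hix] := boolp.choice dom_cover.
pose g x := s (ix x) x / s' (ix x) x.
have [[rs ns] [rs' ns']] := (gs, gs'); have [od _ _ _ _] := hL.
have rg : reg (range e) g.
  apply: nice_reg => // x Ox; have Ux := range_U TD vv Ox; have U'x := range_U TD vv' Ox.
  pose W := dom (ix x) `&` range e.
  have oW : opn W by apply: nice_opnI => //; exact: (range_opn oe).
  exists W, (fun y => s (ix x) y / s' (ix x) y); split => //.
  - apply: nice_mul => //.
      by apply: (nice_res nX (rs (ix x))) => // y [Dy Oy]; split => //; apply: (range_U TD vv).
    apply: reg_inv => //.
      by apply: (nice_res nX (rs' (ix x))) => // y [Dy Oy]; split => //; apply: (range_U TD vv').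
    by move=> y [Dy Oy]; have [] := ns' _ _ Dy (range_U TD vv' Oy).
  - move=> y [Dy Oy]; split => //; apply: (ratio_local oV oV' gs gs') => //.
      exact: (range_U TD vv).
    exact: (range_U TD vv').
have rt := torus_pullback_reg oe rg (fun x Ox => Ox).
have [|c [m [c0 E]]] := torus_unit rt.
  move=> t; have De := Hix (e t); rewrite /g.
  have [a _] := ns _ _ De (td_Ue TD t vA); have [b _] := ns' _ _ De (td_Ue TD t v'A).
  by rewrite mulf_neq0 // invr_neq0.
exists c, m; split => // i t Dt; rewrite -E /g.
have Ut := td_Ue TD t vA; have U't := td_Ue TD t v'A.
rewrite (ratio_local oV oV' gs gs' (Hix (e t)) Dt Ut U't) divfK //.
by have [] := ns' _ _ Dt U't.
Qed.

Lemma bundle_data v0 : vtx v0 -> exists (s : 'rV[int]_n -> idx L -> X -> K) c m, [/\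
  forall v, vtx v -> generates (U v) (s v), forall v, vtx v -> c v != 0, m v0 = 0
  & forall v (i : idx L) t, vtx v -> dom i (e t) ->
     s v i (e t) = c v * chi (m v) (sval t) * s v0 i (e t)].
Proof.
move=> vv0; have [s0 g0] := bundle_generator vv0.
have H v : exists scm : (idx L -> X -> K) * K * 'rV[int]_n, vtx v -> [/\
    generates (U v) scm.1.1, scm.1.2 != 0, v = v0 -> scm.1.1 = s0 /\ scm.2 = 0
   & forall (i : idx L) t, dom i (e t) ->
     scm.1.1 i (e t) = scm.1.2 * chi scm.2 (sval t) * s0 i (e t)].
  have [vv|] := pselect (vtx v); last by exists (s0, 1, 0).
  have [->|vv'] := eqVneq v v0.
    exists (s0, 1, 0) => _; split; rewrite ?oner_neq0 //= => i t _.
    by rewrite chi0 !mul1r.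
  have [s gs] := bundle_generator vv; have [c [m [c0 E]]] := generator_ratio vv vv0 gs g0.
  by exists (s, c, m) => _; split => // vE; rewrite vE eqxx in vv'.
have [F HF] := boolp.choice H.
have [_ _ F0 _] := HF v0 vv0; have [F1 F2] := F0 erefl.
exists (fun v => (F v).1.1), (fun v => (F v).1.2), (fun v => (F v).2); split => //.
- by move=> v /HF[].
- by move=> v /HF[].
- by move=> v i t vv Dt; rewrite F1; have [_ _ _ E] := HF v vv; apply: E.
Qed.

(* Along a common facet the two trivializations have the same order. *)
Lemma order_agree v v' s s' c m i i' : vtx v -> vtx v' ->
  generates (L := L) (U v) s -> generates (U v') s' -> c != 0 ->
  (forall (j : idx L) t, dom j (e t) -> s j (e t) = c * chi m (sval t) * s' j (e t)) ->
  ec v i = ec v' i' -> dotp m (ec v i) = 0.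
Proof.
move=> vv vv' gs gs' c0 E Ec; have [vA _] := vv; have [v'A _] := vv'.
have [x [Ux xi xj]] := xc_point TD i vv.
have U'x : U v' x.
  rewrite (td_UY TD v' Ux) (Y_xc TD vv v'A Ux); apply/prodf_neq0 => j _.
  have [->|ji] := eqVneq j i; last by rewrite expf_neq0 // xj.
  by rewrite ex_vtx // Ec qv_e // addNr mulr0 expr0 oner_neq0.
have [j Dj] := dom_cover x; have [[rs ns] [rs' ns']] := (gs, gs'); have [od _ _ _ _] := hL.
pose V := dom j `&` (U v `&` U v').
have oV : opn V by apply: nice_opnI => //; apply: nice_opnI => //; apply: (td_opn TD).
have rh : reg V (fun y => s j y / s' j y).
  apply: nice_mul => //; first by apply: (nice_res nX (rs j)) => // y [Dy []].
  apply: reg_inv => //; first by apply: (nice_res nX (rs' j)) => // y [Dy []].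
  by move=> y [Dy [_ U'y]]; have [] := ns' _ _ Dy U'y.
have Vx : V x by split.
have -> : dotp m (ec v i) = (m *m invmx (Bv v)) 0 i.
  by rewrite /dotp !mxE; apply: eq_bigr => l _; rewrite !mxE.
apply: (monomial_order TD (d := c) vv Ux rh Vx) => //.
  have [a _] := ns _ _ Dj Ux; have [b _] := ns' _ _ Dj U'x.
  by rewrite mulf_neq0 // invr_neq0.
move=> t [Dt [_ U't]]; rewrite E // mulfK //.
by have [] := ns' _ _ Dt U't.
Qed.

(** [al] plays the role of the support function of the bundle: by [order_agree] its value on a ray
    does not depend on the vertex whose cone contains the ray. As it vanishes on the cone of [v0],
    it amounts to one integer for each remaining ray. *)
Lemma bundle_orders v0 : vtx v0 -> exists (s : 'rV[int]_n -> idx L -> X -> K) c m al, [/\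
  forall v, vtx v -> generates (U v) (s v), forall v, vtx v -> c v != 0,
  forall v (i : idx L) t, vtx v -> dom i (e t) ->
     s v i (e t) = c v * chi (m v) (sval t) * s v0 i (e t),
  forall v i, vtx v -> dotp (m v) (ec v i) = al (ec v i)
  & forall i, al (ec v0 i) = 0].
Proof.
move=> vv0; have [s [c [m [gs c0 m0 E]]]] := bundle_data vv0.
have H f : exists a : int, forall v i, vtx v -> ec v i = f -> dotp (m v) f = a.
  have [[v [i [vv Ef]]]|N] := pselect (exists v i, vtx v /\ ec v i = f); last first.
    by exists 0 => v i vv Ef; case: N; exists v, i.
  exists (dotp (m v) f) => v' i' vv' Ef'; apply/eqP; rewrite -subr_eq0 -dotpB -Ef'; apply/eqP.
  apply: (@order_agree v' v (s v') (s v) (c v' / c v) (m v' - m v) i' i) => //; rewrite ?Ef' ?Ef //.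
  - exact: gs.
  - exact: gs.
  - by rewrite mulf_neq0 ?invr_neq0 ?c0.
  - move=> j t Dt; rewrite E // (E v) // chiB; last exact: (svalP t).
    field; rewrite c0 // chi_neq0 //; exact: (svalP t).
have [al Hal] := boolp.choice H.
exists s, c, m, al; split => //.
  by move=> v i vv; apply: Hal vv _.
move=> i; rewrite -(Hal _ v0 i vv0) // m0.
by rewrite /dotp mul0mx mxE.
Qed.

End Bundle.

(** A global frame pulled back to a curve has neither zeros nor poles, so the degree is computed
    with an empty set of points. *)
Lemma degree0_of_generator (M : cocycle X) : 
  (exists s, generates (L := M) setT s) -> num_trivial M.
Proof.
move=> [s [rs ns]] C f _ mf.
exists 0%N, (fun j : 'I_0 => False_rect C (notF (ltn_ord j))), (fun _ => 0), (fun i y => s i (f y)).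
split.
- by case.
- move=> i; split.
    rewrite (_ : _ `&` _ = f @^-1` (dom (i : idx M) `&` setT)); first exact: mf.2 (rs i).
    by apply/seteqP; split => [y [Dy _]|y [Dy _]]; split => //; case.
  by move=> y Dy _; have [] := ns i (f y) Dy I.
- by move=> i j y Di Dj _; have [_ H] := ns i (f y) Di I; apply: H.
- by case.
- by rewrite big_ord0.
Qed.

(** With more bundles than rays outside the cone of [v0], their orders satisfy an integral relation.
    The corresponding tensor product has trivial characters at all vertices, so its frames on the
    [U v] differ by constants and, once normalized, glue to a global frame: the product is
    numerically trivial. *)
Lemma num_independent_le q (L : 'I_q -> cocycle X) : num_independent L ->
  (q <= size (rays vtxs Bv) - n)%N.
Proof.
move=> [hL ind].
have [x0 _] : exists x : X, True by exists (e (torus_one K n)).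
have [v0 [vv0 _]] := vtx_cover TD x0.
have uB v : v \in vtxs -> Bv v \in unitmx by move/vtxsP; apply: (Bv_unit TD).
have v0V : v0 \in vtxs by apply/vtxsP.
pose Fr := [seq f <- rays vtxs Bv | f \notin [seq ec v0 i | i <- enum 'I_n]].
have szF : size Fr = (size (rays vtxs Bv) - n)%N.
  by apply: (@size_F n vtxs Bv).
rewrite leqNgt; apply/negP => lt; rewrite -szF in lt.
have D l : exists d : ('rV[int]_n -> idx (L l) -> X -> K) * ('rV[int]_n -> K) *
   ('rV[int]_n -> 'rV[int]_n) * ('cV[int]_n -> int), [/\
  forall v, vtx v -> generates (U v) (d.1.1.1 v), forall v, vtx v -> d.1.1.2 v != 0,
  forall v (i : idx (L l)) t, vtx v -> dom i (e t) ->
     d.1.1.1 v i (e t) = d.1.1.2 v * chi (d.1.2 v) (sval t) * d.1.1.1 v0 i (e t),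
  forall v i, vtx v -> dotp (d.1.2 v) (ec v i) = d.2 (ec v i)
  & forall i, d.2 (ec v0 i) = 0].
  by have [s [c [m [al H]]]] := bundle_orders (hL l) vv0; exists (s, c, m, al).
pose d l := projT1 (cid (D l)); have Hd l := projT2 (cid (D l)); rewrite -/(d _) in Hd.
pose M := \matrix_(l < q, j < size Fr) (d l).2 (nth 0 Fr j).
have [a [a0 aM]] := int_left_kernel M lt.
case/eqP: a0; apply/rowP => l; rewrite mxE; apply: (ind (fun l => a 0 l)).
apply: degree0_of_generator.
have al0 v i : vtx v -> \sum_l a 0 l * (d l).2 (ec v i) = 0.
  move=> vv; have fR : ec v i \in rays vtxs Bv by apply: mem_rays => //; apply/vtxsP.
  have [/mapP[j _ Ej]|fv] := boolP (ec v i \in [seq ec v0 i | i <- enum 'I_n]).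
    by rewrite big1 // => l' _; have [_ _ _ _ z] := Hd l'; rewrite Ej z mulr0.
  have fF : ec v i \in Fr by rewrite mem_filter fv.
  have jlt : (index (ec v i) Fr < size Fr)%N by rewrite index_mem.
  have := congr1 (fun N : 'M_(1, _) => N 0 (Ordinal jlt)) aM; rewrite /= !mxE => z.
  by rewrite -[RHS]z; apply: eq_bigr => l' _; rewrite mxE /= nth_index.
have m0 v : vtx v -> \sum_l (d l).1.2 v *~ a 0 l = 0.
  move=> vv; have uv := Bv_unit TD vv.
  have uv' : invmx (Bv v) \in unitmx by rewrite unitmx_inv.
  apply: (can_inj (mulmxK uv')).
  apply/rowP => i; rewrite mul0mx [RHS]mxE; apply: etrans (al0 v i vv).
  have -> : ((\sum_l (d l).1.2 v *~ a 0 l) *m invmx (Bv v)) 0 i =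
      \sum_l a 0 l * dotp ((d l).1.2 v) (ec v i).
    rewrite mulmx_suml summxE; apply: eq_bigr => l' _.
    rewrite -scaler_int intz -scalemxAl [LHS]mxE; congr (_ * _).
    by rewrite /dotp !mxE; apply: eq_bigr => j _; rewrite !mxE.
  by apply: eq_bigr => l' _; have [_ _ _ H _] := Hd l'; rewrite H.
(* Division by [C v] makes the frames of all vertices agree on the torus, hence on overlaps by
   density. *)
pose C v := \prod_l (d l).1.1.2 v ^ a 0 l.
pose S v (i : idx (tensor L (fun l => a 0 l))) x := (C v)^-1 * \prod_l (d l).1.1.1 v (i l) x ^ a 0 l.
have od (i : idx (tensor L (fun l => a 0 l))) : opn (dom i).
  rewrite (_ : dom i = \bigcap_(l in [set: 'I_q]) dom (i l)); last first.
    by apply/seteqP; split => x H l'; [move=> _; apply: H|apply: H].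
  suff H (s : seq 'I_q) : opn [set x | forall l, l \in s -> dom (i l) x].
    have := H (enum 'I_q); rewrite (_ : [set x | _] = \bigcap_(l in [set: 'I_q]) dom (i l)) //.
    apply/seteqP; split => x H' l'; first by move=> _; apply: H'; rewrite mem_enum.
    by move=> _; apply: H'.
  elim: s => [|l' s IH].
    rewrite (_ : [set x | _] = setT); first exact: nice_opnT.
    by apply/seteqP; split.
  rewrite (_ : [set x | _] = dom (i l') `&` [set x | forall l, l \in s -> dom (i l) x]).
    by apply: nice_opnI => //; have [] := hL l'.
  apply/seteqP; split => x.
    by move=> H; split; [apply: H; rewrite mem_head|move=> l2 ls; apply: H; rewrite in_cons ls orbT].
  by move=> [H1 H2] l2; rewrite in_cons => /orP[/eqP ->|/H2].
have rS v i : vtx v -> reg (dom i `&` U v) (S v i).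
  move=> vv; have [vA _] := vv; have oW : opn (dom i `&` U v) by apply: nice_opnI => //; apply: (td_opn TD).
  apply: nice_mul => //; first exact: nice_cst.
  apply: reg_prod => // l' _; have [H _ _ _ _] := Hd l'; have [rs ns] := H v vv.
  apply: reg_exprz => //; first by apply: (nice_res nX (rs (i l'))) => // y [Dy Uy]; split => //; apply: Dy.
  by move=> y [Dy Uy]; have [] := ns _ _ (Dy l') Uy.
have S0 v i x : vtx v -> dom i x -> U v x -> S v i x != 0.
  move=> vv Dx Ux; rewrite /S mulf_neq0 // ?invr_neq0 //.
    by apply/prodf_neq0 => l' _; have [_ H _ _ _] := Hd l'; rewrite expfz_neq0 // H.
  apply/prodf_neq0 => l' _; have [H _ _ _ _] := Hd l'; have [_ ns] := H v vv.
  by have [nz _] := ns _ _ (Dx l') Ux; rewrite expfz_neq0.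
have St v i t : vtx v -> dom i (e t) -> S v i (e t) = \prod_l (d l).1.1.1 v0 (i l) (e t) ^ a 0 l.
  move=> vv Dt; have it := svalP t.
  have -> : S v i (e t) = (C v)^-1 * (C v * chi (\sum_l (d l).1.2 v *~ a 0 l) (sval t) *
      \prod_l (d l).1.1.1 v0 (i l) (e t) ^ a 0 l).
    rewrite /S; congr (_ * _); rewrite chi_sum // /C -!big_split; apply: eq_bigr => l' _ /=.
    have [_ _ H _ _] := Hd l'; rewrite H //.
    by rewrite !expfzMl chiMz.
  rewrite m0 // chi0 mulr1 mulrA mulVf ?mul1r //.
  by apply/prodf_neq0 => l' _; have [_ H _ _ _] := Hd l'; rewrite expfz_neq0 // H.
have SS v v' i x : vtx v -> vtx v' -> dom i x -> U v x -> U v' x -> S v i x = S v' i x.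
  move=> vv vv' Dx Ux U'x; have [vA _] := vv; have [v'A _] := vv'.
  have oW : opn (dom i `&` (U v `&` U v')) by apply: nice_opnI => //; apply: nice_opnI => //; apply: (td_opn TD).
  apply: (@dense_eq _ _ (range e) (dom i `&` (U v `&` U v')) (S v i) (S v' i)) => //.
  - by apply: (nice_res nX (rS v i vv)) => // y [Dy []].
  - by apply: (nice_res nX (rS v' i vv')) => // y [Dy []].
  - move=> y [Dy _] [t _ Et]; rewrite -{y}Et in Dy *.
    by rewrite !St.
have [vx Hvx] := boolp.choice (vtx_cover TD).
exists (fun i x => S (vx x) i x); split.
  move=> i; apply: nice_reg => // x [Dx _]; have [vv Ux] := Hvx x.
  exists (dom i `&` U (vx x)), (S (vx x) i); split => //; first exact: rS.
  move=> y [Dy Uy]; split => //; have [vv' U'y] := Hvx y; exact: SS.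
move=> i x Dx _; have [vv Ux] := Hvx x; split; first exact: S0.
move=> j Dj; rewrite /S mulrCA -big_split; congr (_ * _); apply: eq_bigr => l' _ /=.
have [H _ _ _ _] := Hd l'; have [_ ns] := H _ vv.
by have [_ /(_ (j l') (Dj l')) ->] := ns _ _ (Dx l') Ux; rewrite expfzMl.
Qed.

End Picard.

Lemma ample_toric_data (K : closedFieldType) (X : ringed_set K) (n : nat) (e : torus K n -> X)
    (act : torus_pt K n -> X -> X) :
  (forall x : X, exists t : 'I_n -> X -> K, local_coords x t) ->
  ample (anticanonical X n) -> open_immersion e -> dense (range e) ->
  (forall t, morphism (act t)) -> (forall x, act (torus_one K n) x = x) ->
  (forall t u x, act (torus_mul t u) x = act t (act u x)) ->
  (forall t u, act t (e u) = e (torus_mul t u)) ->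
  exists k A U Y, toric_data (X := X) k e A U Y.
Proof.
move=> smooth [k [N [s [phi [k0 rs trs fi hphi]]]]] oe dO ma act1 actM acte.
have nX := closed_immersion_nice (proj_nice K N) fi.
have [A [c [uA cA flE]]] := fl_laurent nX smooth oe rs.
have [R HR] := R_ex dO ma act1 actM acte rs trs fi uA cA flE.
have hs := hcoord_sv smooth fi hphi; have oD := D_opn nX smooth rs trs fi.
have rr := ratio_reg nX smooth rs trs fi.
have f0 := fl_neq0 nX smooth oe trs fi; have fr := fl_ratio nX smooth oe trs fi.
have R_reg l m : m \in A -> reg (D smooth s fi l) (R l m) by move=> mA; have [] := HR l m mA.
have R_e l m t : m \in A -> D smooth s fi l (e t) -> R l m (e t) = chi m (sval t) / fl nX smooth oe s l t.
  by move=> mA; have [_] := HR l m mA; apply.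
exists k, A, (U hs R), (Y hs R); split => //.
- by move=> m; exact: (U_opn nX dO hs oD rr f0 fr R_reg R_e).
- by move=> m m'; exact: (Y_reg nX dO hs oD rr f0 fr R_reg R_e).
- by move=> m t; exact: (U_e hs f0 R_e).
- by move=> m m' t; exact: (Y_e hs f0 R_e).
- exact: (U_cover nX dO hs oD rr flE fr R_reg R_e).
- by move=> m m' x; apply: U_Y.
- by move=> m x; apply: Y_id.
- by move=> m m' m'' x; apply: Y_trans.
- by move=> m; exact: (U_chart nX dO fi hs oD rr flE f0 fr R_reg R_e).
- by move=> m0 x x'; exact: (Y_sep nX dO fi oD rr flE f0 fr R_reg R_e).
- by move=> x w m0; exact: (limit_point nX dO ma acte fi oD rr flE f0 fr R_reg R_e).
(* In the chart [p] the section of exponent [v] is [R l v] times [s l p]; on the torus, the change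
   to the frame of the torus coordinates produces the power of the jacobian. *)
move=> v p x vA px Ux; pose l := lX hs x; have Dx : D smooth s fi l x := lXP hs x.
have oW : opn (D smooth s fi l `&` dom p).
  by apply: nice_opnI => //; apply: dom_opn.
exists (D smooth s fi l `&` dom p), (fun y => R l v y * s l p y); split => //.
- apply: nice_mul => //; first by apply: (nice_res nX (R_reg l v vA)) => // y [].
  by apply: (nice_res nX (rs l p)) => // y [].
- by rewrite mulf_neq0 // (s_neq0 nX smooth trs fi).
move=> t [Dt pt]; rewrite R_e //; have Ot : dom (iT nX smooth oe) (e t) by exists t.
have ft : fl nX smooth oe s l t != 0 by rewrite f0.
by rewrite (trs l _ _ _ pt Ot) -/(fl nX smooth oe s l t) /=; field.
Qed.

(** * Rational curves of the edges *)

Section Line.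
Variable K : closedFieldType.

Lemma proj_chart_inj N i (l l' : proj_pt K N) : hcoord l i != 0 -> hcoord l' i != 0 ->
  (forall j, hcoord l j / hcoord l i = hcoord l' j / hcoord l' i) -> l = l'.
Proof.
move=> li l'i E; apply: (@proj_pt_ext _ _ _ _ (hcoord l i / hcoord l' i)).
  by rewrite mulf_neq0 ?invr_neq0.
by move=> j; rewrite mulrAC -mulrA -E mulrC divfK.
Qed.

(** An affine coordinate centred at the point [[0 : 1]], which the edge curve sends to the fixed
    point of the far vertex. *)
Definition slope (l : proj_pt K 1) : K := hcoord l ord0 / hcoord l ord_max.

Lemma ord2 (j : 'I_2) : j = ord0 \/ j = ord_max.
Proof. by case: j => -[|[|//]] h; [left|right]; apply: val_inj. Qed.

Lemma slope_inj (l l' : proj_pt K 1) : hcoord l ord_max != 0 -> hcoord l' ord_max != 0 ->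
  slope l = slope l' -> l = l'.
Proof.
move=> h h' E; apply: (proj_chart_inj h h') => j.
by case: (ord2 j) => ->; [exact: E|rewrite !divff].
Qed.

Lemma slope_ex s : exists2 l : proj_pt K 1, hcoord l ord_max != 0 & slope l = s.
Proof.
pose v : 'rV[K]_2 := \row_j (if j == ord0 then s else 1).
have v0 : v != 0.
  by apply/eqP => /rowP/(_ ord_max); rewrite !mxE /= => /eqP; rewrite oner_eq0.
have [c c0 H] := line_hcoord (erefl (sval (mk_line v0))); exists (mk_line v0).
  by rewrite H mxE /= mulr1.
by rewrite /slope !H !mxE /= mulr1 mulrAC divff ?mul1r.
Qed.

Notation G1 := [set f | exists j : 'I_2, f = fun l : proj_pt K 1 => hcoord l j / hcoord l ord_max].

Lemma alg_slope a : alg G1 a ->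
  exists p : {poly K}, forall l, hcoord l ord_max != 0 -> a l = p.[slope l].
Proof.
elim=> {a} [_ [j ->]|c|a b _ [p Ep] _ [q Eq]|a b _ [p Ep] _ [q Eq]].
- case: (ord2 j) => ->; first by exists 'X => l _; rewrite hornerX.
  by exists 1 => l h; rewrite divff // hornerE.
- by exists c%:P => l _; rewrite hornerC.
- by exists (p + q) => l h; rewrite hornerD Ep ?Eq.
- by exists (p * q) => l h; rewrite hornerM Ep ?Eq.
Qed.

Lemma reg_slope (W : set (proj_space K 1)) f z : reg W f -> W z -> hcoord z ord_max != 0 ->
  exists p q : {poly K}, q.[slope z] != 0 /\ forall l, hcoord l ord_max != 0 ->
    q.[slope l] != 0 -> W l /\ f l = p.[slope l] / q.[slope l].
Proof.
move=> rf Wz hz; have [_ _ C] := proj_chart K (N := 1) ord_max.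
have [a [b [Ga Gb bz H]]] := C _ _ _ rf Wz hz.
have [p Ep] := alg_slope Ga; have [q Eq] := alg_slope Gb; exists p, q; split.
  by rewrite -Eq.
by move=> l h; rewrite -Eq // => bl; have [Wl ->] := H l h bl; rewrite Ep.
Qed.

Lemma slope_reg : reg ([set l | hcoord l ord_max != 0] : set (proj_space K 1)) slope.
Proof. by have [_ r _] := proj_chart K (N := 1) ord_max; apply: r; exists ord0. Qed.

(** Functions vanishing at 0 have numerators divisible by ['X], so products of two have numerators
    divisible by ['X^2]. This gives the uniqueness of differentials in [slope_coords]. *)
Lemma ims_slope z f : hcoord z ord_max != 0 -> slope z = 0 ->
  in_max_sq (X := proj_space K 1) z f -> exists p q : {poly K}, [/\ q.[0] != 0, 'X^2 %| p
    & forall l, hcoord l ord_max != 0 -> q.[slope l] != 0 -> f l = p.[slope l] / q.[slope l]].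
Proof.
move=> hz sz [k [a [b [U [Ha Hb oU Uz Hf]]]]].
have H (g : 'I_k -> proj_pt K 1 -> K) : (forall i, regular_at (X := proj_space K 1) z (g i) /\ g i z = 0) ->
    forall i, exists p q : {poly K}, [/\ q.[0] != 0, 'X %| p
    & forall l, hcoord l ord_max != 0 -> q.[slope l] != 0 -> g i l = p.[slope l] / q.[slope l]].
  move=> Hg i; have [[V [oV Vz rg]] g0] := Hg i.
  have [p [q [q0 E]]] := reg_slope rg Vz hz; rewrite sz in q0.
  exists p, q; split => //; last by move=> l h ql; have [] := E l h ql.
  have := (E z hz); rewrite sz => /(_ q0)[_]; rewrite g0 => /esym/eqP.
  rewrite mulf_eq0 invr_eq0 (negbTE q0) orbF => p0.
  by rewrite -['X]subr0 -polyC0 -root_factor_theorem.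
have [d [e [e0 E]]] := reg_slope (nice_cst (proj_nice K 1) 0 oU) Uz hz; rewrite sz in e0.
suff [p [q [q0 Xp Hpq]]] : exists p q : {poly K}, [/\ q.[0] != 0, 'X^2 %| p
    & forall l, hcoord l ord_max != 0 -> q.[slope l] != 0 ->
      \sum_i a i l * b i l = p.[slope l] / q.[slope l]].
  exists (p * e), (q * e); split => //; first by rewrite hornerM mulf_neq0.
    exact: dvdp_mulr.
  move=> l h; rewrite !hornerM mulf_eq0 negb_or => /andP[ql el].
  have [Ul _] := E l h el; rewrite Hf // Hpq //; field.
  by rewrite ql el.
elim: (index_enum 'I_k) => [|i r [p [q [q0 Xp Hpq]]]].
  exists 0, 1; split; rewrite ?hornerE ?oner_neq0 ?dvdp0 //.
  by move=> l _ _; rewrite big_nil horner0 mul0r.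
have [p1 [q1 [q10 Xp1 H1]]] := H a Ha i; have [p2 [q2 [q20 Xp2 H2]]] := H b Hb i.
exists (p1 * p2 * q + p * (q1 * q2)), (q1 * q2 * q); split.
- by rewrite !hornerM !mulf_neq0.
- apply: dvdp_add; last exact: dvdp_mulr.
  by apply: dvdp_mulr; rewrite expr2; apply: dvdp_mul.
move=> l h; rewrite !hornerM !mulf_eq0 !negb_or => /andP[/andP[z1 z2] z3].
rewrite big_cons Hpq // H1 // H2 // hornerD !hornerM; field.
by rewrite z1 z2 z3.
Qed.

Lemma slope_coords z : hcoord z ord_max != 0 -> slope z = 0 ->
  local_coords (X := proj_space K 1) z (fun _ : 'I_1 => slope).
Proof.
move=> hz sz; have nP := proj_nice K 1.
have rs (i : 'I_1) : regular_at (X := proj_space K 1) z slope by apply: (reg_regular_at nP slope_reg).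
split => // f [W [oW Wz rf]].
have [oU _ C] := proj_chart K (N := 1) ord_max.
have [|c Dc] := deriv_frac nP rs oU hz _ (C _ _ _ rf Wz hz).
  move=> _ [j ->]; case: (ord2 j) => ->.
    by exists (fun j => (ord0 == j)%:R); apply: (deriv_coord nP z (fun _ : 'I_1 => slope) ord0).
  exists (fun=> 0); apply: (deriv_ext nP oU hz) (deriv_cst nP z _ 1) => y hy.
  by rewrite divff.
have D (b : 'I_1 -> K) : deriv (X := proj_space K 1) z (fun _ : 'I_1 => slope) f b ->
    b ord0 = c ord0.
  move=> Db; have := imsD nP Db (imsZ nP (-1) Dc) => I.
  have {I} : in_max_sq (X := proj_space K 1) z (fun y => (c ord0 - b ord0) * slope y).
    apply: (ims_eq nP _ I) => y /=; rewrite !big_ord1 sz; ring.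
  move=> /(ims_slope hz sz)[p [q [q0 Xp E]]].
  have F : ((c ord0 - b ord0)%:P * 'X) * q = p.
    apply: (poly_eq_generic (h := q)); first by apply: contraNneq q0 => ->; rewrite horner0.
    move=> s qs; have [l hl Es] := slope_ex s; have := E l hl; rewrite Es => /(_ qs) E'.
    by rewrite !hornerE E' divfK.
  move: Xp; rewrite -F mulrAC mulrC expr2 dvdp_mul2l ?polyX_eq0 //.
  rewrite -['X]subr0 -polyC0 dvdp_XsubCl /root hornerM hornerC mulf_eq0 (negbTE q0) orbF.
  by rewrite subr_eq0 => /eqP.
exists (\row_j c j); split.
  by apply: (ims_eq nP _ Dc) => y /=; rewrite !big_ord1 mxE.
move=> c' Dc'; apply/rowP => j; rewrite mxE (ord1 j); apply/esym; apply: D.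
exact: Dc'.
Qed.
End Line.

(** * The curve joining two neighbouring vertices *)

Section Edge.
Variables (K : closedFieldType) (X : ringed_set K) (n k : nat).
Variables (e : torus K n -> X) (A : seq 'rV[int]_n) (U : 'rV[int]_n -> set X).
Variable Y : 'rV[int]_n -> 'rV[int]_n -> X -> K.
Hypothesis TD : toric_data k e A U Y.

Let nX := td_nice TD.
Let dO := td_dense TD.
Let oe := td_open TD.
Notation vtx := (vtx A U Y).
Notation Bv := (Bv A).
Notation xc := (xc A Y).
Notation ex := (ex A).

Lemma delta_mulrn (i : 'I_n) (L : nat) p :
  (delta_mx 0 i *+ L : 'rV[int]_n) 0 p = (if p == i then L else 0)%N.
Proof. by rewrite mulmxnE mxE eqxx /=; case: eqP => _; rewrite ?natz ?mul0rn. Qed.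

(** The opposite of [u] is a nonnegative combination of the edges at [v'], whose coordinates at [v]
    other than the i-th are nonnegative. Hence one of these edges is a negative multiple of [u], and
    the factor is -1 by integrality of the bases. *)
Lemma edge_back v v' i (L : nat) : vtx v -> vtx v' -> (0 < L)%N ->
  v' = v + row i (Bv v) *+ L -> exists j, row j (Bv v') = - row i (Bv v).
Proof.
move=> vv vv' L0 Ev; set u := row i (Bv v) in Ev *.
have uB := Bv_unit TD vv; have uB' := Bv_unit TD vv'; have [vA _] := vv.
have [_ BA' _] := BvP TD vv'.
pose a : 'rV[int]_n := - u *m invmx (Bv v').
have a0 j : 0 <= a 0 j.
  have := ex_ge0 TD j vv' vA.
  have -> : ex v' v = a *+ L.
    by rewrite /ex /a {1}Ev opprD addrA subrr sub0r -mulNrn -scaler_nat -scalemxAl scaler_nat.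
  by rewrite mulmxnE pmulrn_lge0.
pose c j : 'rV[int]_n := row j (Bv v') *m invmx (Bv v).
have c0 j p : p != i -> 0 <= c j 0 p.
  move=> pi; have := ex_ge0 TD p vv (BA' j).
  have -> : ex v (v' + row j (Bv v')) = delta_mx 0 i *+ L + c j.
    rewrite /ex -/(c j) {1}Ev addrAC [v + _]addrC addrK mulmxDl; congr (_ + _).
    by rewrite -[u *+ L]scaler_nat -scalemxAl -row_mul mulmxV // row1 scaler_nat.
  by rewrite mxE mulmxnE mxE (negbTE pi) andbF mul0rn add0r.
have S p : \sum_j a 0 j * c j 0 p = - (p == i)%:R.
  have : a *m Bv v' *m invmx (Bv v) = - delta_mx 0 i.
    by rewrite /a mulmxKV // mulNmx -row_mul mulmxV // row1.
  move=> /rowP/(_ p); rewrite -mulmxA mulmx_sum_row summxE !mxE eqxx /= => <-.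
  by apply: eq_bigr => j _; rewrite [RHS]mxE row_mul.
have [j] : exists j, a 0 j * c j 0 i < 0.
  apply: contrapT => N; have := S i; rewrite eqxx => E.
  have : 0 <= \sum_j a 0 j * c j 0 i.
    by apply: sumr_ge0 => j _; rewrite leNgt; apply/negP => h; apply: N; exists j.
  by rewrite E.
move=> acn; have aj : 0 < a 0 j by rewrite lt_def a0 andbT; apply: contraTneq acn => ->; rewrite mul0r ltxx.
have cj p : p != i -> c j 0 p = 0.
  move=> pi; have := S p; rewrite (negbTE pi) oppr0 => /eqP.
  rewrite psumr_eq0; last by move=> j' _; rewrite mulr_ge0 ?c0.
  move=> /allP/(_ j (mem_index_enum j)); rewrite mulf_eq0 => /orP[/eqP h|/eqP//].
  by rewrite h ltxx in aj.
have Ec : c j = c j 0 i *: delta_mx 0 i.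
  apply/rowP => p; rewrite [RHS]mxE [X in _ * X]mxE eqxx /=.
  by have [->|pi] := eqVneq p i; rewrite ?mulr1 // mulr0 cj.
have Eu : row j (Bv v') = c j 0 i *: u.
  have -> : row j (Bv v') = c j *m Bv v by rewrite /c mulmxKV.
  by rewrite {1}Ec -scalemxAl -rowE.
exists j; rewrite Eu; suff -> : c j 0 i = -1 by rewrite scaleN1r.
have : c j 0 i * - a 0 j = 1.
  have : row j (Bv v') *m invmx (Bv v') = c j 0 i *: - a.
    by rewrite /a mulNmx opprK Eu -scalemxAl.
  rewrite -row_mul mulmxV // row1 => /rowP/(_ j).
  by rewrite [LHS]mxE !eqxx [RHS]mxE [X in _ * X]mxE.
move: acn aj; move: (a 0 j) (c j 0 i) => x y; clear; nia.
Qed.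

Section Curve.
Variables (v v' : 'rV[int]_n) (i j : 'I_n) (L : nat).
Hypotheses (vv : vtx v) (vv' : vtx v') (Ev : v' = v + row i (Bv v) *+ L).
Hypothesis Ej : row j (Bv v') = - row i (Bv v).

Let uB := Bv_unit TD vv.
Let uB' := Bv_unit TD vv'.

(** Each coordinate at [v'] is a monomial in those at [v]. The j-th is the inverse of the i-th; any
    other involves some coordinate besides the i-th, which vanishes here, since otherwise its row
    would be a multiple of row [j]. *)
Lemma edge_coords x : (0 < L)%N -> U v x -> xc v x 0 i != 0 -> (forall p, p != i -> xc v x 0 p = 0) ->
  U v' x /\ xc v' x = (xc v x 0 i)^-1 *: delta_mx 0 j.
Proof.
move=> L0 Ux xi xp; have [vA _] := vv; have [v'A _] := vv'.
have [_ BA' _] := BvP TD vv'.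
have exd q : ex v (v' + q) = delta_mx 0 i *+ L + q *m invmx (Bv v).
  rewrite /ex {1}Ev addrAC [v + _]addrC addrK mulmxDl; congr (_ + _).
  by rewrite -[_ *+ L]scaler_nat -scalemxAl -row_mul mulmxV // row1 scaler_nat.
have dD p (m : 'rV[int]_n) : (delta_mx 0 i *+ L + m) 0 p = (if p == i then L else 0)%N%:Z + m 0 p.
  by rewrite mxE delta_mulrn.
have dN p : (- delta_mx 0 i : 'rV[int]_n) 0 p = - (p == i)%:R by rewrite !mxE eqxx.
have Yv : Y v' v x = xc v x 0 i ^+ L.
  rewrite (Y_xc TD vv v'A Ux) -[v' in ex v v']addr0 exd mul0mx addr0 (bigD1 i) //=.
  rewrite delta_mulrn eqxx big1 ?mulr1 //.
  by move=> p pi; rewrite delta_mulrn (negbTE pi) expr0.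
have U'x : U v' x by rewrite (td_UY TD v' Ux) Yv expf_neq0.
split => //; apply/rowP => q; rewrite [LHS]mxE [RHS]mxE [X in _ * X]mxE eqxx /=.
have := td_trans TD (v' + row q (Bv v')) U'x Ux.
rewrite Yv (Y_xc TD vv (BA' q) Ux) exd => E.
have xL : xc v x 0 i ^+ L != 0 by rewrite expf_neq0.
have {E} -> : Y (v' + row q (Bv v')) v' x = (\prod_p xc v x 0 p ^+
    absz ((delta_mx 0 i *+ L + row q (Bv v') *m invmx (Bv v)) 0 p)) / xc v x 0 i ^+ L.
  by rewrite E mulfK.
have [->|qj] := eqVneq q j.
  rewrite (bigD1 i) //= big1 ?mulr1; last first.
    move=> p pi; rewrite dD (negbTE pi) add0r Ej mulNmx -row_mul.
    by rewrite mulmxV // row1 dN (negbTE pi) oppr0 expr0.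
  rewrite dD eqxx Ej mulNmx -row_mul mulmxV // row1 dN !eqxx /=.
  case: L L0 xL => // L' _ _; have -> : absz (L'.+1%:Z - 1) = L' by lia.
  rewrite exprS; field; rewrite xi /=; exact: expf_neq0.
rewrite mulr0; apply/eqP; rewrite mulf_eq0 invr_eq0 (negbTE xL) orbF.
pose cq := row q (Bv v') *m invmx (Bv v).
have [p [pi cp]] : exists p, p != i /\ cq 0 p != 0.
  apply: contrapT => N; have Ec : cq = cq 0 i *: delta_mx 0 i.
    apply/rowP => p; rewrite [RHS]mxE [_ 0 p in RHS]mxE eqxx /=.
    have [->|pi] := eqVneq p i; first by rewrite mulr1.
    rewrite mulr0; apply/eqP; apply: contraT => h; case: N; exists p; split => //.
  have Eu : row q (Bv v') = - cq 0 i *: row j (Bv v').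
    have {1}-> : row q (Bv v') = cq *m Bv v by rewrite /cq mulmxKV.
    by rewrite {1}Ec -scalemxAl -rowE Ej scaleNr scalerN opprK.
  have := congr1 (fun w => (w *m invmx (Bv v')) 0 q) Eu.
  by rewrite /= -scalemxAl -!row_mul mulmxV // !row1 [LHS]mxE [RHS]mxE [X in _ * X]mxE !eqxx (negbTE qj) mulr0.
rewrite (bigD1 p) //= mulf_eq0 xp // expr0n; apply/orP; left.
rewrite dD (negbTE pi) add0r -/cq absz_eq0 (negbTE cp).
by rewrite eqxx.
Qed.

Definition xpt w (vw : vtx w) z : X := s2val (cid2 (xc_surj TD z vw)).
Lemma xptU w (vw : vtx w) z : U w (xpt vw z). Proof. exact: (s2valP (cid2 (xc_surj TD z vw))). Qed.
Lemma xptE w (vw : vtx w) z : xc w (xpt vw z) = z. Proof. exact: (s2valP' (cid2 (xc_surj TD z vw))). Qed.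

Definition edge_curve (l : proj_space K 1) : X :=
  if hcoord l ord0 == 0 then xpt vv' 0
  else xpt vv ((hcoord l ord_max / hcoord l ord0) *: delta_mx 0 i).

Hypothesis L0 : (0 < L)%N.

Lemma edge_curve0 l : hcoord l ord0 != 0 -> U v (edge_curve l) /\
  xc v (edge_curve l) = (hcoord l ord_max / hcoord l ord0) *: delta_mx 0 i.
Proof. by move=> /negbTE h; rewrite /edge_curve h; split; [exact: xptU|exact: xptE]. Qed.

Lemma edge_curve1 l : hcoord l ord_max != 0 -> U v' (edge_curve l) /\
  xc v' (edge_curve l) = slope l *: delta_mx 0 j.
Proof.
move=> h1; have [h0|h0] := eqVneq (hcoord l ord0) 0.
  rewrite /edge_curve h0 eqxx; split; first exact: xptU.
  by rewrite xptE /slope h0 mul0r scale0r.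
have [Ux Ex] := edge_curve0 h0.
have xi : xc v (edge_curve l) 0 i = hcoord l ord_max / hcoord l ord0.
  by rewrite Ex !mxE !eqxx mulr1.
have [||U'x ->] := edge_coords L0 Ux.
- by rewrite xi mulf_neq0 ?invr_neq0.
- by move=> p pi; rewrite Ex !mxE (negbTE pi) andbF mulr0.
by split => //; rewrite xi invf_div.
Qed.

Lemma edge_curve_morphism : morphism edge_curve.
Proof.
have nP := proj_nice K 1; apply: (morphism_chart nX nP) => l.
have [h0|h1] : hcoord l ord0 != 0 \/ hcoord l ord_max != 0.
  by have [p hp] := hcoord_neq0 l; case: (ord2 p) hp => ->; [left|right].
- exists [set l | hcoord l ord0 != 0], (U v), [set f | exists i, f = fun y => xc v y 0 i].
  have [oW rG _] := proj_chart K (N := 1) ord0.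
  split => //; first exact: (vchart TD vv).
    by move=> z /edge_curve0[].
  move=> _ [p ->]; have rs := rG _ (ex_intro _ ord_max erefl).
  apply: (reg_ext nP (nice_mul nP rs (nice_cst nP (p == i)%:R oW))).
  by move=> y /edge_curve0[_ ->]; rewrite !mxE eqxx.
exists [set l | hcoord l ord_max != 0], (U v'), [set f | exists i, f = fun y => xc v' y 0 i].
have [oW rG _] := proj_chart K (N := 1) ord_max.
split => //; first exact: (vchart TD vv').
  by move=> z /edge_curve1[].
move=> _ [p ->].
apply: (reg_ext nP (nice_mul nP (@slope_reg K) (nice_cst nP (p == j)%:R oW))).
by move=> y /edge_curve1[_ ->]; rewrite !mxE eqxx.
Qed.

Lemma edge_rational : rational_curve edge_curve.
Proof.
split; first exact: edge_curve_morphism.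
have [oW _ _] := proj_chart K (N := 1) ord0.
exists [set l | hcoord l ord0 != 0]; split => //.
  have [l hl sl] := slope_ex (1 : K); exists l => /=; apply: contra_eqN sl => /eqP h.
  by rewrite /slope h mul0r eq_sym oner_neq0.
move=> l l' /= h h' E; apply: (proj_chart_inj h h') => p.
case: (ord2 p) => ->; first by rewrite !divff.
have [_ E1] := edge_curve0 h; have [_ E2] := edge_curve0 h'.
by move: E2; rewrite -E E1 => /rowP/(_ i); rewrite !mxE !eqxx !mulr1.
Qed.

Variable l : nat.
Hypothesis El : qv A v' = qv A v + row i (Bv v) *+ l.
Notation cs w := (fun i y => xc w y 0 i).

Lemma taus_jacobian w t : vtx w -> \det (jacobian (cs w) (taus e) (e t)) =
  (\det (Bv w))%:~R * chi (- qv A w - const_mx 1) (sval t).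
Proof.
move=> vw; have Ot : range e (e t) by exists t.
rewrite (jacobian_chi nX (td_smooth TD) oe (B := Bv w)) // ?tptE ?opprK //.
exists (range e); split => //; first exact: (range_opn oe).
by move=> p _ [s _ <-]; rewrite (xc_e TD) // tptE.
Qed.

(** On the torus both frames are explicit, and [q_v' = q_v + l u] leaves the character [- l u], the
    l-th power of the coordinate [j] at [v']. *)
Lemma edge_jacobian x : U v x -> U v' x -> \det (jacobian (cs v') (cs v) x) =
  (\det (Bv v'))%:~R / (\det (Bv v))%:~R * xc v' x 0 j ^+ l.
Proof.
move=> Ux U'x; have [vA _] := vv; have [v'A _] := vv'.
have oW : opn (U v `&` U v') by apply: nice_opnI => //; apply: (td_opn TD).
pose c : K := (\det (Bv v'))%:~R / (\det (Bv v))%:~R.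
apply: (@dense_eq _ _ (range e) (U v `&` U v') (fun x => \det (jacobian (cs v') (cs v) x))
  (fun x => c * xc v' x 0 j ^+ l)) => //.
- apply: reg_det => // p q; apply: (xc_jacobian_reg TD vv) => //.
  by move=> p'; apply: (reg_resIr nX (xc_reg TD p' vv')); apply: (td_opn TD).
- apply: nice_mul => //; first exact: nice_cst.
  by apply: reg_exp => //; apply: (reg_resIr nX (xc_reg TD j vv')); apply: (td_opn TD).
move=> y [Uy U'y] [t _ Et]; rewrite -{y}Et in Uy U'y *; have it := svalP t.
have Ot : range e (e t) by exists t.
have r' p : regular_at (e t) (fun y => xc v' y 0 p) := reg_regular_at nX (xc_reg TD p vv') U'y.
have := jacobian_chain nX (torus_coords nX (td_smooth TD) oe Ot) (xc_coords TD vv Uy) r'.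
move=> /(congr1 determinant); rewrite det_mulmx !taus_jacobian //.
have d0 := det_unit_intr K uB.
rewrite (xc_e TD) // -chiMn // El.
have -> : - (qv A v + row i (Bv v) *+ l) - const_mx 1 =
    (- qv A v - const_mx 1) + row j (Bv v') *+ l.
  by rewrite Ej mulNrn opprD addrAC.
rewrite (chiD (- qv A v - const_mx 1)) // => H; have c0 := chi_neq0 (- qv A v - const_mx 1) it.
apply: (mulIf (mulf_neq0 d0 c0)); rewrite H /c; field; exact: d0.
Qed.

(** The frame of the coordinates at [v] is a section of the pulled back bundle without zeros or
    poles away from slope 0, where comparison with the frame at [v'] shows a zero of order [l]. *)
Lemma edge_degree : degree (pullback edge_curve (anticanonical X n)) l.
Proof.
have nP := proj_nice K 1; have [m1 m2] := edge_curve_morphism.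
have [z hz sz] := slope_ex (0 : K).
have z0 y : (forall q : 'I_1, z <> y) -> hcoord y ord0 != 0.
  move=> N; apply/eqP => y0; apply: (N ord0).
  have hy : hcoord y ord_max != 0.
    by have [q] := hcoord_neq0 y; case: (ord2 q) => -> //; rewrite y0 eqxx.
  by apply: slope_inj => //; rewrite sz /slope y0 mul0r.
have [vA _] := vv; have [v'A _] := vv'.
have cp (p : idx (anticanonical X n)) x : dom p x -> local_coords x (sval p).2.
  by case: p => [[V t] cV] /= Vx; case: cV => _ _; apply.
have op (p : idx (anticanonical X n)) : opn (dom p : set X).
  by case: p => [[V t] cV] /=; case: cV.
have rp (p : idx (anticanonical X n)) q : reg (dom p : set X) ((sval p).2 q).
  by case: p => [[V t] cV] /=; case: cV.
have oz : opn ([set y | forall q : 'I_1, z <> y] : set (proj_space K 1)).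
  have [oW _ _] := proj_chart K (N := 1) ord0.
  rewrite (_ : [set y | _] = [set l | hcoord l ord0 != 0]) //.
  apply/seteqP; split=> y /=; first exact: z0.
  by move=> y0 _ E; move: y0; rewrite -E; apply/negP; rewrite negbK; move/eqP: sz;
    rewrite /slope mulf_eq0 invr_eq0 (negbTE hz) orbF.
have reg_jac w (vw : vtx w) (p : idx (anticanonical X n)) :
    reg (dom p `&` U w) (fun x => \det (jacobian (sval p).2 (cs w) x)).
  have [wA _] := vw; have oW : opn (dom p `&` U w) by apply: nice_opnI => //; apply: (td_opn TD).
  apply: reg_det => // q r; apply: (xc_jacobian_reg TD vw) => //.
  by move=> q'; apply: (reg_resI nX (rp p q')); apply: (td_opn TD).
exists 1%N, (fun _ : 'I_1 => z), (fun _ => l%:Z),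
  (fun (p : idx (anticanonical X n)) y => \det (jacobian (sval p).2 (cs v) (edge_curve y))); split.
- by move=> a b _; rewrite (ord1 a) (ord1 b).
- move=> p; split.
    apply: (nice_res nP (m2 _ _ (reg_jac v vv p))).
      by apply: nice_opnI => //; apply: m1.
    by move=> y [Dy /z0/edge_curve0[]].
  move=> y Dy /z0/edge_curve0[Uy _]; apply: (det_jacobian_neq0 nX (xc_coords TD vv Uy)).
  exact: cp.
- move=> p q y Dp Dq /z0/edge_curve0[Uy _].
  rewrite -(jacobian_chain nX (xc_coords TD vv Uy) (cp q (edge_curve y) Dq)) ?det_mulmx //.
  by move=> i'; apply: (reg_regular_at nX (rp p i')); exact: Dp.
- move=> _ p Dz.
  pose c : K := (\det (Bv v'))%:~R / (\det (Bv v))%:~R.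
  have c0 : c != 0 by rewrite mulf_neq0 ?invr_neq0 // det_unit_intr.
  exists (edge_curve @^-1` (@dom K X (anticanonical X n) p `&` U v')),
    (fun y => c * \det (jacobian (sval (p : idx (anticanonical X n))).2 (cs v') (edge_curve y))), (@slope K); split => //.
  + by split => //; have [] := edge_curve1 hz.
  + exact: slope_coords.
  + split.
      by apply: nice_mul => //; [apply: nice_cst => //; apply: m1; exact: (nice_reg_opn nX (reg_jac v' vv' p))
        |exact: (m2 _ _ (reg_jac v' vv' p))].
    move=> y [Dy Uy]; rewrite mulf_neq0 //; apply: (det_jacobian_neq0 nX (xc_coords TD vv' Uy)).
    exact: cp.
  move=> y [Dy U'y] _ /z0 y0; have [Uy _] := edge_curve0 y0.
  rewrite -(jacobian_chain nX (xc_coords TD vv Uy) (xc_coords TD vv' U'y)); last first.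
    by move=> i'; apply: (reg_regular_at nX (rp p i')).
  rewrite det_mulmx edge_jacobian // -/c.
  have -> : xc v' (edge_curve y) 0 j = slope y.
    (* If the last coordinate vanishes, [y] is sent to the fixed point of [v], which lies outside of
       [U v'] as [L > 0]. *)
    have [h1|h1] := eqVneq (hcoord y ord_max) 0; last first.
      by have [_ ->] := edge_curve1 h1; rewrite !mxE !eqxx mulr1.
    have [_ Ex] := edge_curve0 y0; rewrite h1 mul0r scale0r in Ex.
    move: U'y; rewrite (td_UY TD v' Uy) (Y_xc TD vv v'A Uy) Ex (bigD1 i) //= mxE.
    have -> : ex v v' = delta_mx 0 i *+ L.
      rewrite /ex {1}Ev addrAC subrr add0r -[_ *+ L]scaler_nat -scalemxAl -row_mul mulmxV // row1.
      by rewrite scaler_nat.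
    by rewrite delta_mulrn eqxx expr0n gtn_eqF // mulr0n mul0r eqxx.
  by rewrite -mulrA mulrCA.
by rewrite big_ord1.
Qed.
End Curve.

Lemma edge v i : vtx v -> exists v' (l : nat), [/\ vtx v', (0 < l)%N,
  qv A v' = qv A v + row i (Bv v) *+ l
  & exists2 f : proj_space K 1 -> X, rational_curve f & degree (pullback f (anticanonical X n)) l].
Proof.
move=> vv; have [v' [l [vv' l0 El Ev _]]] := neighbor TD i vv.
have L0 : (0 < k * l)%N by rewrite muln_gt0 (td_k TD).
have [j Ej] := edge_back vv vv' L0 Ev.
exists v', l; split => //; exists (edge_curve i vv vv').
  exact: (edge_rational vv vv' Ev Ej).
exact: (edge_degree vv vv' Ev Ej).
Qed.
End Edge.

(** * The equality case *)

Section ProductOfProjectiveSpaces.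
Variables (K : closedFieldType) (X : ringed_set K) (n k : nat).
Variables (e : torus K n -> X) (A : seq 'rV[int]_n) (U : 'rV[int]_n -> set X).
Variable Y : 'rV[int]_n -> 'rV[int]_n -> X -> K.
Hypothesis TD : toric_data k e A U Y.

Let nX := td_nice TD.
Let dO := td_dense TD.
Let oe := td_open TD.
Notation vtx := (vtx A U Y).
Notation Bv := (Bv A).
Notation xc := (xc A Y).
Notation ex := (ex A).
Notation ec v i := (col i (invmx (Bv v))).

Variables (r d : nat) (eps : 'I_r -> 'I_d.+1 -> 'cV[int]_n).
Hypothesis col_eps : forall v i, vtx v -> exists a b, ec v i = eps a b.
Hypothesis eps_inj : forall a b a' b', eps a b = eps a' b' -> a = a' /\ b = b'.
Hypothesis eps_sum : forall a, \sum_b eps a b = 0.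
Hypothesis eps_col : forall v a b, vtx v -> dotp (qv A v) (eps a b) = -1 ->
  exists i, eps a b = ec v i.
Hypothesis choice_vtx : forall be : 'I_r -> 'I_d.+1, exists v, vtx v /\
  forall a b, dotp (qv A v) (eps a b) = if b == be a then d%:Z else -1.

Section Coordinates.
Variable be : 'rV[int]_n -> 'I_r -> 'I_d.+1.
Hypothesis hbe : forall v, vtx v -> forall a b,
  dotp (qv A v) (eps a b) = if b == be v a then d%:Z else -1.
(* [Z v a] are the homogeneous coordinates on the [a]-th factor, normalized so that
   the one of index [be v a] is 1. *)
Variable Z : 'rV[int]_n -> 'I_r -> 'I_d.+1 -> X -> K.
Hypothesis Z1 : forall v a, vtx v -> Z v a (be v a) = fun=> 1.
Hypothesis Zx : forall v a b, vtx v -> b != be v a ->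
  exists i, eps a b = ec v i /\ Z v a b = fun x => xc v x 0 i.

Lemma ray_dual v i j : vtx v -> dotp (row i (Bv v)) (ec v j) = (i == j)%:R.
Proof.
move=> vv; apply: (@dotp_row n [seq v <- A | `[< vtx v >]] Bv).
  by move=> u /vtxsP; apply: (Bv_unit TD).
exact/vtxsP.
Qed.

Lemma ec_eps v i : vtx v -> exists a b, b != be v a /\ ec v i = eps a b.
Proof.
move=> vv; have [a [b E]] := col_eps i vv; exists a, b; split => //.
apply/eqP => Eb; have := qv_e TD i vv; rewrite E hbe // Eb eqxx.
by case: (d).
Qed.

Lemma Z_coord v i : vtx v -> exists a b, [/\ b != be v a, ec v i = eps a b
  & Z v a b = fun x => xc v x 0 i].
Proof.
move=> vv; have [a [b [ne E]]] := ec_eps i vv; have [j [Ej Zj]] := Zx vv ne.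
exists a, b; split => //; rewrite Zj; suff -> : j = i by [].
have := ray_dual i j vv; rewrite -Ej -E ray_dual // eqxx.
by case: eqVneq.
Qed.

Lemma Z_reg v a b : vtx v -> reg (U v) (Z v a b).
Proof.
move=> vv; have [vA _] := vv; have [->|ne] := eqVneq b (be v a).
  by rewrite Z1 //; apply: nice_cst => //; apply: (td_opn TD).
by have [i [_ ->]] := Zx vv ne; apply: (xc_reg TD).
Qed.

(** [Z v a b] has the orders along the rays of the quotient of the homogeneous coordinates [b] and
    [be v a] of the a-th factor. Along the omitted ray the order is deduced from the block having
    sum 0. *)
Lemma Z_torus v a b : vtx v -> exists m : 'rV[int]_n,
  (forall t, Z v a b (e t) = chi m (sval t)) /\
  forall a' b', dotp m (eps a' b') = if a' == a then (b' == b)%:R - (b' == be v a)%:R else 0.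
Proof.
move=> vv; have [->|ne] := eqVneq b (be v a).
  exists 0; split => [t|a' b']; first by rewrite Z1 // chi0.
  by rewrite subrr if_same /dotp mul0mx mxE.
have [i [Ei Zi]] := Zx vv ne; exists (row i (Bv v)); split => [t|].
  by rewrite Zi (xc_e TD).
have far a' b' : b' != be v a' -> dotp (row i (Bv v)) (eps a' b') = ((a' == a) && (b' == b))%:R.
  move=> ne'; have [j Ej] : exists j, eps a' b' = ec v j.
    by apply: eps_col => //; rewrite hbe // (negbTE ne').
  rewrite Ej ray_dual //; congr (nat_of_bool _)%:R; apply/eqP/andP.
    by move=> ij; have [] := @eps_inj a' b' a b; [rewrite Ej Ei ij|move=> -> ->].
  move=> [/eqP aa /eqP bb]; have := ray_dual i j vv.
  by rewrite -Ej aa bb Ei ray_dual // eqxx; case: eqVneq.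
move=> a' b'; have [Eb|ne'] := eqVneq b' (be v a'); last first.
  rewrite far //; case: eqVneq => //= Ea; rewrite -Ea (negbTE ne') subr0.
  by [].
have := dotp_0r (row i (Bv v)); rewrite -(eps_sum a') dotp_sumr (bigD1 b') //=.
under eq_bigr => b'' ne'' do rewrite far -?Eb //.
move/eqP; rewrite addr_eq0 => /eqP ->; case: eqVneq => [Ea|_]; last by rewrite big1 ?oppr0.
rewrite -Ea -Eb eqxx; have bb : b != b' by rewrite Eb Ea.
rewrite (bigD1 b) //= eqxx big1 ?addr0; last by move=> c /andP[_ /negbTE ->].
by rewrite eq_sym (negbTE bb) sub0r.
Qed.

Lemma dotp_ext v (m m' : 'rV[int]_n) : vtx v ->
  (forall i, dotp m (ec v i) = dotp m' (ec v i)) -> m = m'.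
Proof.
move=> vv H; have uB' : invmx (Bv v) \in unitmx by rewrite unitmx_inv (Bv_unit TD).
apply: (can_inj (mulmxK uB')); apply/rowP => i.
have E (w : 'rV[int]_n) : (w *m invmx (Bv v)) 0 i = dotp w (ec v i).
  by rewrite /dotp !mxE; apply: eq_bigr => j _; rewrite !mxE.
by rewrite !E.
Qed.

(** Both sides restrict to characters with equal orders along all rays of the cone of [v], by
    [Z_torus]. This is the change of affine chart in projective space. *)
Lemma Z_change v v' a b x : vtx v -> vtx v' -> U v x -> U v' x ->
  Z v a b x = Z v a (be v' a) x * Z v' a b x.
Proof.
move=> vv vv' Ux U'x; have [vA _] := vv; have [v'A _] := vv'.
have oV := td_opn TD vA; have oV' := td_opn TD v'A.
apply: (@dense_eq _ _ (range e) (U v `&` U v') (Z v a b)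
  (fun x => Z v a (be v' a) x * Z v' a b x)) => //.
- exact: (reg_resI nX (Z_reg a b vv)).
- apply: nice_mul => //; first exact: (reg_resI nX (Z_reg _ _ vv)).
  exact: (reg_resIr nX (Z_reg _ _ vv')).
move=> y [Uy U'y] [t _ Et]; rewrite -{y}Et in Uy U'y *; have it := svalP t.
have [m1 [-> D1]] := Z_torus a b vv; have [m2 [-> D2]] := Z_torus a (be v' a) vv.
have [m3 [-> D3]] := Z_torus a b vv'; rewrite -chiD //; congr chi.
apply: (dotp_ext vv) => i; have [a' [b' ->]] := col_eps i vv.
rewrite dotpD D1 D2 D3; case: eqP => _; last by rewrite addr0.
by rewrite [RHS]addrC addrA subrK.
Qed.

Lemma Z_neq0 v v' a x : vtx v -> vtx v' -> U v x -> U v' x -> Z v a (be v' a) x != 0.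
Proof.
move=> vv vv' Ux U'x; have := Z_change a (be v a) vv vv' Ux U'x.
by rewrite Z1 // => /eqP; apply: contraTneq => ->; rewrite mul0r oner_neq0.
Qed.

(** The section of [v'] relative to that of [v] is a monomial in the coordinates at [v], and those
    occurring belong to rays omitted by [v']: they are among the [Z v a (be v' a)]. *)
Lemma U_of_Z v v' x : vtx v -> vtx v' -> U v x ->
  (forall a, Z v a (be v' a) x != 0) -> U v' x.
Proof.
move=> vv vv' Ux H; have [v'A _] := vv'.
rewrite (td_UY TD v' Ux) (Y_xc TD vv v'A Ux); apply/prodf_neq0 => i _.
have [a [b [ne E Zi]]] := Z_coord i vv; rewrite (ex_vtx TD) // E hbe //.
case: (eqVneq b (be v' a)) => [Eb|_]; last by rewrite addNr mulr0 expr0 oner_neq0.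
by rewrite expf_neq0 //; have := H a; rewrite -Eb Zi.
Qed.

Lemma Z_inj v x x' : vtx v -> U v x -> U v x' ->
  (forall a b, Z v a b x = Z v a b x') -> x = x'.
Proof.
move=> vv Ux Ux' E; apply: (xc_inj TD vv Ux Ux'); apply/rowP => i.
by have [a [b [_ _ Zi]]] := Z_coord i vv; have := E a b; rewrite Zi.
Qed.

Lemma Z_surj v (z : 'I_r -> 'I_d.+1 -> K) : vtx v -> (forall a, z a (be v a) = 1) ->
  exists2 x, U v x & forall a b, Z v a b x = z a b.
Proof.
move=> vv z1; have H i : exists c, exists2 ab : 'I_r * 'I_d.+1, ec v i = eps ab.1 ab.2 & c = z ab.1 ab.2.
  by have [a [b E]] := col_eps i vv; exists (z a b), (a, b).
have [c Hc] := boolp.choice H; have [x Ux Ex] := xc_surj TD (\row_i c i) vv.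
exists x => // a b; have [->|ne] := eqVneq b (be v a); first by rewrite Z1 // z1.
have [i [Ei ->]] := Zx vv ne; rewrite Ex mxE; have [[a' b'] /= Ei' ->] := Hc i.
by have [-> ->] : a' = a /\ b' = b by apply: eps_inj; rewrite -Ei' -Ei.
Qed.

Lemma Z_row_neq0 v a x : vtx v -> (\row_b Z v a b x) != 0.
Proof.
move=> vv; apply/eqP => /rowP/(_ (be v a)); rewrite !mxE Z1 // => /eqP.
by rewrite oner_eq0.
Qed.

Let vx x := projT1 (cid (vtx_cover TD x)).
Let vxP x : vtx (vx x) /\ U (vx x) x := projT2 (cid (vtx_cover TD x)).

(** Homogeneous coordinates are taken from a chosen vertex; by [Z_change] every other vertex gives
    the same line, see [F_hcoord]. *)
Let F (x : X) (a : 'I_r) : proj_space K d := mk_line (Z_row_neq0 a x (vxP x).1).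

Let F_hcoord v x a : vtx v -> U v x ->
  exists2 c, c != 0 & forall j, hcoord (F x a) j = c * Z v a j x.
Proof.
move=> vv Ux; have [vv' U'x] := vxP x.
have [c c0 H] := line_hcoord (erefl (sval (F x a))).
exists (c * Z (vx x) a (be v a) x); first by rewrite mulf_neq0 // Z_neq0.
by move=> j; rewrite H mxE -mulrA -Z_change.
Qed.

Let F_inj x x' : (forall a, F x a = F x' a) -> x = x'.
Proof.
move=> E; have [vv Ux] := vxP x; have [vv' U'x'] := vxP x'; set v := vx x in vv Ux.
set v' := vx x' in vv' U'x'.
have P a : exists2 c, c != 0 & forall b, Z v a b x = c * Z v' a b x'.
  have [c c0 H] := F_hcoord a vv Ux; have [c' c'0 H'] := F_hcoord a vv' U'x'.
  exists (c^-1 * c'); first by rewrite mulf_neq0 ?invr_neq0.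
  by move=> b; rewrite -mulrA -H' -E H mulKf.
have U'x : U v' x.
  apply: (U_of_Z vv vv' Ux) => a; have [c c0 H] := P a.
  by rewrite H Z1 // mulr1.
apply: (Z_inj vv' U'x U'x') => a b; have [c c0 H] := P a.
have := Z_change a b vv vv' Ux U'x; rewrite !H Z1 // mulr1.
by move/(mulfI c0).
Qed.

Let F_morphism : morphism (fun x => power_mk (F x)).
Proof.
apply: (power_mk_morphism nX) => a; apply: (morphism_glue nX) => i y /= Fy.
have [vv Uy] := vxP y; set v := vx y in vv Uy; have [vA _] := vv.
have [c c0 H] := F_hcoord a vv Uy.
have oW := opn_neq0 nX (Z_reg a i vv).
exists (U v `&` [set z | Z v a i z != 0]); split => //.
- by split => //=; move: Fy; rewrite H mulf_eq0 negb_or => /andP[].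
- by move=> z [Uz /= Zz]; have [c' c'0 H'] := F_hcoord a vv Uz; rewrite H' mulf_neq0.
move=> _ [j ->]; have rj := nice_mul nX (nice_res nX (Z_reg a j vv) oW (fun z => @proj1 _ _)) (nice_inv nX (Z_reg a i vv)).
apply: (reg_ext nX rj) => z [Uz /= Zz]; have [c' c'0 H'] := F_hcoord a vv Uz.
by rewrite !H' -mulf_div divff // mul1r.
Qed.

Let F_surj (p : 'I_r -> proj_pt K d) v : vtx v -> (forall a, hcoord (p a) (be v a) != 0) ->
  exists x, [/\ U v x, forall a, F x a = p a
    & forall a b, Z v a b x = hcoord (p a) b / hcoord (p a) (be v a)].
Proof.
move=> vv pv; have [|x Ux Zxx] := Z_surj (z := fun a b => hcoord (p a) b / hcoord (p a) (be v a)) vv.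
  by move=> a; rewrite divff.
exists x; split => // a; have [c c0 H] := F_hcoord a vv Ux.
apply: (@proj_pt_ext _ _ _ _ (c / hcoord (p a) (be v a))).
  by rewrite mulf_neq0 ?invr_neq0.
by move=> j; rewrite H Zxx; field.
Qed.

(** Every combination of standard charts of the factors occurs at some vertex, by [choice_vtx]; this
    is what makes the map surjective. *)
Let vtx_of (p : 'I_r -> proj_pt K d) : exists v, vtx v /\ forall a, hcoord (p a) (be v a) != 0.
Proof.
have [b Hb] := boolp.choice (fun a => hcoord_neq0 (p a)).
have [v [vv Hv]] := choice_vtx b; exists v; split => // a.
suff -> : be v a = b a by [].
by have := Hv a (be v a); rewrite hbe // eqxx; case: eqP => // _; case: (d).
Qed.

Lemma isomorphic_power : isomorphic X (power (proj_space K d) r).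
Proof.
have nP := power_nice r (proj_nice K d).
have S (p : power (proj_space K d) r) : exists x, forall a, F x a = power_pr p a.
  have [v [vv Hv]] := vtx_of (power_pr p); have [x [_ Fx _]] := F_surj vv Hv.
  by exists x.
have [G HG] := boolp.choice S.
have FG p : power_mk (F (G p)) = p by apply: power_ext => a; rewrite power_mkK HG.
exists (fun x => power_mk (F x)), G; split => //; last first.
  by move=> x; apply: F_inj => a; rewrite HG power_mkK.
(* For the inverse map, a vertex is chosen whose affine coordinates near [p] are quotients of
   homogeneous coordinates of the factors, hence regular. *)
apply: (morphism_chart nX nP) => p; have [v [vv Hv]] := vtx_of (power_pr p).
pose W (s : seq 'I_r) : set (power (proj_space K d) r) :=
  [set q | forall a, a \in s -> hcoord (power_pr (X := proj_space K d) q a) (be v a) != 0].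
have oW s : opn (W s).
  elim: s => [|a s IH].
    rewrite (_ : W [::] = setT); first exact: nice_opnT.
    by apply/seteqP; split.
  have [oa _ _] := proj_chart K (be v a).
  rewrite (_ : W (a :: s) = (fun q => power_pr (X := proj_space K d) q a) @^-1` [set l | hcoord l (be v a) != 0] `&` W s).
    by apply: nice_opnI => //; apply: (power_pr_morphism a (proj_nice K d)).1.
  apply/seteqP; split => q.
    by move=> H; split; [apply: H; rewrite mem_head|move=> b bs; apply: H; rewrite in_cons bs orbT].
  by move=> [H1 H2] b; rewrite in_cons => /orP[/eqP ->|/H2].
have GW q : W (enum 'I_r) q -> U v (G q) /\
    forall a b, Z v a b (G q) = hcoord (power_pr (X := proj_space K d) q a) b / hcoord (power_pr (X := proj_space K d) q a) (be v a).
  move=> Wq; have Wa a : hcoord (power_pr (X := proj_space K d) q a) (be v a) != 0 by apply: Wq; rewrite mem_enum.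
  have [x [Ux Fx Zxx]] := F_surj vv Wa.
  by have -> : G q = x by apply: F_inj => a; rewrite HG Fx.
exists (W (enum 'I_r)), (U v), [set f | exists i, f = fun y => xc v y 0 i]; split => //.
- exact: (vchart TD vv).
- by move=> q /GW[].
move=> _ [i ->]; have [a [b [_ _ Zi]]] := Z_coord i vv.
have [_ rG _] := proj_chart K (be v a).
have rb := rG _ (ex_intro _ b erefl).
have rq := (power_pr_morphism (r := r) a (proj_nice K d)).2 _ _ rb.
apply: (reg_ext nP (nice_res nP rq (oW (enum 'I_r)) _)).
  by move=> q Wq; apply: Wq; rewrite mem_enum.
by move=> q /GW[_ H]; rewrite -H Zi.
Qed.

End Coordinates.

Hypothesis vtx_choice : forall v, vtx v -> exists be : 'I_r -> 'I_d.+1,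
  forall a b, dotp (qv A v) (eps a b) = if b == be a then d%:Z else -1.

Lemma isomorphic_power_of_rays : isomorphic X (power (proj_space K d) r).
Proof.
have H v : exists be : 'I_r -> 'I_d.+1, vtx v ->
    forall a b, dotp (qv A v) (eps a b) = if b == be a then d%:Z else -1.
  have [vv|] := pselect (vtx v); last by exists (fun=> ord0).
  by have [be Hbe] := vtx_choice vv; exists be.
have [be hbe] := boolp.choice H.
have HZ (i : 'rV[int]_n * 'I_r * 'I_d.+1) : exists g : X -> K, vtx i.1.1 ->
    (i.2 = be i.1.1 i.1.2 -> g = fun=> 1) /\
    (i.2 != be i.1.1 i.1.2 -> exists j, eps i.1.2 i.2 = ec i.1.1 j /\ g = fun x => xc i.1.1 x 0 j).
  case: i => [[v a] b] /=; have [->|ne] := eqVneq b (be v a).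
    by exists (fun=> 1).
  have [vv|] := pselect (vtx v); last by exists (fun=> 1).
  have [|j Ej] := eps_col (a := a) (b := b) vv; first by rewrite hbe // (negbTE ne).
  by exists (fun x => xc v x 0 j) => _; split; [move=> E; rewrite E eqxx in ne|exists j].
have [Z hZ] := boolp.choice HZ.
apply: (@isomorphic_power be hbe (fun v a b => Z (v, a, b))).
- by move=> v a vv; have [H1 _] := hZ (v, a, be v a) vv; apply: H1.
- by move=> v a b vv; have [_ H2] := hZ (v, a, b) vv; apply: H2.
Qed.
End ProductOfProjectiveSpaces.

(** The edge curves turn the pseudo-index into the bound [iota <= l] on edge lengths, and
    independent line bundles give [rho <= r]; the combinatorial bound on [r] concludes when
    [iota > 1]. *)
Theorem toric_fano_bound (K : closedFieldType) (X : ringed_set K) (n rho : nat) (iota : int) :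
  fano_manifold X n -> toric X n -> pseudo_index X n iota -> picard_number X rho ->
  rho%:Z * (iota - 1) <= n%:Z /\
  (rho%:Z * (iota - 1) = n%:Z -> isomorphic X (power (proj_space K `|iota - 1|%N) rho)).
Proof.
move=> [[[N [f fi]] _ _ smooth] am] [e [act [[oe dO] mact act1 actM acte]]] [_ hi] [[L hL] _].
have nX := closed_immersion_nice (proj_nice K N) fi.
have ma t : morphism (fun x => act (t, x)).
  apply: morphism_comp mact; apply: (pair_morphism nX); last exact: id_morphism.
  exact: (cst_morphism _ nX (torus_nice K n)).
have [k [A [U [Y TD]]]] := ample_toric_data (act := fun t x => act (t, x)) smooth am oe dO ma act1 actM acte.
pose Vs := vtxs A U Y.
have uB v : v \in Vs -> Bv A v \in unitmx by move/vtxsP; apply: (Bv_unit TD).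
have facets v v' i : v \in Vs -> v' \in Vs -> -1 <= dotp (qv A v') (col i (invmx (Bv A v))).
  by move=> /vtxsP vv /vtxsP vv'; apply: (vtx_facets TD).
have edges v i : v \in Vs -> exists v' (l : nat), [/\ v' \in Vs, (0 < l)%N,
    qv A v' = qv A v + row i (Bv A v) *+ l & iota <= l%:Z].
  move=> /vtxsP vv; have [v' [l [vv' l0 El [g rg dg]]]] := edge TD i vv.
  by exists v', l; split => //; [apply/vtxsP|apply: hi rg dg].
have Vs0 : exists v, v \in Vs.
  by have [v [vv _]] := vtx_cover TD (e (torus_one K n)); exists v; apply/vtxsP.
have := comb_bound uB facets edges Vs0; set r := (size _ - n)%N => rb.
have rho_r : (rho <= r)%N := num_independent_le TD hL.
have iso : r%:Z * (iota - 1) = n%:Z ->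
    isomorphic X (power (proj_space K `|iota - 1|%N) r).
  move=> Er; have [eps [[He1 He2 He3] He4 He5 He6]] := comb_equality uB facets edges Vs0 Er.
  apply: (isomorphic_power_of_rays TD (eps := eps)) => //.
  - by move=> v i /vtxsP; apply: He1.
  - by move=> v a b /vtxsP; apply: He4.
  - by move=> be; have [v [/vtxsP vv Hv]] := He6 be; exists v.
  - by move=> v /vtxsP; apply: He5.
(* For [iota <= 1] the bound is immediate, and equality forces [n = 0]: there are then no rays, so
   [rho = r = 0]. *)
have [i0|i0] := lerP (iota - 1) 0.
  have le0 : rho%:Z * (iota - 1) <= 0 by rewrite mulr_ge0_le0.
  split; first exact: le_trans le0 _.
  move=> En; have n0 : n = 0%N by move: le0; rewrite En lez_nat leqn0 => /eqP.
  have r0 : r = 0%N.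
    rewrite /r; case E : (rays Vs (Bv A)) => [|w s] //.
    have wR : w \in rays Vs (Bv A) by rewrite E mem_head.
    by have [v [i _]] := raysP wR; have := ltn_ord i; rewrite {2}n0.
  have rho0 : rho = r by move: rho_r; rewrite r0 leqn0 => /eqP.
  by rewrite rho0; apply: iso; rewrite -rho0.
split; first by apply: le_trans rb; rewrite ler_pM2r // lez_nat.
(* Here [n = rho (iota - 1) <= r (iota - 1) <= n], and cancelling [iota - 1 > 0] gives [rho = r]. *)
move=> En; have Er : r%:Z * (iota - 1) = n%:Z.
  by apply/eqP; rewrite eq_le rb -En ler_pM2r // lez_nat.
have -> : rho = r by move: En; rewrite -Er => /(mulIf (lt0r_neq0 i0)) [].
exact: iso.
Qed.

Unset Implicit Arguments.

Theorem mainTheorem3 (R : realType) (X : ringed_set (complex R)) (n rho : nat)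
    (iota : int) :
  (n <= 7)%N ->
  fano_manifold X n ->
  toric X n ->
  pseudo_index X n iota ->
  picard_number X rho ->
  rho%:Z * (iota - 1) <= n%:Z /\
  (rho%:Z * (iota - 1) = n%:Z ->
     isomorphic X (power (proj_space (complex R) `|iota - 1|%N) rho)).
Proof. by move=> _; apply: toric_fano_bound. Qed.
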